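(* Let $N\ge 2$ be an integer and let $z\neq 0$ be a complex number with $|\arg z|\le\frac{\pi}{2}$. Then \[ |R_N(z)|,\ |\widetilde R_N(z)| \le \frac{(1+\zeta(N))\,\Gamma(N)}{(2\pi)^{N+1}|z|^N}\cdot\frac{2\sqrt N+1}{2}, \] i.e. each of the two quantities on the left satisfies the bound.
   Context: $\zeta$ is the Riemann zeta function. The scaled gamma function is $\Gamma^\ast(z) = \dfrac{\Gamma(z)}{\sqrt{2\pi}\, z^{z-\frac12} e^{-z}}$ for $|\arg z|<\pi$ (principal branch of the power). The Stirling coefficients $\gamma_n$ ($n\ge 0$) are the real numbers in the asymptotic expansion $\Gamma^\ast(z)\sim\sum_{n\ge 0}(-1)^n\gamma_n z^{-n}$ as $z\to\infty$ in $|\arg z|\le\pi-\delta$; equivalently, they are given by the formal power series identity \[ \exp\left(\sum_{n=1}^\infty \frac{B_{2n}}{2n(2n-1)}x^{2n-1}\right)=\sum_{n=0}^\infty(-1)^n\gamma_n x^n, \] where $B_{k}$ are the Bernoulli numbers. Thus $\gamma_0=1$, $\gamma_1=-\frac1{12}$, $\gamma_2=\frac1{288}$, $\gamma_3=\frac{139}{51840}$. One also has $1/\Gamma^\ast(z)\sim\sum_{n\ge0}\gamma_n z^{-n}$. For every integer $N\ge 1$ the remainders $R_N(z)$, $\widetilde R_N(z)$ are defined by \[ \Gamma^\ast(z)=\sum_{n=0}^{N-1}(-1)^n\frac{\gamma_n}{z^n}+R_N(z),\qquad \frac1{\Gamma^\ast(z)}=\sum_{n=0}^{N-1}\frac{\gamma_n}{z^n}+\widetilde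 R_N(z). \] *)

(* Defs.v *)
(* Stdlib reals with Coquelicot; complex numbers are Coquelicot's [C]. *)
From Stdlib Require Import Reals List Arith Lia Lra.
From Coquelicot Require Import Coquelicot.
Import ListNotations.
Open Scope R_scope.

Definition Cexp (z : C) : C := (exp (Re z) * cos (Im z), exp (Re z) * sin (Im z)).

(* Principal argument, with values in (-PI, PI]; meaningful for [z <> 0]. *)
Definition Carg (z : C) : R :=
  if Rle_dec 0 (Im z) then acos (Re z / Cmod z) else - acos (Re z / Cmod z).

Definition Clog (z : C) : C := (ln (Cmod z), Carg z).

Definition Cpower (z w : C) : C := Cexp (w * Clog z)%C.

Fixpoint rising (z : C) (n : nat) : C :=
  match n with
  | O => z
  | S m => (rising z m * (z + RtoC (INR (S m))))%C
  end.

(* Gauss's form of Euler's definition, valid at every [z] that is not a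
   nonpositive integer:
   Gamma(z) = lim_n  n! n^z / (z (z+1) ... (z+n)). *)
Definition Gamma_seq (z : C) (n : nat) : C :=
  (RtoC (INR (fact n)) * Cpower (RtoC (INR n)) z / rising z n)%C.

Definition Gamma (z : C) : C :=
  (real (Lim_seq (fun n => Re (Gamma_seq z n))),
   real (Lim_seq (fun n => Im (Gamma_seq z n)))).

Definition scaled_Gamma (z : C) : C :=
  (Gamma z
   / (RtoC (sqrt (2 * PI)) * Cpower z (z - RtoC (1 / 2)) * Cexp (- z)))%C.

(* Riemann zeta on the half-line [s > 1]. *)
Definition zeta (s : R) : R := Series (fun k => / Rpower (INR (S k)) s).

(* [B_0; ...; B_n], from sum_(k <= m+1) binom(m+2, k) B_k = 0. *)
Fixpoint bernoulli_list (n : nat) : list R :=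
  match n with
  | O => [1]
  | S m =>
      let l := bernoulli_list m in
      l ++ [ - / INR (m + 2)
             * sum_f_R0 (fun k => Binomial.C (m + 2) k * nth k l 0) m ]
  end.

Definition bernoulli (n : nat) : R := nth n (bernoulli_list n) 0.

(* Formal power series over R are coefficient sequences [nat -> R], multiplied
   with Coquelicot's [PS_mult]. *)
Definition PS_one (n : nat) : R := match n with O => 1 | S _ => 0 end.

Fixpoint PS_power (a : nat -> R) (k : nat) : nat -> R :=
  match k with
  | O => PS_one
  | S m => PS_mult a (PS_power a m)
  end.

(* exp a = sum_k a^k / k!, for [a 0 = 0]: then a^k has no term of degree less
   than k, so the coefficient of x^n only involves k <= n. *)
Definition PS_exp (a : nat -> R) (n : nat) : R :=
  sum_f_R0 (fun k => PS_power a k n / INR (fact k)) n.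

(* sum_(n >= 1) B_(2n) / (2n (2n-1)) x^(2n-1), indexed by k = 2n-1. *)
Definition stirling_log (k : nat) : R :=
  if Nat.odd k then bernoulli (k + 1) / (INR (k + 1) * INR k) else 0.

Definition stirling_coef (n : nat) : R := (-1) ^ n * PS_exp stirling_log n.

(* Remainders after the terms of index 0, ..., N-1; meant for [1 <= N]. *)
Definition stirling_R (N : nat) (z : C) : C :=
  (scaled_Gamma z
   - sum_n (fun n => RtoC ((-1) ^ n * stirling_coef n) / Cpow z n) (N - 1))%C.

Definition stirling_R_inv (N : nat) (z : C) : C :=
  (/ scaled_Gamma z
   - sum_n (fun n => RtoC (stirling_coef n) / Cpow z n) (N - 1))%C.

Lemma bernoulli_list_length n : length (bernoulli_list n) = S n.
Proof.
  induction n as [|n IH]; [reflexivity|].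
  cbn [bernoulli_list]; cbv zeta; rewrite length_app, IH; simpl; lia.
Qed.

Lemma nth_bernoulli_list n k :
  (k <= n)%nat -> nth k (bernoulli_list n) 0 = bernoulli k.
Proof.
  induction n as [|n IH]; intros Hk.
  - now replace k with 0%nat by lia.
  - destruct (Nat.eq_dec k (S n)) as [->|Hne]; [reflexivity|].
    cbn [bernoulli_list]; cbv zeta.
    rewrite app_nth1 by (rewrite bernoulli_list_length; lia).
    apply IH; lia.
Qed.

Lemma bernoulli_rec n :
  bernoulli (S n)
  = - / INR (n + 2) * sum_f_R0 (fun k => Binomial.C (n + 2) k * bernoulli k) n.
Proof.
  unfold bernoulli at 1; cbn [bernoulli_list]; cbv zeta.
  rewrite app_nth2 by (rewrite bernoulli_list_length; lia).
  rewrite bernoulli_list_length, Nat.sub_diag; simpl nth.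
  f_equal; apply sum_eq; intros k Hk; now rewrite nth_bernoulli_list.
Qed.

(* Main.v *)
Require Import Defs.
From Stdlib Require Import Reals Arith Lra Lia Classical.
From Coquelicot Require Import Coquelicot.
Open Scope R_scope.

(* Write Phi = exp mu and Psi = exp(-mu) for the scaled gamma function and its
   reciprocal on Re w >= 0, w <> 0, with mu the Binet function. There
   Phi(w) Psi(w) = 1, and on the imaginary axis the reflection formula gives
   Phi(is) - Psi(-is) = Phi(is) exp(-2 pi s) for s > 0. Cauchy's formula for
   z^(N-1) (Phi(z) - partial sum) in the right half-plane, combined with the
   vanishing Cauchy integral of the other function, turns R_N(z) into
   1/(2 pi i z^(N-1)) times the integral of w^(N-1) (Phi(w) - Psi(-w))/(w - z)
   over the imaginary axis. For Im z >= 0 the lower half of the axis stays at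
   distance at least |z| from z and contributes the term with (1 + zeta(N))/2.
   The upper half is turned into the ray through (-kappa, 1), where the jump is
   Psi(-w) q/(1 - q), q = exp(2 pi i w); its distance to z is at least
   |z| kappa/sqrt(1 + kappa^2), and kappa = 1/sqrt N (kappa = 1 for R_2)
   produces the factor sqrt N. Pointwise, |Psi| <= 1 and
   |Phi(w)|^2 <= |1 + 1/(5w)| by the maximum principle. *)

(** * Complex preliminaries *)

(** The method rests on a symmetry: the formal series of mu is odd, so the expansion of Psi at -w is
    that of Phi at w. In the combined integral the partial sums cancel, and only the jump Phi(w) -
    Psi(-w) remains, which is exponentially small towards both ends of the axis. All facts on Gamma
    are drawn from Gauss's product: its modulus on the imaginary axis, computed from the sinh
    product, yields the reflection formula, the constant sqrt(2 pi) and the vanishing of the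
    Bernoulli numbers of odd index from 3 on. The condition N >= 2 acts at the origin: Phi grows
    like |w|^(-1/2) there, and w^(N-1) must leave a continuous function on the closed half-plane.
    Numerically there is little room. The tilt costs a factor rho^(N+1)/kappa with rho = sqrt(1 +
    kappa^2), and once the lower half axis has used its share, the ray must fit into sqrt N (1 +
    zeta(N)). The general bounds on the jump are too weak for R_2 and for the inverse remainder with
    N = 3, which get estimates of their own. *)

Lemma C_eq (a b : C) : Re a = Re b -> Im a = Im b -> a = b.
Proof. destruct a, b; simpl; intros; subst; reflexivity. Qed.

Lemma im_le_Cmod (c : C) : Rabs (Im c) <= Cmod c.
Proof. eapply Rle_trans; [apply Rmax_r|apply (Rmax_Cmod c)]. Qed.

Lemma Cmod_le_ReIm (c : C) : Cmod c <= Rabs (Re c) + Rabs (Im c).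
Proof.
  unfold Cmod; fold (Re c) (Im c).
  pose proof (Rabs_pos (Re c)); pose proof (Rabs_pos (Im c)).
  rewrite <- (sqrt_Rsqr (Rabs (Re c) + Rabs (Im c))) by lra.
  apply sqrt_le_1_alt.
  unfold Rsqr. pose proof (pow2_abs (Re c)); pose proof (pow2_abs (Im c)).
  change (fst c) with (Re c); change (snd c) with (Im c).
  nra.
Qed.

Lemma Cmod_triangle_sub (a b : C) : Cmod (a - b) <= Cmod a + Cmod b.
Proof. unfold Cminus. rewrite <- (Cmod_opp b). apply Cmod_triangle. Qed.

Lemma Cmod_triangle_rev (a b : C) : Cmod a - Cmod b <= Cmod (a + b).
Proof.
  pose proof (Cmod_triangle (a + b) (- b)).
  rewrite Cmod_opp in H. replace (a + b + - b)%C with a in H by ring. lra.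
Qed.

Lemma Cmod_sub_sym (a b : C) : Cmod (a - b) = Cmod (b - a).
Proof. rewrite <- Cmod_opp; f_equal; ring. Qed.

Lemma Cmod_pos_neq (c : C) : 0 < Cmod c -> c <> RtoC 0.
Proof. intros H ->. rewrite Cmod_0 in H; lra. Qed.

Lemma Re_Cmult a b : Re (a * b)%C = Re a * Re b - Im a * Im b.
Proof. reflexivity. Qed.
Lemma Cexp_plus (a b : C) : Cexp (a + b) = (Cexp a * Cexp b)%C.
Proof.
  destruct a, b; apply C_eq; unfold Cexp, Re, Im, Cmult, Cplus; cbn [fst snd]; rewrite exp_plus.
  - rewrite cos_plus; ring.
  - rewrite sin_plus; ring.
Qed.

Lemma Cexp_0 : Cexp 0 = RtoC 1.
Proof. apply C_eq; unfold Cexp, RtoC, Re, Im; cbn [fst snd]; rewrite ?exp_0, ?cos_0, ?sin_0; ring. Qed.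

Lemma Cexp_neq_0 (a : C) : Cexp a <> RtoC 0.
Proof.
  intros H. pose proof (Cexp_plus a (- a)) as E.
  replace (a + - a)%C with (RtoC 0) in E by ring.
  rewrite Cexp_0, H, Cmult_0_l in E. injection E. lra.
Qed.

Lemma Cexp_opp (a : C) : Cexp (- a) = (/ Cexp a)%C.
Proof.
  pose proof (Cexp_plus a (- a)) as E.
  replace (a + - a)%C with (RtoC 0) in E by ring.
  rewrite Cexp_0 in E. pose proof (Cexp_neq_0 a).
  replace (Cexp (- a)) with (Cexp a * Cexp (- a) * / Cexp a)%C by (field; assumption).
  rewrite <- E. ring.
Qed.

Lemma Cmod_Cexp (a : C) : Cmod (Cexp a) = exp (Re a).
Proof.
  destruct a as [x y]. unfold Cmod, Cexp, Re, Im; cbn [fst snd].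
  transitivity (sqrt (Rsqr (exp x))); [|apply sqrt_Rsqr; left; apply exp_pos].
  f_equal. unfold Rsqr.
  pose proof (sin2_cos2 y) as H. unfold Rsqr in H.
  replace (exp x * exp x) with (exp x * exp x * 1) by ring.
  rewrite <- H. ring.
Qed.

Lemma Cexp_Cconj (a : C) : Cexp (Cconj a) = Cconj (Cexp a).
Proof.
  destruct a; apply C_eq; unfold Cexp, Cconj, Re, Im; cbn [fst snd].
  - now rewrite cos_neg.
  - rewrite sin_neg; ring.
Qed.

Lemma Cexp_RtoC (x : R) : Cexp (RtoC x) = RtoC (exp x).
Proof. apply C_eq; unfold Cexp, RtoC, Re, Im; cbn [fst snd]; rewrite ?cos_0, ?sin_0; ring. Qed.

Lemma Cconj_mult a b : Cconj (a * b) = (Cconj a * Cconj b)%C.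
Proof. apply C_eq; simpl; ring. Qed.
Lemma Cconj_plus a b : Cconj (a + b) = (Cconj a + Cconj b)%C.
Proof. apply C_eq; simpl; ring. Qed.
Lemma Cconj_minus a b : Cconj (a - b) = (Cconj a - Cconj b)%C.
Proof. apply C_eq; simpl; ring. Qed.
Lemma Cconj_RtoC x : Cconj (RtoC x) = RtoC x.
Proof. apply C_eq; simpl; ring. Qed.
Lemma Cconj_inv a : Cconj (/ a) = (/ Cconj a)%C.
Proof.
  destruct a as [x y]. unfold Cinv, Cconj; apply C_eq; unfold Re, Im; cbn [fst snd];
  replace ((- y) ^ 2) with (y ^ 2) by ring; unfold Rdiv; ring.
Qed.
Lemma Cconj_pow a n : Cconj (Cpow a n) = Cpow (Cconj a) n.
Proof.
  induction n; simpl; [apply C_eq; simpl; ring|].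
  now rewrite Cconj_mult, IHn.
Qed.

(** * Continuity *)

Section Cont.
Context {U : UniformSpace}.

Lemma cont_pair (f : U -> C) x :
  continuous (fun u => Re (f u)) x -> continuous (fun u => Im (f u)) x ->
  continuous f x.
Proof.
  intros H1 H2 P [eps HP].
  generalize (H1 (ball (Re (f x)) eps) (locally_ball _ eps)); intros A.
  generalize (H2 (ball (Im (f x)) eps) (locally_ball _ eps)); intros B.
  unfold filtermap in *.
  generalize (filter_and _ _ A B). apply filter_imp.
  intros u [Ha Hb]. apply HP. split; assumption.
Qed.

Lemma cont_Re (f : U -> C) x : continuous f x -> continuous (fun u => Re (f u)) x.
Proof.
  intros H. apply (continuous_comp f (fun c : C => Re c)); [assumption|].
  apply (continuous_fst (U:=R_UniformSpace) (V:=R_UniformSpace)).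
Qed.

Lemma cont_Im (f : U -> C) x : continuous f x -> continuous (fun u => Im (f u)) x.
Proof.
  intros H. apply (continuous_comp f (fun c : C => Im c)); [assumption|].
  apply (continuous_snd (U:=R_UniformSpace) (V:=R_UniformSpace)).
Qed.

Lemma cont_Rmult (f g : U -> R) x :
  continuous f x -> continuous g x -> continuous (fun u => f u * g u) x.
Proof. intros; apply (continuous_mult (K:=R_AbsRing)); assumption. Qed.
Lemma cont_Rplus (f g : U -> R) x :
  continuous f x -> continuous g x -> continuous (fun u => f u + g u) x.
Proof. intros; apply (continuous_plus (V:=R_NormedModule)); assumption. Qed.
Lemma cont_Rminus (f g : U -> R) x :
  continuous f x -> continuous g x -> continuous (fun u => f u - g u) x.
Proof. intros; apply (continuous_minus (V:=R_NormedModule)); assumption. Qed.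
Lemma cont_Ropp (f : U -> R) x :
  continuous f x -> continuous (fun u => - f u) x.
Proof. intros; apply (continuous_opp (V:=R_NormedModule)); assumption. Qed.

Lemma cont_Cplus (f g : U -> C) x :
  continuous f x -> continuous g x -> continuous (fun u => f u + g u)%C x.
Proof.
  intros; apply cont_pair; apply cont_Rplus; auto using cont_Re, cont_Im.
Qed.
Lemma cont_Copp (f : U -> C) x :
  continuous f x -> continuous (fun u => - f u)%C x.
Proof.
  intros; apply cont_pair; apply cont_Ropp; auto using cont_Re, cont_Im.
Qed.
Lemma cont_Cminus (f g : U -> C) x :
  continuous f x -> continuous g x -> continuous (fun u => f u - g u)%C x.
Proof. intros; apply cont_Cplus; auto using cont_Copp. Qed.
Lemma cont_Cmult (f g : U -> C) x :
  continuous f x -> continuous g x -> continuous (fun u => f u * g u)%C x.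
Proof.
  intros; apply cont_pair; [apply cont_Rminus|apply cont_Rplus]; apply cont_Rmult;
    auto using cont_Re, cont_Im.
Qed.
Lemma cont_Cinv (f : U -> C) x :
  continuous f x -> f x <> RtoC 0 -> continuous (fun u => / f u)%C x.
Proof.
  intros H Hn.
  assert (Hd : Re (f x) ^ 2 + Im (f x) ^ 2 <> 0).
  { rewrite <- Cmod2_alt. apply Cmod_gt_0 in Hn. nra. }
  assert (continuous (fun u => / (Re (f u) ^ 2 + Im (f u) ^ 2)) x).
  { apply (continuous_comp (fun u => Re (f u) ^ 2 + Im (f u) ^ 2) Rinv); [|apply continuous_Rinv; assumption].
    simpl. apply cont_Rplus; apply cont_Rmult; auto using cont_Re, cont_Im;
    apply cont_Rmult; auto using cont_Re, cont_Im, continuous_const. }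
  apply cont_pair; unfold Cinv; simpl; unfold Rdiv; apply cont_Rmult; auto using cont_Ropp, cont_Re, cont_Im.
Qed.
Lemma cont_Cpow (f : U -> C) n x :
  continuous f x -> continuous (fun u => Cpow (f u) n) x.
Proof.
  intros; induction n; simpl; [apply continuous_const|].
  apply cont_Cmult; auto.
Qed.
Lemma cont_Cexp (f : U -> C) x :
  continuous f x -> continuous (fun u => Cexp (f u)) x.
Proof.
  intros H; apply cont_pair; unfold Cexp; simpl; apply cont_Rmult.
  - apply (continuous_comp _ exp _); [|apply continuous_exp]; auto using cont_Re.
  - apply (continuous_comp _ cos _); [|apply continuous_cos]; auto using cont_Im.
  - apply (continuous_comp _ exp _); [|apply continuous_exp]; auto using cont_Re.
  - apply (continuous_comp _ sin _); [|apply continuous_sin]; auto using cont_Im.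
Qed.
Lemma cont_RtoC (f : U -> R) x : continuous f x -> continuous (fun u => RtoC (f u)) x.
Proof. intros; apply cont_pair; simpl; auto using continuous_const. Qed.
End Cont.

Lemma cont_eps (f : C -> C) (w : C) :
  continuous f w <-> (forall eps, 0 < eps -> exists d, 0 < d /\
    forall v, Cmod (v - w) < d -> Cmod (f v - f w) < eps).
Proof.
  split.
  - intros H eps He.
    assert (He2 : 0 < eps / 2) by lra.
    destruct (H (ball (f w) (mkposreal _ He2)) (locally_ball _ _)) as [d Hd].
    exists d; split; [apply cond_pos|]. intros v Hv.
    assert (B : ball w d v).
    { split; eapply Rle_lt_trans; [apply (re_le_Cmod (v - w))|eassumption|apply (im_le_Cmod (v - w))|eassumption]. }
    apply Hd in B. destruct B as [B1 B2].
    change (Rabs (Re (f v) - Re (f w)) < eps / 2) in B1.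
    change (Rabs (Im (f v) - Im (f w)) < eps / 2) in B2.
    eapply Rle_lt_trans; [apply Cmod_le_ReIm|].
    change (Re (f v - f w)%C) with (Re (f v) - Re (f w)).
    change (Im (f v - f w)%C) with (Im (f v) - Im (f w)). lra.
  - intros H P [eps HP].
    destruct (H eps (cond_pos eps)) as [d [Hd Hv]].
    assert (Hd2 : 0 < d / 2) by lra.
    exists (mkposreal _ Hd2). intros v [B1 B2]. apply HP.
    change (Rabs (Re v - Re w) < d / 2) in B1.
    change (Rabs (Im v - Im w) < d / 2) in B2.
    assert (L : Cmod (v - w) < d).
    { eapply Rle_lt_trans; [apply Cmod_le_ReIm|].
      change (Re (v - w)%C) with (Re v - Re w).
      change (Im (v - w)%C) with (Im v - Im w). lra. }
    apply Hv in L.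
    split; eapply Rle_lt_trans; [apply (re_le_Cmod (f v - f w))|eassumption|apply (im_le_Cmod (f v - f w))|eassumption].
Qed.

(** * Complex derivative *)

(** The error is compared with eps |h| without dividing, so that h = 0 is no exception and the
    differentiation rules are plain norm estimates. *)
Definition Cdiff (f : C -> C) (w l : C) :=
  forall eps, 0 < eps -> exists d, 0 < d /\
    forall h, Cmod h < d -> Cmod (f (w + h) - f w - l * h)%C <= eps * Cmod h.

Lemma Cdiff_quad (f : C -> C) (w l : C) (d0 M : R) :
  0 < d0 ->
  (forall h, Cmod h < d0 -> Cmod (f (w + h) - f w - l * h)%C <= M * Cmod h ^ 2) ->
  Cdiff f w l.
Proof.
  intros Hd H eps He.
  exists (Rmin d0 (eps / (Rabs M + 1))).
  pose proof (Rabs_pos M).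
  split.
  - apply Rmin_pos; [assumption|]. apply Rdiv_lt_0_compat; lra.
  - intros h Hh. eapply Rle_trans; [apply H; eapply Rlt_le_trans; [eassumption|apply Rmin_l]|].
    pose proof (Cmod_ge_0 h).
    assert (Cmod h < eps / (Rabs M + 1)) by (eapply Rlt_le_trans; [eassumption|apply Rmin_r]).
    assert (E : eps / (Rabs M + 1) * (Rabs M + 1) = eps) by (field; lra).
    assert (Cmod h * (Rabs M + 1) <= eps) by (rewrite <- E; apply Rmult_le_compat_r; lra).
    pose proof (Rle_abs M).
    replace (M * Cmod h ^ 2) with ((M * Cmod h) * Cmod h) by ring.
    apply Rmult_le_compat_r; [assumption|]. nra.
Qed.

Lemma Cdiff_ext_loc (f g : C -> C) (w l : C) (d0 : R) :
  0 < d0 -> (forall v, Cmod (v - w) < d0 -> f v = g v) -> Cdiff f w l -> Cdiff g w l.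
Proof.
  intros Hd E H eps He. destruct (H eps He) as [d [Hd1 Hh]].
  exists (Rmin d d0). split; [apply Rmin_pos; assumption|].
  intros h Hlt. rewrite <- !E.
  - apply Hh. eapply Rlt_le_trans; [eassumption|apply Rmin_l].
  - replace (w - w)%C with (RtoC 0) by ring. now rewrite Cmod_0.
  - replace (w + h - w)%C with h by ring. eapply Rlt_le_trans; [eassumption|apply Rmin_r].
Qed.

Lemma Cdiff_lip (f : C -> C) (w l : C) : Cdiff f w l ->
  exists d, 0 < d /\ forall h, Cmod h < d -> Cmod (f (w + h) - f w)%C <= (Cmod l + 1) * Cmod h.
Proof.
  intros H. destruct (H 1 Rlt_0_1) as [d [Hd Hh]]. exists d; split; [assumption|].
  intros h Hlt. specialize (Hh h Hlt).
  replace (f (w + h) - f w)%C with ((f (w + h) - f w - l * h) + l * h)%C by ring.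
  eapply Rle_trans; [apply Cmod_triangle|]. rewrite Cmod_mult. lra.
Qed.

Lemma Cdiff_cont (f : C -> C) (w l : C) : Cdiff f w l -> continuous f w.
Proof.
  intros H. apply cont_eps. intros eps He.
  destruct (Cdiff_lip f w l H) as [d [Hd Hh]].
  pose proof (Cmod_ge_0 l).
  exists (Rmin d (eps / (Cmod l + 1))). split.
  - apply Rmin_pos; [assumption|]. apply Rdiv_lt_0_compat; lra.
  - intros v Hv. replace v with (w + (v - w))%C by ring.
    eapply Rle_lt_trans; [apply Hh; eapply Rlt_le_trans; [eassumption|apply Rmin_l]|].
    assert (Cmod (v - w) < eps / (Cmod l + 1)) by (eapply Rlt_le_trans; [eassumption|apply Rmin_r]).
    replace eps with ((Cmod l + 1) * (eps / (Cmod l + 1))) by (field; lra).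
    apply Rmult_lt_compat_l; lra.
Qed.

Lemma Cdiff_const c w : Cdiff (fun _ => c) w 0.
Proof.
  apply (Cdiff_quad _ _ _ 1 0); [lra|]. intros h _.
  replace (c - c - 0 * h)%C with (RtoC 0) by ring. rewrite Cmod_0. lra.
Qed.

Lemma Cdiff_id w : Cdiff (fun v => v) w 1.
Proof.
  apply (Cdiff_quad _ _ _ 1 0); [lra|]. intros h _.
  replace (w + h - w - 1 * h)%C with (RtoC 0) by ring. rewrite Cmod_0. lra.
Qed.

Lemma Cdiff_plus f g w l m : Cdiff f w l -> Cdiff g w m ->
  Cdiff (fun v => f v + g v)%C w (l + m).
Proof.
  intros H1 H2 eps He.
  destruct (H1 (eps / 2) ltac:(lra)) as [d1 [Hd1 A]].
  destruct (H2 (eps / 2) ltac:(lra)) as [d2 [Hd2 B]].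
  exists (Rmin d1 d2); split; [apply Rmin_pos; assumption|].
  intros h Hh.
  specialize (A h (Rlt_le_trans _ _ _ Hh (Rmin_l _ _))).
  specialize (B h (Rlt_le_trans _ _ _ Hh (Rmin_r _ _))).
  replace (f (w + h) + g (w + h) - (f w + g w) - (l + m) * h)%C
    with ((f (w + h) - f w - l * h) + (g (w + h) - g w - m * h))%C by ring.
  eapply Rle_trans; [apply Cmod_triangle|]. lra.
Qed.

(* [|fg(w+h) - fg(w) - (l g + f m) h| <= |Df||Dg| + |g||Df - l h| + |f||Dg - m h|] *)
Lemma Cdiff_mult f g w l m : Cdiff f w l -> Cdiff g w m ->
  Cdiff (fun v => f v * g v)%C w (l * g w + f w * m).
Proof.
  intros H1 H2 eps He.
  set (K := 2 + Cmod (g w) + Cmod (f w)).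
  pose proof (Cmod_ge_0 (g w)); pose proof (Cmod_ge_0 (f w)).
  pose proof (Cmod_ge_0 l); pose proof (Cmod_ge_0 m).
  assert (HK : 0 < K) by (unfold K; lra).
  assert (He' : 0 < eps / K) by (apply Rdiv_lt_0_compat; lra).
  destruct (H1 _ He') as [d1 [Hd1 A]].
  destruct (H2 _ He') as [d2 [Hd2 B]].
  destruct (Cdiff_lip f w l H1) as [d3 [Hd3 A']].
  destruct (Cdiff_lip g w m H2) as [d4 [Hd4 B']].
  set (L := (Cmod l + 1) * (Cmod m + 1)).
  assert (HL : 0 < L) by (unfold L; apply Rmult_lt_0_compat; lra).
  set (d5 := eps / K / L).
  assert (Hd5 : 0 < d5) by (apply Rdiv_lt_0_compat; assumption).
  exists (Rmin (Rmin d1 d2) (Rmin (Rmin d3 d4) d5)).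
  split; [repeat apply Rmin_pos; assumption|].
  intros h Hh.
  assert (Hs : Cmod h < d1 /\ Cmod h < d2 /\ Cmod h < d3 /\ Cmod h < d4 /\ Cmod h < d5).
  { revert Hh. unfold Rmin; repeat destruct Rle_dec; intros; repeat split; lra. }
  destruct Hs as (h1 & h2 & h3 & h4 & h5).
  specialize (A h h1); specialize (B h h2); specialize (A' h h3); specialize (B' h h4).
  replace (f (w + h) * g (w + h) - f w * g w - (l * g w + f w * m) * h)%C
    with ((f (w + h) - f w) * (g (w + h) - g w) + g w * (f (w + h) - f w - l * h)
          + f w * (g (w + h) - g w - m * h))%C by ring.
  eapply Rle_trans; [apply Cmod_triangle|].
  eapply Rle_trans; [apply Rplus_le_compat_r, Cmod_triangle|].
  rewrite !Cmod_mult.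
  pose proof (Cmod_ge_0 h).
  assert (P1 : Cmod (f (w + h) - f w)%C * Cmod (g (w + h) - g w)%C <= eps / K * Cmod h).
  { apply Rle_trans with (((Cmod l + 1) * Cmod h) * ((Cmod m + 1) * Cmod h)).
    - apply Rmult_le_compat; try apply Cmod_ge_0; assumption.
    - replace ((Cmod l + 1) * Cmod h * ((Cmod m + 1) * Cmod h)) with (L * Cmod h * Cmod h) by (unfold L; ring).
      apply Rmult_le_compat_r; [assumption|].
      replace (eps / K) with (L * d5) by (unfold d5; field; lra).
      apply Rmult_le_compat_l; lra. }
  assert (P2 : Cmod (g w) * Cmod (f (w + h) - f w - l * h)%C <= Cmod (g w) * (eps / K * Cmod h))
    by (apply Rmult_le_compat_l; assumption).
  assert (P3 : Cmod (f w) * Cmod (g (w + h) - g w - m * h)%C <= Cmod (f w) * (eps / K * Cmod h))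
    by (apply Rmult_le_compat_l; assumption).
  assert (P4 : 0 <= eps / K * Cmod h) by (apply Rmult_le_pos; lra).
  replace (eps * Cmod h) with (K * (eps / K * Cmod h)) by (field; lra).
  set (q := eps / K * Cmod h) in *. clearbody q. unfold K. nra.
Qed.

Lemma Cdiff_comp f g w l m : Cdiff f (g w) l -> Cdiff g w m ->
  Cdiff (fun v => f (g v)) w (l * m).
Proof.
  intros H1 H2 eps He.
  pose proof (Cmod_ge_0 l); pose proof (Cmod_ge_0 m).
  set (e1 := eps / 2 / (Cmod m + 1)).
  set (e2 := eps / 2 / (Cmod l + 1)).
  assert (0 < e1) by (unfold e1; apply Rdiv_lt_0_compat; lra).
  assert (0 < e2) by (unfold e2; apply Rdiv_lt_0_compat; lra).
  destruct (H1 e1) as [d1 [Hd1 A]]; [assumption|].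
  destruct (H2 e2) as [d2 [Hd2 B]]; [assumption|].
  destruct (Cdiff_lip g w m H2) as [d3 [Hd3 B']].
  set (d4 := d1 / (Cmod m + 1)).
  assert (0 < d4) by (unfold d4; apply Rdiv_lt_0_compat; lra).
  exists (Rmin d2 (Rmin d3 d4)). split; [repeat apply Rmin_pos; assumption|].
  intros h Hh.
  assert (Hs : Cmod h < d2 /\ Cmod h < d3 /\ Cmod h < d4).
  { revert Hh. unfold Rmin; repeat destruct Rle_dec; intros; repeat split; lra. }
  destruct Hs as (h2 & h3 & h4).
  specialize (B h h2); specialize (B' h h3).
  set (k := (g (w + h) - g w)%C) in *.
  assert (Hk : Cmod k < d1).
  { eapply Rle_lt_trans; [apply B'|]. replace d1 with ((Cmod m + 1) * d4) by (unfold d4; field; lra).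
    apply Rmult_lt_compat_l; lra. }
  specialize (A k Hk).
  replace (g w + k)%C with (g (w + h)%C) in A by (unfold k; ring).
  replace (f (g (w + h)) - f (g w) - l * m * h)%C
    with ((f (g (w + h)) - f (g w) - l * k) + l * (k - m * h))%C by ring.
  eapply Rle_trans; [apply Cmod_triangle|]. rewrite Cmod_mult.
  pose proof (Cmod_ge_0 h).
  assert (e1 * Cmod k <= eps / 2 * Cmod h).
  { apply Rle_trans with (e1 * ((Cmod m + 1) * Cmod h)).
    - apply Rmult_le_compat_l; lra.
    - right. unfold e1. field. lra. }
  assert (Cmod l * Cmod (k - m * h) <= eps / 2 * Cmod h).
  { apply Rle_trans with ((Cmod l + 1) * (e2 * Cmod h)).
    - apply Rmult_le_compat; try apply Cmod_ge_0; try lra.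
    - right. unfold e2. field. lra. }
  lra.
Qed.

Lemma Cdiff_inv w : w <> RtoC 0 -> Cdiff (fun v => / v)%C w (- / (w * w))%C.
Proof.
  intros Hw. pose proof (proj1 (Cmod_gt_0 w) Hw) as Hp.
  apply (Cdiff_quad _ _ _ (Cmod w / 2) (2 / Cmod w ^ 3)); [lra|].
  intros h Hh.
  assert (Hwh : Cmod w / 2 <= Cmod (w + h)).
  { pose proof (Cmod_triangle_rev w h). lra. }
  assert (Hne : (w + h)%C <> RtoC 0) by (apply Cmod_pos_neq; lra).
  replace (/ (w + h) - / w - - / (w * w) * h)%C with (h * h / (w * w * (w + h)))%C
    by (field; auto).
  assert (w * w <> 0)%C by (apply Cmult_neq_0; assumption).
  rewrite Cmod_div by (apply Cmult_neq_0; assumption).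
  rewrite !Cmod_mult. pose proof (Cmod_ge_0 h).
  replace (2 / Cmod w ^ 3 * Cmod h ^ 2)
    with (Cmod h * Cmod h * / (Cmod w * Cmod w * (Cmod w / 2))) by (field; lra).
  apply Rmult_le_compat_l; [nra|].
  apply Rinv_le_contravar; [|apply Rmult_le_compat_l; nra].
  apply Rmult_lt_0_compat; nra.
Qed.


(** * First-order Taylor estimates for the complex exponential *)

Lemma exp_taylor1 x : Rabs x <= 1 -> Rabs (exp x - 1 - x) <= 3 * x ^ 2.
Proof.
  intros H.
  pose proof (exp_ineq1_le x). rewrite Rabs_right by lra.
  assert (Hx' : -1 <= x <= 1) by (apply Rabs_le_between; assumption).
  (* Upper bounds for exp x come from the tangent inequality at -x, by inversion. For x > 0 the
     factor 1 - x could vanish, so the argument is halved and the bound squared. *)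
  destruct (Rle_dec x 0) as [Hx|Hx].
  - assert (H1 : 1 - x <= exp (- x)) by (pose proof (exp_ineq1_le (- x)); lra).
    assert (exp x * exp (-x) = 1) by (rewrite <- exp_plus; rewrite Rplus_opp_r; apply exp_0).
    pose proof (exp_pos x).
    assert (exp x * (1 - x) <= 1) by nra.
    assert ((1 + x + 3 * x^2) * (1 - x) >= 1) by nra. nra.
  - assert (H1 : 1 - x/2 <= exp (- (x/2))) by (pose proof (exp_ineq1_le (- (x/2))); lra).
    assert (E : exp (x/2) * exp (-(x/2)) = 1) by (rewrite <- exp_plus; rewrite Rplus_opp_r; apply exp_0).
    assert (E2 : exp x = exp (x/2) * exp (x/2)) by (rewrite <- exp_plus; f_equal; lra).
    pose proof (exp_pos (x/2)).
    assert (exp (x/2) * (1 - x/2) <= 1) by nra.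
    assert (Q : exp x * (1 - x/2)^2 <= 1).
    { rewrite E2. replace (exp (x / 2) * exp (x / 2) * (1 - x / 2) ^ 2) with ((exp (x/2) * (1 - x/2))^2) by ring.
      assert (0 <= exp (x/2) * (1 - x/2)) by (apply Rmult_le_pos; lra). nra. }
    assert ((1 + x + 3 * x^2) * (1 - x/2)^2 >= 1).
    { replace ((1 + x + 3 * x ^ 2) * (1 - x / 2) ^ 2) with (1 + x^2 * (9/4 - 11/4*x + 3/4*x^2)) by field.
      assert (0 <= 9/4 - 11/4*x + 3/4*x^2) by nra. assert (0 <= x^2) by nra. nra. }
    assert (0 < (1-x/2)^2) by nra. nra.
Qed.

Lemma cos_taylor1 y : Rabs (1 - cos y) <= y ^ 2.
Proof.
  assert (P : forall x, 0 <= x -> sin x ^ 2 <= x ^ 2).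
  { intros x [Hx|<-]; [|rewrite sin_0; lra].
    pose proof (sin_lt_x x Hx). pose proof (SIN_bound x).
    destruct (Rle_dec x 1) as [H1|H1]; [|nra].
    pose proof PI2_1. pose proof (sin_ge_0 x ltac:(lra) ltac:(lra)). nra. }
  pose proof (COS_bound y). rewrite Rabs_right by lra.
  replace (cos y) with (1 - 2 * sin (y / 2) * sin (y / 2))
    by (rewrite <- cos_2a_sin; f_equal; field).
  destruct (Rle_dec 0 y) as [Hy|Hy].
  - pose proof (P (y / 2) ltac:(lra)). nra.
  - pose proof (P (- (y / 2)) ltac:(lra)) as Q. rewrite sin_neg in Q. nra.
Qed.

Lemma sin_taylor1 y : Rabs y <= 1 -> Rabs (sin y - y) <= y ^ 2.
Proof.
  assert (P : forall y, 0 <= y <= 1 -> Rabs (sin y - y) <= y ^ 2).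
  { clear y. intros y Hy.
    (* The derivative 2u + cos u - 1 is at least 2u - u^2, hence nonnegative on [0, 1]. *)
    destruct (MVT_gen (fun u => u ^ 2 + sin u - u) 0 y (fun u => 2 * u + cos u - 1)) as [c [Hc E]].
    - intros x _. auto_derive; [trivial|ring].
    - intros x _. apply continuity_pt_filterlim.
      apply (ex_derive_continuous (fun u => u ^ 2 + sin u - u)). auto_derive; trivial.
    - rewrite Rmin_left, Rmax_right in Hc by lra.
      pose proof (cos_taylor1 c) as Hcos. apply Rabs_le_between in Hcos.
      rewrite sin_0 in E.
      assert (0 <= (2 * c + cos c - 1) * (y - 0)) by (apply Rmult_le_pos; nra).
      apply Rabs_le. split; [nra|].
      destruct (Req_dec y 0) as [->|Hn]; [rewrite sin_0; lra|].
      pose proof (sin_lt_x y ltac:(lra)). nra. }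
  intros H. assert (Hy : -1 <= y <= 1) by (apply Rabs_le_between; assumption).
  destruct (Rle_dec 0 y); [apply P; lra|].
  replace (y ^ 2) with ((-y) ^ 2) by ring. replace (sin y - y) with (- (sin (-y) - (-y))) by (rewrite sin_neg; ring).
  rewrite Rabs_Ropp. apply P; lra.
Qed.

Lemma Cexp_taylor1 h : Cmod h <= 1 -> Cmod (Cexp h - 1 - h) <= 20 * Cmod h ^ 2.
Proof.
  intros Hh.
  pose proof (re_le_Cmod h) as Hx; pose proof (im_le_Cmod h) as Hy.
  set (x := Re h) in *; set (y := Im h) in *.
  pose proof (exp_taylor1 x ltac:(lra)) as E1.
  pose proof (cos_taylor1 y) as E2.
  pose proof (sin_taylor1 y ltac:(lra)) as E3.
  assert (S : Cmod h ^ 2 = x ^ 2 + y ^ 2) by apply Cmod2_alt.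
  assert (Hxx : -1 <= x <= 1) by (apply Rabs_le_between; lra).
  assert (Ex : exp x <= 5).
  { apply Rabs_le_between in E1. nra. }
  pose proof (exp_pos x).
  eapply Rle_trans; [apply Cmod_le_ReIm|].
  (* Each part is regrouped so that only the real Taylor errors of exp, cos and sin and the product
     x sin y remain. *)
  replace (Re (Cexp h - 1 - h)) with ((exp x - 1 - x) - exp x * (1 - cos y)) by (unfold x, y, Cexp, Re, Im; unfold Cminus, Cplus, Copp, RtoC; cbn [fst snd]; ring).
  replace (Im (Cexp h - 1 - h)) with ((exp x - 1 - x) * sin y + x * sin y + (sin y - y)) by (unfold x, y, Cexp, Re, Im; unfold Cminus, Cplus, Copp, RtoC; cbn [fst snd]; ring).
  apply Rabs_le_between in E1, E2, E3.
  assert (Hyy : -1 <= y <= 1) by (apply Rabs_le_between; lra).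
  pose proof (SIN_bound y).
  assert (A1 : Rabs (exp x - 1 - x - exp x * (1 - cos y)) <= 3 * x^2 + 5 * y^2).
  { pose proof (COS_bound y).
    assert (0 <= exp x * (1 - cos y) <= 5 * y ^ 2).
    { split; [apply Rmult_le_pos; lra|]. apply Rmult_le_compat; lra. }
    apply Rabs_le. split; lra. }
  assert (A2 : Rabs ((exp x - 1 - x) * sin y + x * sin y + (sin y - y)) <= 4 * x^2 + 6 * y^2).
  { assert (-(x^2) - 4*y^2 <= x * sin y <= x^2 + 4 * y^2).
    { set (d := sin y - y) in *. replace (sin y) with (y + d) by (unfold d; ring).
      assert (0 <= y^2 <= 1) by nra. assert (d * d <= y^2 * y^2) by nra. assert (d * d <= y^2) by nra.
      pose proof (pow2_ge_0 (x - y)). pose proof (pow2_ge_0 (x + y)). pose proof (pow2_ge_0 (x - d)). pose proof (pow2_ge_0 (x + d)).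
      split; nra. }
    apply Rabs_le. split; nra. }
  rewrite S. nra.
Qed.

Lemma Cdiff_exp w : Cdiff Cexp w (Cexp w).
Proof.
  apply (Cdiff_quad _ _ _ 1 (Cmod (Cexp w) * 20)); [lra|].
  intros h Hh. rewrite Cexp_plus.
  replace (Cexp w * Cexp h - Cexp w - Cexp w * h)%C with (Cexp w * (Cexp h - 1 - h))%C by ring.
  rewrite Cmod_mult, Rmult_assoc. apply Rmult_le_compat_l; [apply Cmod_ge_0|].
  apply Cexp_taylor1; lra.
Qed.

(** * Holomorphic functions *)

(** A continuous derivative is part of the notion, so that Cauchy's theorem becomes a
    differentiation under the integral sign. *)
Definition hol (U : C -> Prop) (f : C -> C) :=
  exists f' : C -> C, forall w, U w -> Cdiff f w (f' w) /\ continuous f' w.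

Lemma hol_const U c : hol U (fun _ => c).
Proof. exists (fun _ => RtoC 0). intros w _; split; [apply Cdiff_const|apply continuous_const]. Qed.

Lemma hol_id U : hol U (fun w => w).
Proof. exists (fun _ => RtoC 1). intros w _; split; [apply Cdiff_id|apply continuous_const]. Qed.

Lemma hol_plus U f g : hol U f -> hol U g -> hol U (fun w => f w + g w)%C.
Proof.
  intros [f' Hf] [g' Hg]. exists (fun w => f' w + g' w)%C. intros w Hw.
  destruct (Hf w Hw), (Hg w Hw). split; [now apply Cdiff_plus|now apply cont_Cplus].
Qed.

Lemma hol_mult U f g : hol U f -> hol U g -> hol U (fun w => f w * g w)%C.
Proof.
  intros [f' Hf] [g' Hg]. exists (fun w => f' w * g w + f w * g' w)%C. intros w Hw.
  destruct (Hf w Hw), (Hg w Hw). split; [now apply Cdiff_mult|].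
  apply cont_Cplus; apply cont_Cmult; eauto using Cdiff_cont.
Qed.

Lemma hol_comp U V f g : hol V f -> hol U g -> (forall w, U w -> V (g w)) ->
  hol U (fun w => f (g w)).
Proof.
  intros [f' Hf] [g' Hg] HUV. exists (fun w => f' (g w) * g' w)%C. intros w Hw.
  destruct (Hg w Hw), (Hf _ (HUV w Hw)). split; [now apply Cdiff_comp|].
  apply cont_Cmult; [|assumption]. apply (continuous_comp g f'); eauto using Cdiff_cont.
Qed.

Lemma hol_inv U f : hol U f -> (forall w, U w -> f w <> RtoC 0) -> hol U (fun w => / f w)%C.
Proof.
  intros Hf Hn. apply (hol_comp U (fun w => w <> RtoC 0) Cinv f); [|assumption|assumption].
  exists (fun w => - / (w * w))%C. intros w Hw. split; [now apply Cdiff_inv|].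
  apply cont_Copp, cont_Cinv; [|apply Cmult_neq_0; assumption].
  apply cont_Cmult; apply continuous_id.
Qed.

Lemma hol_exp U f : hol U f -> hol U (fun w => Cexp (f w)).
Proof.
  intros Hf. apply (hol_comp U (fun _ => True) Cexp f); [|assumption|trivial].
  exists Cexp. intros w _. split; [apply Cdiff_exp|apply cont_Cexp, continuous_id].
Qed.

Lemma hol_opp U f : hol U f -> hol U (fun w => - f w)%C.
Proof.
  intros [f' Hf]. exists (fun w => 0 * f w + (RtoC (-1)) * f' w)%C. intros w Hw.
  destruct (Hf w Hw) as [H1 H2]. split.
  - apply (Cdiff_ext_loc (fun w => (RtoC (-1)) * f w)%C _ _ _ 1); [lra|intros; apply C_eq; simpl; ring|].
    apply Cdiff_mult; [apply Cdiff_const|assumption].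
  - apply cont_Cplus; apply cont_Cmult; try apply continuous_const; eauto using Cdiff_cont.
Qed.

Lemma hol_minus U f g : hol U f -> hol U g -> hol U (fun w => f w - g w)%C.
Proof. intros; apply hol_plus; [|apply hol_opp]; assumption. Qed.

Lemma hol_pow U f n : hol U f -> hol U (fun w => Cpow (f w) n).
Proof.
  intros H; induction n; simpl; [apply hol_const|].
  apply (hol_mult U f (fun w => Cpow (f w) n)); assumption.
Qed.

Lemma hol_subset (U V : C -> Prop) f : (forall w, U w -> V w) -> hol V f -> hol U f.
Proof. intros H [f' Hf]; exists f'; intros; apply Hf, H; assumption. Qed.

Definition Copen (U : C -> Prop) :=
  forall w, U w -> exists d, 0 < d /\ forall v, Cmod (v - w) < d -> U v.

Lemma hol_ext (U : C -> Prop) f g : Copen U -> (forall w, U w -> f w = g w) -> hol U f -> hol U g.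
Proof.
  intros HU E [f' Hf]. exists f'. intros w Hw. destruct (Hf w Hw). split; [|assumption].
  destruct (HU w Hw) as [d [Hd Hv]].
  apply (Cdiff_ext_loc f g w _ d); auto.
Qed.

(** * Complex-valued integrals *)

Definition CInt (f : R -> C) (a b : R) : C :=
  (RInt (fun t => Re (f t)) a b, RInt (fun t => Im (f t)) a b).

(** Continuity is two-sided even at the endpoints, because it refers to [f] on the whole line;
    integrands must behave well slightly beyond the interval. *)
Definition ccont (f : R -> C) (a b : R) :=
  forall t, Rmin a b <= t <= Rmax a b -> continuous f t.

Lemma ccont_ex_Re f a b : ccont f a b -> ex_RInt (fun t => Re (f t)) a b.
Proof.
  intros H. apply (ex_RInt_continuous (V:=R_CompleteNormedModule)).
  intros t Ht. apply cont_Re, H, Ht.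
Qed.

Lemma ccont_ex_Im f a b : ccont f a b -> ex_RInt (fun t => Im (f t)) a b.
Proof.
  intros H. apply (ex_RInt_continuous (V:=R_CompleteNormedModule)).
  intros t Ht. apply cont_Im, H, Ht.
Qed.

Lemma CInt_ext f g a b : (forall t, Rmin a b < t < Rmax a b -> f t = g t) ->
  CInt f a b = CInt g a b.
Proof.
  intros H; unfold CInt; f_equal; apply RInt_ext; intros t Ht; now rewrite H.
Qed.

Lemma CInt_plus f g a b : ccont f a b -> ccont g a b ->
  CInt (fun t => f t + g t)%C a b = (CInt f a b + CInt g a b)%C.
Proof.
  intros Hf Hg. apply C_eq; cbn.
  - apply (RInt_plus (fun t => Re (f t)) (fun t => Re (g t))); now apply ccont_ex_Re.
  - apply (RInt_plus (fun t => Im (f t)) (fun t => Im (g t))); now apply ccont_ex_Im.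
Qed.

Lemma CInt_cmult c f a b : ccont f a b ->
  CInt (fun t => c * f t)%C a b = (c * CInt f a b)%C.
Proof.
  intros Hf. pose proof (ccont_ex_Re f a b Hf) as H1; pose proof (ccont_ex_Im f a b Hf) as H2.
  apply C_eq; unfold CInt, Cmult, Re, Im in *; cbn [fst snd] in *.
  - etransitivity; [apply (RInt_minus (V:=R_CompleteNormedModule) (fun t => fst c * fst (f t)) (fun t => snd c * snd (f t)))|].
    + apply (ex_RInt_scal (V:=R_NormedModule) (fun t => fst (f t))); assumption.
    + apply (ex_RInt_scal (V:=R_NormedModule) (fun t => snd (f t))); assumption.
    + apply (f_equal2 Rminus); apply (RInt_scal (V:=R_CompleteNormedModule)); assumption.
  - etransitivity; [apply (RInt_plus (V:=R_CompleteNormedModule) (fun t => fst c * snd (f t)) (fun t => snd c * fst (f t)))|].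
    + apply (ex_RInt_scal (V:=R_NormedModule) (fun t => snd (f t))); assumption.
    + apply (ex_RInt_scal (V:=R_NormedModule) (fun t => fst (f t))); assumption.
    + apply (f_equal2 Rplus); apply (RInt_scal (V:=R_CompleteNormedModule)); assumption.
Qed.

Lemma CInt_minus f g a b : ccont f a b -> ccont g a b ->
  CInt (fun t => f t - g t)%C a b = (CInt f a b - CInt g a b)%C.
Proof.
  intros Hf Hg. apply C_eq; cbn.
  - apply (RInt_minus (fun t => Re (f t)) (fun t => Re (g t))); now apply ccont_ex_Re.
  - apply (RInt_minus (fun t => Im (f t)) (fun t => Im (g t))); now apply ccont_ex_Im.
Qed.

Lemma CInt_Chasles f a b c : ccont f a b -> ccont f b c ->
  (CInt f a b + CInt f b c)%C = CInt f a c.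
Proof.
  intros H1 H2. apply C_eq; cbn.
  - apply (RInt_Chasles (V:=R_CompleteNormedModule) (fun t => Re (f t))); now apply ccont_ex_Re.
  - apply (RInt_Chasles (V:=R_CompleteNormedModule) (fun t => Im (f t))); now apply ccont_ex_Im.
Qed.

Lemma CInt_le f g a b : a <= b -> ccont f a b -> ex_RInt g a b ->
  (forall t, a <= t <= b -> Cmod (f t) <= g t) -> Cmod (CInt f a b) <= RInt g a b.
Proof.
  intros Hab Hf Hg H.
  (* The norm on pairs of reals is Euclidean and equals [Cmod]. A componentwise estimate would lose
     a constant factor, which the final inequality cannot afford. *)
  assert (N : forall c : C, @norm R_AbsRing C_R_NormedModule c = Cmod c).
  { intros c. change (sqrt (Rabs (fst c) ^ 2 + Rabs (snd c) ^ 2) = Cmod c).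
    rewrite !pow2_abs. reflexivity. }
  rewrite <- N.
  apply (norm_RInt_le (V:=C_R_NormedModule) f g a b (CInt f a b) (RInt g a b)); [assumption| | |].
  - intros t Ht. rewrite N. apply H, Ht.
  - apply (is_RInt_fct_extend_pair (U:=R_NormedModule) (V:=R_NormedModule));
    apply (RInt_correct (V:=R_CompleteNormedModule)); [now apply ccont_ex_Re|now apply ccont_ex_Im].
  - now apply (RInt_correct (V:=R_CompleteNormedModule)).
Qed.

Lemma CInt_le_const f M a b : a <= b -> ccont f a b ->
  (forall t, a <= t <= b -> Cmod (f t) <= M) -> Cmod (CInt f a b) <= M * (b - a).
Proof.
  intros Hab Hf H. eapply Rle_trans; [apply (CInt_le f (fun _ => M)); try assumption|].
  - apply ex_RInt_const.
  - rewrite RInt_const. change scal with Rmult. lra.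
Qed.

Lemma CInt_derive (F f : R -> C) a b :
  (forall t, Rmin a b <= t <= Rmax a b -> is_derive (fun u => Re (F u)) t (Re (f t))) ->
  (forall t, Rmin a b <= t <= Rmax a b -> is_derive (fun u => Im (F u)) t (Im (f t))) ->
  ccont f a b -> CInt f a b = (F b - F a)%C.
Proof.
  intros H1 H2 Hc. apply C_eq; unfold CInt; cbn [Re Im fst snd].
  - apply is_RInt_unique. apply (is_RInt_derive (V:=R_CompleteNormedModule) (fun u => Re (F u))); [assumption|].
    intros t Ht. apply cont_Re, Hc, Ht.
  - apply is_RInt_unique. apply (is_RInt_derive (V:=R_CompleteNormedModule) (fun u => Im (F u))); [assumption|].
    intros t Ht. apply cont_Im, Hc, Ht.
Qed.

Lemma CInt_comp_lin f u v a b : ccont f (u * a + v) (u * b + v) ->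
  CInt (fun t => u * f (u * t + v)%R)%C a b = CInt f (u * a + v) (u * b + v).
Proof.
  intros H. apply C_eq; unfold CInt; cbn [Re Im fst snd].
  - rewrite <- (RInt_comp_lin (V:=R_CompleteNormedModule) (fun t => Re (f t))) by now apply ccont_ex_Re.
    apply RInt_ext; intros t _. unfold Cmult, Re, Im, RtoC; cbn. change scal with Rmult. simpl. ring.
  - rewrite <- (RInt_comp_lin (V:=R_CompleteNormedModule) (fun t => Im (f t))) by now apply ccont_ex_Im.
    apply RInt_ext; intros t _. unfold Cmult, Re, Im, RtoC; cbn. change scal with Rmult. simpl. ring.
Qed.

Definition Seg (f : C -> C) (a b : C) : C :=
  (CInt (fun t => f (a + RtoC t * (b - a))) 0 1 * (b - a))%C.

Lemma eq_of_small (a b : R) : (forall eps, 0 < eps -> Rabs (a - b) <= eps) -> a = b.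
Proof.
  intros H. destruct (Req_dec a b) as [|Hn]; [assumption|].
  assert (0 < Rabs (a - b)) by (apply Rabs_pos_lt; lra).
  specialize (H (Rabs (a - b) / 2) ltac:(lra)). lra.
Qed.

Lemma le_of_small (a b : R) : (forall eps, 0 < eps -> a <= b + eps) -> a <= b.
Proof.
  intros H. destruct (Rle_dec a b); [assumption|].
  specialize (H ((a - b) / 2) ltac:(lra)). lra.
Qed.

Lemma continuous_bounded (G : R -> R) a b : a <= b ->
  (forall x, a <= x <= b -> continuous G x) ->
  exists M, 0 <= M /\ forall x, a <= x <= b -> Rabs (G x) <= M.
Proof.
  intros Hab HG.
  destruct (continuity_ab_maj (fun x => Rabs (G x)) a b Hab) as [c [Hc _]].
  - intros x Hx. apply continuity_pt_filterlim.
    apply (continuous_comp G Rabs); [now apply HG|apply continuous_Rabs].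
  - exists (Rabs (G c)); split; [apply Rabs_pos|assumption].
Qed.

(** * Differentiation under the integral sign and Cauchy's theorem for a triangle *)

Section ParamFTC.
Variables (u du : R -> R -> R) (G : R -> R).
Hypothesis u_cont : forall x t, 0 <= x <= 1 -> 0 <= t <= 1 -> continuity_2d_pt u x t.
Hypothesis u_der : forall x t, 0 < x < 1 -> 0 <= t <= 1 ->
  locally_2d (fun x t => is_derive (fun z => u z t) x (du x t)) x t.
Hypothesis du_cont : forall x t, 0 < x < 1 -> 0 <= t <= 1 -> continuity_2d_pt du x t.
Hypothesis du_int : forall x, 0 < x < 1 -> RInt (du x) 0 1 = G x.
Hypothesis G_cont : forall x, 0 <= x <= 1 -> continuous G x.

Lemma slice_ex x : 0 <= x <= 1 -> ex_RInt (u x) 0 1.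
Proof using u_cont.
  intros Hx. apply (ex_RInt_continuous (V:=R_CompleteNormedModule)).
  rewrite Rmin_left, Rmax_right by lra. intros t Ht.
  pose proof (proj1 (continuity_2d_pt_filterlim _ _ _) (u_cont x t Hx Ht)) as H.
  apply (continuous_comp_2 (fun _ => x) (fun t => t) u t); [apply continuous_const|apply continuous_id|exact H].
Qed.

Lemma slice_cont : forall eps, 0 < eps -> exists d, 0 < d /\
  forall x y, 0 <= x <= 1 -> 0 <= y <= 1 -> Rabs (x - y) < d ->
    Rabs (RInt (u x) 0 1 - RInt (u y) 0 1) <= eps.
Proof using u_cont.
  intros eps He.
  destruct (uniform_continuity_2d u 0 1 0 1 u_cont (mkposreal eps He)) as [d Hd].
  exists d; split; [apply cond_pos|]. intros x y Hx Hy Hxy.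
  change (Rabs (minus (RInt (u x) 0 1) (RInt (u y) 0 1)) <= eps).
  rewrite <- (RInt_minus (V:=R_CompleteNormedModule)) by (apply slice_ex; assumption).
  eapply Rle_trans; [apply (abs_RInt_le_const _ 0 1 eps)|].
  - lra.
  - apply (ex_RInt_minus (V:=R_NormedModule)); apply slice_ex; assumption.
  - intros t Ht. left. apply (Hd y t x t); try assumption.
    replace (t - t) with 0 by ring. rewrite Rabs_R0. apply cond_pos.
  - lra.
Qed.

Lemma slice_der x : 0 < x < 1 -> is_derive (fun x => RInt (u x) 0 1) x (G x).
Proof using u_cont u_der du_cont du_int.
  intros Hx.
  assert (L : locally x (fun y => 0 < y < 1)).
  { apply (locally_interval _ x 0 1); simpl; try lra. intros; split; assumption. }
  assert (D : forall t, 0 <= t <= 1 ->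
    locally_2d (fun x t => Derive (fun z => u z t) x = du x t) x t).
  { intros t Ht. destruct (u_der x t Hx Ht) as [d Hd]. exists d. intros y s Hy Hs.
    apply is_derive_unique, Hd; assumption. }
  rewrite <- du_int by assumption.
  replace (RInt (du x) 0 1) with (RInt (fun t => Derive (fun z => u z t) x) 0 1).
  - apply is_derive_RInt_param; rewrite ?Rmin_left, ?Rmax_right by lra.
    + generalize L; apply filter_imp. intros y Hy t Ht.
      exists (du y t). apply (locally_2d_singleton _ y t (u_der y t Hy Ht)).
    + intros t Ht. apply (continuity_2d_pt_ext_loc du); [|now apply du_cont].
      generalize (D t Ht). intros [d Hd]; exists d; intros; symmetry; apply Hd; assumption.
    + generalize L; apply filter_imp. intros y Hy. apply slice_ex; lra.
  - apply RInt_ext. rewrite Rmin_left, Rmax_right by lra. intros t Ht.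
    apply (locally_2d_singleton _ x t (D t ltac:(lra))).
Qed.

(** The derivative under the integral is known only for 0 < x < 1, because the triangle may touch
    the boundary of the domain at x = 1 and at its apex x = 0. The fundamental theorem is applied on
    [e, 1 - e]; uniform continuity of the slices and boundedness of [G] control the rest. *)
Lemma param_FTC : RInt (u 1) 0 1 - RInt (u 0) 0 1 = RInt G 0 1.
Proof using u_cont u_der du_cont du_int G_cont.
  destruct (continuous_bounded G 0 1 ltac:(lra) G_cont) as [M [HM HG]].
  assert (Gex : forall a b, 0 <= a <= 1 -> 0 <= b <= 1 -> ex_RInt G a b).
  { intros a b Ha Hb. apply (ex_RInt_continuous (V:=R_CompleteNormedModule)).
    intros t Ht. apply G_cont. revert Ht. unfold Rmin, Rmax; repeat destruct Rle_dec; lra. }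
  apply eq_of_small. intros eps He.
  destruct (slice_cont (eps / 4) ltac:(lra)) as [d [Hd Hs]].
  (* Four errors of at most eps/4: two end slices, within the modulus of continuity d, and two end
     pieces of the integral of [G], each at most M e. *)
  set (e := Rmin (Rmin (d / 2) (1 / 4)) (eps / 4 / (M + 1))).
  assert (He4 : 0 < eps / 4 / (M + 1)) by (apply Rdiv_lt_0_compat; lra).
  assert (Hpos : 0 < e) by (unfold e; repeat apply Rmin_pos; lra).
  assert (e < d /\ e <= 1 / 4 /\ e <= eps / 4 / (M + 1)) as (H1 & H2 & H3).
  { unfold e, Rmin; repeat destruct Rle_dec; repeat split; lra. }
  assert (H4 : M * e <= eps / 4).
  { apply Rle_trans with ((M + 1) * (eps / 4 / (M + 1))); [|right; field; lra].
    apply Rmult_le_compat; lra. }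
  assert (I : RInt G e (1 - e) = RInt (u (1 - e)) 0 1 - RInt (u e) 0 1).
  { apply is_RInt_unique.
    apply (is_RInt_derive (V:=R_CompleteNormedModule) (fun x => RInt (u x) 0 1));
    rewrite Rmin_left, Rmax_right by lra; intros x Hx.
    - apply slice_der; lra.
    - apply G_cont; lra. }
  assert (J1 : Rabs (RInt G 0 e) <= (e - 0) * M).
  { apply abs_RInt_le_const; [lra|apply Gex; lra|]. intros; apply HG; lra. }
  assert (J2 : Rabs (RInt G (1 - e) 1) <= (1 - (1 - e)) * M).
  { apply abs_RInt_le_const; [lra|apply Gex; lra|]. intros; apply HG; lra. }
  assert (C1 : RInt G 0 1 = RInt G 0 e + (RInt G e (1 - e) + RInt G (1 - e) 1)).
  { rewrite <- (RInt_Chasles (V:=R_CompleteNormedModule) G 0 e 1) by (apply Gex; lra).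
    rewrite <- (RInt_Chasles (V:=R_CompleteNormedModule) G e (1 - e) 1) by (apply Gex; lra). reflexivity. }
  rewrite C1, I.
  pose proof (Hs 1 (1 - e) ltac:(lra) ltac:(lra)) as K1.
  pose proof (Hs 0 e ltac:(lra) ltac:(lra)) as K2.
  replace (1 - (1 - e)) with e in * by ring. replace (0 - e) with (- e) in K2 by ring.
  rewrite Rabs_Ropp in K2. rewrite (Rabs_right e) in * by lra.
  specialize (K1 ltac:(lra)); specialize (K2 ltac:(lra)).
  apply Rabs_le_between in K1, K2, J1, J2. apply Rabs_le. lra.
Qed.
End ParamFTC.

Lemma cont_2d (f : C -> C) (g : R -> R -> C) x t :
  continuous (fun z : R * R => g (fst z) (snd z)) (x, t) -> continuous f (g x t) ->
  continuous (fun z : R * R => f (g (fst z) (snd z))) (x, t).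
Proof. intros H1 H2. apply (continuous_comp (fun z : R * R => g (fst z) (snd z)) f); assumption. Qed.

Lemma cont2_Re (g : R -> R -> C) x t :
  continuous (fun z : R * R => g (fst z) (snd z)) (x, t) -> continuity_2d_pt (fun a b => Re (g a b)) x t.
Proof. intros H. apply continuity_2d_pt_filterlim. apply (cont_Re (fun z : R * R => g (fst z) (snd z))), H. Qed.

Lemma cont2_Im (g : R -> R -> C) x t :
  continuous (fun z : R * R => g (fst z) (snd z)) (x, t) -> continuity_2d_pt (fun a b => Im (g a b)) x t.
Proof. intros H. apply continuity_2d_pt_filterlim. apply (cont_Im (fun z : R * R => g (fst z) (snd z))), H. Qed.

Lemma cont_fst2 x t : continuous (fun z : R * R => fst z) (x, t).
Proof. apply (continuous_fst (U:=R_UniformSpace) (V:=R_UniformSpace)). Qed.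
Lemma cont_snd2 x t : continuous (fun z : R * R => snd z) (x, t).
Proof. apply (continuous_snd (U:=R_UniformSpace) (V:=R_UniformSpace)). Qed.

Lemma Cdiff_line (f : C -> C) (p v l : C) (x : R) :
  Cdiff f (p + RtoC x * v) l ->
  is_derive (fun z : R => Re (f (p + RtoC z * v)%C)) x (Re (l * v)) /\
  is_derive (fun z : R => Im (f (p + RtoC z * v)%C)) x (Im (l * v)).
Proof.
  intros H.
  (* Both components are treated at once: [P] is a real-linear functional of norm at most 1. *)
  assert (K : forall (P : C -> R) (HPm : forall a b, P (a - b)%C = P a - P b)
      (HPr : forall (r : R) a, P (RtoC r * a)%C = r * P a)
      (HP : forall c, Rabs (P c) <= Cmod c),
     is_derive (fun z : R => P (f (p + RtoC z * v)%C)) x (P (l * v)%C)).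
  { intros P HPm HPr HP. apply is_derive_Reals. intros eps He.
    pose proof (Cmod_ge_0 v).
    destruct (H (eps / 2 / (Cmod v + 1))) as [d [Hd Hh]].
    { apply Rdiv_lt_0_compat; lra. }
    assert (Hdp : 0 < d / (Cmod v + 1)) by (apply Rdiv_lt_0_compat; lra).
    exists (mkposreal _ Hdp). simpl. intros h Hn Hlt.
    pose proof (Rabs_pos_lt h Hn).
    assert (Hv : Cmod (RtoC h * v) = Rabs h * Cmod v) by (rewrite Cmod_mult, Cmod_R; reflexivity).
    assert (Hs : Cmod (RtoC h * v) < d).
    { rewrite Hv. apply Rle_lt_trans with (Rabs h * (Cmod v + 1)); [apply Rmult_le_compat_l; lra|].
      apply Rlt_le_trans with (d / (Cmod v + 1) * (Cmod v + 1)); [apply Rmult_lt_compat_r; lra|].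
      right; field; lra. }
    specialize (Hh _ Hs).
    replace (p + RtoC x * v + RtoC h * v)%C with (p + RtoC (x + h) * v)%C in Hh
      by (rewrite RtoC_plus; ring).
    assert (E : Rabs (P (f (p + RtoC (x + h) * v)%C) - P (f (p + RtoC x * v)%C) - h * P (l * v)%C)
       <= eps / 2 * Rabs h).
    { rewrite <- HPr, <- !HPm. eapply Rle_trans; [apply HP|].
      replace (RtoC h * (l * v))%C with (l * (RtoC h * v))%C by ring.
      eapply Rle_trans; [apply Hh|]. rewrite Hv.
      apply Rle_trans with (eps / 2 / (Cmod v + 1) * (Rabs h * (Cmod v + 1))); [|right; field; lra].
      apply Rmult_le_compat_l; [left; apply Rdiv_lt_0_compat; lra|]. apply Rmult_le_compat_l; lra. }
    replace ((P (f (p + RtoC (x + h) * v)%C) - P (f (p + RtoC x * v)%C)) / h - P (l * v)%C)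
      with ((P (f (p + RtoC (x + h) * v)%C) - P (f (p + RtoC x * v)%C) - h * P (l * v)%C) / h) by (field; assumption).
    unfold Rdiv. rewrite Rabs_mult, Rabs_inv by assumption.
    apply Rle_lt_trans with (eps / 2 * Rabs h * / Rabs h).
    - apply Rmult_le_compat_r; [left; apply Rinv_0_lt_compat|]; assumption.
    - replace (eps / 2 * Rabs h * / Rabs h) with (eps / 2) by (field; lra). lra. }
  split; apply K; try reflexivity.
  - intros r a; unfold Re, RtoC; simpl; ring.
  - apply re_le_Cmod.
  - intros r a; unfold Im, RtoC; simpl; ring.
  - apply im_le_Cmod.
Qed.

Section Triangle.
Variables (U : C -> Prop) (f : C -> C) (p a b : C).
Hypothesis U_open : Copen U.
Hypothesis f_hol : hol U f.
(** The parameter x runs from the apex [p] to the opposite side, t along that side. Only points with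
    0 < x < 1 have to lie in [U], so the apex and the side from [a] to [b] may lie on its boundary;
    mere continuity of [f] is asked there. *)
Let w (x t : R) : C := (p + RtoC x * (a - p + RtoC t * (b - a)))%C.
Hypothesis w_in : forall x t, 0 < x < 1 -> 0 <= t <= 1 -> U (w x t).
Hypothesis f_cont : forall x t, 0 <= x <= 1 -> 0 <= t <= 1 -> continuous f (w x t).

Lemma w_cont x t : continuous (fun z : R * R => w (fst z) (snd z)) (x, t).
Proof using.
  unfold w. apply cont_Cplus; [apply continuous_const|].
  apply cont_Cmult; [apply cont_RtoC, cont_fst2|].
  apply cont_Cplus; [apply continuous_const|].
  apply cont_Cmult; [apply cont_RtoC, cont_snd2|apply continuous_const].
Qed.

Lemma w_in_near x t : 0 < x < 1 -> 0 <= t <= 1 -> locally_2d (fun x t => U (w x t)) x t.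
Proof using U_open w_in.
  intros Hx Ht. destruct (U_open _ (w_in x t Hx Ht)) as [d [Hd Hv]].
  apply locally_2d_locally.
  assert (Hd2 : 0 < d / 2) by lra.
  pose proof (w_cont x t (ball (w x t) (mkposreal _ Hd2)) (locally_ball _ _)) as HB.
  unfold filtermap in HB. revert HB. apply filter_imp. intros z [B1 B2]. apply Hv.
  eapply Rle_lt_trans; [apply Cmod_le_ReIm|].
  change (Rabs (Re (w (fst z) (snd z)) - Re (w x t)) < d / 2) in B1.
  change (Rabs (Im (w (fst z) (snd z)) - Im (w x t)) < d / 2) in B2.
  change (Re (w (fst z) (snd z) - w x t)%C) with (Re (w (fst z) (snd z)) - Re (w x t)).
  change (Im (w (fst z) (snd z) - w x t)%C) with (Im (w (fst z) (snd z)) - Im (w x t)). lra.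
Qed.

Lemma cont_line (c v : C) (t : R) : continuous (fun t : R => (c + RtoC t * v)%C) t.
Proof using.
  apply cont_Cplus; [apply continuous_const|].
  apply cont_Cmult; [apply cont_RtoC, continuous_id|apply continuous_const].
Qed.

(* [d/dx (x f(p + x g(t)) g'(t)) = d/dt (f(p + x g(t)) g(t))] for [g(t) = a - p + t (b - a)]. *)
Lemma Cauchy_triangle : Seg f a b = (Seg f p b - Seg f p a)%C.
Proof using U_open f_hol w_in f_cont.
  destruct f_hol as [f' Hf'].
  set (g := fun t : R => (a - p + RtoC t * (b - a))%C).
  set (V := fun x t : R => (RtoC x * (f (w x t) * (b - a)))%C).
  set (dV := fun x t : R => (f (w x t) * (b - a) + RtoC x * (f' (w x t) * g t * (b - a)))%C).
  set (H := fun x : R => (f (p + RtoC x * (b - p)) * (b - p) - f (p + RtoC x * (a - p)) * (a - p))%C).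
  assert (W0 : forall x, (p + RtoC x * (a - p))%C = w x 0).
  { intros x; unfold w. ring. }
  assert (W1 : forall x, (p + RtoC x * (b - p))%C = w x 1).
  { intros x; unfold w. ring. }
  assert (Hc0 : forall x, 0 <= x <= 1 -> continuous (fun x : R => f (p + RtoC x * (a - p))%C) x).
  { intros x Hx. apply (continuous_comp (fun x : R => (p + RtoC x * (a - p))%C) f); [apply cont_line|].
    rewrite W0. apply f_cont; lra. }
  assert (Hc1 : forall x, 0 <= x <= 1 -> continuous (fun x : R => f (p + RtoC x * (b - p))%C) x).
  { intros x Hx. apply (continuous_comp (fun x : R => (p + RtoC x * (b - p))%C) f); [apply cont_line|].
    rewrite W1. apply f_cont; lra. }
  assert (Hcab : ccont (fun t : R => f (a + RtoC t * (b - a))%C) 0 1).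
  { intros t Ht. rewrite Rmin_left, Rmax_right in Ht by lra.
    apply (continuous_comp (fun t : R => (a + RtoC t * (b - a))%C) f); [apply cont_line|].
    replace (a + RtoC t * (b - a))%C with (w 1 t) by (unfold w; ring). apply f_cont; lra. }
  assert (fw_cont : forall x t, 0 <= x <= 1 -> 0 <= t <= 1 ->
     continuous (fun z : R * R => f (w (fst z) (snd z))) (x, t)).
  { intros. apply cont_2d; [apply w_cont|now apply f_cont]. }
  assert (V_cont : forall x t, 0 <= x <= 1 -> 0 <= t <= 1 ->
     continuous (fun z : R * R => V (fst z) (snd z)) (x, t)).
  { intros. unfold V. apply cont_Cmult; [apply cont_RtoC, cont_fst2|].
    apply cont_Cmult; [now apply fw_cont|apply continuous_const]. }
  assert (dV_cont : forall x t, 0 < x < 1 -> 0 <= t <= 1 ->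
     continuous (fun z : R * R => dV (fst z) (snd z)) (x, t)).
  { intros x t Hx Ht. unfold dV, g. apply cont_Cplus.
    - apply cont_Cmult; [apply fw_cont; lra|apply continuous_const].
    - apply cont_Cmult; [apply cont_RtoC, cont_fst2|].
      apply cont_Cmult; [apply cont_Cmult|apply continuous_const].
      + apply cont_2d; [apply w_cont|apply Hf', w_in; assumption].
      + apply cont_Cplus; [apply continuous_const|].
        apply cont_Cmult; [apply cont_RtoC, cont_snd2|apply continuous_const]. }
  assert (H_cont : forall x, 0 <= x <= 1 -> continuous H x).
  { intros x Hx. unfold H. apply cont_Cminus; apply cont_Cmult; auto using continuous_const. }
  assert (V_der : forall x t, U (w x t) ->
     is_derive (fun z => Re (V z t)) x (Re (dV x t)) /\ is_derive (fun z => Im (V z t)) x (Im (dV x t))).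
  { intros x t Hx. destruct (Hf' _ Hx) as [D _].
    assert (D2 : Cdiff (fun v => f v * (b - a))%C (p + RtoC x * g t) (f' (w x t) * (b - a) + f (w x t) * 0)%C).
    { apply (Cdiff_mult f (fun _ => (b - a)%C)); [exact D|apply Cdiff_const]. }
    apply Cdiff_line in D2. destruct D2 as [D3 D4].
    split.
    - apply (is_derive_ext (fun z : R => z * Re (f (p + RtoC z * g t)%C * (b - a))%C)).
      { intros z. change (V z t) with (RtoC z * (f (p + RtoC z * g t)%C * (b - a)))%C.
        generalize (f (p + RtoC z * g t)%C * (b - a))%C. intros c.
        match goal with |- ?u = ?v => change (@eq R u v) end.
        unfold Re, RtoC, Cmult; cbn [fst snd]. ring. }
      evar_last; [apply (is_derive_mult (K:=R_AbsRing) (fun z => z)); [apply is_derive_id|exact D3|intros; apply Rmult_comm]|].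
      unfold dV. fold (g t). unfold plus, mult, one; simpl.
      change (p + RtoC x * g t)%C with (w x t).
      unfold Re, RtoC, Cmult, Cplus; cbn [fst snd].
      match goal with |- ?u = ?v => change (@eq R u v) end. ring.
    - apply (is_derive_ext (fun z : R => z * Im (f (p + RtoC z * g t)%C * (b - a))%C)).
      { intros z. change (V z t) with (RtoC z * (f (p + RtoC z * g t)%C * (b - a)))%C.
        generalize (f (p + RtoC z * g t)%C * (b - a))%C. intros c.
        match goal with |- ?u = ?v => change (@eq R u v) end.
        unfold Im, RtoC, Cmult; cbn [fst snd]. ring. }
      evar_last; [apply (is_derive_mult (K:=R_AbsRing) (fun z => z)); [apply is_derive_id|exact D4|intros; apply Rmult_comm]|].
      unfold dV. fold (g t). unfold plus, mult, one; simpl.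
      change (p + RtoC x * g t)%C with (w x t).
      unfold Im, RtoC, Cmult, Cplus; cbn [fst snd].
      match goal with |- ?u = ?v => change (@eq R u v) end. ring. }
  assert (dV_int : forall x, 0 < x < 1 -> CInt (dV x) 0 1 = H x).
  { intros x Hx.
    assert (Hx0 : RtoC x <> RtoC 0) by (intros E; injection E; lra).
    assert (Hcc : ccont (fun t => RtoC x * dV x t)%C 0 1).
    { intros t Ht. rewrite Rmin_left, Rmax_right in Ht by lra.
      apply cont_Cmult; [apply continuous_const|].
      apply (continuous_comp_2 (fun _ => x) (fun t => t) dV t);
        [apply continuous_const|apply continuous_id|apply dV_cont; lra]. }
    assert (Hcd : ccont (dV x) 0 1).
    { intros t Ht. rewrite Rmin_left, Rmax_right in Ht by lra.
      apply (continuous_comp_2 (fun _ => x) (fun t => t) dV t);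
        [apply continuous_const|apply continuous_id|apply dV_cont; lra]. }
    assert (E : CInt (fun t => RtoC x * dV x t)%C 0 1 = (RtoC x * H x)%C).
    (* Along v = w x t, the function f(v)(v - p) has x dV as its derivative in t. The integral of dV
       is recovered by dividing by x, which is nonzero inside the triangle. *)
    { set (Q := fun v : C => (f v * (v - p))%C).
      assert (QD : forall t, 0 <= t <= 1 ->
         is_derive (fun t : R => Re (Q (w x 0 + RtoC t * (RtoC x * (b - a)))%C)) t (Re (RtoC x * dV x t)%C) /\
         is_derive (fun t : R => Im (Q (w x 0 + RtoC t * (RtoC x * (b - a)))%C)) t (Im (RtoC x * dV x t)%C)).
      { intros t Ht. destruct (Hf' _ (w_in x t Hx Ht)) as [D _].
        assert (Ew : (w x 0 + RtoC t * (RtoC x * (b - a)))%C = w x t) by (unfold w; ring).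
        assert (D2 : Cdiff Q (w x 0 + RtoC t * (RtoC x * (b - a)))%C (f' (w x t) * (w x t - p) + f (w x t) * (1 + 0))%C).
        { rewrite Ew. unfold Q. apply (Cdiff_mult f (fun v => v - p)%C); [exact D|].
          apply (Cdiff_plus (fun v => v) (fun _ => - p)%C); [apply Cdiff_id|apply Cdiff_const]. }
        apply Cdiff_line in D2.
        replace (RtoC x * dV x t)%C with ((f' (w x t) * (w x t - p) + f (w x t) * (1 + 0)) * (RtoC x * (b - a)))%C; [exact D2|].
        unfold dV. replace (w x t - p)%C with (RtoC x * g t)%C by (unfold w, g; ring). ring. }
      rewrite (CInt_derive (fun t : R => Q (w x 0 + RtoC t * (RtoC x * (b - a)))%C) (fun t => RtoC x * dV x t)%C); try assumption.
      - unfold Q, H. rewrite !W0, !W1.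
        replace (w x 0 + RtoC 1 * (RtoC x * (b - a)))%C with (w x 1) by (unfold w; ring).
        replace (w x 0 + RtoC 0 * (RtoC x * (b - a)))%C with (w x 0) by (unfold w; ring).
        replace (w x 1 - p)%C with (RtoC x * (b - p))%C by (unfold w; ring).
        replace (w x 0 - p)%C with (RtoC x * (a - p))%C by (unfold w; ring). ring.
      - intros t Ht. rewrite Rmin_left, Rmax_right in Ht by lra. apply QD, Ht.
      - intros t Ht. rewrite Rmin_left, Rmax_right in Ht by lra. apply QD, Ht. }
    rewrite CInt_cmult in E by assumption.
    replace (CInt (dV x) 0 1) with (RtoC x * CInt (dV x) 0 1 / RtoC x)%C by (field; assumption).
    rewrite E. field; assumption. }
  assert (HRe : Re (CInt H 0 1) = Re (CInt (V 1) 0 1) - Re (CInt (V 0) 0 1)).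
  { symmetry. apply (param_FTC (fun x t => Re (V x t)) (fun x t => Re (dV x t)) (fun x => Re (H x))).
    - intros; apply cont2_Re, V_cont; assumption.
    - intros x t Hx Ht. destruct (w_in_near x t Hx Ht) as [d Hd]. exists d. intros. apply V_der, Hd; assumption.
    - intros; apply cont2_Re, dV_cont; assumption.
    - intros x Hx. rewrite <- dV_int by assumption. reflexivity.
    - intros; apply cont_Re, H_cont; assumption. }
  assert (HIm : Im (CInt H 0 1) = Im (CInt (V 1) 0 1) - Im (CInt (V 0) 0 1)).
  { symmetry. apply (param_FTC (fun x t => Im (V x t)) (fun x t => Im (dV x t)) (fun x => Im (H x))).
    - intros; apply cont2_Im, V_cont; assumption.
    - intros x t Hx Ht. destruct (w_in_near x t Hx Ht) as [d Hd]. exists d. intros. apply V_der, Hd; assumption.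
    - intros; apply cont2_Im, dV_cont; assumption.
    - intros x Hx. rewrite <- dV_int by assumption. reflexivity.
    - intros; apply cont_Im, H_cont; assumption. }
  assert (E : CInt H 0 1 = (CInt (V 1) 0 1 - CInt (V 0) 0 1)%C).
  { apply C_eq; [rewrite HRe|rewrite HIm]; reflexivity. }
  assert (E0 : CInt (V 0) 0 1 = RtoC 0).
  { rewrite (CInt_ext _ (fun _ => RtoC 0 * RtoC 0)%C).
    - rewrite (CInt_cmult (RtoC 0) (fun _ => RtoC 0)) by (intros t _; apply continuous_const). ring.
    - intros t _. unfold V. ring. }
  assert (E1 : CInt (V 1) 0 1 = Seg f a b).
  { unfold Seg. rewrite (CInt_ext _ (fun t => (b - a) * f (a + RtoC t * (b - a)))%C).
    - rewrite (CInt_cmult (b - a)%C (fun t => f (a + RtoC t * (b - a)))%C) by assumption. ring.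
    - intros t _. unfold V. replace (w 1 t) with (a + RtoC t * (b - a))%C by (unfold w; ring). ring. }
  assert (E2 : CInt H 0 1 = (Seg f p b - Seg f p a)%C).
  { unfold H. rewrite (CInt_minus (fun x => f (p + RtoC x * (b - p)) * (b - p))%C (fun x => f (p + RtoC x * (a - p)) * (a - p))%C).
    - unfold Seg. f_equal; [|f_equal].
      + rewrite (CInt_ext _ (fun t => (b - p) * f (p + RtoC t * (b - p)))%C) by (intros; ring).
        rewrite (CInt_cmult (b - p)%C (fun t => f (p + RtoC t * (b - p)))%C); [ring|].
        intros t Ht. rewrite Rmin_left, Rmax_right in Ht by lra. now apply Hc1.
      + rewrite (CInt_ext _ (fun t => (a - p) * f (p + RtoC t * (a - p)))%C) by (intros; ring).
        rewrite (CInt_cmult (a - p)%C (fun t => f (p + RtoC t * (a - p)))%C); [ring|].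
        intros t Ht. rewrite Rmin_left, Rmax_right in Ht by lra. now apply Hc0.
    - intros t Ht. rewrite Rmin_left, Rmax_right in Ht by lra. apply cont_Cmult; auto using continuous_const.
    - intros t Ht. rewrite Rmin_left, Rmax_right in Ht by lra. apply cont_Cmult; auto using continuous_const. }
  rewrite <- E1, <- E2, E, E0. ring.
Qed.
End Triangle.

(** * Cauchy's formula in the right half-plane *)

Definition RH (w : C) := 0 < Re w.

Lemma RH_open : Copen RH.
Proof.
  intros w Hw. exists (Re w). split; [exact Hw|]. intros v Hv.
  pose proof (re_le_Cmod (v - w)) as H. apply Rle_lt_trans with (2 := Hv) in H.
  change (Re (v - w)%C) with (Re v - Re w) in H. apply Rabs_def2 in H. unfold RH. lra.
Qed.

Lemma Cmod_sub_0 (a b : C) : Cmod (a - b) = 0 -> a = b.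
Proof.
  intros H. apply Cmod_eq_0 in H. replace a with (a - b + b)%C by ring. rewrite H. ring.
Qed.

Lemma punctured_open (U : C -> Prop) z : Copen U -> Copen (fun w => U w /\ w <> z).
Proof.
  intros HU w [Hw Hn]. destruct (HU w Hw) as [d [Hd Hv]].
  assert (Hp : 0 < Cmod (w - z)).
  { destruct (Cmod_ge_0 (w - z)) as [|E]; [assumption|]. symmetry in E. elim Hn. now apply Cmod_sub_0. }
  exists (Rmin d (Cmod (w - z))). split; [now apply Rmin_pos|].
  intros v H. split.
  - apply Hv. eapply Rlt_le_trans; [exact H|apply Rmin_l].
  - intros ->. rewrite Cmod_sub_sym in H. pose proof (Rmin_r d (Cmod (w - z))). lra.
Qed.

Lemma Seg_vert (F : C -> C) (c u v : R) :
  ccont (fun s => F (c, s)) u v ->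
  Seg F (c, u) (c, v) = (Ci * CInt (fun s => F (c, s)) u v)%C.
Proof.
  intros H. unfold Seg.
  pose proof (CInt_comp_lin (fun s => F (c, s)) (v - u) u 0 1) as E.
  replace ((v - u) * 0 + u) with u in E by ring. replace ((v - u) * 1 + u) with v in E by ring.
  rewrite <- E by assumption.
  assert (Hc : ccont (fun t => F ((c, u) + RtoC t * ((c, v) - (c, u)))%C) 0 1).
  { intros t Ht. rewrite Rmin_left, Rmax_right in Ht by lra.
    assert (Et : forall t : R, ((c, u) + RtoC t * ((c, v) - (c, u)))%C = (c, (v - u) * t + u)).
    { intros s; apply C_eq; unfold Re, Im, RtoC; simpl; ring. }
    apply (continuous_ext (fun t => F (c, (v - u) * t + u))); [intros; now rewrite Et|].
    apply (continuous_comp (fun t => (v - u) * t + u) (fun s => F (c, s))).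
    - apply (ex_derive_continuous (fun t => (v - u) * t + u)). auto_derive; trivial.
    - apply H. revert Ht. unfold Rmin, Rmax; repeat destruct Rle_dec; intros; nra. }
  rewrite (CInt_ext (fun t => RtoC (v - u) * F (c, ((v - u) * t + u)%R))%C
     (fun t => RtoC (v - u) * F ((c, u) + RtoC t * ((c, v) - (c, u))))%C).
  - rewrite (CInt_cmult (RtoC (v - u)) (fun t => F ((c, u) + RtoC t * ((c, v) - (c, u))))%C) by assumption.
    replace ((c, v) - (c, u))%C with (Ci * RtoC (v - u))%C; [ring|].
    apply C_eq; unfold Re, Im, RtoC; simpl; ring.
  - intros t _. f_equal. f_equal. apply C_eq; unfold Re, Im, RtoC; simpl; ring.
Qed.

Lemma Seg_horiz (F : C -> C) (c u v : R) :
  ccont (fun s => F (s, c)) u v ->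
  Seg F (u, c) (v, c) = CInt (fun s => F (s, c)) u v.
Proof.
  intros H. unfold Seg.
  pose proof (CInt_comp_lin (fun s => F (s, c)) (v - u) u 0 1) as E.
  replace ((v - u) * 0 + u) with u in E by ring. replace ((v - u) * 1 + u) with v in E by ring.
  rewrite <- E by assumption.
  assert (Hc : ccont (fun t => F ((u, c) + RtoC t * ((v, c) - (u, c)))%C) 0 1).
  { intros t Ht. rewrite Rmin_left, Rmax_right in Ht by lra.
    assert (Et : forall t : R, ((u, c) + RtoC t * ((v, c) - (u, c)))%C = ((v - u) * t + u, c)).
    { intros s; apply C_eq; unfold Re, Im, RtoC; simpl; ring. }
    apply (continuous_ext (fun t => F ((v - u) * t + u, c))); [intros; now rewrite Et|].
    apply (continuous_comp (fun t => (v - u) * t + u) (fun s => F (s, c))).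
    - apply (ex_derive_continuous (fun t => (v - u) * t + u)). auto_derive; trivial.
    - apply H. revert Ht. unfold Rmin, Rmax; repeat destruct Rle_dec; intros; nra. }
  rewrite (CInt_ext (fun t => RtoC (v - u) * F (((v - u) * t + u)%R, c))%C
     (fun t => RtoC (v - u) * F ((u, c) + RtoC t * ((v, c) - (u, c))))%C).
  - rewrite (CInt_cmult (RtoC (v - u)) (fun t => F ((u, c) + RtoC t * ((v, c) - (u, c))))%C) by assumption.
    replace ((v, c) - (u, c))%C with (RtoC (v - u))%C; [ring|].
    apply C_eq; unfold Re, Im, RtoC; simpl; ring.
  - intros t _. f_equal. f_equal. apply C_eq; unfold Re, Im, RtoC; simpl; ring.
Qed.

Lemma cont_vert (F : C -> C) (c s : R) : continuous F (c, s) -> continuous (fun s => F (c, s)) s.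
Proof.
  intros H. apply (continuous_comp (fun s : R => ((c, s) : C)) F); [|exact H].
  apply cont_pair; [apply continuous_const|apply continuous_id].
Qed.

Lemma cont_horiz (F : C -> C) (s c : R) : continuous F (s, c) -> continuous (fun s => F (s, c)) s.
Proof.
  intros H. apply (continuous_comp (fun s : R => ((s, c) : C)) F); [|exact H].
  apply cont_pair; [apply continuous_id|apply continuous_const].
Qed.

Lemma Cinv_pair (a b : R) : (/ (a, b))%C = (a / (a ^ 2 + b ^ 2), - b / (a ^ 2 + b ^ 2)).
Proof. reflexivity. Qed.

Lemma sum_sq_pos (a b : R) : a <> 0 -> 0 < a ^ 2 + b ^ 2.
Proof. intros H. pose proof (pow2_ge_0 b). assert (0 < a ^ 2) by (apply pow2_gt_0; assumption). lra. Qed.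

(** The segment is centred at the height of z, so the logarithms at its two ends cancel and only an
    angle remains. This is why the windows below run from Im z - Y to Im z + Y. *)
Lemma CInt_inv_vert (z : C) (c Y : R) : c - Re z <> 0 -> 0 < Y ->
  CInt (fun s => / ((c, s) - z))%C (Im z - Y) (Im z + Y) = RtoC (2 * atan (Y / (c - Re z))).
Proof.
  intros Hc HY. set (d := c - Re z) in *.
  rewrite (CInt_derive (fun s => (atan ((s - Im z) / d), - (1 / 2) * ln (d ^ 2 + (s - Im z) ^ 2)))).
  - replace (Im z + Y - Im z) with Y by ring. replace (Im z - Y - Im z) with (- Y) by ring.
    replace ((- Y) ^ 2) with (Y ^ 2) by ring.
    replace (- Y / d) with (- (Y / d)) by (field; assumption). rewrite atan_opp.
    unfold Cminus, Cplus, Copp, RtoC; cbn [fst snd]. f_equal; ring.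
  - intros t _. unfold Re at 1; cbn [fst].
    replace (Re (/ ((c, t) - z))%C) with (d / (d ^ 2 + (t - Im z) ^ 2)) by (unfold d; reflexivity).
    pose proof (sum_sq_pos d (t - Im z) Hc).
    auto_derive; [trivial|]. field. split; [|assumption]. unfold Rdiv in *. nra.
  - intros t _. unfold Im at 1; cbn [snd].
    replace (Im (/ ((c, t) - z))%C) with (- (t - Im z) / (d ^ 2 + (t - Im z) ^ 2)) by (unfold d; reflexivity).
    pose proof (sum_sq_pos d (t - Im z) Hc).
    auto_derive; [lra|]. field. lra.
  - intros t _. apply cont_Cinv.
    + apply cont_Cminus; [|apply continuous_const]. apply cont_pair; [apply continuous_const|apply continuous_id].
    + intros E. apply (f_equal Re) in E. unfold d in Hc. apply Hc. exact E.
Qed.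

Lemma CInt_inv_horiz (z : C) (c u v : R) : c - Im z <> 0 ->
  CInt (fun s => / ((s, c) - z))%C u v =
  (1 / 2 * ln ((v - Re z) ^ 2 + (c - Im z) ^ 2) - 1 / 2 * ln ((u - Re z) ^ 2 + (c - Im z) ^ 2),
   - (atan ((v - Re z) / (c - Im z)) - atan ((u - Re z) / (c - Im z)))).
Proof.
  intros Hc. set (d := c - Im z) in *.
  rewrite (CInt_derive (fun s => (1 / 2 * ln ((s - Re z) ^ 2 + d ^ 2), - atan ((s - Re z) / d)))).
  - unfold Cminus, Cplus, Copp, RtoC; cbn [fst snd]. f_equal; ring.
  - intros t _. unfold Re at 1; cbn [fst].
    replace (Re (/ ((t, c) - z))%C) with ((t - Re z) / ((t - Re z) ^ 2 + d ^ 2)) by (unfold d; reflexivity).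
    pose proof (sum_sq_pos d (t - Re z) Hc).
    auto_derive; [lra|]. field. lra.
  - intros t _. unfold Im at 1; cbn [snd].
    replace (Im (/ ((t, c) - z))%C) with (- d / ((t - Re z) ^ 2 + d ^ 2)) by (unfold d; reflexivity).
    pose proof (sum_sq_pos d (t - Re z) Hc).
    auto_derive; [trivial|]. field. repeat split; try assumption; nra.
  - intros t _. apply cont_Cinv.
    + apply cont_Cminus; [|apply continuous_const]. apply cont_pair; [apply continuous_id|apply continuous_const].
    + intros E. apply (f_equal Im) in E. apply Hc. exact E.
Qed.

Lemma atan_inv_pos u : 0 < u -> atan u + atan (/ u) = PI / 2.
Proof. intros Hu. rewrite atan_inv by assumption. ring. Qed.

Section HalfPlane.
Variables (f : C -> C) (z : C) (C0 : R).
Hypothesis f_hol : hol RH f.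
Hypothesis f_cont : forall w, 0 <= Re w -> continuous f w.
Hypothesis f_bd : forall w, 0 <= Re w -> Cmod (f w) * (1 + Cmod w) <= C0.
Hypothesis z_in : RH z.

(** The singularity of the difference quotient at z is removed by the value f'(z). Continuity is all
    that is asked at z, which becomes the common apex of the triangles in Cauchy's formula. *)
Lemma quot_ext : exists g : C -> C,
  hol (fun w => RH w /\ w <> z) g /\ (forall w, 0 <= Re w -> continuous g w) /\
  (forall w, w <> z -> g w = (f w * / (w - z) - f z * / (w - z))%C).
Proof using f_hol f_cont z_in.
  destruct f_hol as [f' Hf']. destruct (Hf' z z_in) as [D _].
  set (q := fun w => (f w * / (w - z) - f z * / (w - z))%C).
  set (g := fun w : C => if Req_EM_T (Cmod (w - z)) 0 then f' z else q w).
  assert (gq : forall w, w <> z -> g w = q w).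
  { intros w Hw. unfold g. destruct Req_EM_T as [E|]; [|reflexivity]. elim Hw. now apply Cmod_sub_0. }
  assert (gz : g z = f' z).
  { unfold g. replace (z - z)%C with (RtoC 0) by ring. rewrite Cmod_0. destruct Req_EM_T; [reflexivity|lra]. }
  assert (nz : forall w, w <> z -> (w - z)%C <> RtoC 0).
  { intros w Hw E. apply Hw. replace w with (w - z + z)%C by ring. rewrite E. ring. }
  exists g. split; [|split].
  - apply (hol_ext _ q); [apply punctured_open, RH_open|intros w [_ Hw]; symmetry; now apply gq|].
    assert (Hi : hol (fun w => RH w /\ w <> z) (fun w => / (w - z))%C).
    { apply hol_inv; [|intros w [_ Hw]; now apply nz].
      apply (hol_minus _ (fun w => w)); [apply hol_id|apply hol_const]. }
    unfold q. apply hol_minus; apply hol_mult; try exact Hi; [|apply hol_const].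
    apply (hol_subset _ RH); [tauto|exact f_hol].
  - intros w Hw. destruct (classic (w = z)) as [->|Hn].
    + apply cont_eps. intros eps He. destruct (D (eps / 2) ltac:(lra)) as [d [Hd Hh]].
      exists d; split; [assumption|]. intros v Hv. rewrite gz.
      destruct (classic (v = z)) as [->|Hvn].
      { rewrite gz. replace (f' z - f' z)%C with (RtoC 0) by ring. now rewrite Cmod_0. }
      rewrite gq by assumption. specialize (Hh (v - z)%C Hv).
      replace (z + (v - z))%C with v in Hh by ring.
      replace (q v - f' z)%C with ((f v - f z - f' z * (v - z)) / (v - z))%C
        by (unfold q; field; now apply nz).
      rewrite Cmod_div by now apply nz.
      assert (Hp : 0 < Cmod (v - z)) by (apply Cmod_gt_0; now apply nz).
      apply Rle_lt_trans with (eps / 2 * Cmod (v - z) / Cmod (v - z)).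
      * apply Rmult_le_compat_r; [left; now apply Rinv_0_lt_compat|assumption].
      * replace (eps / 2 * Cmod (v - z) / Cmod (v - z)) with (eps / 2) by (field; lra). lra.
    + assert (Hp : 0 < Cmod (w - z)) by (apply Cmod_gt_0; now apply nz).
      apply (continuous_ext_loc _ q).
      * exists (mkposreal (Cmod (w - z) / 2) ltac:(lra)). intros v [B1 B2]. symmetry. apply gq.
        intros ->.
        change (Rabs (Re z - Re w) < Cmod (w - z) / 2) in B1.
        change (Rabs (Im z - Im w) < Cmod (w - z) / 2) in B2.
        pose proof (Cmod_le_ReIm (z - w)) as L. rewrite Cmod_sub_sym in L.
        change (Re (z - w)%C) with (Re z - Re w) in L.
        change (Im (z - w)%C) with (Im z - Im w) in L. lra.
      * assert (Hi : continuous (fun w => / (w - z))%C w).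
        { apply cont_Cinv; [|now apply nz]. apply cont_Cminus; [apply continuous_id|apply continuous_const]. }
        unfold q. apply cont_Cminus; apply cont_Cmult; try exact Hi; [now apply f_cont|apply continuous_const].
  - exact gq.
Qed.

(** A rectangle with its left side on the imaginary axis is cut into four triangles with apex z, on
    which the difference quotient integrates to zero; the part containing f(z) is explicit and gives
    2 pi i f(z). On the other three sides |w - z| >= Y, while [f_bd] makes f of order 1/Y, so they
    contribute at most 4 C0/Y, 2 C0/Y and 4 C0/Y. *)
Lemma half_plane_cauchy (Y : R) : 1 <= Y -> Re z <= Y -> 2 * Rabs (Im z) <= Y ->
  Cmod (RtoC (2 * PI) * f z
        + CInt (fun s => f (0%R, s) * / ((0%R, s) - z)) (Im z - Y) (Im z + Y))%C <= 10 * C0 / Y.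
Proof using f_hol f_cont f_bd z_in.
  intros HY1 HYx HYy.
  destruct quot_ext as (g & g_hol & g_cont & gq).
  set (x := Re z) in *. set (y := Im z) in *.
  assert (Hx : 0 < x) by exact z_in.
  set (A := ((0%R, (y - Y)%R) : C)). set (B := (((x + Y)%R, (y - Y)%R) : C)).
  set (D := ((0%R, (y + Y)%R) : C)). set (E := (((x + Y)%R, (y + Y)%R) : C)).
  assert (Tri : forall a b : C, 0 <= Re a -> 0 <= Re b ->
      (forall t, 0 <= t <= 1 -> (a - z + RtoC t * (b - a))%C <> RtoC 0) ->
      Seg g a b = (Seg g z b - Seg g z a)%C).
  { intros a b Ha Hb Hn.
    assert (Hre : forall l t, 0 <= l <= 1 -> 0 <= t <= 1 ->
      Re (z + RtoC l * (a - z + RtoC t * (b - a)))%C = (1 - l) * x + l * ((1 - t) * Re a + t * Re b)).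
    { intros l t _ _. unfold x, Re, RtoC; simpl. ring. }
    apply (Cauchy_triangle (fun w => RH w /\ w <> z)); [apply punctured_open, RH_open|exact g_hol| |].
    - intros l t Hl Ht. split.
      + unfold RH. rewrite Hre by lra.
        assert (0 < (1 - l) * x) by (apply Rmult_lt_0_compat; lra).
        assert (0 <= l * ((1 - t) * Re a + t * Re b)).
        { apply Rmult_le_pos; [lra|]. apply Rplus_le_le_0_compat; apply Rmult_le_pos; lra. }
        lra.
      + intros Eq. apply (Hn t Ht).
        assert (El : RtoC l <> RtoC 0) by (intros H; injection H; lra).
        assert (E0 : (RtoC l * (a - z + RtoC t * (b - a)))%C = RtoC 0).
        { transitivity ((z + RtoC l * (a - z + RtoC t * (b - a))) - z)%C; [ring|]. rewrite Eq. ring. }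
        transitivity (RtoC l * (a - z + RtoC t * (b - a)) / RtoC l)%C; [field; assumption|].
        rewrite E0. field. assumption.
    - intros l t Hl Ht. apply g_cont. rewrite Hre by lra.
      apply Rplus_le_le_0_compat; apply Rmult_le_pos; try lra.
      apply Rplus_le_le_0_compat; apply Rmult_le_pos; lra. }
  assert (nRe : forall c : C, Re c <> 0 -> c <> RtoC 0).
  { intros c Hc ->. apply Hc. reflexivity. }
  assert (nIm : forall c : C, Im c <> 0 -> c <> RtoC 0).
  { intros c Hc ->. apply Hc. reflexivity. }
  (* The sides are directed rightwards and upwards; the spokes from z to the corners cancel in
     pairs. *)
  assert (Sum : (Seg g A B + Seg g B E - Seg g D E - Seg g A D)%C = RtoC 0).
  { rewrite (Tri A B), (Tri B E), (Tri D E), (Tri A D); try (unfold A, B, D, E; cbn [Re fst]; lra); [ring| | | |]; intros t Ht.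
    - apply nRe. unfold A, D, RtoC, Re; simpl. fold (Re z). fold x. nra.
    - apply nIm. unfold D, E, RtoC, Im; simpl. fold (Im z). fold y. nra.
    - apply nRe. unfold B, E, RtoC, Re; simpl. fold (Re z). fold x. nra.
    - apply nIm. unfold A, B, RtoC, Im; simpl. fold (Im z). fold y. nra. }
  unfold A, B, D, E in Sum.
  assert (cf : forall w : C, 0 <= Re w -> w <> z -> continuous (fun w => f w * / (w - z))%C w).
  { intros w Hw Hn. apply cont_Cmult; [now apply f_cont|]. apply cont_Cinv.
    - apply cont_Cminus; [apply continuous_id|apply continuous_const].
    - intros H. apply Hn. replace w with (w - z + z)%C by ring. rewrite H. ring. }
  assert (ci : forall w : C, w <> z -> continuous (fun w => / (w - z))%C w).
  { intros w Hn. apply cont_Cinv.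
    - apply cont_Cminus; [apply continuous_id|apply continuous_const].
    - intros H. apply Hn. replace w with (w - z + z)%C by ring. rewrite H. ring. }
  assert (nzv : forall c s, c <> x -> ((c, s) : C) <> z).
  { intros c s Hc H. apply Hc. unfold x. now rewrite <- H. }
  assert (nzh : forall c s, c <> y -> ((s, c) : C) <> z).
  { intros c s Hc H. apply Hc. unfold y. now rewrite <- H. }
  assert (SV : forall c u v, 0 <= c -> c <> x ->
     Seg g (c, u) (c, v) = (Ci * (CInt (fun s => f (c, s) * / ((c, s) - z)) u v - f z * CInt (fun s => / ((c, s) - z)) u v))%C).
  { intros c u v Hc Hn. rewrite Seg_vert by (intros s _; apply cont_vert, g_cont; exact Hc).
    f_equal. rewrite (CInt_ext _ (fun s => f (c, s) * / ((c, s) - z) - f z * / ((c, s) - z))%C)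
      by (intros s _; apply gq, nzv, Hn).
    assert (c1 : ccont (fun s => f (c, s) * / ((c, s) - z))%C u v).
    { intros s _. apply (cont_vert (fun w => f w * / (w - z))%C). apply cf; [exact Hc|now apply nzv]. }
    assert (c2 : ccont (fun s => / ((c, s) - z))%C u v).
    { intros s _. apply (cont_vert (fun w => / (w - z))%C). apply ci; now apply nzv. }
    rewrite (CInt_minus _ (fun s => f z * / ((c, s) - z))%C); [|exact c1|].
    - rewrite (CInt_cmult (f z) (fun s => / ((c, s) - z))%C) by exact c2. reflexivity.
    - intros s Hs. apply cont_Cmult; [apply continuous_const|now apply c2]. }
  assert (SH : forall c u v, 0 <= u <= v -> c <> y ->
     Seg g (u, c) (v, c) = (CInt (fun s => f (s, c) * / ((s, c) - z)) u v - f z * CInt (fun s => / ((s, c) - z)) u v)%C).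
  { intros c u v Hc Hn.
    assert (Hp : forall s, Rmin u v <= s <= Rmax u v -> 0 <= s).
    { intros s. rewrite Rmin_left, Rmax_right by lra. lra. }
    rewrite Seg_horiz by (intros s Hs; apply cont_horiz, g_cont; now apply Hp).
    rewrite (CInt_ext _ (fun s => f (s, c) * / ((s, c) - z) - f z * / ((s, c) - z))%C)
      by (intros s _; apply gq, nzh, Hn).
    assert (c1 : ccont (fun s => f (s, c) * / ((s, c) - z))%C u v).
    { intros s Hs. apply (cont_horiz (fun w => f w * / (w - z))%C). apply cf; [now apply Hp|now apply nzh]. }
    assert (c2 : ccont (fun s => / ((s, c) - z))%C u v).
    { intros s _. apply (cont_horiz (fun w => / (w - z))%C). apply ci; now apply nzh. }
    rewrite (CInt_minus _ (fun s => f z * / ((s, c) - z))%C); [|exact c1|].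
    - rewrite (CInt_cmult (f z) (fun s => / ((s, c) - z))%C) by exact c2. reflexivity.
    - intros s Hs. apply cont_Cmult; [apply continuous_const|now apply c2]. }
  rewrite !SV in Sum by lra. rewrite !SH in Sum by lra.
  rewrite !CInt_inv_vert in Sum by (fold x; lra).
  rewrite !CInt_inv_horiz in Sum by (fold y; lra).
  fold x y in Sum.
  set (hb := CInt (fun s => f (s, (y - Y)%R) * / ((s, (y - Y)%R) - z))%C 0 (x + Y)) in *.
  set (ht := CInt (fun s => f (s, (y + Y)%R) * / ((s, (y + Y)%R) - z))%C 0 (x + Y)) in *.
  set (hr := CInt (fun s => f ((x + Y)%R, s) * / (((x + Y)%R, s) - z))%C (y - Y) (y + Y)) in *.
  set (hl := CInt (fun s => f (0%R, s) * / ((0%R, s) - z))%C (y - Y) (y + Y)) in *.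
  replace (x + Y - x) with Y in Sum by ring. replace (y + Y - y) with Y in Sum by ring.
  replace (y - Y - y) with (- Y) in Sum by ring. replace (0 - x) with (- x) in Sum by ring.
  replace ((- Y) ^ 2) with (Y ^ 2) in Sum by ring.
  replace (Y / - Y) with (- (1)) in Sum by (field; lra).
  replace (- x / - Y) with (x / Y) in Sum by (field; lra).
  replace (- x / Y) with (- (x / Y)) in Sum by (field; lra).
  replace (Y / Y) with 1 in Sum by (field; lra).
  replace (Y / - x) with (- / (x / Y)) in Sum by (field; lra).
  rewrite !atan_opp in Sum.
  assert (Hpos : 0 < x / Y) by (apply Rdiv_lt_0_compat; lra).
  (* The left side sees the angle atan(Y/x), the horizontal sides atan(x/Y). Together they make a
     right angle, so the total is 2 pi whatever Y is. *)
  pose proof (atan_inv_pos _ Hpos) as HA. rewrite atan_1 in Sum.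
  assert (Key : (Ci * (RtoC (2 * PI) * f z + hl) = hb + Ci * hr - ht)%C).
  { match type of Sum with (?t = _)%C => assert (S2 : (Ci * (RtoC (2 * PI) * f z + hl) - (hb + Ci * hr - ht) = - (t))%C) end.
    { replace (atan (x / Y)) with (PI / 2 - atan (/ (x / Y))) by lra.
      apply C_eq; destruct (f z), hb, hr, hl, ht; unfold Re, Im, RtoC, Ci; simpl; field. }
    rewrite Sum in S2.
    transitivity ((Ci * (RtoC (2 * PI) * f z + hl) - (hb + Ci * hr - ht)) + (hb + Ci * hr - ht))%C; [ring|].
    rewrite S2. ring. }
  replace (Cmod (RtoC (2 * PI) * f z + hl)) with (Cmod (Ci * (RtoC (2 * PI) * f z + hl)))
    by (rewrite Cmod_mult, Cmod_Ci; ring).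
  rewrite Key.
  assert (HC0 : 0 <= C0).
  { eapply Rle_trans; [|apply (f_bd z); fold x; lra]. apply Rmult_le_pos; [apply Cmod_ge_0|]. pose proof (Cmod_ge_0 z); lra. }
  assert (Fb : forall (w : C) r, 0 <= Re w -> 0 < r -> r <= Cmod w -> Y <= Cmod (w - z) ->
     Cmod (f w * / (w - z)) <= C0 / r / Y).
  { intros w r Hw Hr H1 H2. pose proof (f_bd w Hw).
    assert (Hn : (w - z)%C <> RtoC 0) by (apply Cmod_pos_neq; lra).
    rewrite Cmod_mult, Cmod_inv by assumption.
    apply Rmult_le_compat; [apply Cmod_ge_0|left; apply Rinv_0_lt_compat; lra| |apply Rinv_le_contravar; lra].
    pose proof (Cmod_ge_0 (f w)).
    apply Rmult_le_reg_r with r; [assumption|]. replace (C0 / r * r) with C0 by (field; lra).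
    apply Rle_trans with (Cmod (f w) * (1 + Cmod w)); [apply Rmult_le_compat_l; lra|assumption]. }
  assert (Imw : forall s c, Rabs (c - y) <= Cmod ((s, c) - z)).
  { intros s c. apply (im_le_Cmod ((s, c) - z)). }
  assert (Rew : forall s c, Rabs (s - x) <= Cmod ((s, c) - z)).
  { intros s c. apply (re_le_Cmod ((s, c) - z)). }
  assert (Hy2 : Rabs y <= Y / 2) by lra. apply Rabs_le_between in Hy2.
  assert (Bb : Cmod hb <= C0 / (Y / 2) / Y * (x + Y - 0)).
  { apply CInt_le_const; [lra| |].
    - intros s Hs. rewrite Rmin_left, Rmax_right in Hs by lra.
      apply (cont_horiz (fun w => f w * / (w - z))%C). apply cf; [exact (proj1 Hs)|apply nzh; lra].
    - intros s Hs. apply Fb; [exact (proj1 Hs)|lra| |].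
      + eapply Rle_trans; [|apply (im_le_Cmod (s, y - Y))]. cbn [Im snd]. rewrite Rabs_left; lra.
      + eapply Rle_trans; [|apply Imw]. rewrite Rabs_left; lra. }
  assert (Bt : Cmod ht <= C0 / (Y / 2) / Y * (x + Y - 0)).
  { apply CInt_le_const; [lra| |].
    - intros s Hs. rewrite Rmin_left, Rmax_right in Hs by lra.
      apply (cont_horiz (fun w => f w * / (w - z))%C). apply cf; [exact (proj1 Hs)|apply nzh; lra].
    - intros s Hs. apply Fb; [exact (proj1 Hs)|lra| |].
      + eapply Rle_trans; [|apply (im_le_Cmod (s, y + Y))]. cbn [Im snd]. rewrite Rabs_right; lra.
      + eapply Rle_trans; [|apply Imw]. rewrite Rabs_right; lra. }
  assert (Br : Cmod hr <= C0 / Y / Y * (y + Y - (y - Y))).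
  { apply CInt_le_const; [lra| |].
    - intros s Hs.
      apply (cont_vert (fun w => f w * / (w - z))%C). apply cf; [cbn [Re fst]; lra|apply nzv; lra].
    - intros s Hs. apply Fb; [cbn [Re fst]; lra|lra| |].
      + eapply Rle_trans; [|apply (re_le_Cmod (x + Y, s))]. cbn [Re fst]. rewrite Rabs_right; lra.
      + eapply Rle_trans; [|apply Rew]. rewrite Rabs_right; lra. }
  assert (Q : C0 / (Y / 2) / Y * (x + Y - 0) <= 4 * C0 / Y).
  { apply Rle_trans with (C0 / (Y / 2) / Y * (2 * Y)); [|right; field; lra].
    apply Rmult_le_compat_l; [|lra]. repeat apply Rmult_le_pos; try lra; left; apply Rinv_0_lt_compat; lra. }
  replace (C0 / Y / Y * (y + Y - (y - Y))) with (2 * C0 / Y) in Br by (field; lra).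
  eapply Rle_trans; [apply Cmod_triangle_sub|].
  eapply Rle_trans; [apply Rplus_le_compat_r, Cmod_triangle|].
  rewrite Cmod_mult, Cmod_Ci.
  replace (10 * C0 / Y) with (4 * C0 / Y + 2 * C0 / Y + 4 * C0 / Y) by (field; lra). lra.
Qed.
End HalfPlane.

(** * A maximum principle for the right half-plane *)

Lemma pow_unbounded (a : R) (M : R) : 1 < a -> exists n, M < a ^ n.
Proof.
  intros Ha. destruct (Pow_x_infinity a ltac:(rewrite Rabs_right; lra) (M + 1)) as [n Hn].
  exists n. specialize (Hn n (Nat.le_refl n)).
  rewrite Rabs_right in Hn by (left; apply pow_lt; lra) || (apply Rle_ge, pow_le; lra). lra.
Qed.

Lemma cont_0_lin (f : C -> C) (M d : R) : 0 < d -> f (RtoC 0) = RtoC 0 ->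
  (forall w, Cmod w < d -> Cmod (f w) <= M * Cmod w) -> continuous f (RtoC 0).
Proof.
  intros Hd H0 H. apply cont_eps. intros eps He.
  pose proof (Rabs_pos M). exists (Rmin d (eps / (Rabs M + 1))). split.
  - apply Rmin_pos; [assumption|]. apply Rdiv_lt_0_compat; lra.
  - intros v Hv. replace (v - RtoC 0)%C with v in Hv by ring. rewrite H0.
    replace (f v - RtoC 0)%C with (f v) by ring.
    assert (V1 : Cmod v < eps / (Rabs M + 1)) by (eapply Rlt_le_trans; [exact Hv|apply Rmin_r]).
    assert (V2 : Cmod v < d) by (eapply Rlt_le_trans; [exact Hv|apply Rmin_l]).
    eapply Rle_lt_trans; [now apply H|]. pose proof (Cmod_ge_0 v). pose proof (Rle_abs M).
    apply Rle_lt_trans with ((Rabs M + 1) * Cmod v); [apply Rmult_le_compat_r; lra|].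
    replace eps with ((Rabs M + 1) * (eps / (Rabs M + 1))) by (field; lra).
    apply Rmult_lt_compat_l; lra.
Qed.

Lemma Cmod_1p (w : C) : 0 <= Re w -> 1 + Cmod w ^ 2 <= Cmod (1 + w) ^ 2.
Proof.
  intros H. rewrite !Cmod2_alt. destruct w as [x y]. unfold Re, Im in *; simpl in *. nra.
Qed.

(* Landau's trick: Cauchy's formula for [h^n w / (1+w)^3] bounds [|h z|^n] by a
   constant independent of [n]. *)
Lemma max_principle (h : C -> C) (M : R) :
  hol RH h -> (forall w, 0 <= Re w -> w <> RtoC 0 -> continuous h w) ->
  (forall w, Cmod (h w) <= M) -> (forall s, s <> 0 -> Cmod (h (0, s)) <= 1) ->
  forall z, RH z -> Cmod (h z) <= 1.
Proof.
  intros Hh Hc HM H1 z Hz.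
  assert (HM0 : 0 <= M) by (eapply Rle_trans; [apply (Cmod_ge_0 (h z))|apply HM]).
  (* The factor [k] vanishes at 0, which repairs a possible discontinuity of [h] there, and decays
     like |w|^(-2), which supplies the bound for Cauchy's formula as well as a convergent integral
     along the axis. *)
  set (k := fun w : C => (w * / Cpow (1 + w) 3)%C).
  assert (np : forall w : C, 0 <= Re w -> (1 + w)%C <> RtoC 0).
  { intros w Hw. apply Cmod_pos_neq. pose proof (Cmod_1p w Hw). pose proof (Cmod_ge_0 w). pose proof (Cmod_ge_0 (1 + w)). nra. }
  assert (kb : forall w, 0 <= Re w -> Cmod (k w) * (1 + Cmod w ^ 2) <= 1).
  { intros w Hw. unfold k. rewrite Cmod_mult, Cmod_inv, Cmod_pow by (apply Cpow_nz, np, Hw).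
    pose proof (Cmod_1p w Hw). pose proof (Cmod_ge_0 w). pose proof (Cmod_ge_0 (1 + w)).
    set (a := Cmod w) in *. set (b := Cmod (1 + w)) in *.
    assert (0 < b) by nra. assert (a <= b) by nra.
    apply Rmult_le_reg_r with (b ^ 3); [now apply pow_lt|].
    replace (a * / b ^ 3 * (1 + a ^ 2) * b ^ 3) with (a * (1 + a ^ 2)) by (field; lra).
    rewrite Rmult_1_l. replace (b ^ 3) with (b * b ^ 2) by ring.
    apply Rmult_le_compat; nra. }
  (* On the axis |h| <= 1, |k(is)| <= 1/(1 + s^2) and |is - z| >= Re z, and the integral of 1/(1 +
     s^2) is at most pi. The bound [M] enters only the error term that disappears as Y grows, hence
     the right side is free of n. *)
  assert (Main : forall n, 2 * PI * (Cmod (h z) ^ n * Cmod (k z)) <= / Re z * PI).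
  { intros n. set (f := fun w => (Cpow (h w) n * k w)%C).
    assert (f_hol : hol RH f).
    { unfold f, k. apply hol_mult; [now apply hol_pow|]. apply hol_mult; [apply hol_id|].
      apply hol_inv; [apply (hol_pow _ (fun w => 1 + w)%C)|].
      - apply hol_plus; [apply hol_const|apply hol_id].
      - intros w Hw. apply Cpow_nz, np. unfold RH in Hw. lra. }
    assert (f_cont : forall w, 0 <= Re w -> continuous f w).
    { intros w Hw. destruct (classic (w = RtoC 0)) as [->|Hn].
      - apply (cont_0_lin f (M ^ n * 8) (1 / 2)); [lra|unfold f, k; ring|].
        intros v Hv. unfold f, k.
        assert (Hp : 1 / 2 <= Cmod (1 + v)).
        { pose proof (Cmod_triangle_rev 1 v) as T. rewrite Cmod_1 in T. lra. }
        rewrite !Cmod_mult, Cmod_inv, !Cmod_pow by (apply Cpow_nz, Cmod_pos_neq; lra).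
        rewrite Rmult_assoc. apply Rmult_le_compat.
        + apply pow_le, Cmod_ge_0.
        + apply Rmult_le_pos; [apply Cmod_ge_0|left; apply Rinv_0_lt_compat, pow_lt; lra].
        + apply pow_incr; split; [apply Cmod_ge_0|apply HM].
        + rewrite Rmult_comm. apply Rmult_le_compat_r; [apply Cmod_ge_0|].
          replace 8 with (/ ((1 / 2) ^ 3)) by field.
          apply Rinv_le_contravar; [apply pow_lt; lra|]. apply pow_incr; lra.
      - unfold f, k. apply cont_Cmult; [apply cont_Cpow; now apply Hc|].
        apply cont_Cmult; [apply continuous_id|]. apply cont_Cinv.
        + apply cont_Cpow. apply cont_Cplus; [apply continuous_const|apply continuous_id].
        + apply Cpow_nz, np, Hw. }
    assert (Mn : 0 <= M ^ n) by now apply pow_le.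
    assert (f_bd : forall w, 0 <= Re w -> Cmod (f w) * (1 + Cmod w) <= 2 * M ^ n).
    { intros w Hw. unfold f. rewrite Cmod_mult, Cmod_pow, Rmult_assoc.
      replace (2 * M ^ n) with (M ^ n * 2) by ring.
      pose proof (kb w Hw). pose proof (Cmod_ge_0 (k w)). pose proof (Cmod_ge_0 w).
      apply Rmult_le_compat.
      - apply pow_le, Cmod_ge_0.
      - apply Rmult_le_pos; lra.
      - apply pow_incr; split; [apply Cmod_ge_0|apply HM].
      - assert (1 + Cmod w <= 2 * (1 + Cmod w ^ 2)) by nra. nra. }
    apply le_of_small. intros eps He.
    set (Y := 1 + Rabs (Re z) + 2 * Rabs (Im z) + 10 * (2 * M ^ n) / eps).
    assert (HY0 : 0 <= 10 * (2 * M ^ n) / eps) by (apply Rmult_le_pos; [lra|left; now apply Rinv_0_lt_compat]).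
    pose proof (Rabs_pos (Re z)). pose proof (Rabs_pos (Im z)). pose proof (Rle_abs (Re z)).
    pose proof (half_plane_cauchy f z (2 * M ^ n) f_hol f_cont f_bd Hz Y
      ltac:(unfold Y; lra) ltac:(unfold Y; lra) ltac:(unfold Y; lra)) as HC.
    assert (HYp : 0 < Y) by (unfold Y; lra).
    assert (HE : 10 * (2 * M ^ n) / Y <= eps).
    { apply Rmult_le_reg_r with Y; [assumption|].
      replace (10 * (2 * M ^ n) / Y * Y) with (10 * (2 * M ^ n)) by (field; lra).
      replace (10 * (2 * M ^ n)) with (eps * (10 * (2 * M ^ n) / eps)) by (field; lra).
      apply Rmult_le_compat_l; [lra|]. unfold Y; lra. }
    set (I := CInt (fun s => f (0%R, s) * / ((0%R, s) - z))%C (Im z - Y) (Im z + Y)) in *.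
    assert (HI : Cmod I <= / Re z * PI).
    { assert (RI : RInt (fun s => / Re z * / (1 + s ^ 2)) (Im z - Y) (Im z + Y)
         = / Re z * (atan (Im z + Y) - atan (Im z - Y))).
      { apply is_RInt_unique.
        apply (is_RInt_ext (fun s => scal (/ Re z) (/ (1 + s ^ 2)))); [reflexivity|].
        apply (is_RInt_scal (V:=R_NormedModule) (fun s => / (1 + s ^ 2))).
        apply (is_RInt_derive (V:=R_CompleteNormedModule) atan).
        - intros s _. auto_derive; [trivial|]. field. nra.
        - intros s _. apply continuous_Rinv_comp; [|nra].
          apply (ex_derive_continuous (fun s => 1 + s ^ 2)). auto_derive; trivial. }
      assert (nzz : forall s, ((0%R, s) - z)%C <> RtoC 0).
      { intros s E. apply (f_equal Re) in E. unfold RH in Hz. unfold Re, RtoC in *; simpl in *. lra. }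
      eapply Rle_trans; [apply (CInt_le _ (fun s => / Re z * / (1 + s ^ 2)))|].
      - lra.
      - intros s _. apply (cont_vert (fun w => f w * / (w - z))%C).
        apply cont_Cmult; [apply f_cont; cbn [Re fst]; lra|]. apply cont_Cinv; [|apply nzz].
        apply cont_Cminus; [apply continuous_id|apply continuous_const].
      - apply (ex_RInt_continuous (V:=R_CompleteNormedModule)). intros s _.
        apply cont_Rmult; [apply continuous_const|]. apply continuous_Rinv_comp; [|nra].
        apply (ex_derive_continuous (fun s => 1 + s ^ 2)). auto_derive; trivial.
      - intros s _. rewrite Cmod_mult, Cmod_inv by apply nzz. rewrite Rmult_comm.
        apply Rmult_le_compat.
        + left. apply Rinv_0_lt_compat, Cmod_gt_0, nzz.
        + apply Cmod_ge_0.
        + apply Rinv_le_contravar; [exact Hz|].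
          eapply Rle_trans; [|apply (re_le_Cmod ((0%R, s) - z))].
          change (Re ((0%R, s) - z)%C) with (0 - Re z). unfold RH in Hz. rewrite Rabs_left; lra.
        + unfold f. rewrite Cmod_mult, Cmod_pow.
          pose proof (kb (0, s) ltac:(cbn [Re fst]; lra)) as Hk.
          replace (Cmod (0, s) ^ 2) with (s ^ 2) in Hk by (rewrite Cmod2_alt; cbn [Re Im fst snd]; ring).
          destruct (Req_dec s 0) as [->|Hs].
          * replace (k (0, 0)) with (RtoC 0) by (unfold k; change (0, 0) with (RtoC 0); ring).
            rewrite Cmod_0, Rmult_0_r. left. apply Rinv_0_lt_compat. nra.
          * apply Rle_trans with (1 * Cmod (k (0, s))).
            -- apply Rmult_le_compat_r; [apply Cmod_ge_0|]. rewrite <- (pow1 n).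
               apply pow_incr. split; [apply Cmod_ge_0|now apply H1].
            -- apply Rmult_le_reg_r with (1 + s ^ 2); [nra|]. rewrite Rinv_l by nra. lra.
      - rewrite RI. apply Rmult_le_compat_l; [left; now apply Rinv_0_lt_compat|].
        pose proof (atan_bound (Im z + Y)). pose proof (atan_bound (Im z - Y)). lra. }
    assert (HF : 2 * PI * (Cmod (h z) ^ n * Cmod (k z)) = Cmod (RtoC (2 * PI) * f z)).
    { rewrite Cmod_mult, Cmod_R, Rabs_right by (pose proof PI_RGT_0; lra).
      unfold f. now rewrite Cmod_mult, Cmod_pow. }
    rewrite HF. pose proof (Cmod_triangle_rev (RtoC (2 * PI) * f z) I). lra. }
  destruct (Rle_dec (Cmod (h z)) 1) as [|Hgt]; [assumption|exfalso].
  assert (Hz0 : z <> RtoC 0).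
  { intros ->. unfold RH, Re, RtoC in Hz; simpl in Hz; lra. }
  assert (Hkz : 0 < Cmod (k z)).
  { apply Cmod_gt_0. unfold k. apply Cmult_neq_0; [assumption|].
    intros E.
    assert (E1 : (Cpow (1 + z) 3 * / Cpow (1 + z) 3)%C = RtoC 1) by (field; apply np; unfold RH in Hz; lra).
    rewrite E in E1. rewrite Cmult_0_r in E1. injection E1. lra. }
  destruct (pow_unbounded (Cmod (h z)) (/ Re z * PI / (2 * PI * Cmod (k z))) ltac:(lra)) as [n Hn].
  specialize (Main n). pose proof PI_RGT_0.
  assert (Hq : 0 < 2 * PI * Cmod (k z)) by (apply Rmult_lt_0_compat; lra).
  apply (Rmult_lt_compat_r _ _ _ Hq) in Hn.
  replace (/ Re z * PI / (2 * PI * Cmod (k z)) * (2 * PI * Cmod (k z))) with (/ Re z * PI) in Hn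
    by (field; unfold RH in Hz; repeat split; lra).
  nra.
Qed.

(** * Series of complex numbers *)

Definition CSer (f : nat -> C) : C := (Series (fun n => Re (f n)), Series (fun n => Im (f n))).

Lemma CSer_ex_Re (f : nat -> C) (b : nat -> R) :
  (forall n, Cmod (f n) <= b n) -> ex_series b -> ex_series (fun n => Re (f n)).
Proof.
  intros H Hb. apply (ex_series_le (V:=R_CompleteNormedModule) _ b); [|assumption].
  intros n. eapply Rle_trans; [apply re_le_Cmod|apply H].
Qed.

Lemma CSer_ex_Im (f : nat -> C) (b : nat -> R) :
  (forall n, Cmod (f n) <= b n) -> ex_series b -> ex_series (fun n => Im (f n)).
Proof.
  intros H Hb. apply (ex_series_le (V:=R_CompleteNormedModule) _ b); [|assumption].
  intros n. eapply Rle_trans; [apply im_le_Cmod|apply H].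
Qed.

Lemma Series_abs_le (a b : nat -> R) : (forall n, Rabs (a n) <= b n) -> ex_series b ->
  Rabs (Series a) <= Series b.
Proof.
  intros H Hb. eapply Rle_trans; [apply Series_Rabs|apply Series_le; [|assumption]].
  - apply (ex_series_le (V:=R_CompleteNormedModule) _ b); [|assumption].
    intros n. unfold norm; simpl. unfold abs; simpl. rewrite Rabs_Rabsolu. apply H.
  - intros n; split; [apply Rabs_pos|apply H].
Qed.

(** Adding the two components costs the factor 2. It is harmless, since the bounds on series only
    feed qualitative estimates. *)
Lemma CSer_le (f : nat -> C) (b : nat -> R) :
  (forall n, Cmod (f n) <= b n) -> ex_series b -> Cmod (CSer f) <= 2 * Series b.
Proof.
  intros H Hb. eapply Rle_trans; [apply Cmod_le_ReIm|]. unfold CSer, Re, Im; cbn [fst snd].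
  assert (A : Rabs (Series (fun n => Re (f n))) <= Series b).
  { apply Series_abs_le; [|assumption]. intros n. eapply Rle_trans; [apply re_le_Cmod|apply H]. }
  assert (B : Rabs (Series (fun n => Im (f n))) <= Series b).
  { apply Series_abs_le; [|assumption]. intros n. eapply Rle_trans; [apply im_le_Cmod|apply H]. }
  unfold Re, Im in *. lra.
Qed.

Lemma CSer_minus (f g : nat -> C) (b c : nat -> R) :
  (forall n, Cmod (f n) <= b n) -> ex_series b ->
  (forall n, Cmod (g n) <= c n) -> ex_series c ->
  CSer (fun n => f n - g n)%C = (CSer f - CSer g)%C.
Proof.
  intros Hf Hb Hg Hc. apply C_eq.
  - change (Series (fun n => Re (f n) - Re (g n)) = Series (fun n => Re (f n)) - Series (fun n => Re (g n))).
    apply Series_minus; eapply CSer_ex_Re; eassumption.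
  - change (Series (fun n => Im (f n) - Im (g n)) = Series (fun n => Im (f n)) - Series (fun n => Im (g n))).
    apply Series_minus; eapply CSer_ex_Im; eassumption.
Qed.

Lemma CSer_cmult (c : C) (f : nat -> C) (b : nat -> R) :
  (forall n, Cmod (f n) <= b n) -> ex_series b ->
  CSer (fun n => f n * c)%C = (CSer f * c)%C.
Proof.
  intros Hf Hb.
  pose proof (CSer_ex_Re f b Hf Hb). pose proof (CSer_ex_Im f b Hf Hb).
  apply C_eq; unfold CSer, Cmult, Re, Im in *; cbn [fst snd].
  - rewrite Series_minus by (apply ex_series_scal_r; assumption).
    now rewrite !Series_scal_r.
  - rewrite Series_plus by (apply ex_series_scal_r; assumption).
    now rewrite !Series_scal_r.
Qed.

Lemma is_series_telescope (r : R) : 0 < r ->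
  is_series (fun n => / (r + INR n) - / (r + INR (S n))) (/ r).
Proof.
  intros Hr.
  assert (P : forall n, 0 < r + INR n) by (intros n; pose proof (pos_INR n); lra).
  assert (E : forall n, sum_n (fun n => / (r + INR n) - / (r + INR (S n))) n = / r - / (r + INR (S n))).
  { induction n.
    - rewrite sum_O. simpl INR. rewrite Rplus_0_r. reflexivity.
    - rewrite sum_Sn, IHn.
      match goal with |- ?x = ?y => change (@eq R x y) end. change plus with Rplus. ring. }
  change (is_lim_seq (sum_n (fun n => / (r + INR n) - / (r + INR (S n)))) (Finite (/ r))).
  apply (is_lim_seq_ext (fun n => / r - / (r + INR (S n)))); [intros n; now rewrite E|].
  replace (Finite (/ r)) with (Finite (/ r - 0)) by (f_equal; ring).
  apply is_lim_seq_minus'; [apply is_lim_seq_const|].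
  apply (is_lim_seq_incr_1 (fun n => / (r + INR n))).
  replace (Finite 0) with (Rbar_inv p_infty) by reflexivity.
  apply is_lim_seq_inv; [|discriminate].
  apply (is_lim_seq_plus _ _ r p_infty); [apply is_lim_seq_const|apply is_lim_seq_INR|reflexivity].
Qed.

(** This is 1/((r + n)(r + n + 1)), the majorant of all series over the shifts w + n; its sum is
    exactly 1/r. *)
Definition tele (r : R) (n : nat) : R := / (r + INR n) - / (r + INR (S n)).

Lemma ex_series_tele r c : 0 < r -> ex_series (fun n => c * tele r n).
Proof.
  intros Hr. apply (ex_series_scal (V:=R_NormedModule) c). exists (/ r). now apply is_series_telescope.
Qed.

Lemma Series_tele r c : 0 < r -> Series (fun n => c * tele r n) = c / r.
Proof.
  intros Hr. rewrite Series_scal_l. unfold Rdiv; f_equal.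
  apply is_series_unique. now apply is_series_telescope.
Qed.

(** * The closed half-plane *)

Definition RHc (w : C) := 0 <= Re w /\ w <> RtoC 0.

Lemma RHc_mod w : RHc w -> 0 < Cmod w.
Proof. intros [_ H]. now apply Cmod_gt_0. Qed.

Lemma Re_shift w u : Re (w + RtoC u) = Re w + u.
Proof. reflexivity. Qed.
Lemma Im_shift w u : Im (w + RtoC u) = Im w.
Proof. unfold Im, RtoC; simpl; ring. Qed.

Lemma Cmod_shift2 w u : 0 <= Re w -> 0 <= u -> Cmod w ^ 2 + u ^ 2 <= Cmod (w + RtoC u) ^ 2.
Proof. intros Hw Hu. rewrite !Cmod2_alt, Re_shift, Im_shift. nra. Qed.

Lemma Cmod_shift w u : 0 <= Re w -> 0 <= u -> Cmod w <= Cmod (w + RtoC u).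
Proof.
  intros Hw Hu. pose proof (Cmod_shift2 w u Hw Hu).
  pose proof (Cmod_ge_0 w). pose proof (Cmod_ge_0 (w + RtoC u)).
  apply Rsqr_incr_0_var; [unfold Rsqr; nra|assumption].
Qed.

Lemma Cmod_shift_sum w u : 0 <= Re w -> 0 <= u -> (Cmod w + u) ^ 2 <= 2 * Cmod (w + RtoC u) ^ 2.
Proof.
  intros Hw Hu. pose proof (Cmod_shift2 w u Hw Hu). pose proof (pow2_ge_0 (Cmod w - u)). nra.
Qed.

Lemma RHc_shift w u : RHc w -> 0 <= u -> RHc (w + RtoC u).
Proof.
  intros Hw Hu. split; [rewrite Re_shift; destruct Hw; lra|].
  apply Cmod_pos_neq. pose proof (RHc_mod w Hw). pose proof (Cmod_shift w u (proj1 Hw) Hu). lra.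
Qed.

(** In the half-plane |w + n|^2 dominates (|w| + n)^2/2, and (r + n + 1)/(r + n) <= 1 + 1/r turns
    the square into a telescoping product. *)
Lemma inv_shift_tele w n : RHc w ->
  / Cmod (w + RtoC (INR n)) ^ 2 <= 2 * (1 + / Cmod w) * tele (Cmod w) n.
Proof.
  intros Hw. pose proof (RHc_mod w Hw) as Hp. set (r := Cmod w) in *.
  pose proof (pos_INR n) as Hn. pose proof (Cmod_shift_sum w (INR n) (proj1 Hw) Hn) as H. fold r in H.
  assert (Hs : 0 < r + INR n) by lra.
  apply Rle_trans with (2 * / (r + INR n) ^ 2).
  - replace (2 * / (r + INR n) ^ 2) with (/ ((r + INR n) ^ 2 / 2)) by (field; lra).
    apply Rinv_le_contravar; [|lra]. assert (0 < (r + INR n) ^ 2) by (apply pow_lt; lra). lra.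
  - unfold tele. rewrite S_INR.
    replace (/ (r + INR n) - / (r + (INR n + 1))) with (/ ((r + INR n) * (r + INR n + 1))) by (field; lra).
    rewrite Rmult_assoc. apply Rmult_le_compat_l; [lra|].
    apply Rmult_le_reg_r with ((r + INR n) ^ 2 * (r + INR n + 1) * r).
    { repeat apply Rmult_lt_0_compat; lra. }
    replace (/ (r + INR n) ^ 2 * ((r + INR n) ^ 2 * (r + INR n + 1) * r)) with ((r + INR n + 1) * r) by (field; lra).
    replace ((1 + / r) * / ((r + INR n) * (r + INR n + 1)) * ((r + INR n) ^ 2 * (r + INR n + 1) * r))
      with ((r + 1) * (r + INR n)) by (field; lra).
    nra.
Qed.

(** * The Binet function *)

(** The term (w + 1/2) log(1 + 1/w) - 1 of Gudermann's series for the Binet function, in an integral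
    form without logarithms: estimates and derivatives in w reduce to those of 1/(w + u). *)
Definition gterm (w : C) : C := CInt (fun u => RtoC (1 / 2 - u) * / (w + RtoC u))%C 0 1.
Definition gterm' (w : C) : C := (- CInt (fun u => RtoC (1 / 2 - u) * / Cpow (w + RtoC u) 2) 0 1)%C.

Definition slit (w : C) := forall u, 0 <= u <= 1 -> (w + RtoC u)%C <> RtoC 0.

Lemma RHc_slit w : RHc w -> slit w.
Proof. intros H u Hu. apply (RHc_shift w u H). lra. Qed.

Lemma cont_shift (w : C) (u : R) : continuous (fun u : R => (w + RtoC u)%C) u.
Proof. apply cont_Cplus; [apply continuous_const|apply cont_RtoC, continuous_id]. Qed.

Lemma cont_halfsub u : continuous (fun u : R => RtoC (1 / 2 - u)) u.
Proof. apply cont_RtoC. apply cont_Rminus; [apply continuous_const|apply continuous_id]. Qed.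

Lemma gterm_ccont w : slit w -> ccont (fun u => RtoC (1 / 2 - u) * / (w + RtoC u))%C 0 1.
Proof.
  intros H u Hu. rewrite Rmin_left, Rmax_right in Hu by lra.
  apply cont_Cmult; [apply cont_halfsub|]. apply cont_Cinv; [apply cont_shift|now apply H].
Qed.

Lemma gterm'_ccont w : slit w -> ccont (fun u => RtoC (1 / 2 - u) * / Cpow (w + RtoC u) 2)%C 0 1.
Proof.
  intros H u Hu. rewrite Rmin_left, Rmax_right in Hu by lra.
  apply cont_Cmult; [apply cont_halfsub|]. apply cont_Cinv; [apply cont_Cpow, cont_shift|apply Cpow_nz; now apply H].
Qed.

Lemma half_abs u : 0 <= u <= 1 -> Cmod (RtoC (1 / 2 - u)) <= 1 / 2.
Proof. intros H. rewrite Cmod_R. apply Rabs_le. lra. Qed.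

Lemma gterm_lip v w : RHc v -> RHc w ->
  Cmod (gterm v - gterm w) <= Cmod (v - w) / (Cmod v * Cmod w).
Proof.
  intros Hv Hw. pose proof (RHc_mod v Hv). pose proof (RHc_mod w Hw).
  unfold gterm. rewrite <- CInt_minus by (apply gterm_ccont; now apply RHc_slit).
  set (M := Cmod (v - w) / (Cmod v * Cmod w)). replace M with (M * (1 - 0)) by ring.
  assert (HM : 0 <= M).
  { apply Rmult_le_pos; [apply Cmod_ge_0|]. left; apply Rinv_0_lt_compat, Rmult_lt_0_compat; assumption. }
  apply CInt_le_const; [lra| |].
  - intros u Hu. apply cont_Cminus; apply gterm_ccont; try apply RHc_slit; assumption.
  - intros u Hu.
    assert (Av : (v + RtoC u)%C <> RtoC 0) by (now apply RHc_slit).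
    assert (Aw : (w + RtoC u)%C <> RtoC 0) by (now apply RHc_slit).
    replace (RtoC (1 / 2 - u) * / (v + RtoC u) - RtoC (1 / 2 - u) * / (w + RtoC u))%C
      with (RtoC (1 / 2 - u) * (- (v - w) / ((v + RtoC u) * (w + RtoC u))))%C by (field; auto).
    rewrite Cmod_mult, Cmod_div, Cmod_opp, Cmod_mult by (now apply Cmult_neq_0).
    pose proof (half_abs u Hu).
    pose proof (Cmod_shift v u (proj1 Hv) (proj1 Hu)). pose proof (Cmod_shift w u (proj1 Hw) (proj1 Hu)).
    assert (Q : Cmod (v - w) / (Cmod (v + RtoC u) * Cmod (w + RtoC u)) <= M).
    { apply Rmult_le_compat_l; [apply Cmod_ge_0|]. apply Rinv_le_contravar; [now apply Rmult_lt_0_compat|].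
      apply Rmult_le_compat; lra. }
    pose proof (Cmod_ge_0 (RtoC (1 / 2 - u))).
    apply Rle_trans with (1 / 2 * M); [|lra].
    apply Rmult_le_compat; try lra. apply Rmult_le_pos; [apply Cmod_ge_0|].
    left; apply Rinv_0_lt_compat, Rmult_lt_0_compat; apply Cmod_gt_0; assumption.
Qed.

Lemma gterm_quad v w : RHc v -> RHc w ->
  Cmod (gterm v - gterm w - gterm' w * (v - w)) <= Cmod (v - w) ^ 2 / (Cmod v * Cmod w ^ 2).
Proof.
  intros Hv Hw. pose proof (RHc_mod v Hv). pose proof (RHc_mod w Hw).
  assert (Cv : ccont (fun u => RtoC (1 / 2 - u) * / (v + RtoC u))%C 0 1) by (apply gterm_ccont; now apply RHc_slit).
  assert (Cw : ccont (fun u => RtoC (1 / 2 - u) * / (w + RtoC u))%C 0 1) by (apply gterm_ccont; now apply RHc_slit).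
  assert (Cw' : ccont (fun u => RtoC (1 / 2 - u) * / Cpow (w + RtoC u) 2)%C 0 1) by (apply gterm'_ccont; now apply RHc_slit).
  assert (Cm : ccont (fun u => (v - w) * (RtoC (1 / 2 - u) * / Cpow (w + RtoC u) 2))%C 0 1).
  { intros u Hu. apply cont_Cmult; [apply continuous_const|now apply Cw']. }
  assert (Cvw : ccont (fun u => RtoC (1 / 2 - u) * / (v + RtoC u) - RtoC (1 / 2 - u) * / (w + RtoC u))%C 0 1).
  { intros u Hu. apply cont_Cminus; auto. }
  unfold gterm, gterm'.
  match goal with |- Cmod (?a - ?b - - ?c * ?d) <= _ => replace (a - b - - c * d)%C with ((a - b) + d * c)%C by ring end.
  rewrite <- CInt_minus, <- CInt_cmult by assumption. rewrite <- CInt_plus by assumption.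
  set (M := Cmod (v - w) ^ 2 / (Cmod v * Cmod w ^ 2)). replace M with (M * (1 - 0)) by ring.
  assert (HM : 0 <= M).
  { apply Rmult_le_pos; [apply pow2_ge_0|]. left; apply Rinv_0_lt_compat, Rmult_lt_0_compat; [|apply pow_lt]; assumption. }
  apply CInt_le_const; [lra| |].
  - intros u Hu. apply cont_Cplus; auto.
  - intros u Hu.
    assert (Av : (v + RtoC u)%C <> RtoC 0) by (now apply RHc_slit).
    assert (Aw : (w + RtoC u)%C <> RtoC 0) by (now apply RHc_slit).
    match goal with |- Cmod ?t <= _ => replace t
      with (RtoC (1 / 2 - u) * (Cpow (v - w) 2 / ((v + RtoC u) * Cpow (w + RtoC u) 2)))%C
      by (simpl; field; auto) end.
    rewrite Cmod_mult, Cmod_div, Cmod_mult, !Cmod_pow by (apply Cmult_neq_0; [|apply Cpow_nz]; assumption).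
    pose proof (half_abs u Hu).
    pose proof (Cmod_shift v u (proj1 Hv) (proj1 Hu)). pose proof (Cmod_shift w u (proj1 Hw) (proj1 Hu)).
    assert (Q : Cmod (v - w) ^ 2 / (Cmod (v + RtoC u) * Cmod (w + RtoC u) ^ 2) <= M).
    { apply Rmult_le_compat_l; [apply pow2_ge_0|]. apply Rinv_le_contravar; [apply Rmult_lt_0_compat; [|apply pow_lt]; assumption|].
      apply Rmult_le_compat; try lra; [apply pow_le; lra|]. apply pow_incr; lra. }
    pose proof (Cmod_ge_0 (RtoC (1 / 2 - u))).
    apply Rle_trans with (1 / 2 * M); [|lra].
    apply Rmult_le_compat; try lra. apply Rmult_le_pos; [apply pow2_ge_0|].
    left; apply Rinv_0_lt_compat, Rmult_lt_0_compat; [|apply pow_lt]; apply Cmod_gt_0; assumption.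
Qed.

Lemma gterm'_lip v w : RHc v -> RHc w ->
  Cmod (gterm' v - gterm' w) <= Cmod (v - w) * (/ Cmod v + / Cmod w) / (Cmod v * Cmod w).
Proof.
  intros Hv Hw. pose proof (RHc_mod v Hv). pose proof (RHc_mod w Hw).
  unfold gterm'.
  match goal with |- Cmod (- ?a - - ?b) <= _ => replace (- a - - b)%C with (- (a - b))%C by ring end.
  rewrite Cmod_opp.
  rewrite <- CInt_minus by (apply gterm'_ccont; now apply RHc_slit).
  set (M := Cmod (v - w) * (/ Cmod v + / Cmod w) / (Cmod v * Cmod w)). replace M with (M * (1 - 0)) by ring.
  pose proof (Rinv_0_lt_compat _ H). pose proof (Rinv_0_lt_compat _ H0).
  assert (HM : 0 <= M).
  { apply Rmult_le_pos; [apply Rmult_le_pos; [apply Cmod_ge_0|lra]|]. left; apply Rinv_0_lt_compat, Rmult_lt_0_compat; assumption. }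
  apply CInt_le_const; [lra| |].
  - intros u Hu. apply cont_Cminus; apply gterm'_ccont; try apply RHc_slit; assumption.
  - intros u Hu.
    assert (Av : (v + RtoC u)%C <> RtoC 0) by (now apply RHc_slit).
    assert (Aw : (w + RtoC u)%C <> RtoC 0) by (now apply RHc_slit).
    match goal with |- Cmod ?t <= _ => replace t
      with (RtoC (1 / 2 - u) * (- ((v - w) * (/ (v + RtoC u) + / (w + RtoC u)) / ((v + RtoC u) * (w + RtoC u)))))%C
      by (simpl; field; auto) end.
    rewrite Cmod_mult, Cmod_opp, Cmod_div, !Cmod_mult by (now apply Cmult_neq_0).
    pose proof (half_abs u Hu).
    pose proof (Cmod_shift v u (proj1 Hv) (proj1 Hu)). pose proof (Cmod_shift w u (proj1 Hw) (proj1 Hu)).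
    assert (Q : Cmod (v - w) * Cmod (/ (v + RtoC u) + / (w + RtoC u)) / (Cmod (v + RtoC u) * Cmod (w + RtoC u)) <= M).
    { apply Rmult_le_compat.
      - apply Rmult_le_pos; apply Cmod_ge_0.
      - left; apply Rinv_0_lt_compat, Rmult_lt_0_compat; lra.
      - apply Rmult_le_compat_l; [apply Cmod_ge_0|]. eapply Rle_trans; [apply Cmod_triangle|].
        rewrite !Cmod_inv by assumption. apply Rplus_le_compat; apply Rinv_le_contravar; assumption.
      - apply Rinv_le_contravar; [now apply Rmult_lt_0_compat|]. apply Rmult_le_compat; lra. }
    pose proof (Cmod_ge_0 (RtoC (1 / 2 - u))).
    apply Rle_trans with (1 / 2 * M); [|lra].
    apply Rmult_le_compat; try lra. apply Rmult_le_pos; [apply Rmult_le_pos; apply Cmod_ge_0|].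
    left; apply Rinv_0_lt_compat, Rmult_lt_0_compat; lra.
Qed.

Lemma gterm'_bound w : RHc w -> Cmod (gterm' w) <= / Cmod w ^ 2.
Proof.
  intros Hw. pose proof (RHc_mod w Hw). unfold gterm'. rewrite Cmod_opp.
  assert (Hi : 0 < / Cmod w ^ 2) by (apply Rinv_0_lt_compat, pow_lt; assumption).
  replace (/ Cmod w ^ 2) with (/ Cmod w ^ 2 * (1 - 0)) by ring.
  apply CInt_le_const; [lra|apply gterm'_ccont; now apply RHc_slit|].
  intros u Hu.
  assert (Aw : (w + RtoC u)%C <> RtoC 0) by (now apply RHc_slit).
  rewrite Cmod_mult, Cmod_inv, Cmod_pow by (now apply Cpow_nz).
  pose proof (half_abs u Hu). pose proof (Cmod_shift w u (proj1 Hw) (proj1 Hu)).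
  assert (/ Cmod (w + RtoC u) ^ 2 <= / Cmod w ^ 2).
  { apply Rinv_le_contravar; [now apply pow_lt|]. apply pow_incr; lra. }
  assert (0 < / Cmod (w + RtoC u) ^ 2) by (apply Rinv_0_lt_compat, pow_lt; lra).
  pose proof (Cmod_ge_0 (RtoC (1 / 2 - u))). nra.
Qed.

Lemma Cdiff_inv_pow n w : w <> RtoC 0 ->
  Cdiff (fun v => / Cpow v n)%C w (RtoC (- INR n) * / Cpow w (S n))%C.
Proof.
  intros Hw. induction n.
  - apply (Cdiff_ext_loc (fun _ => RtoC 1) _ _ _ 1); [lra| |].
    + intros v _. simpl. field. 
    + replace (RtoC (- INR 0) * / Cpow w 1)%C with (RtoC 0); [apply Cdiff_const|].
      simpl INR. rewrite Ropp_0. ring.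
  - apply (Cdiff_ext_loc (fun v => / v * / Cpow v n)%C _ _ _ (Cmod w)).
    + now apply Cmod_gt_0.
    + intros v Hv. 
      assert (v <> RtoC 0).
      { intros ->. replace (RtoC 0 - w)%C with (- w)%C in Hv by ring. rewrite Cmod_opp in Hv. lra. }
      simpl. field. split; [apply Cpow_nz|]; assumption.
    + replace (RtoC (- INR (S n)) * / Cpow w (S (S n)))%C
        with (- / (w * w) * / Cpow w n + / w * (RtoC (- INR n) * / Cpow w (S n)))%C.
      * apply (Cdiff_mult (fun v => / v)%C (fun v => / Cpow v n)%C); [now apply Cdiff_inv|assumption].
      * rewrite S_INR. rewrite !RtoC_opp, RtoC_plus. simpl. field. split; [apply Cpow_nz|]; assumption.
Qed.

Lemma CInt_parts (B B' : R -> R) (Q Q' : R -> C) a b :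
  (forall t, Rmin a b <= t <= Rmax a b -> is_derive B t (B' t)) ->
  (forall t, Rmin a b <= t <= Rmax a b -> continuous B' t) ->
  (forall t, Rmin a b <= t <= Rmax a b -> is_derive (fun u => Re (Q u)) t (Re (Q' t))) ->
  (forall t, Rmin a b <= t <= Rmax a b -> is_derive (fun u => Im (Q u)) t (Im (Q' t))) ->
  ccont Q' a b -> ccont Q a b ->
  CInt (fun t => RtoC (B t) * Q' t)%C a b
  = (RtoC (B b) * Q b - RtoC (B a) * Q a - CInt (fun t => RtoC (B' t) * Q t) a b)%C.
Proof.
  intros HB HB' H1 H2 Hc' Hc.
  assert (cB : forall t, Rmin a b <= t <= Rmax a b -> continuous B t).
  { intros t Ht. apply (ex_derive_continuous B). exists (B' t). now apply HB. }
  assert (c1 : ccont (fun t => RtoC (B' t) * Q t)%C a b).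
  { intros t Ht. apply cont_Cmult; [apply cont_RtoC; now apply HB'|now apply Hc]. }
  assert (c2 : ccont (fun t => RtoC (B t) * Q' t)%C a b).
  { intros t Ht. apply cont_Cmult; [apply cont_RtoC; now apply cB|now apply Hc']. }
  assert (E : (CInt (fun t => RtoC (B' t) * Q t) a b + CInt (fun t => RtoC (B t) * Q' t) a b
     = RtoC (B b) * Q b - RtoC (B a) * Q a)%C).
  { rewrite <- CInt_plus by assumption.
    apply (CInt_derive (fun t => RtoC (B t) * Q t)%C).
    - intros t Ht. apply (is_derive_ext (fun t => B t * Re (Q t))).
      { intros u. unfold Re, RtoC, Cmult; cbn [fst snd]. match goal with |- ?x = ?y => change (@eq R x y) end. ring. }
      evar_last; [apply (is_derive_mult (K:=R_AbsRing) B); [now apply HB|now apply H1|intros; apply Rmult_comm]|].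
      unfold plus, mult; simpl. unfold Re, RtoC, Cmult; simpl. match goal with |- ?x = ?y => change (@eq R x y) end. ring.
    - intros t Ht. apply (is_derive_ext (fun t => B t * Im (Q t))).
      { intros u. unfold Im, RtoC, Cmult; cbn [fst snd]. match goal with |- ?x = ?y => change (@eq R x y) end. ring. }
      evar_last; [apply (is_derive_mult (K:=R_AbsRing) B); [now apply HB|now apply H2|intros; apply Rmult_comm]|].
      unfold plus, mult; simpl. unfold Im, RtoC, Cmult; simpl. match goal with |- ?x = ?y => change (@eq R x y) end. ring.
    - intros t Ht. apply cont_Cplus; auto. }
  rewrite <- E. ring.
Qed.

Lemma inv_pow_line n w u : (w + RtoC u)%C <> RtoC 0 ->
  is_derive (fun t : R => Re (/ Cpow (w + RtoC t) n)%C) u (Re (RtoC (- INR n) * / Cpow (w + RtoC u) (S n))%C) /\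
  is_derive (fun t : R => Im (/ Cpow (w + RtoC t) n)%C) u (Im (RtoC (- INR n) * / Cpow (w + RtoC u) (S n))%C).
Proof.
  intros Hn.
  assert (E : forall t : R, (w + RtoC t * 1)%C = (w + RtoC t)%C) by (intros; ring).
  pose proof (Cdiff_line (fun v => / Cpow v n)%C w 1 (RtoC (- INR n) * / Cpow (w + RtoC u) (S n))%C u) as H.
  rewrite E in H. specialize (H (Cdiff_inv_pow n _ Hn)). destruct H as [H1 H2].
  rewrite Cmult_1_r in H1, H2. split.
  - eapply is_derive_ext; [|exact H1]. intros t; cbv beta. now rewrite E.
  - eapply is_derive_ext; [|exact H2]. intros t; cbv beta. now rewrite E.
Qed.

Lemma cont_inv_pow n w u : (w + RtoC u)%C <> RtoC 0 -> continuous (fun u : R => / Cpow (w + RtoC u) n)%C u.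
Proof. intros H. apply cont_Cinv; [apply cont_Cpow, cont_shift|now apply Cpow_nz]. Qed.

(** Integration by parts against u(1 - u)/2, which vanishes at both ends and is at most 1/8, gains a
    second power of 1/|w|. The first power alone would leave a divergent majorant for the sum over
    shifts. *)
Lemma gterm_bound w : RHc w -> Cmod (gterm w) <= / 8 * / Cmod w ^ 2.
Proof.
  intros Hw. pose proof (RHc_mod w Hw) as Hp.
  set (B := fun u : R => 1 / 2 * u * (1 - u)).
  assert (Cq : ccont (fun u => RtoC (- INR 1) * / Cpow (w + RtoC u) 2)%C 0 1).
  { intros u Hu. rewrite Rmin_left, Rmax_right in Hu by lra.
    apply cont_Cmult; [apply continuous_const|]. apply cont_inv_pow. now apply RHc_slit. }
  assert (E : CInt (fun u => RtoC (B u) * (RtoC (- INR 1) * / Cpow (w + RtoC u) 2))%C 0 1 = (- gterm w)%C).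
  { rewrite (CInt_parts B (fun u => 1 / 2 - u) (fun u => / Cpow (w + RtoC u) 1)%C); try assumption.
    - unfold B. replace (1 / 2 * 1 * (1 - 1)) with 0 by ring. replace (1 / 2 * 0 * (1 - 0)) with 0 by ring.
      unfold gterm. rewrite (CInt_ext (fun t => RtoC (1 / 2 - t) * / Cpow (w + RtoC t) 1)%C (fun u => RtoC (1 / 2 - u) * / (w + RtoC u))%C).
      + ring.
      + intros t _. simpl. now rewrite Cmult_1_r.
    - intros t _. unfold B. auto_derive; [trivial|field].
    - intros t _. apply cont_Rminus; [apply continuous_const|apply continuous_id].
    - intros t Ht. rewrite Rmin_left, Rmax_right in Ht by lra. apply inv_pow_line. now apply RHc_slit.
    - intros t Ht. rewrite Rmin_left, Rmax_right in Ht by lra. apply inv_pow_line. now apply RHc_slit.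
    - intros t Ht. rewrite Rmin_left, Rmax_right in Ht by lra. apply cont_inv_pow. now apply RHc_slit. }
  rewrite <- Cmod_opp, <- E. replace (/ 8 * / Cmod w ^ 2) with (/ 8 * / Cmod w ^ 2 * (1 - 0)) by ring.
  apply CInt_le_const; [lra| |].
  - intros u Hu. apply cont_Cmult; [|now apply Cq]. apply cont_RtoC.
    apply (ex_derive_continuous B). unfold B. auto_derive; trivial.
  - intros u Hu. rewrite !Cmod_mult, !Cmod_R, Cmod_inv, Cmod_pow by (apply Cpow_nz; now apply RHc_slit).
    rewrite Rabs_Ropp. simpl INR. rewrite Rabs_R1, Rmult_1_l.
    pose proof (Cmod_shift w u (proj1 Hw) (proj1 Hu)).
    apply Rmult_le_compat.
    + apply Rabs_pos.
    + left; apply Rinv_0_lt_compat, pow_lt; lra.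
    + unfold B. rewrite Rabs_right by nra. pose proof (pow2_ge_0 (u - 1 / 2)). nra.
    + apply Rinv_le_contravar; [now apply pow_lt|]. apply pow_incr; lra.
Qed.

(** * The Binet function as a series *)

Definition binet (w : C) : C := CSer (fun n => gterm (w + RtoC (INR n))).
Definition binet' (w : C) : C := CSer (fun n => gterm' (w + RtoC (INR n))).

Definition Kb (r : R) := 2 * (1 + / r).

Lemma Kb_pos r : 0 < r -> 0 < Kb r.
Proof. intros H. unfold Kb. pose proof (Rinv_0_lt_compat r H). lra. Qed.

Lemma gterm_shift_bound w n : RHc w -> Cmod (gterm (w + RtoC (INR n))) <= / 8 * Kb (Cmod w) * tele (Cmod w) n.
Proof.
  intros Hw. pose proof (RHc_shift w (INR n) Hw (pos_INR n)) as Hn.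
  eapply Rle_trans; [now apply gterm_bound|]. rewrite Rmult_assoc.
  apply Rmult_le_compat_l; [lra|]. now apply inv_shift_tele.
Qed.

Lemma gterm'_shift_bound w n : RHc w -> Cmod (gterm' (w + RtoC (INR n))) <= Kb (Cmod w) * tele (Cmod w) n.
Proof.
  intros Hw. pose proof (RHc_shift w (INR n) Hw (pos_INR n)) as Hn.
  eapply Rle_trans; [now apply gterm'_bound|]. now apply inv_shift_tele.
Qed.

Lemma binet_bound w : RHc w -> Cmod (binet w) <= (1 + / Cmod w) / Cmod w.
Proof.
  intros Hw. pose proof (RHc_mod w Hw) as Hp.
  eapply Rle_trans; [apply (CSer_le _ (fun n => / 8 * Kb (Cmod w) * tele (Cmod w) n))|].
  - intros n. now apply gterm_shift_bound.
  - now apply ex_series_tele.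
  - rewrite Series_tele by assumption. unfold Kb.
    pose proof (Rinv_0_lt_compat _ Hp).
    replace (2 * (/ 8 * (2 * (1 + / Cmod w)) / Cmod w)) with (/ 2 * ((1 + / Cmod w) / Cmod w)) by (field; lra).
    assert (0 <= (1 + / Cmod w) / Cmod w) by (apply Rmult_le_pos; lra). lra.
Qed.

Lemma close_shift v w n : RHc w -> Cmod (v - w) <= Cmod w / 2 ->
  Cmod (w + RtoC (INR n)) / 2 <= Cmod (v + RtoC (INR n)).
Proof.
  intros Hw H. pose proof (Cmod_shift w (INR n) (proj1 Hw) (pos_INR n)).
  pose proof (Cmod_triangle_rev (w + RtoC (INR n)) (v - w)) as T.
  replace (w + RtoC (INR n) + (v - w))%C with (v + RtoC (INR n))%C in T by ring. lra.
Qed.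

Lemma binet_lip v w : RHc v -> RHc w -> Cmod (v - w) <= Cmod w / 2 ->
  Cmod (binet v - binet w) <= 4 * Cmod (v - w) * Kb (Cmod w) / Cmod w.
Proof.
  intros Hv Hw H. pose proof (RHc_mod w Hw) as Hp. pose proof (RHc_mod v Hv) as Hpv.
  unfold binet. rewrite <- (CSer_minus _ _ (fun n => / 8 * Kb (Cmod v) * tele (Cmod v) n) (fun n => / 8 * Kb (Cmod w) * tele (Cmod w) n)).
  - eapply Rle_trans; [apply (CSer_le _ (fun n => 2 * Cmod (v - w) * Kb (Cmod w) * tele (Cmod w) n))|].
    + intros n. pose proof (RHc_shift v (INR n) Hv (pos_INR n)) as Hvn. pose proof (RHc_shift w (INR n) Hw (pos_INR n)) as Hwn.
      eapply Rle_trans; [now apply gterm_lip|].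
      replace (v + RtoC (INR n) - (w + RtoC (INR n)))%C with (v - w)%C by ring.
      pose proof (close_shift v w n Hw H). pose proof (RHc_mod _ Hwn). pose proof (RHc_mod _ Hvn).
      apply Rle_trans with (2 * Cmod (v - w) * / Cmod (w + RtoC (INR n)) ^ 2).
      * replace (2 * Cmod (v - w) * / Cmod (w + RtoC (INR n)) ^ 2)
          with (Cmod (v - w) / (Cmod (w + RtoC (INR n)) / 2 * Cmod (w + RtoC (INR n)))) by (field; lra).
        apply Rmult_le_compat_l; [apply Cmod_ge_0|]. apply Rinv_le_contravar.
        -- apply Rmult_lt_0_compat; lra.
        -- apply Rmult_le_compat_r; lra.
      * rewrite (Rmult_assoc (2 * _)). apply Rmult_le_compat_l.
        -- pose proof (Cmod_ge_0 (v - w)). lra.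
        -- now apply inv_shift_tele.
    + now apply ex_series_tele.
    + rewrite Series_tele by assumption. right. field. lra.
  - intros; now apply gterm_shift_bound.
  - now apply ex_series_tele.
  - intros; now apply gterm_shift_bound.
  - now apply ex_series_tele.
Qed.

(** Differentiability of the series is obtained by summing the quadratic Taylor remainders of its
    terms, which have a summable majorant. The estimate holds up to the boundary; openness of the
    half-plane enters only in [binet_hol]. *)
Lemma binet_quad v w : RHc v -> RHc w -> Cmod (v - w) <= Cmod w / 2 ->
  Cmod (binet v - binet w - binet' w * (v - w)) <= 4 * Kb (Cmod w) / Cmod w ^ 2 * Cmod (v - w) ^ 2.
Proof.
  intros Hv Hw H. pose proof (RHc_mod w Hw) as Hp. pose proof (RHc_mod v Hv) as Hpv.
  assert (B1 : forall n, Cmod (gterm (v + RtoC (INR n)) - gterm (w + RtoC (INR n)))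
     <= / 8 * Kb (Cmod v) * tele (Cmod v) n + / 8 * Kb (Cmod w) * tele (Cmod w) n).
  { intros n. eapply Rle_trans; [apply Cmod_triangle_sub|]. apply Rplus_le_compat; now apply gterm_shift_bound. }
  assert (X1 : ex_series (fun n => / 8 * Kb (Cmod v) * tele (Cmod v) n + / 8 * Kb (Cmod w) * tele (Cmod w) n)).
  { apply (ex_series_plus (V:=R_NormedModule) (fun n => / 8 * Kb (Cmod v) * tele (Cmod v) n)); now apply ex_series_tele. }
  assert (B2 : forall n, Cmod (gterm' (w + RtoC (INR n)) * (v - w)) <= Cmod (v - w) * Kb (Cmod w) * tele (Cmod w) n).
  { intros n. rewrite Cmod_mult, Rmult_comm, Rmult_assoc. apply Rmult_le_compat_l; [apply Cmod_ge_0|now apply gterm'_shift_bound]. }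
  assert (X2 : ex_series (fun n => Cmod (v - w) * Kb (Cmod w) * tele (Cmod w) n)) by now apply ex_series_tele.
  unfold binet, binet'.
  rewrite <- (CSer_cmult _ _ (fun n => Kb (Cmod w) * tele (Cmod w) n));
    [|intros; now apply gterm'_shift_bound|now apply ex_series_tele].
  rewrite <- (CSer_minus _ _ (fun n => / 8 * Kb (Cmod v) * tele (Cmod v) n) (fun n => / 8 * Kb (Cmod w) * tele (Cmod w) n));
    try (intros; now apply gterm_shift_bound); try now apply ex_series_tele.
  rewrite <- (CSer_minus _ _ _ _ B1 X1 B2 X2).
  eapply Rle_trans; [apply (CSer_le _ (fun n => 2 / Cmod w * Cmod (v - w) ^ 2 * Kb (Cmod w) * tele (Cmod w) n))|].
  - intros n. pose proof (RHc_shift v (INR n) Hv (pos_INR n)) as Hvn. pose proof (RHc_shift w (INR n) Hw (pos_INR n)) as Hwn.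
    pose proof (gterm_quad _ _ Hvn Hwn) as Q.
    replace (v + RtoC (INR n) - (w + RtoC (INR n)))%C with (v - w)%C in Q by ring.
    eapply Rle_trans; [exact Q|].
    pose proof (close_shift v w n Hw H). pose proof (RHc_mod _ Hwn). pose proof (RHc_mod _ Hvn).
    pose proof (Cmod_shift w (INR n) (proj1 Hw) (pos_INR n)).
    assert (Hi : 0 < / Cmod (w + RtoC (INR n)) ^ 2) by (apply Rinv_0_lt_compat, pow_lt; assumption).
    apply Rle_trans with (2 / Cmod w * Cmod (v - w) ^ 2 * / Cmod (w + RtoC (INR n)) ^ 2).
    + replace (Cmod (v - w) ^ 2 / (Cmod (v + RtoC (INR n)) * Cmod (w + RtoC (INR n)) ^ 2))
        with (/ Cmod (v + RtoC (INR n)) * Cmod (v - w) ^ 2 * / Cmod (w + RtoC (INR n)) ^ 2) by (field; lra).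
      apply Rmult_le_compat_r; [lra|]. apply Rmult_le_compat_r; [apply pow2_ge_0|].
      replace (2 / Cmod w) with (/ (Cmod w / 2)) by (field; lra). apply Rinv_le_contravar; lra.
    + rewrite (Rmult_assoc (2 / Cmod w * _)). apply Rmult_le_compat_l; [|now apply inv_shift_tele].
      apply Rmult_le_pos; [|apply pow2_ge_0]. apply Rmult_le_pos; [lra|]. left; now apply Rinv_0_lt_compat.
  - now apply ex_series_tele.
  - rewrite Series_tele by assumption. right. field. lra.
Qed.

Lemma binet'_lip v w : RHc v -> RHc w -> Cmod (v - w) <= Cmod w / 2 ->
  Cmod (binet' v - binet' w) <= 12 * Kb (Cmod w) / Cmod w ^ 2 * Cmod (v - w).
Proof.
  intros Hv Hw H. pose proof (RHc_mod w Hw) as Hp. pose proof (RHc_mod v Hv) as Hpv.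
  unfold binet'. rewrite <- (CSer_minus _ _ (fun n => Kb (Cmod v) * tele (Cmod v) n) (fun n => Kb (Cmod w) * tele (Cmod w) n));
    try (intros; now apply gterm'_shift_bound); try now apply ex_series_tele.
  eapply Rle_trans; [apply (CSer_le _ (fun n => 6 / Cmod w * Cmod (v - w) * Kb (Cmod w) * tele (Cmod w) n))|].
  - intros n. pose proof (RHc_shift v (INR n) Hv (pos_INR n)) as Hvn. pose proof (RHc_shift w (INR n) Hw (pos_INR n)) as Hwn.
    eapply Rle_trans; [now apply gterm'_lip|].
    replace (v + RtoC (INR n) - (w + RtoC (INR n)))%C with (v - w)%C by ring.
    pose proof (close_shift v w n Hw H). pose proof (RHc_mod _ Hwn). pose proof (RHc_mod _ Hvn).
    pose proof (Cmod_shift w (INR n) (proj1 Hw) (pos_INR n)). pose proof (Cmod_ge_0 (v - w)).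
    apply Rle_trans with (6 / Cmod w * Cmod (v - w) * / Cmod (w + RtoC (INR n)) ^ 2).
    + set (a := Cmod (v + RtoC (INR n))) in *. set (b := Cmod (w + RtoC (INR n))) in *.
      assert (I1 : / a <= 2 / b) by (replace (2 / b) with (/ (b / 2)) by (field; lra); apply Rinv_le_contravar; lra).
      assert (I2 : / b <= / Cmod w) by (apply Rinv_le_contravar; lra).
      pose proof (Rinv_0_lt_compat a H2). pose proof (Rinv_0_lt_compat b H1).
      replace (Cmod (v - w) * (/ a + / b) / (a * b)) with (Cmod (v - w) * ((/ a + / b) * / a * / b)) by (field; lra).
      replace (6 / Cmod w * Cmod (v - w) * / b ^ 2) with (Cmod (v - w) * ((3 * / Cmod w) * (2 * / b) * / b)) by (field; lra).
      apply Rmult_le_compat_l; [assumption|]. apply Rmult_le_compat_r; [lra|].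
      apply Rmult_le_compat; unfold Rdiv in *; lra.
    + rewrite (Rmult_assoc (6 / Cmod w * _)). apply Rmult_le_compat_l; [|now apply inv_shift_tele].
      apply Rmult_le_pos; [|assumption]. apply Rmult_le_pos; [lra|]. left; now apply Rinv_0_lt_compat.
  - now apply ex_series_tele.
  - rewrite Series_tele by assumption. right. field. lra.
Qed.

Lemma RH_RHc w : RH w -> RHc w.
Proof.
  unfold RH, RHc. intros H; split; [lra|]. intros ->. unfold Re, RtoC in H; simpl in H; lra.
Qed.

Lemma binet_hol : hol RH binet.
Proof.
  exists binet'. intros w Hw. pose proof (RH_RHc w Hw) as Hwc. pose proof (RHc_mod w Hwc) as Hp.
  destruct (RH_open w Hw) as [d [Hd Hv]].
  assert (Hm : 0 < Rmin d (Cmod w / 2)) by (apply Rmin_pos; lra).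
  split.
  - apply (Cdiff_quad _ _ _ (Rmin d (Cmod w / 2)) (4 * Kb (Cmod w) / Cmod w ^ 2)); [assumption|].
    intros h Hh.
    assert (E : (w + h - w)%C = h) by ring.
    assert (R1 : RHc (w + h)).
    { apply RH_RHc, Hv. rewrite E. eapply Rlt_le_trans; [exact Hh|apply Rmin_l]. }
    pose proof (binet_quad (w + h) w R1 Hwc) as Q. rewrite E in Q. apply Q.
    left. eapply Rlt_le_trans; [exact Hh|apply Rmin_r].
  - apply cont_eps. intros eps He.
    set (K := 12 * Kb (Cmod w) / Cmod w ^ 2).
    assert (HK : 0 < K).
    { unfold K. pose proof (Kb_pos _ Hp). apply Rmult_lt_0_compat; [lra|]. apply Rinv_0_lt_compat, pow_lt; assumption. }
    exists (Rmin (Rmin d (Cmod w / 2)) (eps / K)). split.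
    + apply Rmin_pos; [assumption|]. now apply Rdiv_lt_0_compat.
    + intros v Hlt.
      assert (V1 : Cmod (v - w) < Rmin d (Cmod w / 2)) by (eapply Rlt_le_trans; [exact Hlt|apply Rmin_l]).
      assert (V2 : Cmod (v - w) < eps / K) by (eapply Rlt_le_trans; [exact Hlt|apply Rmin_r]).
      eapply Rle_lt_trans; [apply binet'_lip|].
      * apply RH_RHc, Hv. eapply Rlt_le_trans; [exact V1|apply Rmin_l].
      * assumption.
      * left; eapply Rlt_le_trans; [exact V1|apply Rmin_r].
      * fold K. replace eps with (K * (eps / K)) by (field; lra). apply Rmult_lt_compat_l; assumption.
Qed.

(* [mu] extends the Binet function to the whole plane, so that functions built
   from it are continuous, without restriction of the domain, at the points of
   the closed half-plane. *)
Definition fold_re (w : C) : C := (Rabs (Re w), Im w).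
Definition mu (w : C) : C := binet (fold_re w).

Lemma fold_re_id w : 0 <= Re w -> fold_re w = w.
Proof. intros H. unfold fold_re. rewrite Rabs_right by lra. destruct w; reflexivity. Qed.

Lemma fold_re_Re w : 0 <= Re (fold_re w).
Proof. apply Rabs_pos. Qed.

Lemma Cmod_fold_re w : Cmod (fold_re w) = Cmod w.
Proof. unfold Cmod, fold_re, Re, Im; cbn [fst snd]. now rewrite pow2_abs. Qed.

Lemma fold_re_RHc w : w <> RtoC 0 -> RHc (fold_re w).
Proof.
  intros H. split; [apply fold_re_Re|]. apply Cmod_pos_neq. rewrite Cmod_fold_re. now apply Cmod_gt_0.
Qed.

Lemma fold_re_lip v w : Cmod (fold_re v - fold_re w) <= Cmod (v - w).
Proof.
  destruct v as [a b], w as [c d]. unfold Cmod, fold_re, Re, Im; cbn [fst snd Cminus Cplus Copp].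
  apply sqrt_le_1_alt.
  pose proof (Rabs_triang_inv2 a c) as H. apply Rsqr_le_abs_1 in H. unfold Rsqr in H.
  unfold Rminus in *. nra.
Qed.

Lemma mu_hol : hol RH mu.
Proof.
  apply (hol_ext RH binet); [apply RH_open| |apply binet_hol].
  intros w Hw. unfold mu. rewrite fold_re_id; [reflexivity|]. unfold RH in Hw; lra.
Qed.

Lemma mu_cont w : w <> RtoC 0 -> continuous mu w.
Proof.
  intros Hn. pose proof (fold_re_RHc w Hn) as Hc.
  pose proof (RHc_mod _ Hc) as Hp.
  apply cont_eps. intros eps He.
  set (K := 4 * Kb (Cmod (fold_re w)) / Cmod (fold_re w)).
  assert (HK : 0 < K).
  { unfold K. pose proof (Kb_pos _ Hp). apply Rmult_lt_0_compat; [lra|]. now apply Rinv_0_lt_compat. }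
  exists (Rmin (Cmod (fold_re w) / 2) (eps / K)). split.
  - apply Rmin_pos; [lra|]. now apply Rdiv_lt_0_compat.
  - intros v Hv. pose proof (fold_re_lip v w) as L.
    assert (V1 : Cmod (fold_re v - fold_re w) < Cmod (fold_re w) / 2).
    { eapply Rle_lt_trans; [exact L|]. eapply Rlt_le_trans; [exact Hv|apply Rmin_l]. }
    assert (V2 : Cmod (fold_re v - fold_re w) < eps / K).
    { eapply Rle_lt_trans; [exact L|]. eapply Rlt_le_trans; [exact Hv|apply Rmin_r]. }
    unfold mu. eapply Rle_lt_trans; [apply binet_lip|].
    + split; [apply fold_re_Re|]. apply Cmod_pos_neq.
      pose proof (Cmod_triangle_rev (fold_re w) (fold_re v - fold_re w)) as T.
      replace (fold_re w + (fold_re v - fold_re w))%C with (fold_re v) in T by ring. lra.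
    + assumption.
    + lra.
    + replace (4 * Cmod (fold_re v - fold_re w) * Kb (Cmod (fold_re w)) / Cmod (fold_re w))
        with (K * Cmod (fold_re v - fold_re w)) by (unfold K; field; lra).
      replace eps with (K * (eps / K)) by (field; lra). apply Rmult_lt_compat_l; assumption.
Qed.

Lemma mu_eq w : 0 <= Re w -> mu w = binet w.
Proof. intros H. unfold mu. now rewrite fold_re_id. Qed.

(** * Conjugation symmetry and the behaviour of mu at the origin *)

Lemma CInt_conj f a b : ccont f a b -> CInt (fun t => Cconj (f t)) a b = Cconj (CInt f a b).
Proof.
  intros H. pose proof (ccont_ex_Im f a b H) as HI.
  unfold CInt, Cconj, Re, Im in *; cbn [fst snd]. f_equal.
  apply (RInt_opp (V:=R_CompleteNormedModule) (fun t => snd (f t))). exact HI.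
Qed.

Lemma gterm_conj w : RHc w -> gterm (Cconj w) = Cconj (gterm w).
Proof.
  intros Hw. unfold gterm. rewrite <- CInt_conj by (apply gterm_ccont; now apply RHc_slit).
  apply CInt_ext. intros t _. now rewrite Cconj_mult, Cconj_inv, Cconj_plus, !Cconj_RtoC.
Qed.

Lemma mu_conj w : RHc w -> mu (Cconj w) = Cconj (mu w).
Proof.
  intros Hw. destruct Hw as [H1 H2]. rewrite !mu_eq by assumption. unfold binet, CSer, Cconj at 3; cbn [fst snd].
  rewrite <- Series_opp.
  assert (E : forall n, gterm (Cconj w + RtoC (INR n)) = Cconj (gterm (w + RtoC (INR n)))).
  { intros n. rewrite <- gterm_conj by (apply RHc_shift; [split; assumption|apply pos_INR]).
    now rewrite Cconj_plus, Cconj_RtoC. }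
  f_equal; apply Series_ext; intros n; rewrite E; reflexivity.
Qed.

(** Near the origin only the first term of the series is singular; the rest is the Binet function at
    w + 1. *)
Lemma binet_shift w : RHc w -> binet w = (gterm w + binet (w + 1))%C.
Proof.
  intros Hw. pose proof (RHc_mod w Hw) as Hp.
  assert (E : forall n, gterm (w + RtoC (INR (S n))) = gterm (w + 1 + RtoC (INR n))).
  { intros n. f_equal. rewrite S_INR, RtoC_plus. ring. }
  apply C_eq; unfold binet, CSer, Cplus at 3; unfold Re, Im; cbn [fst snd].
  - rewrite Series_incr_1.
    + change (INR 0) with 0. rewrite Cplus_0_r. f_equal. apply Series_ext. intros n. now rewrite E.
    + apply (CSer_ex_Re _ (fun n => / 8 * Kb (Cmod w) * tele (Cmod w) n)); [intros; now apply gterm_shift_bound|now apply ex_series_tele].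
  - rewrite Series_incr_1.
    + change (INR 0) with 0. rewrite Cplus_0_r. f_equal. apply Series_ext. intros n. now rewrite E.
    + apply (CSer_ex_Im _ (fun n => / 8 * Kb (Cmod w) * tele (Cmod w) n)); [intros; now apply gterm_shift_bound|now apply ex_series_tele].
Qed.

(** Splitting 1/2 - u leaves one half of the integral of 1/(w + u), a logarithm, and the integral of
    u/(w + u), whose integrand has modulus at most 1. Hence exp(mu) behaves like |w|^(-1/2) at the
    origin. *)
Lemma Re_gterm_near0 w : RHc w ->
  Rabs (Re (gterm w) - / 2 * (ln (Cmod (w + 1)) - ln (Cmod w))) <= 1.
Proof.
  intros Hw. pose proof (RHc_mod w Hw) as Hp.
  assert (c1 : ccont (fun u => / (w + RtoC u))%C 0 1).
  { intros u Hu. rewrite Rmin_left, Rmax_right in Hu by lra. apply cont_Cinv; [apply cont_shift|now apply RHc_slit]. }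
  assert (c2 : ccont (fun u => RtoC u * / (w + RtoC u))%C 0 1).
  { intros u Hu. apply cont_Cmult; [apply cont_RtoC, continuous_id|now apply c1]. }
  assert (c3 : ccont (fun u => RtoC (1 / 2) * / (w + RtoC u))%C 0 1).
  { intros u Hu. apply cont_Cmult; [apply continuous_const|now apply c1]. }
  assert (E : gterm w = (RtoC (1 / 2) * CInt (fun u => / (w + RtoC u)) 0 1 - CInt (fun u => RtoC u * / (w + RtoC u)) 0 1)%C).
  { rewrite <- CInt_cmult, <- CInt_minus by assumption. apply CInt_ext. intros t _.
    rewrite RtoC_minus. ring. }
  assert (B : Cmod (CInt (fun u => RtoC u * / (w + RtoC u)) 0 1)%C <= 1).
  { replace 1 with (1 * (1 - 0)) at 2 by ring. apply CInt_le_const; [lra|assumption|].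
    intros u Hu. rewrite Cmod_mult, Cmod_inv, Cmod_R, Rabs_right by (try (now apply RHc_slit); lra).
    pose proof (Cmod_shift w u (proj1 Hw) (proj1 Hu)).
    pose proof (re_le_Cmod (w + RtoC u)) as R. rewrite Re_shift in R. pose proof (Rle_abs (Re w + u)). destruct Hw.
    apply Rmult_le_reg_r with (Cmod (w + RtoC u)); [lra|]. rewrite Rmult_assoc, Rinv_l by lra. lra. }
  assert (L : Re (CInt (fun u => / (w + RtoC u)) 0 1)%C = ln (Cmod (w + 1)) - ln (Cmod w)).
  { unfold CInt, Re at 1; cbn [fst]. apply is_RInt_unique.
    assert (Hq : forall t, 0 <= t <= 1 -> 0 < (Re w + t) ^ 2 + Im w ^ 2).
    { intros t Ht. replace ((Re w + t) ^ 2 + Im w ^ 2) with (Cmod (w + RtoC t) ^ 2).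
      - apply pow_lt, RHc_mod, RHc_shift; [assumption|lra].
      - rewrite Cmod2_alt, Re_shift, Im_shift. reflexivity. }
    assert (Hl : forall t, 0 <= t <= 1 -> ln (Cmod (w + RtoC t)) = 1 / 2 * ln ((Re w + t) ^ 2 + Im w ^ 2)).
    { intros t Ht. replace ((Re w + t) ^ 2 + Im w ^ 2) with (Cmod (w + RtoC t) ^ 2)
        by (rewrite Cmod2_alt, Re_shift, Im_shift; reflexivity).
      simpl pow. rewrite Rmult_1_r. rewrite ln_mult by (apply RHc_mod, RHc_shift; [assumption|lra]). field. }
    replace (w + 1)%C with (w + RtoC 1)%C by reflexivity.
    replace (ln (Cmod w)) with (ln (Cmod (w + RtoC 0))) by (now rewrite Cplus_0_r).
    rewrite !Hl by lra.
    apply (is_RInt_derive (V:=R_CompleteNormedModule) (fun t => 1 / 2 * ln ((Re w + t) ^ 2 + Im w ^ 2))).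
    - intros t Ht. rewrite Rmin_left, Rmax_right in Ht by lra. specialize (Hq t Ht).
      replace (Re (/ (w + RtoC t))%C) with ((Re w + t) / ((Re w + t) ^ 2 + Im w ^ 2)).
      + auto_derive; [lra|]. field. lra.
      + unfold Cinv, Re at 3; cbn [fst]. change (fst (w + RtoC t)%C) with (Re w + t).
        change (snd (w + RtoC t)%C) with (Im (w + RtoC t)%C). now rewrite Im_shift.
    - intros t Ht. apply cont_Re. now apply c1. }
  rewrite E. 
  replace (Re (RtoC (1 / 2) * CInt (fun u => / (w + RtoC u)) 0 1 - CInt (fun u => RtoC u * / (w + RtoC u)) 0 1)%C)
    with (1 / 2 * Re (CInt (fun u => / (w + RtoC u)) 0 1)%C - Re (CInt (fun u => RtoC u * / (w + RtoC u)) 0 1)%C)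
    by (unfold RtoC, Cmult, Cminus, Cplus, Copp, Re; cbn [fst snd]; ring).
  rewrite L.
  match goal with |- Rabs ?t <= _ => replace t with (- Re (CInt (fun u => RtoC u * / (w + RtoC u)) 0 1)%C) by field end.
  rewrite Rabs_Ropp. eapply Rle_trans; [apply re_le_Cmod|exact B].
Qed.

Lemma exp_mono x y : x <= y -> exp x <= exp y.
Proof. intros [H| ->]; [left; now apply exp_increasing|lra]. Qed.

Lemma mu_near0 : exists K, 0 < K /\ forall w, RHc w -> Cmod w <= 1 ->
  exp (Re (mu w)) ^ 2 * Cmod w <= K /\ exp (- Re (mu w)) ^ 2 <= K * Cmod w.
Proof.
  (* The factor 2 bounds |w + 1|, and 6 is twice the sum of the errors 1, from [Re_gterm_near0], and
     2, from [binet_bound] at w + 1. *)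
  exists (2 * exp 6). split; [pose proof (exp_pos 6); lra|].
  intros w Hw H1. pose proof (RHc_mod w Hw) as Hp.
  rewrite mu_eq by apply Hw. rewrite binet_shift by assumption.
  replace (Re (gterm w + binet (w + 1))%C) with (Re (gterm w) + Re (binet (w + 1))) by reflexivity.
  assert (Hw1 : RHc (w + 1)) by (apply (RHc_shift w 1 Hw); lra).
  assert (M1 : 1 <= Cmod (w + 1)).
  { eapply Rle_trans; [|apply (re_le_Cmod (w + 1))]. change (Re (w + 1)%C) with (Re w + 1). destruct Hw. rewrite Rabs_right; lra. }
  assert (M2 : Cmod (w + 1) <= 2).
  { eapply Rle_trans; [apply Cmod_triangle|]. rewrite Cmod_1. lra. }
  assert (B : Rabs (Re (binet (w + 1))) <= 2).
  { eapply Rle_trans; [apply re_le_Cmod|]. eapply Rle_trans; [now apply binet_bound|].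
    assert (/ Cmod (w + 1) <= 1) by (apply Rle_trans with (/ 1); [apply Rinv_le_contravar; lra|lra]).
    assert (0 < / Cmod (w + 1)) by (apply Rinv_0_lt_compat; lra).
    unfold Rdiv. nra. }
  pose proof (Re_gterm_near0 w Hw) as G.
  apply Rabs_le_between in B, G.
  set (a := Re (gterm w)) in *. set (b := Re (binet (w + 1))) in *.
  assert (Ea : forall x, exp x ^ 2 = exp (2 * x)).
  { intros x. replace (2 * x) with (x + x) by ring. rewrite exp_plus. ring. }
  assert (Eq : forall c, 0 < c -> exp (ln c) = c) by (intros; now apply exp_ln).
  assert (L0 : 0 <= ln (Cmod (w + 1))).
  { rewrite <- ln_1. destruct M1 as [M1| <-]; [left; apply ln_increasing; lra|lra]. }
  assert (L2 : ln (Cmod (w + 1)) <= ln 2).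
  { destruct M2 as [M2| ->]; [left; apply ln_increasing; lra|lra]. }
  split.
  - rewrite Ea. rewrite <- (Eq (Cmod w)) by assumption. rewrite <- exp_plus.
    replace (2 * exp 6) with (exp (ln 2 + 6)) by (rewrite exp_plus, Eq; lra).
    apply exp_mono. lra.
  - rewrite Ea. replace (2 * exp 6 * Cmod w) with (2 * exp 6 * exp (ln (Cmod w))) by (now rewrite Eq).
    replace (2 * exp 6 * exp (ln (Cmod w))) with (exp (ln 2 + 6 + ln (Cmod w))) by (rewrite !exp_plus, (Eq 2); lra).
    assert (0 < ln 2) by (rewrite <- ln_1; apply ln_increasing; lra).
    left; apply exp_increasing. lra.
Qed.

(** * The logarithm and Gauss's product *)

Lemma sqrt_1_sub (v : C) : v <> RtoC 0 -> sqrt (1 - (Re v / Cmod v)²) = Rabs (Im v) / Cmod v.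
Proof.
  intros Hv. pose proof (proj1 (Cmod_gt_0 v) Hv) as Hp. pose proof (Cmod2_alt v) as E.
  replace (1 - (Re v / Cmod v)²) with ((Rabs (Im v) / Cmod v)²).
  - apply sqrt_Rsqr. apply Rmult_le_pos; [apply Rabs_pos|left; now apply Rinv_0_lt_compat].
  - unfold Rsqr. apply Rmult_eq_reg_r with (Cmod v ^ 2); [|apply pow_nonzero; lra].
    replace (Rabs (Im v) / Cmod v * (Rabs (Im v) / Cmod v) * Cmod v ^ 2) with (Rabs (Im v) ^ 2) by (field; lra).
    replace ((1 - Re v / Cmod v * (Re v / Cmod v)) * Cmod v ^ 2) with (Cmod v ^ 2 - Re v ^ 2) by (field; lra).
    rewrite pow2_abs. lra.
Qed.

Lemma cos_ratio_bound (v : C) : v <> RtoC 0 -> -1 <= Re v / Cmod v <= 1.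
Proof.
  intros Hv. pose proof (proj1 (Cmod_gt_0 v) Hv) as Hp.
  pose proof (re_le_Cmod v) as H. apply Rabs_le_between in H.
  split; apply Rmult_le_reg_r with (Cmod v); try assumption;
  unfold Rdiv; rewrite Rmult_assoc, Rinv_l by lra; lra.
Qed.

Lemma cos_Carg v : v <> RtoC 0 -> cos (Carg v) = Re v / Cmod v.
Proof.
  intros Hv. unfold Carg. destruct Rle_dec; [|rewrite cos_neg]; apply cos_acos; now apply cos_ratio_bound.
Qed.

Lemma sin_Carg v : v <> RtoC 0 -> sin (Carg v) = Im v / Cmod v.
Proof.
  intros Hv. unfold Carg. destruct (Rle_dec 0 (Im v)) as [H|H]; [|rewrite sin_neg];
  rewrite sin_acos, sqrt_1_sub by (try apply cos_ratio_bound; assumption).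
  - rewrite Rabs_right by lra. reflexivity.
  - rewrite Rabs_left by lra. unfold Rdiv; ring.
Qed.

Lemma Cexp_Clog v : v <> RtoC 0 -> Cexp (Clog v) = v.
Proof.
  intros Hv. pose proof (proj1 (Cmod_gt_0 v) Hv) as Hp.
  apply C_eq; unfold Cexp, Clog, Re, Im; cbn [fst snd]; rewrite exp_ln by assumption.
  - rewrite cos_Carg by assumption. unfold Re. field. lra.
  - rewrite sin_Carg by assumption. unfold Im. field. lra.
Qed.

Lemma Carg_atan v : 0 < Re v -> Carg v = atan (Im v / Re v).
Proof.
  intros Hv. assert (Hn : v <> RtoC 0) by (intros ->; unfold Re, RtoC in Hv; simpl in Hv; lra).
  pose proof (proj1 (Cmod_gt_0 v) Hn) as Hp.
  assert (Hq : 0 < Re v / Cmod v) by now apply Rdiv_lt_0_compat.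
  unfold Carg. rewrite acos_atan, sqrt_1_sub by assumption.
  replace (Rabs (Im v) / Cmod v / (Re v / Cmod v)) with (Rabs (Im v) / Re v) by (field; lra).
  destruct Rle_dec.
  - now rewrite Rabs_right by lra.
  - rewrite Rabs_left by lra. rewrite <- atan_opp. f_equal. field. lra.
Qed.

(** The arctangent of Im v / Re v breaks down on the imaginary axis, which belongs to the domain.
    This form is smooth across it, with a constant that depends only on the sign of Im v. *)
Lemma Carg_atan_inv v : Im v <> 0 ->
  Carg v = (if Rle_dec 0 (Im v) then PI / 2 else - (PI / 2)) - atan (Re v / Im v).
Proof.
  intros Hv. assert (Hn : v <> RtoC 0) by (intros ->; unfold Im, RtoC in Hv; simpl in Hv; lra).
  pose proof (proj1 (Cmod_gt_0 v) Hn) as Hp.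
  pose proof (Rabs_pos_lt _ Hv) as Ha.
  assert (Hq : -1 < Re v / Cmod v < 1).
  { pose proof (sqrt_1_sub v Hn) as S. destruct (cos_ratio_bound v Hn) as [[A|A] [B|B]]; try (split; assumption); exfalso.
    all: assert (Z : 1 - (Re v / Cmod v)² = 0) by (unfold Rsqr; first [rewrite <- A|rewrite B]; ring);
      rewrite Z, sqrt_0 in S; assert (0 < Rabs (Im v) / Cmod v) by (now apply Rdiv_lt_0_compat); lra. }
  unfold Carg. rewrite acos_asin, asin_atan, sqrt_1_sub by (try assumption; lra).
  replace (Re v / Cmod v / (Rabs (Im v) / Cmod v)) with (Re v / Rabs (Im v)) by (field; lra).
  destruct Rle_dec.
  - now rewrite Rabs_right by lra.
  - rewrite Rabs_left by lra. replace (Re v / - Im v) with (- (Re v / Im v)) by (field; lra). rewrite atan_opp. lra.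
Qed.

Lemma Clog_shift w : RHc w -> CInt (fun u => / (w + RtoC u))%C 0 1 = (Clog (w + 1) - Clog w)%C.
Proof.
  intros Hw.
  replace (Clog w) with (Clog (w + RtoC 0)) by (now rewrite Cplus_0_r).
  assert (Hq : forall t, 0 <= t <= 1 -> 0 < (Re w + t) ^ 2 + Im w ^ 2).
  { intros t Ht. replace ((Re w + t) ^ 2 + Im w ^ 2) with (Cmod (w + RtoC t) ^ 2).
    - apply pow_lt, RHc_mod, RHc_shift; [assumption|lra].
    - rewrite Cmod2_alt, Re_shift, Im_shift. reflexivity. }
  assert (c1 : ccont (fun u => / (w + RtoC u))%C 0 1).
  { intros u Hu. rewrite Rmin_left, Rmax_right in Hu by lra. apply cont_Cinv; [apply cont_shift|now apply RHc_slit]. }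
  assert (Hre : forall t, 0 <= t <= 1 -> is_derive (fun t : R => 1 / 2 * ln ((Re w + t) ^ 2 + Im w ^ 2)) t (Re (/ (w + RtoC t))%C)).
  { intros t Ht. specialize (Hq t Ht).
    replace (Re (/ (w + RtoC t))%C) with ((Re w + t) / ((Re w + t) ^ 2 + Im w ^ 2)).
    + auto_derive; [lra|]. field. lra.
    + unfold Cinv, Re at 3; cbn [fst]. change (fst (w + RtoC t)%C) with (Re w + t).
      change (snd (w + RtoC t)%C) with (Im (w + RtoC t)%C). now rewrite Im_shift. }
  assert (Him : forall t : R, Im (/ (w + RtoC t))%C = - Im w / ((Re w + t) ^ 2 + Im w ^ 2)).
  { intros t. unfold Cinv, Im at 1; cbn [snd]. change (fst (w + RtoC t)%C) with (Re w + t).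
    change (snd (w + RtoC t)%C) with (Im (w + RtoC t)%C). now rewrite Im_shift. }
  assert (Hl : forall t : R, 0 <= t <= 1 -> ln (Cmod (w + RtoC t)) = 1 / 2 * ln ((Re w + t) ^ 2 + Im w ^ 2)).
  { intros t Ht. replace ((Re w + t) ^ 2 + Im w ^ 2) with (Cmod (w + RtoC t) ^ 2)
      by (rewrite Cmod2_alt, Re_shift, Im_shift; reflexivity).
    simpl pow. rewrite Rmult_1_r. rewrite ln_mult by (apply RHc_mod, RHc_shift; [assumption|lra]). field. }
  change (w + 1)%C with (w + RtoC 1)%C.
  (* The primitive of the imaginary part depends on the case: for real w the argument is constantly
     0, and otherwise the arctangent of (Re w + t)/Im w remains smooth even when Re w = 0. *)
  assert (HI : exists F : R -> R, (forall t, 0 <= t <= 1 -> is_derive F t (Im (/ (w + RtoC t))%C)) /\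
     F 1 - F 0 = Carg (w + RtoC 1) - Carg (w + RtoC 0)).
  { destruct (Req_dec (Im w) 0) as [H0|H0].
    - exists (fun _ => 0). split.
      + intros t Ht. rewrite Him, H0. replace (- 0 / ((Re w + t) ^ 2 + 0 ^ 2)) with 0 by (unfold Rdiv; ring). apply (is_derive_const (V:=R_NormedModule)).
      + assert (Hx : 0 < Re w).
        { specialize (Hq 0 ltac:(lra)). rewrite H0 in Hq. destruct Hw as [[Hx|Hx] _]; [assumption|]. rewrite <- Hx in Hq. exfalso. simpl in Hq. lra. }
        rewrite !Carg_atan by (rewrite Re_shift; lra). rewrite !Im_shift, H0. unfold Rdiv. rewrite !Rmult_0_l. ring.
    - exists (fun t => - atan ((Re w + t) / Im w)). split.
      + intros t Ht. rewrite Him. specialize (Hq t Ht). auto_derive; [trivial|]. field. repeat split; try assumption; lra.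
      + rewrite !Carg_atan_inv by (rewrite Im_shift; assumption). rewrite !Re_shift, !Im_shift. ring. }
  destruct HI as [F [HF HF2]].
  rewrite (CInt_derive (fun t => (1 / 2 * ln ((Re w + t) ^ 2 + Im w ^ 2), F t))).
  - unfold Clog. rewrite !Hl by lra. apply C_eq; [reflexivity|exact HF2].
  - intros t Ht. rewrite Rmin_left, Rmax_right in Ht by lra. now apply Hre.
  - intros t Ht. rewrite Rmin_left, Rmax_right in Ht by lra. now apply HF.
  - assumption.
Qed.

Lemma gterm_log w : RHc w -> gterm w = ((w + RtoC (1 / 2)) * (Clog (w + 1) - Clog w) - 1)%C.
Proof.
  intros Hw.
  assert (c1 : ccont (fun u => / (w + RtoC u))%C 0 1).
  { intros u Hu. rewrite Rmin_left, Rmax_right in Hu by lra. apply cont_Cinv; [apply cont_shift|now apply RHc_slit]. }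
  rewrite <- Clog_shift by assumption. rewrite <- CInt_cmult by assumption.
  assert (E1 : CInt (fun _ => RtoC 1) 0 1 = RtoC 1).
  { unfold CInt. rewrite !RInt_const. apply C_eq; unfold Re, Im, RtoC; cbn; unfold scal; simpl; unfold mult; simpl; ring. }
  rewrite <- E1. rewrite <- CInt_minus.
  - unfold gterm. apply CInt_ext. intros t Ht. rewrite Rmin_left, Rmax_right in Ht by lra.
    rewrite RtoC_minus. field. apply RHc_slit; [assumption|lra].
  - intros u Hu. apply cont_Cmult; [apply continuous_const|now apply c1].
  - intros u Hu. apply continuous_const.
Qed.

Fixpoint Csum (f : nat -> C) (n : nat) : C :=
  match n with O => RtoC 0 | S m => (Csum f m + f m)%C end.

(** Abel summation of the logarithmic form of the terms. There are n terms but n + 1 logarithms, to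
    match the n + 1 factors of [rising w n]. *)
Lemma Csum_gterm w n : RHc w ->
  Csum (fun k => gterm (w + RtoC (INR k))) n
  = ((w + RtoC (INR n) + RtoC (1 / 2)) * Clog (w + RtoC (INR n)) - (w - RtoC (1 / 2)) * Clog w
     - Csum (fun k => Clog (w + RtoC (INR k))) (S n) - RtoC (INR n))%C.
Proof.
  intros Hw. induction n.
  - cbn [Csum]. change (INR 0) with 0. rewrite Cplus_0_r.
    replace (RtoC (1 / 2)) with (1 - RtoC (1 / 2))%C at 2 by (rewrite <- RtoC_minus; f_equal; field). ring.
  - cbn [Csum] in *. rewrite IHn, gterm_log by (apply RHc_shift; [assumption|apply pos_INR]).
    rewrite S_INR, RtoC_plus. replace (w + RtoC (INR n) + 1)%C with (w + (RtoC (INR n) + RtoC 1))%C by ring. ring.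
Qed.

Lemma rising_exp w n : RHc w -> rising w n = Cexp (Csum (fun k => Clog (w + RtoC (INR k))) (S n)).
Proof.
  intros Hw.
  assert (Hk : forall k, Cexp (Clog (w + RtoC (INR k))) = (w + RtoC (INR k))%C).
  { intros k. apply Cexp_Clog. apply (RHc_shift w (INR k) Hw (pos_INR k)). }
  induction n.
  - cbn [Csum rising]. rewrite Cplus_0_l, Hk. change (INR 0) with 0. now rewrite Cplus_0_r.
  - cbn [rising]. rewrite IHn. cbn [Csum]. rewrite !(Cexp_plus _ (Clog (w + RtoC (INR (S n))))), Hk. reflexivity.
Qed.

Lemma Clog_INR n : (0 < n)%nat -> Clog (RtoC (INR n)) = RtoC (ln (INR n)).
Proof.
  intros Hn. assert (0 < INR n) by (apply lt_0_INR; assumption).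
  unfold Clog. rewrite Carg_atan by assumption. rewrite Cmod_R, Rabs_right by lra.
  unfold Im, RtoC; cbn [fst snd]. unfold Rdiv. rewrite Rmult_0_l, atan_0. reflexivity.
Qed.

(** Stirling's quotient n! e^n / n^(n + 1/2), whose limit will turn out to be sqrt(2 pi). *)
Definition stirling_seq (n : nat) : R := INR (fact n) * exp (INR n - (INR n + 1 / 2) * ln (INR n)).

(** Gauss's quotient is separated into factors that converge individually: the exponential of a
    partial Binet sum, the constant w^(w - 1/2), Stirling's quotient, and a correction that tends to
    exp(-w). *)
Lemma Gamma_seq_split w n : RHc w -> (0 < n)%nat ->
  Gamma_seq w n =
  (Cexp (Csum (fun k => gterm (w + RtoC (INR k))) n) * Cexp ((w - RtoC (1 / 2)) * Clog w)
   * RtoC (stirling_seq n)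
   * Cexp (- ((w + RtoC (INR n) + RtoC (1 / 2)) * (Clog (w + RtoC (INR n)) - Clog (RtoC (INR n))))))%C.
Proof.
  intros Hw Hn. unfold Gamma_seq, Cpower, stirling_seq.
  rewrite rising_exp by assumption. unfold Cdiv. rewrite <- Cexp_opp.
  rewrite RtoC_mult, <- Cexp_RtoC. rewrite !Clog_INR by assumption.
  rewrite Csum_gterm by assumption.
  set (S1 := Csum _ (S n)). set (L0 := Clog w). set (Ln := Clog (w + RtoC (INR n))).
  rewrite RtoC_minus, RtoC_mult, RtoC_plus.
  set (l := RtoC (ln (INR n))). set (N := RtoC (INR n)). set (h := RtoC (1 / 2)).
  match goal with |- (?F * ?A * ?B)%C = (?X * ?Y * (_ * ?Z) * ?T)%C =>
    transitivity (F * (A * B))%C; [ring|]; transitivity (F * (X * Y * Z * T))%C; [|ring] end.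
  f_equal. rewrite <- !Cexp_plus. f_equal. ring.
Qed.

(** * The product formula for sinh *)

Definition ch (u : R) := (exp u + exp (- u)) / 2.
Definition sh (u : R) := (exp u - exp (- u)) / 2.

(** Wallis-type integrals with parameter s. By their two-term recursion, the ratio of the values at
    s and at 0 reproduces the factors k^2/(s^2 + k^2) of the sinh product. *)
Definition wint (s : R) (n : nat) : R := RInt (fun x => ch (2 * s * x) * cos x ^ (2 * n)) 0 (PI / 2).

Lemma wint_ex s n a b : ex_RInt (fun x => ch (2 * s * x) * cos x ^ (2 * n)) a b.
Proof.
  apply (ex_RInt_continuous (V:=R_CompleteNormedModule)). intros x _.
  apply (ex_derive_continuous (fun x => ch (2 * s * x) * cos x ^ (2 * n))). unfold ch. auto_derive; trivial.
Qed.

Lemma wint_rec s n :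
  (s ^ 2 + INR (S n) ^ 2) * 2 * wint s (S n) = INR (S n) * (2 * INR n + 1) * wint s n.
Proof.
  set (m := (2 * n)%nat).
  assert (Hk : INR (S n) = INR n + 1) by apply S_INR. revert Hk. generalize (INR (S n)). intros k Hk.
  (* Two integrations by parts condensed into one explicit primitive, which vanishes at 0 and at
     pi/2. *)
  set (F := fun x => s * sh (2 * s * x) * cos x ^ (m + 2) + k * ch (2 * s * x) * cos x ^ (m + 1) * sin x).
  assert (E : RInt (fun x => (s ^ 2 + k ^ 2) * 2 * (ch (2 * s * x) * cos x ^ (2 * S n))
       - k * (2 * INR n + 1) * (ch (2 * s * x) * cos x ^ (2 * n))) 0 (PI / 2) = F (PI / 2) - F 0).
  { apply is_RInt_unique. apply (is_RInt_derive (V:=R_CompleteNormedModule) F).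
    - intros x _. unfold F, sh, ch. auto_derive; [trivial|].
      replace (2 * S n)%nat with (S (S m)) by (unfold m; lia). fold m.
      replace (m + 2)%nat with (S (S m)) by lia. replace (m + 1)%nat with (S m) by lia.
      cbn [Nat.pred]. replace (INR (S (S m))) with (2 * INR n + 2) by (rewrite !S_INR; unfold m; rewrite mult_INR; simpl INR; ring).
      replace (INR (S m)) with (2 * INR n + 1) by (rewrite !S_INR; unfold m; rewrite mult_INR; simpl INR; ring).
      rewrite Hk. pose proof (sin2_cos2 x) as SC. unfold Rsqr in SC.
      assert (SC2 : sin x * sin x = 1 - cos x * cos x) by lra.
      set (a := exp (2 * s * x)). set (b := exp (- (2 * s * x))).
      simpl pow. set (c := cos x) in *. set (d := sin x) in *. set (p := c ^ m).
      match goal with |- ?l = ?r => assert (Z : l - r = 0) end.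
      { transitivity ((INR n + 1) * (2 * INR n + 1) * ((a + b) / 2) * p * (1 - c * c - d * d)); [field|].
        rewrite <- SC2. ring. }
      lra.
    - intros x _. apply (ex_derive_continuous (fun x => (s ^ 2 + k ^ 2) * 2 * (ch (2 * s * x) * cos x ^ (2 * S n))
       - k * (2 * INR n + 1) * (ch (2 * s * x) * cos x ^ (2 * n)))). unfold ch. auto_derive; trivial. }
  assert (FE : F (PI / 2) - F 0 = 0).
  { unfold F. rewrite cos_PI2, sin_0. replace (m + 2)%nat with (S (m + 1)) by lia. replace (m + 1)%nat with (S m) by lia.
    simpl pow. unfold sh. replace (2 * s * 0) with 0 by ring. rewrite Ropp_0, exp_0. field. }
  rewrite FE in E.
  rewrite (RInt_minus (V:=R_CompleteNormedModule) (fun x => (s ^ 2 + k ^ 2) * 2 * (ch (2 * s * x) * cos x ^ (2 * S n)))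
     (fun x => k * (2 * INR n + 1) * (ch (2 * s * x) * cos x ^ (2 * n)))) in E.
  - rewrite (RInt_scal (V:=R_CompleteNormedModule) (fun x => ch (2 * s * x) * cos x ^ (2 * S n))) in E by apply wint_ex.
    rewrite (RInt_scal (V:=R_CompleteNormedModule) (fun x => ch (2 * s * x) * cos x ^ (2 * n))) in E by apply wint_ex.
    change ((s ^ 2 + k ^ 2) * 2 * wint s (S n) - k * (2 * INR n + 1) * wint s n = 0) in E. lra.
  - apply (ex_RInt_scal (V:=R_NormedModule)), wint_ex.
  - apply (ex_RInt_scal (V:=R_NormedModule)), wint_ex.
Qed.

Lemma wint_0 s : s <> 0 -> wint s 0 = sh (PI * s) / (2 * s).
Proof.
  intros Hs. unfold wint. apply is_RInt_unique.
  replace (sh (PI * s) / (2 * s)) with (minus (sh (2 * s * (PI / 2)) / (2 * s)) (sh (2 * s * 0) / (2 * s))).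
  - apply (is_RInt_derive (V:=R_CompleteNormedModule) (fun x => sh (2 * s * x) / (2 * s))).
    + intros x _. unfold sh, ch. auto_derive; [trivial|]. simpl. field. assumption.
    + intros x _. apply (ex_derive_continuous (fun x => ch (2 * s * x) * cos x ^ (2 * 0))). unfold ch. auto_derive; trivial.
  - unfold minus, plus, opp; simpl. unfold sh. replace (2 * s * 0) with 0 by ring. rewrite Ropp_0, exp_0.
    replace (2 * s * (PI / 2)) with (PI * s) by field. field. assumption.
Qed.

Lemma wint_00 : wint 0 0 = PI / 2.
Proof.
  unfold wint. rewrite (RInt_ext _ (fun _ => 1)).
  - rewrite RInt_const. unfold scal; simpl; unfold mult; simpl. ring.
  - intros x _. unfold ch. replace (2 * 0 * x) with 0 by ring. rewrite Ropp_0, exp_0. simpl. field.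
Qed.

Lemma wint0_pos n : 0 < wint 0 n.
Proof.
  induction n; [rewrite wint_00; pose proof PI_RGT_0; lra|].
  pose proof (wint_rec 0 n) as E. pose proof (pos_INR n). rewrite S_INR in E.
  assert (0 < (INR n + 1) * (2 * INR n + 1) * wint 0 n) by (repeat apply Rmult_lt_0_compat; lra).
  assert (0 < (INR n + 1) ^ 2 * 2) by (apply Rmult_lt_0_compat; [apply pow_lt; lra|lra]).
  apply Rmult_lt_reg_l with ((INR n + 1) ^ 2 * 2); [assumption|]. 
  replace ((0 ^ 2 + (INR n + 1) ^ 2) * 2) with ((INR n + 1) ^ 2 * 2) in E by ring. rewrite E. lra.
Qed.

Lemma sin_lower x : 0 <= x <= PI / 2 -> x / 8 <= sin x.
Proof.
  intros Hx. pose proof PI_4. pose proof PI2_1.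
  destruct (Rle_dec x (1 / 2)) as [H1|H1].
  - pose proof (sin_taylor1 x ltac:(rewrite Rabs_right; lra)) as T. apply Rabs_le_between in T. nra.
  - assert (H2 : sin (1 / 2) <= sin x) by (left; apply sin_increasing_1; lra).
    pose proof (sin_taylor1 (1 / 2) ltac:(rewrite Rabs_right; lra)) as T. apply Rabs_le_between in T. lra.
Qed.

(** With v = s x, use cosh(2v) - 1 = 2 sinh(v)^2 and sinh v <= v e^v; the exponential factor is
    bounded generously through x <= 4. *)
Lemma ch_upper s x : 0 <= s -> 0 <= x <= PI / 2 -> ch (2 * s * x) - 1 <= 2 * s ^ 2 * exp (8 * s) * x ^ 2.
Proof.
  intros Hs Hx. pose proof PI_4.
  set (v := s * x). assert (Hv : 0 <= v) by (apply Rmult_le_pos; lra).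
  assert (E : ch (2 * s * x) - 1 = 2 * sh v ^ 2).
  { unfold ch, sh. replace (2 * s * x) with (v + v) by (unfold v; ring). rewrite Ropp_plus_distr, !exp_plus.
    assert (exp v * exp (- v) = 1) by (rewrite <- exp_plus, Rplus_opp_r; apply exp_0). nra. }
  assert (B : 0 <= sh v <= v * exp v).
  { unfold sh. pose proof (exp_pos v). pose proof (exp_pos (- v)).
    assert (exp v * exp (- v) = 1) by (rewrite <- exp_plus, Rplus_opp_r; apply exp_0).
    pose proof (exp_ineq1_le (- v)). pose proof (exp_ineq1_le v).
    assert (1 - 2 * v <= exp (- v) * exp (- v)).
    { rewrite <- exp_plus. pose proof (exp_ineq1_le (- v + - v)). lra. }
    split; [assert (exp (- v) <= 1 <= exp v) by (split; [rewrite <- exp_0; apply exp_mono; lra|lra]); lra|].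
    assert (exp v * (exp (- v) * exp (- v)) = exp (- v)) by (rewrite <- Rmult_assoc, H2; ring).
    nra. }
  rewrite E.
  assert (exp v ^ 2 <= exp (8 * s)).
  { simpl. rewrite Rmult_1_r, <- exp_plus. apply exp_mono. unfold v. nra. }
  replace (2 * s ^ 2 * exp (8 * s) * x ^ 2) with (2 * (v ^ 2 * exp (8 * s))) by (unfold v; ring).
  apply Rmult_le_compat_l; [lra|]. apply Rle_trans with ((v * exp v) ^ 2); [apply pow_incr; exact B|].
  rewrite Rpow_mult_distr. apply Rmult_le_compat_l; [apply pow2_ge_0|assumption].
Qed.

(** The weight cos^(2n) concentrates at 0, where cosh(2sx) is 1. Quantitatively, cosh(2sx) - 1 <= K
    sin(x)^2, and the integral of sin^2 cos^(2n) is a difference of consecutive Wallis integrals,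
    which the recursion at s = 0 bounds by the first of them over n + 1. *)
Lemma wint_ratio s : 0 < s -> is_lim_seq (fun n => wint s n / wint 0 n) 1.
Proof.
  intros Hs. set (K := 2 * s ^ 2 * exp (8 * s) * 64).
  assert (HK : 0 <= K).
  { unfold K. pose proof (exp_pos (8 * s)). pose proof (pow2_ge_0 s). repeat apply Rmult_le_pos; lra. }
  apply (is_lim_seq_le_le (fun _ => 1) _ (fun n => 1 + K * / INR (S n))).
  - intros n. pose proof (wint0_pos n) as Hp. pose proof PI_RGT_0.
    assert (L : wint 0 n <= wint s n).
    { apply RInt_le; [lra|apply wint_ex|apply wint_ex|]. intros x Hx.
      apply Rmult_le_compat_r.
      - apply pow_le. apply cos_ge_0; lra.
      - unfold ch. replace (2 * 0 * x) with 0 by ring. rewrite Ropp_0, exp_0.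
        set (e := exp (2 * s * x)). set (f := exp (- (2 * s * x))).
        assert (e * f = 1) by (unfold e, f; rewrite <- exp_plus, Rplus_opp_r; apply exp_0).
        assert (0 < e) by apply exp_pos. assert (0 < f) by apply exp_pos. pose proof (pow2_ge_0 (e - f)). nra. }
    assert (U : wint s n <= wint 0 n + K * (wint 0 n - wint 0 (S n))).
    { assert (E : wint 0 n + K * (wint 0 n - wint 0 (S n))
        = RInt (fun x => (1 + K) * (ch (2 * 0 * x) * cos x ^ (2 * n)) - K * (ch (2 * 0 * x) * cos x ^ (2 * S n))) 0 (PI / 2)).
      { rewrite (RInt_minus (V:=R_CompleteNormedModule) (fun x => (1 + K) * (ch (2 * 0 * x) * cos x ^ (2 * n)))
          (fun x => K * (ch (2 * 0 * x) * cos x ^ (2 * S n)))) by (apply (ex_RInt_scal (V:=R_NormedModule)), wint_ex).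
        rewrite (RInt_scal (V:=R_CompleteNormedModule) (fun x => ch (2 * 0 * x) * cos x ^ (2 * n))) by apply wint_ex.
        rewrite (RInt_scal (V:=R_CompleteNormedModule) (fun x => ch (2 * 0 * x) * cos x ^ (2 * S n))) by apply wint_ex.
        change (wint 0 n + K * (wint 0 n - wint 0 (S n)) = (1 + K) * wint 0 n - K * wint 0 (S n)). ring. }
      rewrite E. apply RInt_le; [lra|apply wint_ex| |].
      - apply (ex_RInt_minus (V:=R_NormedModule)); apply (ex_RInt_scal (V:=R_NormedModule)), wint_ex.
      - intros x Hx. replace (2 * S n)%nat with (2 * n + 2)%nat by lia. rewrite pow_add.
        assert (Hc : 0 <= cos x ^ (2 * n)) by (apply pow_le, cos_ge_0; lra).
        replace (ch (2 * 0 * x)) with 1 by (unfold ch; replace (2 * 0 * x) with 0 by ring; rewrite Ropp_0, exp_0; field).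
        replace ((1 + K) * (1 * cos x ^ (2 * n)) - K * (1 * (cos x ^ (2 * n) * cos x ^ 2)))
          with ((1 + K * (1 - cos x ^ 2)) * cos x ^ (2 * n)) by ring.
        apply Rmult_le_compat_r; [assumption|].
        pose proof (ch_upper s x ltac:(lra) ltac:(lra)). pose proof (sin_lower x ltac:(lra)).
        pose proof (sin2_cos2 x) as SC. unfold Rsqr in SC. replace (1 - cos x ^ 2) with (sin x ^ 2) by (simpl; lra).
        assert (x ^ 2 <= 64 * sin x ^ 2) by nra.
        assert (2 * s ^ 2 * exp (8 * s) * x ^ 2 <= 2 * s ^ 2 * exp (8 * s) * (64 * sin x ^ 2)).
        { apply Rmult_le_compat_l; [|assumption]. pose proof (exp_pos (8 * s)). pose proof (pow2_ge_0 s). apply Rmult_le_pos; lra. }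
        unfold K. lra. }
    assert (D : wint 0 n - wint 0 (S n) <= wint 0 n * / INR (S n)).
    { pose proof (wint_rec 0 n) as R. pose proof (pos_INR n). rewrite S_INR in *.
      replace (wint 0 (S n)) with ((2 * INR n + 1) * wint 0 n / (2 * (INR n + 1))).
      - replace (wint 0 n - (2 * INR n + 1) * wint 0 n / (2 * (INR n + 1))) with (wint 0 n * / (INR n + 1) * / 2) by (field; lra).
        assert (0 < wint 0 n * / (INR n + 1)) by (apply Rmult_lt_0_compat; [assumption|apply Rinv_0_lt_compat; lra]). lra.
      - apply Rmult_eq_reg_l with ((INR n + 1) ^ 2 * 2); [|apply Rmult_integral_contrapositive; split; [apply pow_nonzero; lra|lra]].
        replace ((0 ^ 2 + (INR n + 1) ^ 2) * 2) with ((INR n + 1) ^ 2 * 2) in R by ring. rewrite R. field. lra. }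
    split.
    + apply Rmult_le_reg_r with (wint 0 n); [assumption|]. unfold Rdiv. rewrite Rmult_assoc, Rinv_l by lra. lra.
    + apply Rmult_le_reg_r with (wint 0 n); [assumption|]. unfold Rdiv. rewrite (Rmult_assoc (wint s n)), Rinv_l by lra.
      assert (K * (wint 0 n - wint 0 (S n)) <= K * (wint 0 n * / INR (S n))) by (now apply Rmult_le_compat_l). lra.
  - apply is_lim_seq_const.
  - replace (Finite 1) with (Finite (1 + K * 0)) by (f_equal; ring).
    apply is_lim_seq_plus'; [apply is_lim_seq_const|]. apply is_lim_seq_mult'; [apply is_lim_seq_const|].
    apply (is_lim_seq_incr_1 (fun n => / INR n)).
    replace (Finite 0) with (Rbar_inv p_infty) by reflexivity.
    apply is_lim_seq_inv; [apply is_lim_seq_INR|discriminate].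
Qed.

Fixpoint sinhprod (s : R) (n : nat) : R :=
  match n with O => 1 | S m => sinhprod s m * (INR (S m) ^ 2 / (s ^ 2 + INR (S m) ^ 2)) end.

Lemma sinhprod_lim s : 0 < s -> is_lim_seq (sinhprod s) (PI * s / sh (PI * s)).
Proof.
  intros Hs. pose proof PI_RGT_0.
  assert (Hsh : 0 < sh (PI * s)).
  { unfold sh. assert (0 < PI * s) by (apply Rmult_lt_0_compat; assumption).
    assert (exp (- (PI * s)) < exp (PI * s)) by (apply exp_increasing; lra). lra. }
  assert (E : forall n, sinhprod s n = wint s n / wint 0 n * (PI * s / sh (PI * s))).
  { induction n.
    - cbn [sinhprod]. rewrite wint_0, wint_00 by lra. field. repeat split; lra.
    - cbn [sinhprod]. rewrite IHn. pose proof (wint_rec s n) as R1. pose proof (wint_rec 0 n) as R2.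
      pose proof (wint0_pos n). pose proof (wint0_pos (S n)). pose proof (pos_INR n). rewrite S_INR in *.
      assert (0 < s ^ 2 + (INR n + 1) ^ 2) by (pose proof (pow2_ge_0 s); assert (0 < (INR n + 1) ^ 2) by (apply pow_lt; lra); lra).
      replace (wint s (S n)) with ((INR n + 1) * (2 * INR n + 1) * wint s n / ((s ^ 2 + (INR n + 1) ^ 2) * 2)) by (rewrite <- R1; field; lra).
      replace (wint 0 (S n)) with ((2 * INR n + 1) * wint 0 n / ((INR n + 1) * 2)).
      + field. repeat split; lra.
      + apply Rmult_eq_reg_l with ((INR n + 1) ^ 2 * 2); [|apply Rmult_integral_contrapositive; split; [apply pow_nonzero; lra|lra]].
        replace ((0 ^ 2 + (INR n + 1) ^ 2) * 2) with ((INR n + 1) ^ 2 * 2) in R2 by ring. rewrite R2. field. lra. }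
  apply (is_lim_seq_ext (fun n => wint s n / wint 0 n * (PI * s / sh (PI * s)))); [intros n; now rewrite E|].
  replace (Finite (PI * s / sh (PI * s))) with (Finite (1 * (PI * s / sh (PI * s)))) by (f_equal; ring).
  apply is_lim_seq_mult'; [now apply wint_ratio|apply is_lim_seq_const].
Qed.

Lemma rising_mod s n : Cmod (rising (0, s) n) ^ 2 * sinhprod s n = s ^ 2 * INR (fact n) ^ 2.
Proof.
  induction n.
  - cbn [rising sinhprod]. rewrite Cmod2_alt. unfold Re, Im; cbn [fst snd]. simpl. ring.
  - cbn [rising sinhprod]. rewrite Cmod_mult, Rpow_mult_distr.
    assert (Hs : 0 < INR (S n)) by (apply lt_0_INR; lia).
    assert (E : Cmod ((0, s) + RtoC (INR (S n))) ^ 2 = s ^ 2 + INR (S n) ^ 2).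
    { rewrite Cmod2_alt, Re_shift, Im_shift. unfold Re, Im; cbn [fst snd]. ring. }
    rewrite E. rewrite fact_simpl, mult_INR.
    assert (0 < s ^ 2 + INR (S n) ^ 2) by (pose proof (pow2_ge_0 s); assert (0 < INR (S n) ^ 2) by (now apply pow_lt); lra).
    transitivity (Cmod (rising (0, s) n) ^ 2 * sinhprod s n * INR (S n) ^ 2); [field; lra|].
    rewrite IHn. ring.
Qed.

(** The alternative n = 0 is set aside because the power n^z would then involve the logarithm of 0;
    only large n matters for the limit. *)
Lemma Gamma_seq_imag s n : 0 < s -> Cmod (Gamma_seq (0, s) n) ^ 2 = sinhprod s n / s ^ 2 \/ n = O.
Proof.
  intros Hs. destruct n as [|n]; [now right|left].
  assert (Hr : RHc (0, s)).
  { split; [unfold Re; cbn [fst]; lra|]. intros E. apply (f_equal Im) in E. unfold Im, RtoC in E; cbn [snd] in E. lra. }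
  pose proof (rising_mod s (S n)) as E.
  assert (Hn : rising (0, s) (S n) <> RtoC 0) by (rewrite rising_exp by assumption; apply Cexp_neq_0).
  pose proof (proj1 (Cmod_gt_0 _) Hn) as Hp.
  unfold Gamma_seq. rewrite Cmod_div, Cmod_mult by assumption.
  rewrite Cmod_R, Rabs_right by (apply Rle_ge, pos_INR).
  unfold Cpower. rewrite Clog_INR by lia. rewrite Cmod_Cexp.
  replace (Re ((0, s) * RtoC (ln (INR (S n))))%C) with 0 by (unfold Re, RtoC; simpl; ring).
  rewrite exp_0, Rmult_1_r.
  apply Rmult_eq_reg_r with (Cmod (rising (0, s) (S n)) ^ 2 * s ^ 2); [|apply Rmult_integral_contrapositive; split; apply pow_nonzero; lra].
  replace ((INR (fact (S n)) / Cmod (rising (0, s) (S n))) ^ 2 * (Cmod (rising (0, s) (S n)) ^ 2 * s ^ 2))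
    with (s ^ 2 * INR (fact (S n)) ^ 2) by (field; lra).
  rewrite <- E. field. lra.
Qed.

(** * Limits of complex sequences *)

Definition Clim (f : nat -> C) (l : C) :=
  is_lim_seq (fun n => Re (f n)) (Re l) /\ is_lim_seq (fun n => Im (f n)) (Im l).

Lemma Clim_const c : Clim (fun _ => c) c.
Proof. split; apply is_lim_seq_const. Qed.

Lemma Clim_mult f g a b : Clim f a -> Clim g b -> Clim (fun n => f n * g n)%C (a * b)%C.
Proof.
  intros [F1 F2] [G1 G2]. split.
  - apply (is_lim_seq_minus' (fun n => Re (f n) * Re (g n)) (fun n => Im (f n) * Im (g n)));
    now apply is_lim_seq_mult'.
  - apply (is_lim_seq_plus' (fun n => Re (f n) * Im (g n)) (fun n => Im (f n) * Re (g n)));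
    now apply is_lim_seq_mult'.
Qed.

Lemma Clim_exp f a : Clim f a -> Clim (fun n => Cexp (f n)) (Cexp a).
Proof.
  intros [F1 F2]. 
  assert (H1 : is_lim_seq (fun n => exp (Re (f n))) (exp (Re a)))
    by (apply (is_lim_seq_continuous exp _ (Re a)); [apply derivable_continuous_pt, derivable_pt_exp|assumption]).
  split.
  - apply (is_lim_seq_mult' (fun n => exp (Re (f n))) (fun n => cos (Im (f n)))); [assumption|].
    apply (is_lim_seq_continuous cos _ (Im a)); [apply derivable_continuous_pt, derivable_pt_cos|assumption].
  - apply (is_lim_seq_mult' (fun n => exp (Re (f n))) (fun n => sin (Im (f n)))); [assumption|].
    apply (is_lim_seq_continuous sin _ (Im a)); [apply derivable_continuous_pt, derivable_pt_sin|assumption].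
Qed.

Lemma Clim_opp f a : Clim f a -> Clim (fun n => - f n)%C (- a)%C.
Proof.
  intros H. apply (Clim_mult (fun _ => RtoC (-1)) f (RtoC (-1)) a (Clim_const _)) in H.
  destruct H as [H1 H2]. split.
  - replace (Re (- a)%C) with (Re (RtoC (-1) * a)%C) by (unfold Re, RtoC; simpl; ring).
    eapply is_lim_seq_ext; [|exact H1]. intros n; unfold Re, RtoC; simpl; ring.
  - replace (Im (- a)%C) with (Im (RtoC (-1) * a)%C) by (unfold Im, RtoC; simpl; ring).
    eapply is_lim_seq_ext; [|exact H2]. intros n; unfold Im, RtoC; simpl; ring.
Qed.

Lemma Clim_Cmod f a : Clim f a -> is_lim_seq (fun n => Cmod (f n)) (Cmod a).
Proof.
  intros [H1 H2]. unfold Cmod.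
  apply (is_lim_seq_continuous sqrt (fun n => fst (f n) ^ 2 + snd (f n) ^ 2) (fst a ^ 2 + snd a ^ 2)).
  - apply continuity_pt_sqrt. pose proof (pow2_ge_0 (fst a)). pose proof (pow2_ge_0 (snd a)). lra.
  - apply (is_lim_seq_plus' (fun n => fst (f n) ^ 2) (fun n => snd (f n) ^ 2)); simpl;
    apply is_lim_seq_mult'; try apply is_lim_seq_mult'; try apply is_lim_seq_const; assumption.
Qed.

Lemma Clim_ext_from f g a n0 : (forall n, (n0 <= n)%nat -> f n = g n) -> Clim f a -> Clim g a.
Proof.
  intros E [H1 H2]. split.
  - eapply is_lim_seq_ext_loc; [|exact H1]. exists n0. intros n Hn. now rewrite E.
  - eapply is_lim_seq_ext_loc; [|exact H2]. exists n0. intros n Hn. now rewrite E.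
Qed.

Lemma is_lim_seq_invINR K : is_lim_seq (fun n => K * / INR n) 0.
Proof.
  replace (Finite 0) with (Finite (K * 0)) by (f_equal; ring).
  apply is_lim_seq_mult'; [apply is_lim_seq_const|].
  replace (Finite 0) with (Rbar_inv p_infty) by reflexivity.
  apply is_lim_seq_inv; [apply is_lim_seq_INR|discriminate].
Qed.

Lemma Clim_bound f a K : (forall n, (1 <= n)%nat -> Cmod (f n - a) <= K * / INR n) -> Clim f a.
Proof.
  intros H.
  assert (P : forall g : C -> R, (forall u v, g (u - v)%C = g u - g v) -> (forall u, Rabs (g u) <= Cmod u) ->
    is_lim_seq (fun n => g (f n)) (g a)).
  { intros g Hg Hb. apply (is_lim_seq_le_le_loc (fun n => g a - K * / INR n) _ (fun n => g a + K * / INR n)).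
    - exists 1%nat. intros n Hn. specialize (H n Hn). pose proof (Hb (f n - a)%C) as B. rewrite Hg in B.
      assert (B2 : Rabs (g (f n) - g a) <= K * / INR n) by lra. apply Rabs_le_between in B2. lra.
    - replace (Finite (g a)) with (Finite (g a - 0)) by (f_equal; ring).
      apply is_lim_seq_minus'; [apply is_lim_seq_const|apply is_lim_seq_invINR].
    - replace (Finite (g a)) with (Finite (g a + 0)) by (f_equal; ring).
      apply is_lim_seq_plus'; [apply is_lim_seq_const|apply is_lim_seq_invINR]. }
  split; apply P; try reflexivity; [apply re_le_Cmod|apply im_le_Cmod].
Qed.

Lemma Clim_Csum (f : nat -> C) (b : nat -> R) :
  (forall n, Cmod (f n) <= b n) -> ex_series b -> Clim (Csum f) (CSer f).
Proof.
  intros H Hb.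
  assert (Er : forall n, Re (Csum f (S n)) = sum_n (fun n => Re (f n)) n).
  { induction n; [rewrite sum_O; cbn [Csum]; unfold Re, RtoC; simpl; ring|].
    rewrite sum_Sn, <- IHn. reflexivity. }
  assert (Ei : forall n, Im (Csum f (S n)) = sum_n (fun n => Im (f n)) n).
  { induction n; [rewrite sum_O; cbn [Csum]; unfold Im, RtoC; simpl; ring|].
    rewrite sum_Sn, <- IHn. reflexivity. }
  split; apply is_lim_seq_incr_1.
  - apply (is_lim_seq_ext (sum_n (fun n => Re (f n)))); [intros; symmetry; apply Er|].
    apply (Series_correct (fun n => Re (f n))). eapply CSer_ex_Re; eassumption.
  - apply (is_lim_seq_ext (sum_n (fun n => Im (f n)))); [intros; symmetry; apply Ei|].
    apply (Series_correct (fun n => Im (f n))). eapply CSer_ex_Im; eassumption.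
Qed.

Lemma Clim_binet w : RHc w -> Clim (Csum (fun k => gterm (w + RtoC (INR k)))) (binet w).
Proof.
  intros Hw. apply (Clim_Csum _ (fun n => / 8 * Kb (Cmod w) * tele (Cmod w) n)).
  - intros n. now apply gterm_shift_bound.
  - apply ex_series_tele. now apply RHc_mod.
Qed.

(** The path from a to a + v stays in Re > 0, where the argument is an arctangent throughout, so the
    principal logarithm can be differentiated along it. *)
Lemma Clog_diff (a : R) (v : C) : 0 < a -> 0 <= Re v ->
  CInt (fun t => v * / (RtoC a + RtoC t * v))%C 0 1 = (Clog (RtoC a + v) - Clog (RtoC a))%C.
Proof.
  intros Ha Hv.
  assert (HR : forall t : R, Re (RtoC a + RtoC t * v)%C = a + t * Re v) by (intros; unfold Re, RtoC; simpl; ring).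
  assert (HI : forall t : R, Im (RtoC a + RtoC t * v)%C = t * Im v) by (intros; unfold Im, RtoC; simpl; ring).
  assert (Hp : forall t, 0 <= t <= 1 -> 0 < a + t * Re v).
  { intros t Ht. assert (0 <= t * Re v) by (apply Rmult_le_pos; lra). lra. }
  assert (Hq : forall t, 0 <= t <= 1 -> 0 < (a + t * Re v) ^ 2 + (t * Im v) ^ 2).
  { intros t Ht. pose proof (Hp t Ht). pose proof (pow2_ge_0 (t * Im v)).
    assert (0 < (a + t * Re v) ^ 2) by (now apply pow_lt). lra. }
  assert (Hn : forall t, 0 <= t <= 1 -> (RtoC a + RtoC t * v)%C <> RtoC 0).
  { intros t Ht E. apply (f_equal Re) in E. rewrite HR in E. pose proof (Hp t Ht). unfold Re, RtoC in E; simpl in E. unfold Re in *. lra. }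
  assert (Hl : forall t, 0 <= t <= 1 -> Clog (RtoC a + RtoC t * v)%C
     = (1 / 2 * ln ((a + t * Re v) ^ 2 + (t * Im v) ^ 2), atan (t * Im v / (a + t * Re v)))).
  { intros t Ht. unfold Clog. rewrite Carg_atan by (rewrite HR; now apply Hp). rewrite HR, HI. f_equal.
    replace ((a + t * Re v) ^ 2 + (t * Im v) ^ 2) with (Cmod (RtoC a + RtoC t * v) ^ 2)
      by (rewrite Cmod2_alt, HR, HI; reflexivity).
    simpl pow. rewrite Rmult_1_r. rewrite ln_mult by (apply Cmod_gt_0; now apply Hn). field. }
  replace (RtoC a + v)%C with (RtoC a + RtoC 1 * v)%C by ring.
  replace (Clog (RtoC a)) with (Clog (RtoC a + RtoC 0 * v)) by (f_equal; ring).
  rewrite !Hl by lra.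
  assert (Ev : forall t : R, (v * / (RtoC a + RtoC t * v))%C =
    ((Re v * (a + t * Re v) + Im v * (t * Im v)) / ((a + t * Re v) ^ 2 + (t * Im v) ^ 2),
     (Im v * (a + t * Re v) - Re v * (t * Im v)) / ((a + t * Re v) ^ 2 + (t * Im v) ^ 2))).
  { intros t. rewrite (surjective_pairing (RtoC a + RtoC t * v)%C).
    change (fst (RtoC a + RtoC t * v)%C) with (Re (RtoC a + RtoC t * v)%C).
    change (snd (RtoC a + RtoC t * v)%C) with (Im (RtoC a + RtoC t * v)%C). rewrite HR, HI, Cinv_pair.
    apply C_eq; unfold Re, Im; simpl; unfold Rdiv; ring. }
  apply (CInt_derive (fun t => (1 / 2 * ln ((a + t * Re v) ^ 2 + (t * Im v) ^ 2), atan (t * Im v / (a + t * Re v))))).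
  - intros t Ht. rewrite Rmin_left, Rmax_right in Ht by lra. rewrite Ev.
    unfold Re at 1 4; cbn [fst]. pose proof (Hq t Ht).
    auto_derive; [lra|]. field. lra.
  - intros t Ht. rewrite Rmin_left, Rmax_right in Ht by lra. rewrite Ev.
    unfold Im at 1 4; cbn [snd]. pose proof (Hq t Ht). pose proof (Hp t Ht).
    auto_derive; [lra|]. field. repeat split; try lra; nra.
  - intros t Ht. rewrite Rmin_left, Rmax_right in Ht by lra. apply cont_Cmult; [apply continuous_const|].
    apply cont_Cinv; [|now apply Hn]. apply cont_Cplus; [apply continuous_const|].
    apply cont_Cmult; [apply cont_RtoC, continuous_id|apply continuous_const].
Qed.

(** The difference of the logarithms is w/n up to |w|^2/n^2, so multiplication by w + n + 1/2 leaves
    w with an error of order 1/n. *)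
Lemma Clim_stirling_factor w : RHc w ->
  Clim (fun n => Cexp (- ((w + RtoC (INR n) + RtoC (1 / 2)) * (Clog (w + RtoC (INR n)) - Clog (RtoC (INR n)))))) (Cexp (- w)).
Proof.
  intros Hw. apply Clim_exp, Clim_opp.
  set (r := Cmod w). set (q := Cmod (w + RtoC (1 / 2))).
  assert (Hr : 0 <= r) by apply Cmod_ge_0. assert (Hq : 0 <= q) by apply Cmod_ge_0.
  apply (Clim_bound _ _ (q * (r + r ^ 2) + r ^ 2)). intros n Hn.
  assert (Hn1 : 1 <= INR n) by (apply (le_INR 1); exact Hn).
  assert (Hnn : RtoC (INR n) <> RtoC 0) by (intros E; injection E; lra).
  set (d := (Clog (w + RtoC (INR n)) - Clog (RtoC (INR n)))%C).
  assert (Hd : Cmod (d - w * / RtoC (INR n)) <= r ^ 2 * / INR n * / INR n).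
  { unfold d. replace (w + RtoC (INR n))%C with (RtoC (INR n) + w)%C by ring.
    rewrite <- Clog_diff by (try (destruct Hw; assumption); lra).
    assert (Hs : forall t, 0 <= t <= 1 -> INR n <= Cmod (RtoC (INR n) + RtoC t * w)).
    { intros t Ht. eapply Rle_trans; [|apply (re_le_Cmod (RtoC (INR n) + RtoC t * w))].
      replace (Re (RtoC (INR n) + RtoC t * w)%C) with (INR n + t * Re w) by (unfold Re, RtoC; simpl; ring).
      destruct Hw as [Hw _]. assert (0 <= t * Re w) by (apply Rmult_le_pos; lra). rewrite Rabs_right; lra. }
    assert (c1 : ccont (fun t => w * / (RtoC (INR n) + RtoC t * w))%C 0 1).
    { intros t Ht. rewrite Rmin_left, Rmax_right in Ht by lra. apply cont_Cmult; [apply continuous_const|].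
      apply cont_Cinv; [|apply Cmod_pos_neq; specialize (Hs t Ht); lra]. apply cont_Cplus; [apply continuous_const|].
      apply cont_Cmult; [apply cont_RtoC, continuous_id|apply continuous_const]. }
    assert (E1 : CInt (fun _ => (w * / RtoC (INR n))%C) 0 1 = (w * / RtoC (INR n))%C).
    { unfold CInt. rewrite !RInt_const. apply C_eq; unfold Re, Im; cbn [fst snd]; unfold scal; simpl; unfold mult; simpl; ring. }
    rewrite <- E1. rewrite <- CInt_minus; [|exact c1|intros t _; apply continuous_const].
    replace (r ^ 2 * / INR n * / INR n) with (r ^ 2 * / INR n * / INR n * (1 - 0)) by ring.
    apply CInt_le_const; [lra| |].
    - intros t Ht. apply cont_Cminus; [now apply c1|apply continuous_const].
    - intros t Ht. specialize (Hs t Ht).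
      assert (Hz : (RtoC (INR n) + RtoC t * w)%C <> RtoC 0) by (apply Cmod_pos_neq; lra).
      replace (w * / (RtoC (INR n) + RtoC t * w) - w * / RtoC (INR n))%C
        with (RtoC (- t) * Cpow w 2 * / RtoC (INR n) * / (RtoC (INR n) + RtoC t * w))%C
        by (rewrite RtoC_opp; simpl; field; split; assumption).
      rewrite !Cmod_mult, !Cmod_inv, Cmod_pow, !Cmod_R by assumption. fold r.
      rewrite Rabs_Ropp, !Rabs_right by lra.
      pose proof (pow2_ge_0 r). assert (0 < / INR n) by (apply Rinv_0_lt_compat; lra).
      assert (/ Cmod (RtoC (INR n) + RtoC t * w) <= / INR n) by (apply Rinv_le_contravar; lra).
      apply Rmult_le_compat; try assumption.
      + repeat apply Rmult_le_pos; lra.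
      + left. apply Rinv_0_lt_compat. lra.
      + apply Rmult_le_compat_r; [lra|]. nra. }
  assert (Hd2 : Cmod d <= (r + r ^ 2) * / INR n).
  { replace d with ((d - w * / RtoC (INR n)) + w * / RtoC (INR n))%C by ring.
    eapply Rle_trans; [apply Cmod_triangle|]. rewrite Cmod_mult, Cmod_inv, Cmod_R, Rabs_right by (try assumption; lra).
    fold r. assert (0 < / INR n <= 1).
    { split; [apply Rinv_0_lt_compat; lra|]. apply Rle_trans with (/ 1); [apply Rinv_le_contravar; lra|lra]. }
    assert (r ^ 2 * / INR n * / INR n <= r ^ 2 * / INR n).
    { rewrite <- (Rmult_1_r (r ^ 2 * / INR n)) at 2. apply Rmult_le_compat_l; [|lra]. pose proof (pow2_ge_0 r). apply Rmult_le_pos; lra. }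
    lra. }
  replace ((w + RtoC (INR n) + RtoC (1 / 2)) * d - w)%C
    with ((w + RtoC (1 / 2)) * d + RtoC (INR n) * (d - w * / RtoC (INR n)))%C by (field; assumption).
  eapply Rle_trans; [apply Cmod_triangle|]. rewrite !Cmod_mult, Cmod_R, Rabs_right by lra. fold q.
  assert (A1 : q * Cmod d <= q * ((r + r ^ 2) * / INR n)) by (now apply Rmult_le_compat_l).
  assert (A2 : INR n * Cmod (d - w * / RtoC (INR n)) <= r ^ 2 * / INR n).
  { apply Rle_trans with (INR n * (r ^ 2 * / INR n * / INR n)); [apply Rmult_le_compat_l; lra|]. right. field. lra. }
  lra.
Qed.

(** * The Stirling constant and the modulus of Gamma on the imaginary axis *)

Lemma rising_1 n : rising 1 n = RtoC (INR (fact (S n))).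
Proof.
  induction n.
  - reflexivity.
  - cbn [rising]. rewrite IHn, (fact_simpl (S n)), mult_INR, !RtoC_mult, (S_INR (S n)), RtoC_plus. ring.
Qed.

Lemma RHc_1 : RHc 1.
Proof. split; [unfold Re, RtoC; simpl; lra|]. intros E; injection E; lra. Qed.

Lemma Gamma_seq_1 n : (0 < n)%nat -> Cmod (Gamma_seq 1 n) = INR n / INR (S n).
Proof.
  intros Hn. unfold Gamma_seq, Cpower. rewrite rising_1, Cmult_1_l, Cexp_Clog.
  - rewrite fact_simpl, mult_INR. pose proof (INR_fact_lt_0 n). assert (0 < INR (S n)) by (apply lt_0_INR; lia).
    assert (0 < INR n) by (now apply lt_0_INR).
    rewrite <- RtoC_mult, <- RtoC_div by (apply Rmult_integral_contrapositive; lra).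
    rewrite Cmod_R, Rabs_right; [field; lra|]. apply Rle_ge, Rlt_le.
    apply Rdiv_lt_0_compat; apply Rmult_lt_0_compat; assumption.
  - intros E. injection E. intros E2. apply not_0_INR in E2; [assumption|lia].
Qed.

(** At w = 1 Gauss's quotient is n/(n + 1), of limit 1, and the remaining factors have nonzero
    limits, so Stirling's quotient must converge as well. Its limit is left undetermined here. *)
Lemma stirling_seq_lim : exists A : R, 0 < A /\ is_lim_seq stirling_seq A.
Proof.
  set (X := fun n => Cexp (Csum (fun k => gterm (1 + RtoC (INR k))) n)).
  set (E := fun n => Cexp (- ((1 + RtoC (INR n) + RtoC (1 / 2)) * (Clog (1 + RtoC (INR n)) - Clog (RtoC (INR n)))))%C).
  assert (LX : is_lim_seq (fun n => Cmod (X n)) (Cmod (Cexp (binet 1)))).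
  { apply Clim_Cmod, Clim_exp, Clim_binet, RHc_1. }
  assert (LE : is_lim_seq (fun n => Cmod (E n)) (Cmod (Cexp (- (1))))).
  { apply Clim_Cmod, (Clim_stirling_factor 1), RHc_1. }
  set (a := Cmod (Cexp (binet 1))). set (b := Cmod (Cexp (- (1)))).
  assert (Ha : 0 < a) by (apply Cmod_gt_0, Cexp_neq_0).
  assert (Hb : 0 < b) by (apply Cmod_gt_0, Cexp_neq_0).
  set (Y := Cmod (Cexp ((1 - RtoC (1 / 2)) * Clog 1))).
  assert (HY : 0 < Y) by (apply Cmod_gt_0, Cexp_neq_0).
  exists (1 * / (a * Y * b)). split.
  - rewrite Rmult_1_l. apply Rinv_0_lt_compat. repeat apply Rmult_lt_0_compat; assumption.
  - apply (is_lim_seq_ext_loc (fun n => (INR n / INR (S n)) * / (Cmod (X n) * Y * Cmod (E n)))).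
    + exists 1%nat. intros n Hn. rewrite <- Gamma_seq_1 by lia.
      rewrite Gamma_seq_split by (try apply RHc_1; lia). fold (X n) (E n). rewrite !Cmod_mult. fold Y.
      rewrite Cmod_R, Rabs_right.
      * field. repeat split; try lra; apply Rgt_not_eq, Cmod_gt_0, Cexp_neq_0.
      * apply Rle_ge, Rmult_le_pos; [apply pos_INR|left; apply exp_pos].
    + apply is_lim_seq_mult'.
      * apply (is_lim_seq_ext (fun n => 1 - / INR (S n))).
        { intros n. rewrite S_INR. pose proof (pos_INR n). field. lra. }
        replace (Finite 1) with (Finite (1 - 0)) by (f_equal; ring).
        apply is_lim_seq_minus'; [apply is_lim_seq_const|].
        apply (is_lim_seq_ext (fun n => 1 * / INR (S n))); [intros; ring|].
        apply (is_lim_seq_incr_1 (fun n => 1 * / INR n)). apply is_lim_seq_invINR.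
      * apply (is_lim_seq_inv (fun n => Cmod (X n) * Y * Cmod (E n)) (Finite (a * Y * b))).
        -- apply is_lim_seq_mult'; [apply is_lim_seq_mult'; [assumption|apply is_lim_seq_const]|assumption].
        -- intros Z. injection Z. apply Rgt_not_eq. repeat apply Rmult_lt_0_compat; assumption.
Qed.

Lemma Gamma_lim (A : R) w : is_lim_seq stirling_seq A -> RHc w ->
  Clim (Gamma_seq w) (Cexp (mu w) * Cexp ((w - RtoC (1 / 2)) * Clog w) * RtoC A * Cexp (- w))%C.
Proof.
  intros HA Hw. rewrite mu_eq by apply Hw.
  apply (Clim_ext_from (fun n => Cexp (Csum (fun k => gterm (w + RtoC (INR k))) n) * Cexp ((w - RtoC (1 / 2)) * Clog w)
   * RtoC (stirling_seq n)
   * Cexp (- ((w + RtoC (INR n) + RtoC (1 / 2)) * (Clog (w + RtoC (INR n)) - Clog (RtoC (INR n))))))%C _ _ 1).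
  - intros n Hn. symmetry. now apply Gamma_seq_split.
  - apply Clim_mult; [apply Clim_mult; [apply Clim_mult|]|].
    + apply Clim_exp, Clim_binet, Hw.
    + apply Clim_const.
    + split; [exact HA|apply is_lim_seq_const].
    + now apply Clim_stirling_factor.
Qed.

Lemma Gamma_formula (A : R) w : is_lim_seq stirling_seq A -> RHc w ->
  Gamma w = (Cexp (mu w) * Cexp ((w - RtoC (1 / 2)) * Clog w) * RtoC A * Cexp (- w))%C.
Proof.
  intros HA Hw. destruct (Gamma_lim A w HA Hw) as [H1 H2].
  unfold Gamma. apply is_lim_seq_unique in H1, H2. rewrite H1, H2. now apply C_eq.
Qed.

Lemma RHc_imag s : s <> 0 -> RHc (0, s).
Proof.
  intros Hs. split; [unfold Re; cbn [fst]; lra|]. intros E. apply (f_equal Im) in E. unfold Im, RtoC in E; cbn [snd] in E. lra.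
Qed.

(** The limit of the squared modulus of Gauss's quotient at is is computed twice: by the sinh
    product, and by the Binet factorization with the unknown constant A. Their comparison is the
    reflection formula up to A; since mu(is) tends to 0 as s grows, it later determines A as
    well. *)
Lemma mu_imag_A (A : R) s : is_lim_seq stirling_seq A -> 0 < s ->
  exp (2 * Re (mu (0, s))) * A ^ 2 = 2 * PI / (1 - exp (- (2 * PI * s))).
Proof.
  intros HA Hs. pose proof PI_RGT_0.
  pose proof (Gamma_lim A (0, s) HA (RHc_imag s ltac:(lra))) as L.
  apply Clim_Cmod in L. apply (is_lim_seq_mult' _ _ _ _ L) in L.
  assert (L2 : is_lim_seq (fun n => Cmod (Gamma_seq (0, s) n) * Cmod (Gamma_seq (0, s) n)) (PI * s / sh (PI * s) * / s ^ 2)).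
  { apply (is_lim_seq_ext_loc (fun n => sinhprod s n * / s ^ 2)).
    - exists 1%nat. intros n Hn. destruct (Gamma_seq_imag s n Hs) as [E|E]; [|lia].
      replace (Cmod (Gamma_seq (0, s) n) * Cmod (Gamma_seq (0, s) n)) with (Cmod (Gamma_seq (0, s) n) ^ 2) by ring.
      rewrite E. reflexivity.
    - apply is_lim_seq_mult'; [now apply sinhprod_lim|apply is_lim_seq_const]. }
  apply is_lim_seq_unique in L, L2. rewrite L in L2. injection L2. clear L L2. intros E.
  replace (s * (s * 1)) with (s ^ 2) in E by ring.
  rewrite !Cmod_mult, !Cmod_Cexp, Cmod_R in E.
  assert (Hlog : Clog (0, s) = (ln s, PI / 2)).
  { unfold Clog. f_equal.
    - f_equal. unfold Cmod; cbn [fst snd]. replace (0 ^ 2 + s ^ 2) with (Rsqr s) by (unfold Rsqr; ring). apply sqrt_Rsqr; lra.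
    - rewrite Carg_atan_inv by (unfold Im; cbn [snd]; lra). unfold Im, Re; cbn [fst snd].
      destruct Rle_dec; [|lra]. unfold Rdiv. rewrite Rmult_0_l, atan_0. ring. }
  rewrite Hlog in E.
  replace (Re (((0%R, s) - RtoC (1 / 2)) * (ln s, (PI / 2)%R))%C) with (- (ln s * / 2) - PI * s * / 2) in E
    by (unfold Re, RtoC; simpl; field).
  replace (Re (- (0%R, s))%C) with 0 in E by (unfold Re; simpl; ring).
  rewrite exp_0 in E.
  assert (Hx : 0 < exp (PI * s)) by apply exp_pos.
  assert (Hy : exp (- (PI * s)) = / exp (PI * s)) by apply exp_Ropp.
  assert (Hgt : exp (- (2 * PI * s)) < 1).
  { rewrite <- exp_0. apply exp_increasing. assert (0 < PI * s) by (now apply Rmult_lt_0_compat). lra. }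
  assert (H2x : exp (- (2 * PI * s)) = / exp (PI * s) * / exp (PI * s)).
  { rewrite <- Hy, <- exp_plus. f_equal. ring. }
  set (m := Re (mu (0, s))) in *.
  assert (E3 : exp (2 * m) * (/ s * / exp (PI * s)) * A ^ 2 = PI * s / sh (PI * s) * / s ^ 2).
  { rewrite <- E. rewrite <- Hy. 
    replace (Rabs A) with (Rabs A) by reflexivity.
    replace (A ^ 2) with (Rabs A ^ 2) by apply pow2_abs.
    replace (exp (2 * m)) with (exp m * exp m) by (rewrite <- exp_plus; f_equal; ring).
    replace (/ s * exp (- (PI * s))) with (exp (- (ln s * / 2) - PI * s * / 2) * exp (- (ln s * / 2) - PI * s * / 2)).
    - ring.
    - rewrite <- exp_plus. replace (/ s) with (exp (- ln s)) by (rewrite exp_Ropp, exp_ln by assumption; reflexivity).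
      rewrite <- exp_plus. f_equal. field. }
  unfold sh in E3. rewrite Hy in E3.
  assert (Hne : exp (PI * s) - / exp (PI * s) <> 0).
  { apply Rgt_not_eq. rewrite <- Hy. assert (exp (- (PI * s)) < exp (PI * s)); [|lra]. apply exp_increasing.
    assert (0 < PI * s) by (now apply Rmult_lt_0_compat). lra. }
  rewrite H2x in *. set (x := exp (PI * s)) in *.
  assert (Hne2 : 1 - / x * / x <> 0) by lra.
  assert (Hx2 : x * x - 1 <> 0).
  { intros Z. apply Hne2. replace (1 - / x * / x) with ((x * x - 1) * / x * / x) by (field; lra). rewrite Z. ring. }
  replace (exp (2 * m) * A ^ 2) with (exp (2 * m) * (/ s * / x) * A ^ 2 * s * x) by (field; lra).
  rewrite E3. field. repeat split; try lra.
Qed.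

Lemma stirling_const : is_lim_seq stirling_seq (sqrt (2 * PI)).
Proof.
  destruct stirling_seq_lim as [A [HA0 HA]]. pose proof PI_RGT_0.
  replace (sqrt (2 * PI)) with A; [assumption|].
  assert (E : A ^ 2 = 2 * PI); [|rewrite <- E; simpl; rewrite Rmult_1_r; symmetry; apply sqrt_square; lra].
  (* the two sides of [mu_imag_A] at [s = n -> infinity] *)
  assert (L1 : is_lim_seq (fun n => exp (2 * Re (mu (0, INR (S n)))) * A ^ 2) (exp (2 * 0) * A ^ 2)).
  { apply is_lim_seq_mult'; [|apply is_lim_seq_const].
    apply (is_lim_seq_continuous exp); [apply derivable_continuous_pt, derivable_pt_exp|].
    apply is_lim_seq_mult'; [apply is_lim_seq_const|].
    apply (is_lim_seq_incr_1 (fun n => Re (mu (0, INR n)))).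
    apply (is_lim_seq_le_le_loc (fun n => - (2 * / INR n)) _ (fun n => 2 * / INR n)).
    - exists 1%nat. intros n Hn. assert (Hn1 : 1 <= INR n) by (apply (le_INR 1); exact Hn).
      apply Rabs_le_between. eapply Rle_trans; [apply re_le_Cmod|].
      assert (Hr : RHc (0, INR n)) by (apply RHc_imag; lra).
      rewrite mu_eq by apply Hr. eapply Rle_trans; [now apply binet_bound|].
      replace (Cmod (0, INR n)) with (INR n).
      + assert (0 < / INR n <= 1).
        { split; [apply Rinv_0_lt_compat; lra|]. apply Rle_trans with (/ 1); [apply Rinv_le_contravar; lra|lra]. }
        unfold Rdiv. apply Rmult_le_compat_r; lra.
      + unfold Cmod; cbn [fst snd]. replace (0 ^ 2 + INR n ^ 2) with (Rsqr (INR n)) by (unfold Rsqr; ring).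
        symmetry. apply sqrt_Rsqr; lra.
    - replace (Finite 0) with (Rbar_opp 0) by (simpl; f_equal; ring). apply (is_lim_seq_opp (fun n => 2 * / INR n) 0). apply is_lim_seq_invINR.
    - apply is_lim_seq_invINR. }
  assert (L2 : is_lim_seq (fun n => 2 * PI / (1 - exp (- (2 * PI * INR (S n))))) (2 * PI / (1 - 0))).
  { apply is_lim_seq_mult'; [apply is_lim_seq_const|].
    apply (is_lim_seq_inv (fun n => 1 - exp (- (2 * PI * INR (S n)))) (Finite (1 - 0))); [|intros Z; injection Z; lra].
    apply is_lim_seq_minus'; [apply is_lim_seq_const|].
    apply (is_lim_seq_le_le (fun _ => 0) _ (fun n => 1 * / INR (S n))).
    - intros n. split; [left; apply exp_pos|]. rewrite exp_Ropp, Rmult_1_l.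
      assert (0 < INR (S n)) by (apply lt_0_INR; lia).
      apply Rinv_le_contravar; [assumption|]. pose proof (exp_ineq1_le (2 * PI * INR (S n))). pose proof PI2_1. nra.
    - apply is_lim_seq_const.
    - apply (is_lim_seq_incr_1 (fun n => 1 * / INR n)). apply is_lim_seq_invINR. }
  apply (is_lim_seq_ext _ (fun n => 2 * PI / (1 - exp (- (2 * PI * INR (S n)))))) in L1.
  - apply is_lim_seq_unique in L1, L2. rewrite L1 in L2. injection L2. intros Z.
    rewrite Rmult_0_r, exp_0 in Z. lra.
  - intros n. apply mu_imag_A; [assumption|apply lt_0_INR; lia].
Qed.

Lemma scaled_Gamma_mu w : RHc w -> scaled_Gamma w = Cexp (mu w).
Proof.
  intros Hw. unfold scaled_Gamma. rewrite (Gamma_formula _ w stirling_const Hw). unfold Cpower.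
  assert (RtoC (sqrt (2 * PI)) <> RtoC 0).
  { intros E; injection E. apply Rgt_not_eq, sqrt_lt_R0. pose proof PI_RGT_0. lra. }
  field. repeat split; try apply Cexp_neq_0; assumption.
Qed.

Lemma exp_mu_imag s : 0 < s -> exp (2 * Re (mu (0, s))) = / (1 - exp (- (2 * PI * s))).
Proof.
  intros Hs. pose proof (mu_imag_A _ s stirling_const Hs) as E. pose proof PI_RGT_0.
  replace (sqrt (2 * PI) ^ 2) with (2 * PI) in E by (simpl; rewrite Rmult_1_r, sqrt_sqrt; lra).
  apply Rmult_eq_reg_r with (2 * PI); [|lra]. rewrite E. unfold Rdiv. ring.
Qed.

(** * Bernoulli polynomials and the Euler-Maclaurin expansion *)

Definition bpoly (n : nat) (u : R) : R :=
  sum_f_R0 (fun k => Binomial.C n k * bernoulli k * u ^ (n - k)) n.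

Lemma binom_absorb n k : (k <= n)%nat ->
  Binomial.C (S n) k * INR (S n - k) = INR (S n) * Binomial.C n k.
Proof.
  intros Hk. unfold Binomial.C. replace (S n - k)%nat with (S (n - k)) by lia.
  rewrite !fact_simpl, !mult_INR. field.
  repeat split; try apply INR_fact_neq_0; apply not_0_INR; lia.
Qed.

Lemma is_derive_sum_f_R0 (f df : nat -> R -> R) n x :
  (forall k, (k <= n)%nat -> is_derive (f k) x (df k x)) ->
  is_derive (fun u => sum_f_R0 (fun k => f k u) n) x (sum_f_R0 (fun k => df k x) n).
Proof.
  induction n; intros H; cbn [sum_f_R0].
  - apply H; lia.
  - apply (is_derive_plus (V:=R_NormedModule)); [apply IHn; intros; apply H; lia|apply H; lia].
Qed.

Lemma bpoly_der n u : is_derive (bpoly (S n)) u (INR (S n) * bpoly n u).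
Proof.
  unfold bpoly.
  replace (INR (S n) * sum_f_R0 (fun k => Binomial.C n k * bernoulli k * u ^ (n - k)) n)
    with (sum_f_R0 (fun k => Binomial.C (S n) k * bernoulli k * (INR (S n - k) * u ^ (pred (S n - k)))) (S n)).
  - apply (is_derive_sum_f_R0 (fun k u => Binomial.C (S n) k * bernoulli k * u ^ (S n - k))
      (fun k u => Binomial.C (S n) k * bernoulli k * (INR (S n - k) * u ^ (pred (S n - k))))).
    intros k _. generalize (S n - k)%nat (Binomial.C (S n) k * bernoulli k). intros m c. auto_derive; [trivial|]. ring.
  - cbn [sum_f_R0]. replace (S n - S n)%nat with O by lia. simpl INR at 2. rewrite Rmult_0_l, Rmult_0_r, Rplus_0_r.
    rewrite scal_sum. apply sum_eq. intros k Hk.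
    pose proof (binom_absorb n k Hk) as E. replace (pred (S n - k)) with (n - k)%nat by lia.
    transitivity (Binomial.C (S n) k * INR (S n - k) * bernoulli k * u ^ (n - k)); [ring|]. rewrite E. ring.
Qed.

Lemma bpoly_0 n : bpoly n 0 = bernoulli n.
Proof.
  unfold bpoly. destruct n.
  - simpl. unfold Binomial.C. simpl. field.
  - cbn [sum_f_R0]. replace (S n - S n)%nat with O by lia.
    rewrite (sum_eq _ (fun _ => 0)).
    + rewrite sum_cte. simpl pow. unfold Binomial.C. replace (S n - S n)%nat with O by lia. simpl (fact 0). simpl (INR 1).
      field. apply INR_fact_neq_0.
    + intros k Hk. rewrite pow_i by lia. ring.
Qed.

(** This is the defining recursion of the Bernoulli numbers in disguise. For n = 1 the endpoint
    values differ: they are -1/2 and 1/2. *)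
Lemma bpoly_1 n : (2 <= n)%nat -> bpoly n 1 = bernoulli n.
Proof.
  intros Hn. destruct n as [|[|n]]; try lia.
  unfold bpoly. rewrite (sum_eq _ (fun k => Binomial.C (S (S n)) k * bernoulli k)) by (intros; rewrite pow1; ring).
  cbn [sum_f_R0]. pose proof (bernoulli_rec n) as E. replace (n + 2)%nat with (S (S n)) in E by lia.
  assert (C1 : Binomial.C (S (S n)) (S n) = INR (S (S n))).
  { unfold Binomial.C. replace (S (S n) - S n)%nat with 1%nat by lia. rewrite (fact_simpl (S n)), mult_INR. change (INR (fact 1)) with 1.
    field. apply INR_fact_neq_0. }
  assert (C2 : Binomial.C (S (S n)) (S (S n)) = 1).
  { unfold Binomial.C. rewrite Nat.sub_diag. change (INR (fact 0)) with 1. field. apply INR_fact_neq_0. }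
  rewrite C1, C2, E. field. apply not_0_INR; lia.
Qed.

Lemma bpoly_1u u : bpoly 1 u = u - 1 / 2.
Proof.
  unfold bpoly. cbn [sum_f_R0]. pose proof (bernoulli_rec 0) as E. cbn [sum_f_R0] in E.
  rewrite E. unfold Binomial.C, bernoulli; simpl. field.
Qed.

Lemma bpoly_cont n u : continuous (bpoly n) u.
Proof.
  unfold bpoly. induction n as [|n IH] using nat_ind; [apply (continuous_ext (fun _ => Binomial.C 0 0 * bernoulli 0 * 1)); [reflexivity|apply continuous_const]|].
  apply (ex_derive_continuous (bpoly (S n))). exists (INR (S n) * bpoly n u). apply bpoly_der.
Qed.

Lemma bpoly_bounded n : exists M, 0 <= M /\ forall u, 0 <= u <= 1 -> Rabs (bpoly n u) <= M.
Proof. apply continuous_bounded; [lra|]. intros; apply bpoly_cont. Qed.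

(** Up to the factor -1/n, the Euler-Maclaurin remainder of order n on one unit step, as
    [gterm_euler] makes precise. *)
Definition bint (n : nat) (w : C) : C := CInt (fun u => RtoC (bpoly n u) * / Cpow (w + RtoC u) n)%C 0 1.

Lemma bint_ccont n w : RHc w -> ccont (fun u => RtoC (bpoly n u) * / Cpow (w + RtoC u) n)%C 0 1.
Proof.
  intros Hw u Hu. rewrite Rmin_left, Rmax_right in Hu by lra.
  apply cont_Cmult; [apply cont_RtoC, bpoly_cont|]. apply cont_inv_pow. now apply RHc_slit.
Qed.

Lemma gterm_bint w : RHc w -> gterm w = (- bint 1 w)%C.
Proof.
  intros Hw. unfold bint. replace (- CInt (fun u => RtoC (bpoly 1 u) * / Cpow (w + RtoC u) 1) 0 1)%C
    with (RtoC (-1) * CInt (fun u => RtoC (bpoly 1 u) * / Cpow (w + RtoC u) 1) 0 1)%C by (apply C_eq; unfold Re, Im, RtoC; simpl; ring).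
  rewrite <- CInt_cmult by (now apply bint_ccont). apply CInt_ext. intros t _.
  rewrite bpoly_1u. simpl Cpow. rewrite Cmult_1_r. rewrite Cmult_assoc, <- RtoC_mult. f_equal. f_equal. field.
Qed.

(** The even indices are kept although their coefficients, Bernoulli numbers of odd index, are zero:
    this is proved only in [binet_coef_even], from the asymptotic expansion itself. *)
Definition binet_coef (k : nat) : R :=
  match k with O => 0 | S _ => bernoulli (S k) / (INR k * INR (S k)) end.

Lemma bint_step n w : (1 <= n)%nat -> RHc w ->
  (- (RtoC (/ INR n) * bint n w) = RtoC (binet_coef n) * (/ Cpow w n - / Cpow (w + 1) n) - RtoC (/ INR (S n)) * bint (S n) w)%C.
Proof.
  intros Hn Hw.
  assert (Hn0 : 0 < INR n) by (apply lt_0_INR; lia).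
  assert (Hn1 : 0 < INR (S n)) by (apply lt_0_INR; lia).
  assert (Cq : ccont (fun t => RtoC (- INR n) * / Cpow (w + RtoC t) (S n))%C 0 1).
  { intros t Ht. rewrite Rmin_left, Rmax_right in Ht by lra. apply cont_Cmult; [apply continuous_const|].
    apply cont_inv_pow; now apply RHc_slit. }
  pose proof (CInt_parts (fun u => / INR (S n) * bpoly (S n) u) (bpoly n)
     (fun u => / Cpow (w + RtoC u) n)%C (fun u => RtoC (- INR n) * / Cpow (w + RtoC u) (S n))%C 0 1) as P.
  cbv beta in P. fold (bint n w) in P.
  rewrite bpoly_0, bpoly_1 in P by lia. rewrite Cplus_0_r in P.
  rewrite (CInt_ext _ (fun u => RtoC (- INR n * / INR (S n)) * (RtoC (bpoly (S n) u) * / Cpow (w + RtoC u) (S n)))%C) in P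
    by (intros t _; rewrite !RtoC_mult; ring).
  rewrite CInt_cmult in P by (now apply bint_ccont). fold (bint (S n) w) in P.
  assert (E : (RtoC (- INR n * / INR (S n)) * bint (S n) w =
     RtoC (/ INR (S n) * bernoulli (S n)) * / Cpow (w + 1) n - RtoC (/ INR (S n) * bernoulli (S n)) * / Cpow w n - bint n w)%C).
  { apply P; clear P.
    - intros t _. evar_last; [apply is_derive_scal, bpoly_der|]. simpl. match goal with |- ?x = ?y => change (@eq R x y) end.
      change (match n with O => 1 | S _ => INR n + 1 end) with (INR (S n)). field. lra.
    - intros; apply bpoly_cont.
    - intros t Ht. rewrite Rmin_left, Rmax_right in Ht by lra. apply inv_pow_line; now apply RHc_slit.
    - intros t Ht. rewrite Rmin_left, Rmax_right in Ht by lra. apply inv_pow_line; now apply RHc_slit.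
    - exact Cq.
    - intros t Ht. rewrite Rmin_left, Rmax_right in Ht by lra. apply cont_inv_pow; now apply RHc_slit. }
  assert (E2 : bint n w = (RtoC (/ INR (S n) * bernoulli (S n)) * (/ Cpow (w + 1) n - / Cpow w n)
      + RtoC (INR n * / INR (S n)) * bint (S n) w)%C).
  { replace (RtoC (- INR n * / INR (S n))) with (- RtoC (INR n * / INR (S n)))%C in E by (rewrite <- RtoC_opp; f_equal; ring).
    transitivity (RtoC (/ INR (S n) * bernoulli (S n)) * / Cpow (w + 1) n - RtoC (/ INR (S n) * bernoulli (S n)) * / Cpow w n
      - (- RtoC (INR n * / INR (S n)) * bint (S n) w))%C; [rewrite E; ring|ring]. }
  rewrite E2. destruct n as [|n]; [lia|]. cbn [binet_coef].
  replace (RtoC (bernoulli (S (S n)) / (INR (S n) * INR (S (S n))))) with (RtoC (/ INR (S n)) * RtoC (/ INR (S (S n)) * bernoulli (S (S n))))%C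
    by (rewrite <- RtoC_mult; f_equal; field; lra).
  replace (RtoC (/ INR (S (S n)))) with (RtoC (/ INR (S n)) * RtoC (INR (S n) * / INR (S (S n))))%C
    by (rewrite <- RtoC_mult; f_equal; field; lra).
  ring.
Qed.

(** * Asymptotic expansions in the right half-plane *)

Definition ipoly (a : nat -> R) (N : nat) (w : C) : C := Csum (fun k => RtoC (a k) * / Cpow w k)%C N.

(** Repeated integration by parts. The boundary terms are values of one polynomial in 1/w, taken at
    w and at w + 1, so they telescope when the shifts are summed. *)
Lemma gterm_euler K w : RHc w ->
  gterm w = (ipoly binet_coef (S K) w - ipoly binet_coef (S K) (w + 1) - RtoC (/ INR (S K)) * bint (S K) w)%C.
Proof.
  intros Hw. induction K.
  - rewrite gterm_bint by assumption. unfold ipoly; cbn [Csum binet_coef]. simpl INR. rewrite Rinv_1. ring.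
  - rewrite IHK. unfold ipoly.
    change (Csum (fun k => RtoC (binet_coef k) * / Cpow w k)%C (S (S K)))
      with (Csum (fun k => RtoC (binet_coef k) * / Cpow w k)%C (S K) + RtoC (binet_coef (S K)) * / Cpow w (S K))%C.
    change (Csum (fun k => RtoC (binet_coef k) * / Cpow (w + 1) k)%C (S (S K)))
      with (Csum (fun k => RtoC (binet_coef k) * / Cpow (w + 1) k)%C (S K) + RtoC (binet_coef (S K)) * / Cpow (w + 1) (S K))%C.
    pose proof (bint_step (S K) w ltac:(lia) Hw) as E.
    set (X := Csum (fun k => RtoC (binet_coef k) * / Cpow w k)%C (S K)) in *.
    set (Y := Csum (fun k => RtoC (binet_coef k) * / Cpow (w + 1) k)%C (S K)) in *.
    transitivity (X - Y + - (RtoC (/ INR (S K)) * bint (S K) w))%C; [ring|]. rewrite E. ring.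
Qed.

Lemma bint_bound n : exists M, 0 <= M /\ forall w, RHc w -> Cmod (bint n w) <= M * / Cmod w ^ n.
Proof.
  destruct (bpoly_bounded n) as [M [HM HB]]. exists M. split; [assumption|].
  intros w Hw. pose proof (RHc_mod w Hw) as Hp.
  replace (M * / Cmod w ^ n) with (M * / Cmod w ^ n * (1 - 0)) by ring.
  apply CInt_le_const; [lra|now apply bint_ccont|]. intros u Hu.
  rewrite Cmod_mult, Cmod_inv, Cmod_pow, Cmod_R by (apply Cpow_nz; now apply RHc_slit).
  pose proof (Cmod_shift w u (proj1 Hw) (proj1 Hu)).
  apply Rmult_le_compat; [apply Rabs_pos| |now apply HB|].
  - left; apply Rinv_0_lt_compat, pow_lt; lra.
  - apply Rinv_le_contravar; [now apply pow_lt|]. apply pow_incr; lra.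
Qed.

Lemma ipoly_bound a N : exists M, 0 <= M /\ forall w : C, 1 <= Cmod w -> Cmod (ipoly a N w) <= M.
Proof.
  induction N.
  - exists 0. split; [lra|]. intros w _. unfold ipoly; cbn [Csum]. rewrite Cmod_0. lra.
  - destruct IHN as [M [HM H]]. exists (M + Rabs (a N)). pose proof (Rabs_pos (a N)). split; [lra|].
    intros w Hw. unfold ipoly in *; cbn [Csum]. eapply Rle_trans; [apply Cmod_triangle|].
    apply Rplus_le_compat; [now apply H|].
    assert (w <> RtoC 0) by (apply Cmod_pos_neq; lra).
    rewrite Cmod_mult, Cmod_inv, Cmod_pow, Cmod_R by (now apply Cpow_nz).
    rewrite <- (Rmult_1_r (Rabs (a N))) at 2. apply Rmult_le_compat_l; [assumption|].
    rewrite <- Rinv_1. apply Rinv_le_contravar; [lra|]. now apply pow_R1_Rle.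
Qed.

(** The constant is uniform up to the imaginary axis, since the expansion is used on the boundary.
    The case N = 0 says that [f] is bounded for |w| >= 1. *)
Definition asy (f : C -> C) (a : nat -> R) :=
  forall N, exists K, 0 <= K /\ forall w, RHc w -> 1 <= Cmod w -> Cmod (f w - ipoly a N w) <= K * / Cmod w ^ N.

Lemma ipoly_small a N : a O = 0 -> exists M, 0 <= M /\ forall w : C, 1 <= Cmod w -> Cmod (ipoly a N w) <= M * / Cmod w.
Proof.
  intros H0. induction N.
  - exists 0. split; [lra|]. intros w _. unfold ipoly; cbn [Csum]. rewrite Cmod_0. lra.
  - destruct IHN as [M [HM H]]. exists (M + Rabs (a N)). pose proof (Rabs_pos (a N)). split; [lra|].
    intros w Hw. unfold ipoly in *; cbn [Csum]. eapply Rle_trans; [apply Cmod_triangle|]. rewrite Rmult_plus_distr_r.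
    apply Rplus_le_compat; [now apply H|].
    assert (w <> RtoC 0) by (apply Cmod_pos_neq; lra).
    rewrite Cmod_mult, Cmod_inv, Cmod_pow, Cmod_R by (now apply Cpow_nz).
    destruct N as [|N]; [rewrite H0, Rabs_R0, !Rmult_0_l; lra|].
    apply Rmult_le_compat_l; [assumption|]. apply Rinv_le_contravar; [lra|].
    simpl. rewrite <- (Rmult_1_r (Cmod w)) at 1. apply Rmult_le_compat_l; [lra|]. now apply pow_R1_Rle.
Qed.

(** Summing over the shifts loses one power: terms of order |w + n|^(-K-2) add up to order
    |w|^(-K-1). The truncation therefore carries one term more than its error deserves, and [mu_asy]
    moves that term into the error. *)
Lemma mu_asy_aux (K : nat) : exists M, 0 <= M /\ forall w, RHc w -> 1 <= Cmod w ->
  Cmod (mu w - ipoly binet_coef (S (S K)) w) <= M * / Cmod w ^ (S K).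
Proof.
  destruct (bint_bound (S (S K))) as [M [HM HB]].
  destruct (ipoly_small binet_coef (S (S K)) eq_refl) as [L [HL HS]].
  exists (4 * M). split; [lra|]. intros w Hw H1. pose proof (RHc_mod w Hw) as Hp. set (r := Cmod w) in *.
  assert (Hir : 0 < / r <= 1).
  { split; [apply Rinv_0_lt_compat; lra|]. apply Rle_trans with (/ 1); [apply Rinv_le_contravar; lra|lra]. }
  assert (Hk : 0 < / r ^ K) by (apply Rinv_0_lt_compat, pow_lt; lra).
  set (P := ipoly binet_coef (S (S K))) in *.
  assert (S1 : forall n, Cmod (Csum (fun k => gterm (w + RtoC (INR k))) n - (P w - P (w + RtoC (INR n))%C))
     <= 4 * M * / r ^ K * (/ r - / (r + INR n))).
  { induction n.
    - cbn [Csum]. change (INR 0) with 0. rewrite Cplus_0_r, Rplus_0_r.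
      replace (0 - (P w - P w))%C with (RtoC 0) by ring. rewrite Cmod_0. lra.
    - cbn [Csum]. assert (Hwn : RHc (w + RtoC (INR n))) by (apply RHc_shift; [assumption|apply pos_INR]).
      rewrite (gterm_euler (S K)) by assumption. fold P.
      replace (w + RtoC (INR n) + 1)%C with (w + RtoC (INR (S n)))%C by (rewrite S_INR, RtoC_plus; ring).
      match goal with |- Cmod ?t <= _ => replace t with
        ((Csum (fun k => gterm (w + RtoC (INR k))) n - (P w - P (w + RtoC (INR n)))) - RtoC (/ INR (S (S K))) * bint (S (S K)) (w + RtoC (INR n)))%C by ring end.
      eapply Rle_trans; [apply Cmod_triangle_sub|]. rewrite Cmod_mult, Cmod_R.
      pose proof (HB _ Hwn) as B. pose proof (inv_shift_tele w n Hw) as T. fold r in T.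
      pose proof (Cmod_shift w (INR n) (proj1 Hw) (pos_INR n)) as Sh. fold r in Sh.
      set (q := Cmod (w + RtoC (INR n))) in *.
      assert (B2 : Rabs (/ INR (S (S K))) * Cmod (bint (S (S K)) (w + RtoC (INR n))) <= 4 * M * / r ^ K * tele r n).
      { apply Rle_trans with (1 * (M * / q ^ S (S K))).
        - apply Rmult_le_compat; [apply Rabs_pos|apply Cmod_ge_0| |assumption].
          assert (1 <= INR (S (S K))) by (apply (le_INR 1); lia).
          rewrite Rabs_right by (left; apply Rinv_0_lt_compat; lra). rewrite <- Rinv_1. apply Rinv_le_contravar; lra.
        (* K of the powers are bounded by their value at w; the other two telescope, with 2 (1 +
           1/r) <= 4 because r >= 1. *)
        - rewrite Rmult_1_l. replace (/ q ^ S (S K)) with (/ q ^ K * / q ^ 2).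
          + replace (4 * M * / r ^ K * tele r n) with (M * (/ r ^ K * (4 * tele r n))) by ring.
            apply Rmult_le_compat_l; [assumption|]. apply Rmult_le_compat.
            * left; apply Rinv_0_lt_compat, pow_lt; lra.
            * left; apply Rinv_0_lt_compat, pow_lt; lra.
            * apply Rinv_le_contravar; [apply pow_lt; lra|apply pow_incr; lra].
            * eapply Rle_trans; [exact T|]. apply Rmult_le_compat_r; [|lra].
              unfold tele. rewrite S_INR. pose proof (pos_INR n).
              assert (/ (r + (INR n + 1)) <= / (r + INR n)) by (apply Rinv_le_contravar; lra). lra.
          + rewrite <- Rinv_mult. f_equal. simpl. ring. }
      replace (4 * M * / r ^ K * (/ r - / (r + INR (S n))))
        with (4 * M * / r ^ K * (/ r - / (r + INR n)) + 4 * M * / r ^ K * tele r n) by (unfold tele; ring).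
      lra. }
  assert (S2 : forall n, (1 <= n)%nat -> Cmod (Csum (fun k => gterm (w + RtoC (INR k))) n - P w) <= 4 * M * / r ^ S K + L * / INR n).
  { intros n Hn. assert (Hn1 : 1 <= INR n) by (apply (le_INR 1); exact Hn).
    replace (Csum (fun k => gterm (w + RtoC (INR k))) n - P w)%C
      with ((Csum (fun k => gterm (w + RtoC (INR k))) n - (P w - P (w + RtoC (INR n)))) - P (w + RtoC (INR n)))%C by ring.
    eapply Rle_trans; [apply Cmod_triangle_sub|]. apply Rplus_le_compat.
    - eapply Rle_trans; [apply S1|]. replace (/ r ^ S K) with (/ r ^ K * / r) by (rewrite <- Rinv_mult; f_equal; simpl; ring).
      rewrite <- Rmult_assoc. apply Rmult_le_compat_l; [apply Rmult_le_pos; lra|].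
      assert (0 < / (r + INR n)) by (apply Rinv_0_lt_compat; lra). lra.
    - pose proof (Cmod_shift w (INR n) (proj1 Hw) (pos_INR n)) as Sh. fold r in Sh.
      eapply Rle_trans; [apply HS; lra|]. apply Rmult_le_compat_l; [assumption|]. apply Rinv_le_contravar; [lra|].
      eapply Rle_trans; [|apply (re_le_Cmod (w + RtoC (INR n)))]. rewrite Re_shift. destruct Hw. rewrite Rabs_right; lra. }
  rewrite mu_eq by apply Hw.
  assert (L1 : is_lim_seq (fun n => Cmod (Csum (fun k => gterm (w + RtoC (INR k))) n - P w)) (Cmod (binet w - P w))).
  { apply (Clim_Cmod (fun n => Csum (fun k => gterm (w + RtoC (INR k))) n - P w)%C).
    pose proof (Clim_binet w Hw) as [A1 A2]. split.
    - apply (is_lim_seq_minus' (fun n => Re (Csum (fun k => gterm (w + RtoC (INR k))) n)) (fun _ => Re (P w))); [exact A1|apply is_lim_seq_const].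
    - apply (is_lim_seq_minus' (fun n => Im (Csum (fun k => gterm (w + RtoC (INR k))) n)) (fun _ => Im (P w))); [exact A2|apply is_lim_seq_const]. }
  assert (L2 : is_lim_seq (fun n => 4 * M * / r ^ S K + L * / INR n) (4 * M * / r ^ S K + 0)).
  { apply is_lim_seq_plus'; [apply is_lim_seq_const|apply is_lim_seq_invINR]. }
  rewrite Rplus_0_r in L2.
  pose proof (is_lim_seq_le_loc _ _ _ _ (ex_intro _ 1%nat S2) L1 L2) as F. exact F.
Qed.

Lemma mu_asy : asy mu binet_coef.
Proof.
  intros [|N].
  - destruct (mu_asy_aux 0) as [M [HM H]]. destruct (ipoly_bound binet_coef 2) as [L [HL H2]].
    exists (M + L). split; [lra|]. intros w Hw H1. unfold ipoly at 1; cbn [Csum]. simpl pow. rewrite Rinv_1, Rmult_1_r.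
    replace (mu w - 0)%C with ((mu w - ipoly binet_coef 2 w) + ipoly binet_coef 2 w)%C by ring.
    eapply Rle_trans; [apply Cmod_triangle|]. apply Rplus_le_compat; [|now apply H2].
    eapply Rle_trans; [now apply H|]. rewrite <- (Rmult_1_r M) at 2. apply Rmult_le_compat_l; [assumption|].
    simpl. rewrite Rmult_1_r, <- Rinv_1. apply Rinv_le_contravar; lra.
  - destruct (mu_asy_aux N) as [M [HM H]]. exists (M + Rabs (binet_coef (S N))).
    pose proof (Rabs_pos (binet_coef (S N))). split; [lra|]. intros w Hw H1.
    assert (w <> RtoC 0) by apply Hw.
    assert (Hp : 0 < Cmod w) by lra.
    replace (mu w - ipoly binet_coef (S N) w)%C
      with ((mu w - ipoly binet_coef (S (S N)) w) + RtoC (binet_coef (S N)) * / Cpow w (S N))%C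
      by (unfold ipoly; cbn [Csum]; ring).
    eapply Rle_trans; [apply Cmod_triangle|]. rewrite Rmult_plus_distr_r. apply Rplus_le_compat; [now apply H|].
    rewrite Cmod_mult, Cmod_inv, Cmod_pow, Cmod_R by (now apply Cpow_nz). lra.
Qed.

(** * Exponentials of asymptotic expansions *)

(** The truncation in the variable t = 1/w, where products and Horner's scheme involve no
    inverses. *)
Definition tpoly (a : nat -> R) (N : nat) (t : C) : C := Csum (fun k => RtoC (a k) * Cpow t k)%C N.

Lemma Csum_ext f g n : (forall k, (k < n)%nat -> f k = g k) -> Csum f n = Csum g n.
Proof. induction n; intros H; cbn [Csum]; [reflexivity|]. rewrite IHn by (intros; apply H; lia). now rewrite H by lia. Qed.

Lemma Csum_plus f g n : Csum (fun k => f k + g k)%C n = (Csum f n + Csum g n)%C.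
Proof. induction n; cbn [Csum]; [ring|]. rewrite IHn. ring. Qed.

Lemma Csum_cmult c f n : Csum (fun k => c * f k)%C n = (c * Csum f n)%C.
Proof. induction n; cbn [Csum]; [ring|]. rewrite IHn. ring. Qed.

Lemma Csum_S_l f n : Csum f (S n) = (f O + Csum (fun k => f (S k)) n)%C.
Proof. induction n; [cbn [Csum]; ring|]. change (Csum f (S (S n))) with (Csum f (S n) + f (S n))%C. rewrite IHn. cbn [Csum]. ring. Qed.

Lemma Cpow_inv w k : w <> RtoC 0 -> Cpow (/ w) k = (/ Cpow w k)%C.
Proof.
  intros H. induction k; simpl; [field|]. rewrite IHk. field. split; [now apply Cpow_nz|assumption].
Qed.

Lemma ipoly_tpoly a N w : w <> RtoC 0 -> ipoly a N w = tpoly a N (/ w).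
Proof. intros H. apply Csum_ext. intros k _. now rewrite Cpow_inv. Qed.

Lemma tpoly_S a N t : tpoly a (S N) t = (RtoC (a O) + t * tpoly (fun k => a (S k)) N t)%C.
Proof.
  unfold tpoly. rewrite Csum_S_l, <- Csum_cmult. simpl Cpow at 1. rewrite Cmult_1_r. f_equal.
  apply Csum_ext. intros k _. simpl. ring.
Qed.

Lemma tpoly_ext a b N t : (forall k, (k < N)%nat -> a k = b k) -> tpoly a N t = tpoly b N t.
Proof. intros H. apply Csum_ext. intros k Hk. now rewrite H. Qed.

Lemma tpoly_plus a b N t : tpoly (fun k => a k + b k) N t = (tpoly a N t + tpoly b N t)%C.
Proof. unfold tpoly. rewrite <- Csum_plus. apply Csum_ext. intros. rewrite RtoC_plus. ring. Qed.

Lemma tpoly_scal r a N t : tpoly (fun k => r * a k) N t = (RtoC r * tpoly a N t)%C.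
Proof. unfold tpoly. rewrite <- Csum_cmult. apply Csum_ext. intros. rewrite RtoC_mult. ring. Qed.

Lemma tpoly_bound a N : exists M, 0 <= M /\ forall t : C, Cmod t <= 1 -> Cmod (tpoly a N t) <= M.
Proof.
  revert a. induction N; intros a.
  - exists 0. split; [lra|]. intros t _. unfold tpoly; cbn [Csum]. rewrite Cmod_0; lra.
  - destruct (IHN (fun k => a (S k))) as [M [HM H]]. pose proof (Rabs_pos (a O)). exists (Rabs (a O) + M). split; [lra|].
    intros t Ht. rewrite tpoly_S. eapply Rle_trans; [apply Cmod_triangle|]. rewrite Cmod_mult, Cmod_R.
    apply Rplus_le_compat_l. rewrite <- (Rmult_1_l M). apply Rmult_le_compat; try apply Cmod_ge_0; auto.
Qed.

Lemma PS_mult_0 a b : PS_mult a b O = a O * b O.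
Proof. reflexivity. Qed.

Lemma PS_mult_S a b n : PS_mult a b (S n) = a O * b (S n) + PS_mult (fun k => a (S k)) b n.
Proof.
  unfold PS_mult. rewrite decomp_sum by lia. cbn [pred]. rewrite Nat.sub_0_r. f_equal.
Qed.

(** Induction along Horner's scheme for [a]: the leading coefficient multiplies [b] without error,
    and the rest carries a factor t, which raises the order of its error by one. *)
Lemma tpoly_mult a b N : exists M, 0 <= M /\ forall t : C, Cmod t <= 1 ->
  Cmod (tpoly a N t * tpoly b N t - tpoly (PS_mult a b) N t) <= M * Cmod t ^ N.
Proof.
  revert a. induction N; intros a.
  - exists 0. split; [lra|]. intros t _. unfold tpoly; cbn [Csum].
    replace (0 * 0 - 0)%C with (RtoC 0) by ring. rewrite Cmod_0. lra.
  - destruct (IHN (fun k => a (S k))) as [M [HM H]].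
    destruct (tpoly_bound (fun k => a (S k)) N) as [L [HL HB]].
    pose proof (Rabs_pos (b N)) as Hb.
    exists (M + L * Rabs (b N)). split; [pose proof (Rmult_le_pos _ _ HL Hb); lra|]. intros t Ht.
    set (A := tpoly (fun k => a (S k)) N t). set (B := tpoly b N t).
    assert (EP : tpoly (PS_mult a b) (S N) t = (RtoC (a O) * tpoly b (S N) t + t * tpoly (PS_mult (fun k => a (S k)) b) N t)%C).
    { rewrite !tpoly_S. rewrite PS_mult_0, RtoC_mult.
      rewrite (tpoly_ext (fun k => PS_mult a b (S k)) (fun k => a O * b (S k) + PS_mult (fun k => a (S k)) b k))
        by (intros; apply PS_mult_S).
      rewrite (tpoly_plus (fun k => a O * b (S k))), tpoly_scal. ring. }
    rewrite EP, (tpoly_S a). fold A.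
    assert (EB : tpoly b (S N) t = (B + RtoC (b N) * Cpow t N)%C) by reflexivity.
    match goal with |- Cmod ?x <= _ => replace x with
      (t * ((A * B - tpoly (PS_mult (fun k => a (S k)) b) N t) + A * (RtoC (b N) * Cpow t N)))%C by (rewrite EB; ring) end.
    rewrite Cmod_mult. replace ((M + L * Rabs (b N)) * Cmod t ^ S N) with (Cmod t * (M * Cmod t ^ N + L * (Rabs (b N) * Cmod t ^ N))) by (simpl; ring).
    apply Rmult_le_compat_l; [apply Cmod_ge_0|]. eapply Rle_trans; [apply Cmod_triangle|].
    apply Rplus_le_compat; [now apply H|]. rewrite !Cmod_mult, Cmod_R, Cmod_pow.
    apply Rmult_le_compat_r; [|now apply HB]. apply Rmult_le_pos; [assumption|apply pow_le, Cmod_ge_0].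
Qed.

Lemma inv_mod_le1 w : 1 <= Cmod w -> w <> RtoC 0 /\ Cmod (/ w) <= 1 /\ Cmod (/ w) = / Cmod w.
Proof.
  intros H. assert (Hn : w <> RtoC 0) by (apply Cmod_pos_neq; lra).
  split; [assumption|]. rewrite Cmod_inv by assumption. split; [|reflexivity].
  apply Rle_trans with (/ 1); [apply Rinv_le_contravar; lra|lra].
Qed.

Lemma asy_bound f a : asy f a -> exists M, 0 <= M /\ forall w, RHc w -> 1 <= Cmod w -> Cmod (f w) <= M.
Proof.
  intros H. destruct (H O) as [M [HM HK]]. exists M; split; [assumption|]. intros w Hw H1.
  specialize (HK w Hw H1). unfold ipoly in HK; cbn [Csum] in HK. simpl in HK. rewrite Rinv_1, Rmult_1_r in HK.
  replace (f w - 0)%C with (f w) in HK by ring. exact HK.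
Qed.

Lemma asy_mult f g a b : asy f a -> asy g b -> asy (fun w => f w * g w)%C (PS_mult a b).
Proof.
  intros Hf Hg N. destruct (Hf N) as [A [HA HfN]]. destruct (Hg N) as [B [HB HgN]].
  destruct (asy_bound f a Hf) as [M [HM HfM]]. destruct (ipoly_bound b N) as [L [HL HbL]].
  destruct (tpoly_mult a b N) as [P [HP HtP]].
  exists (M * B + A * L + P). split; [pose proof (Rmult_le_pos _ _ HM HB); pose proof (Rmult_le_pos _ _ HA HL); lra|].
  intros w Hw H1. destruct (inv_mod_le1 w H1) as (Hn & Hi & Hie).
  specialize (HfN w Hw H1). specialize (HgN w Hw H1). specialize (HfM w Hw H1). specialize (HbL w H1).
  specialize (HtP _ Hi). rewrite <- !ipoly_tpoly in HtP by assumption. rewrite Hie, pow_inv in HtP.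
  set (r := / Cmod w ^ N) in *. assert (Hr : 0 < r) by (apply Rinv_0_lt_compat, pow_lt; lra).
  set (Pa := ipoly a N w) in *. set (Pb := ipoly b N w) in *. set (Pab := ipoly (PS_mult a b) N w) in *.
  replace (f w * g w - Pab)%C with (f w * (g w - Pb) + (f w - Pa) * Pb + (Pa * Pb - Pab))%C by ring.
  eapply Rle_trans; [apply Cmod_triangle|]. eapply Rle_trans; [apply Rplus_le_compat_r, Cmod_triangle|].
  rewrite !Cmod_mult.
  assert (Cmod (f w) * Cmod (g w - Pb) <= M * (B * r)) by (apply Rmult_le_compat; try apply Cmod_ge_0; assumption).
  assert (Cmod (f w - Pa) * Cmod Pb <= A * r * L) by (apply Rmult_le_compat; try apply Cmod_ge_0; assumption).
  lra.
Qed.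

Lemma asy_plus f g a b : asy f a -> asy g b -> asy (fun w => f w + g w)%C (fun k => a k + b k).
Proof.
  intros Hf Hg N. destruct (Hf N) as [A [HA HfN]]. destruct (Hg N) as [B [HB HgN]].
  exists (A + B). split; [lra|]. intros w Hw H1. destruct (inv_mod_le1 w H1) as (Hn & _ & _).
  specialize (HfN w Hw H1). specialize (HgN w Hw H1). rewrite ipoly_tpoly in * by assumption.
  rewrite tpoly_plus. match goal with |- Cmod ?x <= _ => replace x with ((f w - tpoly a N (/ w)) + (g w - tpoly b N (/ w)))%C by ring end.
  eapply Rle_trans; [apply Cmod_triangle|]. lra.
Qed.

Lemma asy_scal r f a : asy f a -> asy (fun w => RtoC r * f w)%C (fun k => r * a k).
Proof.
  intros Hf N. destruct (Hf N) as [A [HA HfN]]. pose proof (Rabs_pos r).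
  exists (Rabs r * A). split; [now apply Rmult_le_pos|]. intros w Hw H1. destruct (inv_mod_le1 w H1) as (Hn & _ & _).
  specialize (HfN w Hw H1). rewrite ipoly_tpoly in * by assumption.
  rewrite tpoly_scal. match goal with |- Cmod ?x <= _ => replace x with (RtoC r * (f w - tpoly a N (/ w)))%C by ring end.
  rewrite Cmod_mult, Cmod_R, Rmult_assoc. now apply Rmult_le_compat_l.
Qed.

Lemma asy_ext f g a b : (forall w, RHc w -> f w = g w) -> (forall n, a n = b n) -> asy f a -> asy g b.
Proof.
  intros Hf Ha H N. destruct (H N) as [K [HK HN]]. exists K; split; [assumption|]. intros w Hw H1.
  rewrite <- Hf by assumption. replace (ipoly b N w) with (ipoly a N w); [now apply HN|].
  apply Csum_ext. intros k _. now rewrite Ha.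
Qed.

Lemma asy_one : asy (fun _ => RtoC 1) PS_one.
Proof.
  intros N. exists 1. split; [lra|]. intros w Hw H1. destruct (inv_mod_le1 w H1) as (Hn & _ & _).
  assert (Hp : 0 < / Cmod w ^ N) by (apply Rinv_0_lt_compat, pow_lt; lra).
  rewrite ipoly_tpoly by assumption. destruct N.
  - unfold tpoly; cbn [Csum]. replace (RtoC 1 - 0)%C with (RtoC 1) by ring. rewrite Cmod_1. simpl. lra.
  - rewrite tpoly_S. rewrite (tpoly_ext _ (fun _ => 0 * 0)) by (intros; unfold PS_one; ring). rewrite (tpoly_scal 0 (fun _ => 0)).
    cbn [PS_one]. replace (RtoC 1 - (RtoC 1 + / w * (RtoC 0 * tpoly (fun _ => 0%R) N (/ w))))%C with (RtoC 0) by ring.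
    rewrite Cmod_0. lra.
Qed.

Lemma asy_pow f a k : asy f a -> asy (fun w => Cpow (f w) k) (PS_power a k).
Proof.
  intros H. induction k; cbn [Cpow PS_power]; [apply asy_one|]. now apply asy_mult.
Qed.

Lemma PS_power_low a k n : a O = 0 -> (n < k)%nat -> PS_power a k n = 0.
Proof.
  intros H0. revert n. induction k; intros n Hn; [lia|]. cbn [PS_power].
  destruct n; [rewrite PS_mult_0, H0; ring|]. rewrite PS_mult_S, H0, Rmult_0_l, Rplus_0_l.
  unfold PS_mult. rewrite (sum_eq _ (fun _ => 0)); [rewrite sum_cte; ring|].
  intros j Hj. rewrite IHk by lia. ring.
Qed.

Definition expsum (N : nat) (v : C) : C := Csum (fun k => Cpow v k * RtoC (/ INR (fact k)))%C N.

Lemma Cdiff_pow n w : Cdiff (fun v => Cpow v (S n)) w (RtoC (INR (S n)) * Cpow w n).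
Proof.
  induction n.
  - apply (Cdiff_ext_loc (fun v => v) _ _ _ 1); [lra|intros; simpl; ring|].
    replace (RtoC (INR 1) * Cpow w 0)%C with (RtoC 1) by (simpl; ring). apply Cdiff_id.
  - replace (RtoC (INR (S (S n))) * Cpow w (S n))%C with (1 * Cpow w (S n) + w * (RtoC (INR (S n)) * Cpow w n))%C
      by (rewrite (S_INR (S n)), RtoC_plus; simpl; ring).
    apply (Cdiff_mult (fun v => v) (fun v => Cpow v (S n))); [apply Cdiff_id|assumption].
Qed.

Lemma Cdiff_expsum N w : Cdiff (expsum (S N)) w (expsum N w).
Proof.
  induction N.
  - apply (Cdiff_ext_loc (fun _ => RtoC 1) _ _ _ 1); [lra| |apply Cdiff_const].
    intros v _. unfold expsum; cbn [Csum]. simpl. rewrite Rinv_1. ring.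
  - unfold expsum. cbn [Csum].
    apply (Cdiff_plus (expsum (S N)) (fun v => Cpow v (S N) * RtoC (/ INR (fact (S N))))%C); [exact IHN|].
    replace (Cpow w N * RtoC (/ INR (fact N)))%C with (RtoC (INR (S N)) * Cpow w N * RtoC (/ INR (fact (S N))) + Cpow w (S N) * 0)%C.
    + apply (Cdiff_mult (fun v => Cpow v (S N)) (fun _ => RtoC (/ INR (fact (S N))))); [apply Cdiff_pow|apply Cdiff_const].
    + rewrite fact_simpl, mult_INR.
      replace (RtoC (/ INR (fact N))) with (RtoC (INR (S N)) * RtoC (/ (INR (S N) * INR (fact N))))%C; [ring|].
      rewrite <- RtoC_mult. f_equal. field. split; [apply INR_fact_neq_0|apply not_0_INR; lia].
Qed.

Lemma expsum_0 N : expsum (S N) 0 = RtoC 1.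
Proof.
  induction N; unfold expsum in *; cbn [Csum] in *.
  - simpl. rewrite Rinv_1. ring.
  - rewrite IHN. simpl Cpow. ring.
Qed.

(** The error with N + 1 terms vanishes at 0 and has the error with N terms as its derivative, so it
    is integrated along the segment from 0 to v. The constant is crude, since only the order in v
    matters. *)
Lemma exp_taylor_C N M : 0 <= M -> forall v, Cmod v <= M -> Cmod (Cexp v - expsum N v) <= exp M * Cmod v ^ N.
Proof.
  intros HM. induction N; intros v Hv.
  - unfold expsum; cbn [Csum]. replace (Cexp v - 0)%C with (Cexp v) by ring. rewrite Cmod_Cexp. simpl pow. rewrite Rmult_1_r.
    apply exp_mono. pose proof (re_le_Cmod v). pose proof (Rle_abs (Re v)). lra.
  - set (E := fun n v => (Cexp v - expsum n v)%C).
    assert (HE : forall w, Cdiff (E (S N)) w (E N w)).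
    { intros w. unfold E. apply (Cdiff_ext_loc (fun v => Cexp v + RtoC (-1) * expsum (S N) v)%C _ _ _ 1); [lra|intros; apply C_eq; unfold Re, Im, RtoC; simpl; ring|].
      replace (Cexp w - expsum N w)%C with (Cexp w + (0 * expsum (S N) w + RtoC (-1) * expsum N w))%C by (apply C_eq; unfold Re, Im, RtoC; simpl; ring).
      apply Cdiff_plus; [apply Cdiff_exp|]. apply (Cdiff_mult (fun _ => RtoC (-1)) (expsum (S N))); [apply Cdiff_const|apply Cdiff_expsum]. }
    assert (Hc : forall n w, continuous (E n) w).
    { intros n w. unfold E, expsum. apply cont_Cminus; [apply cont_Cexp, continuous_id|].
      induction n; cbn [Csum]; [apply continuous_const|]. apply cont_Cplus; [exact IHn|].
      apply cont_Cmult; [apply cont_Cpow, continuous_id|apply continuous_const]. }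
    assert (Hcl : ccont (fun t => E N (0 + RtoC t * v) * v)%C 0 1).
    { intros t _. apply cont_Cmult; [|apply continuous_const].
      apply (continuous_comp (fun t : R => (0 + RtoC t * v)%C) (E N)); [|apply Hc].
      apply cont_Cplus; [apply continuous_const|]. apply cont_Cmult; [apply cont_RtoC, continuous_id|apply continuous_const]. }
    assert (EI : CInt (fun t => E N (0 + RtoC t * v) * v)%C 0 1 = E (S N) v).
    { rewrite (CInt_derive (fun t => E (S N) (0 + RtoC t * v)%C)); try assumption.
      - replace (0 + RtoC 1 * v)%C with v by ring. replace (0 + RtoC 0 * v)%C with (RtoC 0) by ring.
        unfold E at 2. rewrite Cexp_0, expsum_0. ring.
      - intros t _. apply (Cdiff_line (E (S N)) 0 v _ t (HE _)).
      - intros t _. apply (Cdiff_line (E (S N)) 0 v _ t (HE _)). }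
    fold (E (S N) v). rewrite <- EI.
    replace (exp M * Cmod v ^ S N) with (exp M * Cmod v ^ S N * (1 - 0)) by ring.
    apply CInt_le_const; [lra|assumption|]. intros t Ht. rewrite Cmod_mult.
    replace (0 + RtoC t * v)%C with (RtoC t * v)%C by ring.
    assert (Hl : Cmod (RtoC t * v) <= Cmod v).
    { rewrite Cmod_mult, Cmod_R, Rabs_right by lra. pose proof (Cmod_ge_0 v). nra. }
    simpl pow. replace (exp M * (Cmod v * Cmod v ^ N)) with (exp M * Cmod v ^ N * Cmod v) by ring.
    apply Rmult_le_compat_r; [apply Cmod_ge_0|]. eapply Rle_trans; [apply IHN; lra|].
    apply Rmult_le_compat_l; [left; apply exp_pos|]. apply pow_incr. split; [apply Cmod_ge_0|assumption].
Qed.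

(** The case distinction on N adjusts to [sum_f_R0], which includes its upper index: N terms are
    those up to index N - 1. *)
Lemma asy_expsum m c N : asy m c -> asy (fun w => expsum N (m w))
  (fun n => match N with O => 0 | S M => sum_f_R0 (fun k => PS_power c k n / INR (fact k)) M end).
Proof.
  intros Hm. destruct N.
  - apply (asy_ext (fun w => RtoC 0 * RtoC 1)%C _ (fun n => 0 * PS_one n)); [intros; unfold expsum; cbn [Csum]; ring|intros; ring|].
    apply (asy_scal 0 (fun _ => RtoC 1)), asy_one.
  - induction N.
    + apply (asy_ext (fun w => RtoC (/ INR (fact 0)) * Cpow (m w) 0)%C _ (fun n => / INR (fact 0) * PS_power c 0 n)).
      * intros; unfold expsum; cbn [Csum]. ring.
      * intros; cbn [sum_f_R0]. unfold Rdiv; ring.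
      * apply (asy_scal _ (fun w => Cpow (m w) 0)), asy_pow, Hm.
    + apply (asy_ext (fun w => expsum (S N) (m w) + RtoC (/ INR (fact (S N))) * Cpow (m w) (S N))%C _
        (fun n => sum_f_R0 (fun k => PS_power c k n / INR (fact k)) N + / INR (fact (S N)) * PS_power c (S N) n)).
      * intros; unfold expsum. cbn [Csum]. ring.
      * intros; cbn [sum_f_R0]. unfold Rdiv; ring.
      * apply (asy_plus (fun w => expsum (S N) (m w)) (fun w => RtoC (/ INR (fact (S N))) * Cpow (m w) (S N))%C); [exact IHN|].
        apply (asy_scal _ (fun w => Cpow (m w) (S N))), asy_pow, Hm.
Qed.

Lemma sum_f_R0_tail_0 (f : nat -> R) n m : (n <= m)%nat -> (forall k, (n < k)%nat -> f k = 0) -> sum_f_R0 f m = sum_f_R0 f n.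
Proof.
  intros H H0. induction m.
  - now replace n with O by lia.
  - destruct (Nat.eq_dec n (S m)) as [->|]; [reflexivity|]. cbn [sum_f_R0]. rewrite IHm, H0 by lia. ring.
Qed.

(** As [c] has no constant term, m(w) = O(1/|w|), and the exponential series may be cut after N
    terms with an error O(|w|^(-N)). Powers m^k with k >= N contribute nothing to coefficients of
    index below N, so the cut leaves these intact. *)
Lemma asy_exp m c : c O = 0 -> asy m c -> asy (fun w => Cexp (m w)) (PS_exp c).
Proof.
  intros H0 Hm N.
  destruct (asy_bound m c Hm) as [M [HM HB]].
  destruct (Hm 1%nat) as [A [HA HmA]].
  destruct (asy_expsum m c N Hm N) as [K [HK HE]].
  exists (exp M * A ^ N + K). split.
  { pose proof (exp_pos M). pose proof (pow_le A N HA). pose proof (Rmult_le_pos _ _ (Rlt_le _ _ H) H1). lra. }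
  intros w Hw H1. specialize (HmA w Hw H1). specialize (HB w Hw H1). specialize (HE w Hw H1).
  unfold ipoly at 1 in HmA; cbn [Csum] in HmA. rewrite H0 in HmA.
  replace (m w - (0 + RtoC 0 * / Cpow w 0))%C with (m w) in HmA by (simpl; ring). rewrite pow_1 in HmA.
  pose proof (exp_taylor_C N M HM (m w) HB) as T.
  assert (Hpow : Cmod (m w) ^ N <= A ^ N * / Cmod w ^ N).
  { rewrite <- pow_inv, <- Rpow_mult_distr. apply pow_incr. split; [apply Cmod_ge_0|assumption]. }
  assert (Eq : ipoly (PS_exp c) N w = ipoly (fun n => match N with O => 0 | S M => sum_f_R0 (fun k => PS_power c k n / INR (fact k)) M end) N w).
  { apply Csum_ext. intros k Hk. destruct N; [lia|]. f_equal. f_equal. unfold PS_exp.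
    symmetry. apply sum_f_R0_tail_0; [lia|]. intros j Hj. rewrite PS_power_low by (assumption || lia). unfold Rdiv; ring. }
  rewrite Eq. match goal with |- Cmod (?x - ?y) <= _ => replace (x - y)%C with ((x - expsum N (m w)) + (expsum N (m w) - y))%C by ring end.
  eapply Rle_trans; [apply Cmod_triangle|]. rewrite Rmult_plus_distr_r. apply Rplus_le_compat; [|exact HE].
  eapply Rle_trans; [exact T|]. rewrite Rmult_assoc. apply Rmult_le_compat_l; [left; apply exp_pos|exact Hpow].
Qed.

(** * Parity of the Binet expansion and the expansions of Phi and Psi *)

Lemma exp_pow x n : exp x ^ n = exp (INR n * x).
Proof.
  induction n; [simpl; rewrite Rmult_0_l, exp_0; reflexivity|].
  rewrite S_INR. simpl pow. rewrite IHn, <- exp_plus. f_equal. ring.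
Qed.

Lemma pow_le_exp m s : 0 <= s -> s ^ S m <= INR (S m) ^ S m * exp s.
Proof.
  intros Hs. assert (Hm : 0 < INR (S m)) by (apply lt_0_INR; lia).
  replace (exp s) with (exp (s / INR (S m)) ^ S m) by (rewrite exp_pow; f_equal; field; lra).
  rewrite <- Rpow_mult_distr. apply pow_incr. split; [assumption|].
  replace s with (INR (S m) * (s / INR (S m))) at 1 by (field; lra).
  apply Rmult_le_compat_l; [lra|]. pose proof (exp_ineq1_le (s / INR (S m))). lra.
Qed.

(** The reflection formula gives exp(2 Re mu) = 1/(1 - q) with q = exp(-2 pi s), and q <= 1/2 for s
    >= 1, so this lies between 1 and 1 + 2q. *)
Lemma Re_mu_imag s : 1 <= s -> 0 <= Re (mu (0, s)) <= exp (- s).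
Proof.
  intros Hs. pose proof (exp_mu_imag s ltac:(lra)) as E. pose proof PI2_1.
  set (q := exp (- (2 * PI * s))) in *.
  assert (Hq0 : 0 < q) by apply exp_pos.
  assert (Hq : q <= 1 / 2).
  { unfold q. rewrite exp_Ropp. replace (1 / 2) with (/ 2) by field. apply Rinv_le_contravar; [lra|].
    pose proof (exp_ineq1_le (2 * PI * s)). nra. }
  assert (Hqs : q <= exp (- s)) by (apply exp_mono; nra).
  set (m := Re (mu (0, s))) in *.
  assert (H1 : 1 <= exp (2 * m)).
  { rewrite E. apply Rle_trans with (/ 1); [lra|]. apply Rinv_le_contravar; lra. }
  split.
  - destruct (Rle_dec 0 m); [assumption|]. assert (exp (2 * m) < exp 0) by (apply exp_increasing; lra). rewrite exp_0 in *. lra.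
  - pose proof (exp_ineq1_le (2 * m)).
    assert (/ (1 - q) <= 1 + 2 * q).
    { apply Rmult_le_reg_r with (1 - q); [lra|]. rewrite Rinv_l by lra. nra. }
    lra.
Qed.

Lemma Cpow_imag_even s i : Cpow (0, s) (2 * i) = RtoC ((- s ^ 2) ^ i).
Proof.
  induction i; [reflexivity|]. replace (2 * S i)%nat with (S (S (2 * i))) by lia.
  cbn [Cpow]. rewrite IHi. apply C_eq; unfold Re, Im, RtoC; simpl; ring.
Qed.

Lemma Re_ipoly_term_odd a s k : Nat.odd k = true -> Re (RtoC a * / Cpow (0, s) k)%C = 0.
Proof.
  intros Hk. apply Nat.odd_spec in Hk. destruct Hk as [i ->].
  replace (2 * i + 1)%nat with (S (2 * i)) by lia. cbn [Cpow]. rewrite Cpow_imag_even.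
  replace ((0%R, s) * RtoC ((- s ^ 2) ^ i))%C with ((0%R, (s * (- s ^ 2) ^ i)%R) : C) by (apply C_eq; unfold Re, Im, RtoC; simpl; ring).
  rewrite Cinv_pair. unfold Re, RtoC; cbn [fst snd Cmult]. unfold Rdiv. ring.
Qed.

Lemma Re_ipoly_term_even a s i : 0 < s -> Re (RtoC a * / Cpow (0, s) (2 * i))%C = a * / (- s ^ 2) ^ i.
Proof.
  intros Hs. rewrite Cpow_imag_even. rewrite <- RtoC_inv, <- RtoC_mult; [reflexivity|].
  apply pow_nonzero. assert (0 < s ^ 2) by (now apply pow_lt). lra.
Qed.

(* On the imaginary axis [Re mu] is exponentially small, which kills the even
   coefficients, that is, the Bernoulli numbers of odd index. *)
Lemma binet_coef_even j : binet_coef (2 * j) = 0.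
Proof.
  induction j as [j IH] using (well_founded_induction lt_wf).
  destruct (mu_asy (S (2 * j))) as [K [HK HA]].
  set (L := INR (S (2 * j)) ^ S (2 * j)).
  assert (HL : 0 <= L) by (apply pow_le, pos_INR).
  (* On the axis odd powers of 1/w are imaginary, and the lower even coefficients vanish by
     induction, so the real part of the truncation is its last term alone. *)
  assert (Hre : forall s, 0 < s -> Re (ipoly binet_coef (S (2 * j)) (0, s)) = binet_coef (2 * j) * / (- s ^ 2) ^ j).
  { intros s Hs. unfold ipoly. cbn [Csum].
    assert (Z : forall n, (n <= 2 * j)%nat -> Re (Csum (fun k => RtoC (binet_coef k) * / Cpow (0, s) k)%C n) = 0).
    { induction n; intros Hn; [reflexivity|]. cbn [Csum].
      change (Re (Csum (fun k => RtoC (binet_coef k) * / Cpow (0%R, s) k)%C n) + Re (RtoC (binet_coef n) * / Cpow (0%R, s) n)%C = 0).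
      rewrite IHn by lia. rewrite Rplus_0_l. destruct (Nat.odd n) eqn:En; [now apply Re_ipoly_term_odd|].
      rewrite <- Nat.negb_even in En. apply Bool.negb_false_iff in En. apply Nat.even_spec in En. destruct En as [i ->].
      rewrite IH by lia. rewrite Re_ipoly_term_even by assumption. ring. }
    match goal with |- Re (?x + ?y)%C = _ => change (Re x + Re y = binet_coef (2 * j) * / (- s ^ 2) ^ j) end.
    rewrite Z, Re_ipoly_term_even by (assumption || lia). ring. }
  apply eq_of_small. rewrite Rminus_0_r. intros eps He.
  set (s := 1 + (K + L) / eps).
  assert (Hs0 : 0 <= (K + L) / eps) by (apply Rmult_le_pos; [lra|left; now apply Rinv_0_lt_compat]).
  assert (Hs : 1 <= s) by (unfold s; lra).
  assert (Hm : Cmod (0, s) = s).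
  { unfold Cmod; cbn [fst snd]. replace (0 ^ 2 + s ^ 2) with (Rsqr s) by (unfold Rsqr; ring). apply sqrt_Rsqr; lra. }
  specialize (HA (0, s) (RHc_imag s ltac:(lra)) ltac:(rewrite Hm; lra)). rewrite Hm in HA.
  pose proof (re_le_Cmod (mu (0, s) - ipoly binet_coef (S (2 * j)) (0, s))) as R.
  change (Re (mu (0%R, s) - ipoly binet_coef (S (2 * j)) (0%R, s))%C) with (Re (mu (0, s)) - Re (ipoly binet_coef (S (2 * j)) (0, s))) in R.
  rewrite Hre in R by lra.
  pose proof (Re_mu_imag s Hs) as M.
  assert (Q : Rabs (binet_coef (2 * j) * / (- s ^ 2) ^ j) <= exp (- s) + K * / s ^ S (2 * j)).
  { assert (R2 : Rabs (Re (mu (0, s)) - binet_coef (2 * j) * / (- s ^ 2) ^ j) <= K * / s ^ S (2 * j)) by lra.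
    apply Rabs_le_between in R2. apply Rabs_le. lra. }
  assert (HP : 0 < s ^ (2 * j)) by (apply pow_lt; lra).
  assert (Habs : Rabs (binet_coef (2 * j) * / (- s ^ 2) ^ j) = Rabs (binet_coef (2 * j)) * / s ^ (2 * j)).
  { rewrite Rabs_mult. f_equal. rewrite Rabs_inv by (apply pow_nonzero; nra). rewrite <- RPow_abs, Rabs_Ropp, pow_mult. f_equal. f_equal. apply Rabs_right. nra. }
  rewrite Habs in Q.
  pose proof (pow_le_exp (2 * j) s ltac:(lra)) as PE. fold L in PE.
  assert (Hes : exp (- s) <= L * / s ^ S (2 * j)).
  { rewrite exp_Ropp. pose proof (exp_pos s). assert (0 < s ^ S (2 * j)) by (apply pow_lt; lra).
    apply Rmult_le_reg_r with (exp s * s ^ S (2 * j)); [now apply Rmult_lt_0_compat|].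
    replace (/ exp s * (exp s * s ^ S (2 * j))) with (s ^ S (2 * j)) by (field; lra).
    replace (L * / s ^ S (2 * j) * (exp s * s ^ S (2 * j))) with (L * exp s) by (field; lra). exact PE. }
  assert (F : Rabs (binet_coef (2 * j)) <= (K + L) * / s).
  { apply Rmult_le_reg_r with (/ s ^ (2 * j)); [now apply Rinv_0_lt_compat|].
    replace ((K + L) * / s * / s ^ (2 * j)) with ((K + L) * / s ^ S (2 * j)) by (cbn [pow]; field; lra). lra. }
  eapply Rle_trans; [exact F|]. apply Rmult_le_reg_r with s; [lra|]. rewrite Rmult_assoc, Rinv_l, Rmult_1_r by lra.
  unfold s. replace (eps * (1 + (K + L) / eps)) with (eps + (K + L)) by (field; lra). lra.
Qed.

Lemma stirling_log_binet k : stirling_log k = binet_coef k.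
Proof.
  unfold stirling_log. destruct (Nat.odd k) eqn:E.
  - destruct k; [discriminate|]. cbn [binet_coef]. replace (S k + 1)%nat with (S (S k)) by lia. f_equal. ring.
  - rewrite <- Nat.negb_even in E. apply Bool.negb_false_iff in E. apply Nat.even_spec in E. destruct E as [i ->].
    now rewrite binet_coef_even.
Qed.

Lemma PS_exp_ext a b n : (forall k, a k = b k) -> PS_exp a n = PS_exp b n.
Proof.
  intros H. unfold PS_exp. apply sum_eq. intros k _. f_equal. revert n.
  induction k; intros n; [reflexivity|]. cbn [PS_power]. unfold PS_mult. apply sum_eq. intros i _. now rewrite H, IHk.
Qed.

Lemma PS_exp_alt a n : PS_exp (fun k => (-1) ^ k * a k) n = (-1) ^ n * PS_exp a n.
Proof.
  unfold PS_exp. rewrite scal_sum. apply sum_eq. intros k _.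
  replace (PS_power (fun k0 => (-1) ^ k0 * a k0) k n) with ((-1) ^ n * PS_power a k n); [unfold Rdiv; ring|].
  revert n. induction k; intros n; cbn [PS_power].
  - destruct n; cbn [PS_one]; simpl; ring.
  - unfold PS_mult. rewrite scal_sum. apply sum_eq. intros i Hi. rewrite <- IHk.
    replace ((-1) ^ n) with ((-1) ^ i * (-1) ^ (n - i)) by (rewrite <- pow_add; f_equal; lia). ring.
Qed.

Definition Phi (w : C) : C := Cexp (mu w).
Definition Psi (w : C) : C := Cexp (- mu w).

Lemma Phi_asy : asy Phi (fun n => (-1) ^ n * stirling_coef n).
Proof.
  apply (asy_ext Phi _ (PS_exp binet_coef)); [reflexivity| |apply asy_exp; [reflexivity|apply mu_asy]].
  intros n. unfold stirling_coef. rewrite (PS_exp_ext _ _ _ stirling_log_binet).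
  rewrite <- Rmult_assoc, <- Rpow_mult_distr. replace (-1 * -1) with 1 by ring. rewrite pow1. ring.
Qed.

(** With its even coefficients gone, the formal series of mu is odd. Negating it amounts to
    substituting -x for x, which removes the alternating signs from the expansion of Phi. *)
Lemma Psi_asy : asy Psi stirling_coef.
Proof.
  apply (asy_ext (fun w => Cexp (RtoC (-1) * mu w)) _ (PS_exp (fun k => (-1) * binet_coef k))).
  - intros w _. unfold Psi. f_equal. apply C_eq; unfold Re, Im, RtoC; simpl; ring.
  - intros n. unfold stirling_coef. rewrite (PS_exp_ext _ _ _ stirling_log_binet), <- PS_exp_alt.
    apply PS_exp_ext. intros k. destruct (Nat.odd k) eqn:E.
    + apply Nat.odd_spec in E. destruct E as [i ->]. rewrite pow_add, pow_mult. replace ((-1) ^ 2) with 1 by ring. rewrite pow1. ring.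
    + rewrite <- Nat.negb_even in E. apply Bool.negb_false_iff in E. apply Nat.even_spec in E. destruct E as [i ->].
      rewrite binet_coef_even. ring.
  - apply asy_exp; [cbn [binet_coef]; ring|]. apply asy_scal, mu_asy.
Qed.

(** * The remainder as an integral along two rays *)

(* An upper integral over [(0, +oo)] at most [B]: [f] itself may be discontinuous at 0. *)
Definition majorized (f : R -> R) (B : R) :=
  forall eps, 0 < eps -> exists g : R -> R,
    (forall s, continuous g s) /\ (forall s, 0 <= s -> 0 <= g s) /\
    (forall s, 0 < s -> f s <= g s) /\ (forall T, 0 < T -> RInt g 0 T <= B + eps).

(** The square-root companion of [cont_0_lin]: w Phi(w) tends to 0 only like |w|^(1/2). *)
Lemma cont_0_sqrt (f : C -> C) (K d : R) : 0 < d -> f (RtoC 0) = RtoC 0 ->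
  (forall w, w <> RtoC 0 -> Cmod w < d -> Cmod (f w) ^ 2 <= K * Cmod w) -> continuous f (RtoC 0).
Proof.
  intros Hd H0 H. apply cont_eps. intros eps He.
  pose proof (Rabs_pos K). assert (He2 : 0 < eps ^ 2) by (now apply pow_lt).
  exists (Rmin d (eps ^ 2 / (Rabs K + 1))). split.
  - apply Rmin_pos; [assumption|]. apply Rdiv_lt_0_compat; lra.
  - intros v Hv. replace (v - RtoC 0)%C with v in Hv by ring. rewrite H0.
    replace (f v - RtoC 0)%C with (f v) by ring.
    destruct (classic (v = RtoC 0)) as [->|Hn]; [rewrite H0, Cmod_0; assumption|].
    assert (V1 : Cmod v < eps ^ 2 / (Rabs K + 1)) by (eapply Rlt_le_trans; [exact Hv|apply Rmin_r]).
    assert (V2 : Cmod v < d) by (eapply Rlt_le_trans; [exact Hv|apply Rmin_l]).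
    specialize (H v Hn V2). pose proof (Cmod_ge_0 v). pose proof (Rle_abs K). pose proof (Cmod_ge_0 (f v)).
    assert (L : Cmod (f v) ^ 2 < eps ^ 2).
    { eapply Rle_lt_trans; [exact H|]. apply Rle_lt_trans with ((Rabs K + 1) * Cmod v); [apply Rmult_le_compat_r; lra|].
      replace (eps ^ 2) with ((Rabs K + 1) * (eps ^ 2 / (Rabs K + 1))) by (field; lra).
      apply Rmult_lt_compat_l; lra. }
    nra.
Qed.

Lemma Cmod_Im_axis s : Cmod (0, s) = Rabs s.
Proof.
  unfold Cmod; cbn [fst snd]. replace (0 ^ 2 + s ^ 2) with (Rsqr s) by (unfold Rsqr; ring). apply sqrt_Rsqr_abs.
Qed.

(** The partial sum with M + 1 terms, multiplied by w^M and written as a polynomial, so that it is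
    holomorphic at 0 too. *)
Definition qpoly (a : nat -> R) (M : nat) (w : C) : C := Csum (fun k => RtoC (a k) * Cpow w (M - k))%C (S M).

Lemma qpoly_ipoly a M w : w <> RtoC 0 -> qpoly a M w = (Cpow w M * ipoly a (S M) w)%C.
Proof.
  intros Hw. unfold qpoly, ipoly. rewrite <- Csum_cmult. apply Csum_ext. intros k Hk.
  replace (Cpow w M) with (Cpow w (M - k) * Cpow w k)%C.
  - field. now apply Cpow_nz.
  - rewrite <- Cpow_add_r. f_equal. lia.
Qed.

Lemma Cpow_opp w n : Cpow (- w) n = (RtoC ((-1) ^ n) * Cpow w n)%C.
Proof.
  induction n; simpl; [ring|]. rewrite IHn, RtoC_mult. apply C_eq; destruct w; unfold Re, Im, RtoC; simpl; ring.
Qed.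

Lemma qpoly_alt a M w : qpoly (fun k => (-1) ^ k * a k) M (- w) = (RtoC ((-1) ^ M) * qpoly a M w)%C.
Proof.
  unfold qpoly. rewrite <- Csum_cmult. apply Csum_ext. intros k Hk. rewrite Cpow_opp, RtoC_mult.
  replace ((-1) ^ M) with ((-1) ^ k * (-1) ^ (M - k)) by (rewrite <- pow_add; f_equal; lia). rewrite RtoC_mult. ring.
Qed.

Lemma qpoly_cont a M w : continuous (qpoly a M) w.
Proof.
  unfold qpoly. generalize (S M). intros n. induction n; cbn [Csum]; [apply continuous_const|].
  apply cont_Cplus; [exact IHn|]. apply cont_Cmult; [apply continuous_const|apply cont_Cpow, continuous_id].
Qed.

Lemma qpoly_hol U a M : hol U (qpoly a M).
Proof.
  unfold qpoly. generalize (S M). intros n. induction n; cbn [Csum]; [apply hol_const|].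
  apply hol_plus; [exact IHn|]. apply hol_mult; [apply hol_const|apply (hol_pow _ (fun w => w)), hol_id].
Qed.

Lemma qpoly_bound a M : exists L, 0 <= L /\ forall w : C, Cmod w <= 1 -> Cmod (qpoly a M w) <= L.
Proof.
  unfold qpoly. generalize (S M). intros n. induction n.
  - exists 0. split; [lra|]. intros w _. cbn [Csum]. rewrite Cmod_0; lra.
  - destruct IHn as [L [HL H]]. pose proof (Rabs_pos (a n)). exists (L + Rabs (a n)). split; [lra|].
    intros w Hw. cbn [Csum]. eapply Rle_trans; [apply Cmod_triangle|]. apply Rplus_le_compat; [now apply H|].
    rewrite Cmod_mult, Cmod_R, Cmod_pow. rewrite <- (Rmult_1_r (Rabs (a n))) at 2. apply Rmult_le_compat_l; [assumption|].
    rewrite <- (pow1 (M - n)). apply pow_incr. split; [apply Cmod_ge_0|assumption].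
Qed.

Section Axis.
Variables (F : C -> C) (a : nat -> R) (M : nat).
Hypothesis F_hol : hol RH F.
Hypothesis F_cont : forall w, w <> RtoC 0 -> continuous F w.
Hypothesis F_asy : asy F a.
Hypothesis F_near0 : exists K, 0 <= K /\ forall w, w <> RtoC 0 -> Cmod w <= 1 -> Cmod (F w) ^ 2 * Cmod w <= K.

(** From here on M stands for N - 2, so this is w^(N-1) R_N(w). The factor removes the pole of the
    partial sum, and containing at least one power of w it forces continuity at 0 despite the growth
    of Phi. At infinity it leaves the decay 1/|w| required by [half_plane_cauchy]. *)
Definition Hrem (w : C) : C := (Cpow w (S M) * F w - qpoly a (S M) w)%C.

Lemma pow_F_near0 : exists K, 0 <= K /\ forall w, w <> RtoC 0 -> Cmod w <= 1 -> Cmod (Cpow w (S M) * F w) ^ 2 <= K * Cmod w.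
Proof.
  destruct F_near0 as [K [HK H]]. exists K. split; [assumption|]. intros w Hn H1. specialize (H w Hn H1).
  pose proof (Cmod_ge_0 w). pose proof (Cmod_ge_0 (F w)).
  rewrite Cmod_mult, Cmod_pow. simpl pow.
  assert (P : 0 <= Cmod w ^ M <= 1).
  { split; [now apply pow_le|]. rewrite <- (pow1 M). apply pow_incr; lra. }
  set (p := Cmod w ^ M) in *. set (r := Cmod w) in *. set (f := Cmod (F w)) in *.
  replace (r * p * f * (r * p * f * 1)) with ((p * p) * (f ^ 2 * r) * r) by ring.
  apply Rmult_le_compat_r; [assumption|]. rewrite <- (Rmult_1_l K).
  apply Rmult_le_compat; nra.
Qed.

Lemma Hrem_hol : hol RH Hrem.
Proof.
  unfold Hrem. apply hol_minus; [|apply qpoly_hol]. apply hol_mult; [apply (hol_pow _ (fun w => w)), hol_id|assumption].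
Qed.

Lemma Hrem_cont w : continuous Hrem w.
Proof.
  unfold Hrem. apply cont_Cminus; [|apply qpoly_cont].
  destruct (classic (w = RtoC 0)) as [->|Hn].
  - destruct pow_F_near0 as [K [HK H]]. apply (cont_0_sqrt _ K 1); [lra|simpl; ring|]. intros w Hn H1. apply H; [assumption|lra].
  - apply cont_Cmult; [apply cont_Cpow, continuous_id|now apply F_cont].
Qed.

Lemma Hrem_bound : exists C0, 0 <= C0 /\ forall w, 0 <= Re w -> Cmod (Hrem w) * (1 + Cmod w) <= C0.
Proof.
  destruct pow_F_near0 as [K [HK H0]]. destruct (qpoly_bound a (S M)) as [L [HL HqL]].
  destruct (F_asy (S (S M))) as [A [HA HF]].
  exists (2 * (1 + K + L) + 2 * A). split; [lra|]. intros w Hw. pose proof (Cmod_ge_0 w) as Hr.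
  destruct (Rle_dec (Cmod w) 1) as [H1|H1].
  - assert (B : Cmod (Hrem w) <= 1 + K + L).
    { unfold Hrem. eapply Rle_trans; [apply Cmod_triangle_sub|]. apply Rplus_le_compat; [|now apply HqL].
      destruct (classic (w = RtoC 0)) as [->|Hn].
      - replace (Cpow 0 (S M) * F 0)%C with (RtoC 0) by (simpl; ring). rewrite Cmod_0. lra.
      - specialize (H0 w Hn H1). set (e := Cmod (Cpow w (S M) * F w)) in *. assert (0 <= e) by apply Cmod_ge_0. nra. }
    pose proof (Cmod_ge_0 (Hrem w)).
    assert (Cmod (Hrem w) * (1 + Cmod w) <= (1 + K + L) * 2) by (apply Rmult_le_compat; lra). lra.
  - assert (Hn : w <> RtoC 0) by (apply Cmod_pos_neq; lra).
    specialize (HF w (conj Hw Hn) ltac:(lra)).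
    assert (E : Hrem w = (Cpow w (S M) * (F w - ipoly a (S (S M)) w))%C).
    { unfold Hrem. rewrite qpoly_ipoly by assumption. ring. }
    assert (B : Cmod (Hrem w) <= A * / Cmod w).
    { rewrite E, Cmod_mult, Cmod_pow. apply Rle_trans with (Cmod w ^ S M * (A * / Cmod w ^ S (S M))).
      - apply Rmult_le_compat_l; [now apply pow_le|assumption].
      - right. simpl. field. repeat split; try apply pow_nonzero; lra. }
    assert (A * / Cmod w * (1 + Cmod w) <= 2 * A).
    { replace (A * / Cmod w * (1 + Cmod w)) with (A * (1 + / Cmod w)) by (field; lra).
      assert (/ Cmod w <= 1) by (apply Rle_trans with (/ 1); [apply Rinv_le_contravar; lra|lra]). nra. }
    assert (Cmod (Hrem w) * (1 + Cmod w) <= A * / Cmod w * (1 + Cmod w)) by (apply Rmult_le_compat_r; lra). lra.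
Qed.
End Axis.

Lemma Ropp_involutive_m1 (X : R) : - (-1 * X) = X.
Proof. ring. Qed.

Lemma CInt_neg (f : R -> C) a b : (forall s, continuous f s) ->
  CInt (fun s => f (- s)) a b = CInt f (- b) (- a).
Proof.
  intros Hf.
  assert (P : forall g : R -> R, (forall s, continuous g s) -> RInt (fun s => g (- s)) a b = RInt g (- b) (- a)).
  { intros g Hg. 
    assert (ex : forall u v, ex_RInt g u v) by (intros; apply (ex_RInt_continuous (V:=R_CompleteNormedModule)); intros; apply Hg).
    pose proof (RInt_comp_lin (V:=R_CompleteNormedModule) g (-1) 0 a b (ex _ _)) as E.
    replace (-1 * a + 0) with (- a) in E by ring. replace (-1 * b + 0) with (- b) in E by ring.
    rewrite <- (opp_RInt_swap (V:=R_CompleteNormedModule) g (- a) (- b)) by apply ex. rewrite <- E.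
    rewrite (RInt_scal (V:=R_CompleteNormedModule) (fun y => g (-1 * y + 0))).
    - rewrite (RInt_ext (fun s => g (- s)) (fun y => g (-1 * y + 0))) by (intros; f_equal; ring).
      set (X := RInt (fun y => g (-1 * y + 0)) a b). exact (eq_sym (Ropp_involutive_m1 X)).
    - apply (ex_RInt_continuous (V:=R_CompleteNormedModule)). intros s _.
      apply (continuous_comp (fun y => -1 * y + 0) g); [|apply Hg].
      apply (ex_derive_continuous (fun y => -1 * y + 0)). auto_derive; trivial. }
  unfold CInt. f_equal.
  - apply (P (fun s => Re (f s))). intros s. now apply cont_Re.
  - apply (P (fun s => Im (f s))). intros s. now apply cont_Im.
Qed.

Lemma Cpair_opp s : (- (0%R, s))%C = (0, - s).
Proof. apply C_eq; unfold Re, Im; simpl; ring. Qed.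

Lemma alt_alt (a : nat -> R) k : (-1) ^ k * ((-1) ^ k * a k) = a k.
Proof. rewrite <- Rmult_assoc, <- Rpow_mult_distr. replace (-1 * -1) with 1 by ring. rewrite pow1. ring. Qed.

Section AxisFormula.
Variables (F1 F2 : C -> C) (a : nat -> R) (M : nat) (z : C).
Hypothesis F1_hol : hol RH F1.
Hypothesis F2_hol : hol RH F2.
Hypothesis F1_cont : forall w, w <> RtoC 0 -> continuous F1 w.
Hypothesis F2_cont : forall w, w <> RtoC 0 -> continuous F2 w.
Hypothesis F1_asy : asy F1 a.
Hypothesis F2_asy : asy F2 (fun n => (-1) ^ n * a n).
Hypothesis F1_near0 : exists K, 0 <= K /\ forall w, w <> RtoC 0 -> Cmod w <= 1 -> Cmod (F1 w) ^ 2 * Cmod w <= K.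
Hypothesis F2_near0 : exists K, 0 <= K /\ forall w, w <> RtoC 0 -> Cmod w <= 1 -> Cmod (F2 w) ^ 2 * Cmod w <= K.
Hypothesis z_in : RH z.

Definition jump (s : R) : C := (Cpow (0%R, s) (S M) * (F1 (0%R, s) - F2 (0%R, (- s)%R)) * / ((0%R, s) - z))%C.

Lemma axis_ne s : ((0%R, s) - z)%C <> RtoC 0.
Proof.
  intros E. apply (f_equal Re) in E. unfold RH in z_in. unfold Re, RtoC in *; simpl in *. lra.
Qed.

Lemma axis_ne' s : ((0%R, s) + z)%C <> RtoC 0.
Proof.
  intros E. apply (f_equal Re) in E. unfold RH in z_in. unfold Re, RtoC in *; simpl in *. lra.
Qed.

Let H1 := Hrem F1 a M.
Let H2 := Hrem F2 (fun n => (-1) ^ n * a n) M.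

Lemma H2_neg s : (H2 (0%R, (- s)%R) = RtoC ((-1) ^ S M) * (Cpow (0%R, s) (S M) * F2 (0%R, (- s)%R) - qpoly a (S M) (0%R, s)))%C.
Proof.
  unfold H2, Hrem. rewrite <- Cpair_opp, Cpow_opp, qpoly_alt. ring.
Qed.

(** As the coefficients of the two functions differ by the sign (-1)^n, their polynomials cancel.
    Each summand on the right is the boundary value of a decaying holomorphic function, one for each
    side of the axis. *)
Lemma jump_eq s : (jump s = H1 (0%R, s) * / ((0%R, s) - z) + RtoC ((-1) ^ S M) * (H2 (0%R, (- s)%R) * / ((0%R, (- s)%R) + z)))%C.
Proof.
  rewrite H2_neg. unfold H1, Hrem, jump.
  replace ((0%R, (- s)%R) + z)%C with (- ((0%R, s) - z))%C by (apply C_eq; unfold Re, Im; simpl; ring).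
  assert (E : (RtoC ((-1) ^ S M) * RtoC ((-1) ^ S M) = 1)%C).
  { rewrite <- RtoC_mult, <- Rpow_mult_distr. replace (-1 * -1) with 1 by ring. now rewrite pow1. }
  pose proof (axis_ne s) as Hn.
  set (e := RtoC ((-1) ^ S M)) in *. set (d := ((0%R, s) - z)%C) in *.
  set (P := Cpow (0%R, s) (S M)). set (Q := qpoly a (S M) (0%R, s)). set (A := F1 (0%R, s)). set (B := F2 (0%R, (- s)%R)).
  assert (Hn2 : (- d)%C <> RtoC 0).
  { intros Z. apply Hn. replace d with (- - d)%C by ring. rewrite Z. ring. }
  replace (/ - d)%C with (- / d)%C by (field; assumption).
  replace (e * (e * (P * B - Q) * - / d))%C with (e * e * ((P * B - Q) * - / d))%C by ring. rewrite E. ring.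
Qed.

Lemma jump_cont s : continuous jump s.
Proof.
  apply (continuous_ext (fun s => H1 (0%R, s) * / ((0%R, s) - z) + RtoC ((-1) ^ S M) * (H2 (0%R, (- s)%R) * / ((0%R, (- s)%R) + z)))%C);
    [intros; symmetry; apply jump_eq|].
  assert (c1 : continuous (fun s : R => ((0%R, s) : C)) s) by (apply cont_pair; [apply continuous_const|apply continuous_id]).
  assert (c2 : continuous (fun s : R => ((0%R, (- s)%R) : C)) s).
  { apply cont_pair; [apply continuous_const|]. apply (ex_derive_continuous (fun s : R => - s)). auto_derive; trivial. }
  apply cont_Cplus.
  - apply cont_Cmult; [apply (continuous_comp _ H1); [exact c1|now apply Hrem_cont]|].
    apply cont_Cinv; [|apply axis_ne]. apply cont_Cminus; [exact c1|apply continuous_const].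
  - apply cont_Cmult; [apply continuous_const|].
    apply cont_Cmult; [apply (continuous_comp _ H2); [exact c2|now apply Hrem_cont]|].
    apply cont_Cinv; [|apply axis_ne']. apply cont_Cplus; [exact c2|apply continuous_const].
Qed.

Lemma axis_formula : exists K Y0, 0 <= K /\ forall Y, Y0 <= Y -> 1 <= Y ->
  Cmod (RtoC (2 * PI) * H1 z + CInt jump (Im z - Y) (Im z + Y)) <= K / Y.
Proof.
  destruct (Hrem_bound F1 a M F1_asy F1_near0) as [C1 [HC1 B1]].
  destruct (Hrem_bound F2 (fun n => (-1) ^ n * a n) M F2_asy F2_near0) as [C2 [HC2 B2]].
  fold H1 in B1. fold H2 in B2.
  exists (10 * C1 + 10 * C2), (Re z + 2 * Rabs (Im z)). split; [lra|]. intros Y HY HY1.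
  assert (Hx : 0 < Re z) by exact z_in. pose proof (Rabs_pos (Im z)).
  pose proof (half_plane_cauchy H1 z C1 (Hrem_hol F1 a M F1_hol) (fun w _ => Hrem_cont F1 a M F1_cont F1_near0 w) B1 z_in Y
    HY1 ltac:(lra) ltac:(lra)) as A1.
  (* the second function is evaluated at the conjugate point, where it vanishes *)
  set (zb := Cconj z).
  assert (HnR : forall w, 0 <= Re w -> (w + z)%C <> RtoC 0).
  { intros w Hw E. apply (f_equal Re) in E. unfold Re, RtoC in *; simpl in *. lra. }
  (* In the half-plane |w - zb| <= |w + z|, so the quotient preserves the bound on H2, and division
     by w - zb in Cauchy's formula leaves H2(w)/(w + z). The window around Im zb becomes the one
     around Im z when s is replaced by -s. *)
  set (f2 := fun w => (H2 w * ((w - zb) * / (w + z)))%C).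
  assert (zb_in : RH zb) by exact z_in.
  assert (f2_hol : hol RH f2).
  { unfold f2. apply hol_mult; [now apply Hrem_hol|]. apply hol_mult.
    - apply hol_minus; [apply hol_id|apply hol_const].
    - apply hol_inv; [apply hol_plus; [apply hol_id|apply hol_const]|]. intros w Hw. apply HnR. unfold RH in Hw; lra. }
  assert (f2_cont : forall w, 0 <= Re w -> continuous f2 w).
  { intros w Hw. unfold f2. apply cont_Cmult; [now apply Hrem_cont|]. apply cont_Cmult.
    - apply cont_Cminus; [apply continuous_id|apply continuous_const].
    - apply cont_Cinv; [apply cont_Cplus; [apply continuous_id|apply continuous_const]|now apply HnR]. }
  assert (f2_bd : forall w, 0 <= Re w -> Cmod (f2 w) * (1 + Cmod w) <= C2).
  { intros w Hw. eapply Rle_trans; [|now apply (B2 w)]. unfold f2. rewrite !Cmod_mult, Cmod_inv by now apply HnR.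
    pose proof (Cmod_ge_0 w). apply Rmult_le_compat_r; [lra|].
    rewrite <- (Rmult_1_r (Cmod (H2 w))) at 2. apply Rmult_le_compat_l; [apply Cmod_ge_0|].
    pose proof (proj1 (Cmod_gt_0 _) (HnR w Hw)) as Hp.
    apply Rmult_le_reg_r with (Cmod (w + z)); [assumption|]. rewrite Rmult_assoc, Rinv_l, Rmult_1_r, Rmult_1_l by lra.
    unfold Cmod. apply sqrt_le_1_alt. unfold zb, Re in *; simpl. nra. }
  pose proof (half_plane_cauchy f2 zb C2 f2_hol f2_cont f2_bd zb_in Y HY1) as A2.
  assert (Ezb : Re zb = Re z /\ Im zb = - Im z) by (split; reflexivity). destruct Ezb as [Ez1 Ez2].
  rewrite Ez1, Ez2, Rabs_Ropp in A2. specialize (A2 ltac:(lra) ltac:(lra)).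
  replace (f2 zb) with (RtoC 0) in A2 by (unfold f2; ring). rewrite Cmult_0_r, Cplus_0_l in A2.
  assert (nzb : forall s, ((0%R, s) - zb)%C <> RtoC 0).
  { intros s E. apply (f_equal Re) in E. unfold zb, Re, RtoC in *; simpl in *. lra. }
  set (k := fun s : R => (H2 (0%R, s) * / ((0%R, s) + z))%C).
  assert (k_cont : forall s, continuous k s).
  { intros s. unfold k. apply (cont_vert (fun w => H2 w * / (w + z))%C). apply cont_Cmult; [now apply Hrem_cont|].
    apply cont_Cinv; [|apply axis_ne']. apply cont_Cplus; [apply continuous_id|apply continuous_const]. }
  rewrite (CInt_ext _ k) in A2.
  2:{ intros s _. unfold f2, k. field. split; [apply axis_ne'|apply nzb]. }
  replace (- Im z - Y) with (- (Im z + Y)) in A2 by ring. replace (- Im z + Y) with (- (Im z - Y)) in A2 by ring.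
  rewrite <- CInt_neg in A2 by exact k_cont.
  assert (cn : forall s, continuous (fun s => k (- s)) s).
  { intros s. apply (continuous_comp (fun s : R => - s) k); [|apply k_cont].
    apply (ex_derive_continuous (fun s : R => - s)). auto_derive; trivial. }
  assert (Ej : CInt jump (Im z - Y) (Im z + Y) = (CInt (fun s => H1 (0%R, s) * / ((0%R, s) - z)) (Im z - Y) (Im z + Y)
      + RtoC ((-1) ^ S M) * CInt (fun s => k (- s)%R) (Im z - Y) (Im z + Y))%C).
  { rewrite (CInt_ext jump (fun s => H1 (0%R, s) * / ((0%R, s) - z) + RtoC ((-1) ^ S M) * k (- s)%R)%C) by (intros; apply jump_eq).
    rewrite (CInt_plus (fun s => H1 (0%R, s) * / ((0%R, s) - z))%C (fun s => RtoC ((-1) ^ S M) * k (- s)%R)%C).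
    - rewrite (CInt_cmult _ (fun s => k (- s)%R)); [reflexivity|]. intros s _. apply cn.
    - intros s _. apply (cont_vert (fun w => H1 w * / (w - z))%C). apply cont_Cmult; [now apply Hrem_cont|].
      apply cont_Cinv; [|apply axis_ne]. apply cont_Cminus; [apply continuous_id|apply continuous_const].
    - intros s _. apply cont_Cmult; [apply continuous_const|apply cn]. }
  rewrite Ej, Cplus_assoc. eapply Rle_trans; [apply Cmod_triangle|].
  rewrite (Cmod_mult (RtoC ((-1) ^ S M))), Cmod_R, pow_1_abs, Rmult_1_l.
  replace ((10 * C1 + 10 * C2) / Y) with (10 * C1 / Y + 10 * C2 / Y) by (field; lra). lra.
Qed.
End AxisFormula.

(** * Turning the upper half of the axis into a ray *)

Definition quad2 (w : C) := Re w < 0 /\ 0 < Im w.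

Lemma quad2_open : Copen quad2.
Proof.
  intros w [H1 H2]. exists (Rmin (- Re w) (Im w)). split; [apply Rmin_pos; lra|]. intros v Hv.
  pose proof (re_le_Cmod (v - w)) as R. pose proof (im_le_Cmod (v - w)) as I.
  change (Re (v - w)%C) with (Re v - Re w) in R. change (Im (v - w)%C) with (Im v - Im w) in I.
  pose proof (Rmin_l (- Re w) (Im w)). pose proof (Rmin_r (- Re w) (Im w)).
  apply Rabs_le_between in R, I. split; lra.
Qed.

Section Ray.
Variables (F1 F2 G : C -> C) (a : nat -> R) (M : nat) (z : C) (kap B1 B2 : R).
Hypothesis F1_hol : hol RH F1.
Hypothesis F2_hol : hol RH F2.
Hypothesis F1_cont : forall w, w <> RtoC 0 -> continuous F1 w.
Hypothesis F2_cont : forall w, w <> RtoC 0 -> continuous F2 w.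
Hypothesis F1_asy : asy F1 a.
Hypothesis F2_asy : asy F2 (fun n => (-1) ^ n * a n).
Hypothesis F1_near0 : exists K, 0 <= K /\ forall w, w <> RtoC 0 -> Cmod w <= 1 -> Cmod (F1 w) ^ 2 * Cmod w <= K.
Hypothesis F2_near0 : exists K, 0 <= K /\ forall w, w <> RtoC 0 -> Cmod w <= 1 -> Cmod (F2 w) ^ 2 * Cmod w <= K.
Hypothesis z_in : RH z.
Hypothesis z_up : 0 <= Im z.
Hypothesis kap_in : 0 < kap <= 1.
Hypothesis G_hol : hol quad2 G.
Hypothesis G_cont : forall w, 0 < Im w -> continuous G w.
Hypothesis G_near0 : exists K d, 0 <= K /\ 0 < d <= 1 /\ forall w, w <> RtoC 0 -> Cmod w < d -> Cmod (w * G w) ^ 2 <= K * Cmod w.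
Hypothesis G_decay : exists K, 0 <= K /\ forall w, Re w <= 0 -> 1 <= Im w -> Cmod (G w) <= K * exp (- Im w).
Hypothesis G_axis : forall s, 0 < s -> (F1 (0%R, s) - F2 (0%R, (- s)%R))%C = G (0%R, s).
Hypothesis axis_major : majorized (fun s => s ^ S M * Cmod (F1 (0, - s) - F2 (0, s))) B1.
Hypothesis ray_major : majorized (fun s => s ^ S M * Cmod (G (- kap * s, s))) B2.

Let rho := sqrt (1 + kap ^ 2).

Lemma rho_sqr : rho ^ 2 = 1 + kap ^ 2.
Proof. unfold rho. rewrite <- (Rsqr_pow2 (sqrt _)). apply Rsqr_sqrt. nra. Qed.

Lemma rho_ge1 : 1 <= rho.
Proof. pose proof rho_sqr. assert (0 <= rho) by apply sqrt_pos. nra. Qed.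

Lemma left_ne w : Re w <= 0 -> (w - z)%C <> RtoC 0.
Proof.
  intros Hw E. apply (f_equal Re) in E. unfold RH in z_in. unfold Re, RtoC in *; simpl in *. lra.
Qed.

Let Fw (w : C) : C := (Cpow w (S M) * G w * / (w - z))%C.

Lemma Fw_0 : Fw 0 = RtoC 0.
Proof. unfold Fw. simpl. ring. Qed.

Lemma Fw_cont w : Re w <= 0 -> 0 < Im w \/ w = RtoC 0 -> continuous Fw w.
Proof.
  intros Hw Hor. unfold Fw. apply cont_Cmult.
  2:{ apply cont_Cinv; [apply cont_Cminus; [apply continuous_id|apply continuous_const]|now apply left_ne]. }
  destruct Hor as [HI| ->].
  - apply cont_Cmult; [apply cont_Cpow, continuous_id|now apply G_cont].
  - destruct G_near0 as (K & d & HK & Hd & H). apply (cont_0_sqrt _ K d); [lra|simpl; ring|].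
    intros w Hn Hlt. specialize (H w Hn Hlt).
    replace (Cpow w (S M) * G w)%C with (Cpow w M * (w * G w))%C by (simpl; ring).
    rewrite Cmod_mult, Cmod_pow, Rpow_mult_distr. rewrite <- (Rmult_1_l (K * Cmod w)).
    pose proof (Cmod_ge_0 w).
    assert (P : 0 <= Cmod w ^ M <= 1).
    { split; [now apply pow_le|]. rewrite <- (pow1 M). apply pow_incr; lra. }
    apply Rmult_le_compat; [apply pow2_ge_0|apply pow2_ge_0|nra|exact H].
Qed.

Lemma Fw_hol : hol quad2 Fw.
Proof.
  unfold Fw. apply hol_mult; [apply hol_mult; [apply (hol_pow _ (fun w => w)), hol_id|exact G_hol]|].
  apply hol_inv; [apply hol_minus; [apply hol_id|apply hol_const]|]. intros w [Hw _]. apply left_ne. lra.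
Qed.

(** The line of the ray has distance (Re z + kap Im z)/rho from z. Since kap <= 1 and both parts of
    z are nonnegative, this is at least kap (Re z + Im z)/rho. *)
Lemma ray_dist s : 0 <= s -> Cmod z * kap / rho <= Cmod ((- kap * s, s)%R - z).
Proof.
  intros Hs. pose proof rho_ge1. pose proof rho_sqr. unfold RH in z_in.
  set (x := Re z) in *. set (y := Im z) in *.
  assert (Hz : Cmod z <= x + y).
  { eapply Rle_trans; [apply Cmod_le_ReIm|]. fold x y. rewrite !Rabs_right by lra. lra. }
  apply Rmult_le_reg_r with rho; [lra|]. replace (Cmod z * kap / rho * rho) with (Cmod z * kap) by (field; lra).
  set (D := Cmod ((- kap * s, s)%R - z)).
  assert (HD : D ^ 2 = (- kap * s - x) ^ 2 + (s - y) ^ 2) by (unfold D; rewrite Cmod2_alt; reflexivity).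
  assert (H1 : x + kap * y <= D * rho).
  { apply Rsqr_incr_0_var; [|apply Rmult_le_pos; [apply Cmod_ge_0|lra]]. unfold Rsqr.
    replace (D * rho * (D * rho)) with (D ^ 2 * rho ^ 2) by ring. rewrite HD, H0.
    (* Lagrange's identity, the explicit form of the Cauchy-Schwarz inequality. *)
    replace (((- kap * s - x) ^ 2 + (s - y) ^ 2) * (1 + kap ^ 2))
      with ((x + kap * y) * (x + kap * y) + (kap * (kap * s + x) + (s - y)) ^ 2) by ring.
    pose proof (pow2_ge_0 (kap * (kap * s + x) + (s - y))). lra. }
  nra.
Qed.

(** At s = 0 the value of [G] is arbitrary, but both sides vanish because of the power of w. *)
Lemma Fw_axis s : 0 <= s -> Fw (0, s) = jump F1 F2 M z s.
Proof.
  intros [Hs| <-].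
  - unfold Fw, jump. now rewrite G_axis.
  - change (0, 0) with (RtoC 0). rewrite Fw_0. unfold jump. change (0, 0) with (RtoC 0). simpl. ring.
Qed.

(** The triangle 0, iT, (-kap T, T) trades the segment of the axis for the ray; its horizontal side
    is negligible because [G] decays exponentially. The apex is the outer end of the ray, so that
    the opposite side may lie on the axis, the boundary of the quadrant. *)
Lemma upper_bound eps : 0 < eps -> exists K3, 0 <= K3 /\ forall T, 1 <= T -> 2 * Im z <= T ->
  Cmod (CInt (jump F1 F2 M z) 0 T) <= K3 / T + rho ^ S (S (S M)) / kap * (B2 + eps) / Cmod z.
Proof.
  intros He. destruct (ray_major eps He) as (g & g_cont & g_pos & g_maj & g_int).
  destruct G_decay as [K [HK HG]]. pose proof rho_ge1 as Hr1. pose proof rho_sqr as Hr2.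
  set (P := INR (S (S M)) ^ S (S M)). assert (HP : 0 <= P) by (apply pow_le, pos_INR).
  (* On the horizontal side |w| <= 2T accounts for the power of 2, |w - z| >= T/2 for the second 2,
     and [P] absorbs T^N against exp(T). *)
  set (K3 := 2 ^ S M * K * 2 * P). assert (HK3 : 0 <= K3).
  { unfold K3. pose proof (pow_lt 2 (S M) ltac:(lra)) as H2M. revert H2M HP. generalize (2 ^ S M) P. intros q2 q3 H2M HP. repeat apply Rmult_le_pos; lra. }
  exists K3. split; [assumption|]. intros T HT1 HTz.
  assert (Hz0 : 0 < Cmod z).
  { apply RHc_mod, RH_RHc, z_in. }
  set (p := ((- kap * T)%R, T) : C).
  assert (Tri : Seg Fw (0%R, 0%R) (0%R, T) = (Seg Fw p (0%R, T) - Seg Fw p (0%R, 0%R))%C).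
  { assert (Hw : forall x t, (p + RtoC x * ((0%R, 0%R) - p + RtoC t * ((0%R, T) - (0%R, 0%R))))%C
        = ((- kap * T * (1 - x))%R, (T * (1 - x + x * t))%R)).
    { intros x t. unfold p. apply C_eq; unfold Re, Im, RtoC; simpl; ring. }
    apply (Cauchy_triangle quad2); [apply quad2_open|apply Fw_hol| |].
    - intros x t Hx Ht. rewrite Hw. unfold quad2, Re, Im; cbn [fst snd]. split.
      + assert (0 < kap * T * (1 - x)) by (repeat apply Rmult_lt_0_compat; lra). lra.
      + apply Rmult_lt_0_compat; [lra|]. assert (0 <= x * t) by (apply Rmult_le_pos; lra). lra.
    - intros x t Hx Ht. rewrite Hw. apply Fw_cont; unfold Re, Im; cbn [fst snd].
      + assert (0 <= kap * T * (1 - x)) by (repeat apply Rmult_le_pos; lra). lra.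
      + assert (0 <= x * t) by (apply Rmult_le_pos; lra).
        destruct (Req_dec (1 - x + x * t) 0) as [E0|E0].
        * right. assert (x = 1) by lra. subst x. rewrite E0. apply C_eq; unfold Re, Im, RtoC; simpl; ring.
        * left. apply Rmult_lt_0_compat; lra. }
  assert (EL : Seg Fw (0%R, 0%R) (0%R, T) = (Ci * CInt (jump F1 F2 M z) 0 T)%C).
  { rewrite Seg_vert.
    - f_equal. apply CInt_ext. intros t Ht. rewrite Rmin_left in Ht by lra. apply Fw_axis. lra.
    - intros s Hs. rewrite Rmin_left, Rmax_right in Hs by lra. apply cont_vert, Fw_cont; unfold Re, Im; cbn [fst snd]; [lra|].
      destruct (Req_dec s 0) as [->|]; [right; reflexivity|left; lra]. }
  assert (ET : Cmod (Seg Fw p (0%R, T)) <= K3 / T).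
  { assert (HkT : 0 <= kap * T) by (apply Rmult_le_pos; lra).
    unfold p. rewrite Seg_horiz.
    2:{ intros s Hs. apply cont_horiz, Fw_cont; unfold Re, Im; cbn [fst snd]; [|left; lra].
        revert Hs. rewrite Rmax_right by lra. lra. }
    assert (HkT1 : kap * T <= T) by nra.
    apply Rle_trans with ((2 * T) ^ S M * (K * exp (- T)) * / (T / 2) * (0 - - kap * T)).
    - apply CInt_le_const; [lra| |].
      + intros s Hs. apply cont_horiz, Fw_cont; unfold Re, Im; cbn [fst snd]; [|left; lra].
        revert Hs. unfold Rmin, Rmax. destruct Rle_dec; lra.
      + intros s Hs. unfold Fw. rewrite !Cmod_mult, Cmod_inv, Cmod_pow by (apply left_ne; unfold Re; cbn [fst]; lra).
        apply Rmult_le_compat.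
        * apply Rmult_le_pos; [apply pow_le, Cmod_ge_0|apply Cmod_ge_0].
        * left. apply Rinv_0_lt_compat, Cmod_gt_0, left_ne. unfold Re; cbn [fst]; lra.
        * apply Rmult_le_compat; [apply pow_le, Cmod_ge_0|apply Cmod_ge_0| |].
          -- apply pow_incr. split; [apply Cmod_ge_0|]. eapply Rle_trans; [apply Cmod_le_ReIm|]. unfold Re, Im; cbn [fst snd].
             rewrite (Rabs_right T) by lra. assert (Rabs s <= T) by (apply Rabs_le; lra). lra.
          -- apply (HG (s, T)); unfold Re, Im; cbn [fst snd]; lra.
        * apply Rinv_le_contravar; [lra|]. eapply Rle_trans; [|apply im_le_Cmod].
          change (Im ((s, T) - z)%C) with (T - Im z). rewrite Rabs_right; lra.
    - pose proof (pow_le_exp (S M) T ltac:(lra)) as PE. fold P in PE.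
      pose proof (exp_pos T). pose proof (pow_lt T (S M) ltac:(lra)).
      rewrite exp_Ropp, Rpow_mult_distr. unfold K3.
      apply Rle_trans with (2 ^ S M * K * 2 * (T ^ S M * / exp T)).
      + replace (2 ^ S M * T ^ S M * (K * / exp T) * / (T / 2) * (0 - - kap * T))
          with (2 ^ S M * K * 2 * (T ^ S M * / exp T) * kap) by (field; lra).
        rewrite <- (Rmult_1_r (2 ^ S M * K * 2 * (T ^ S M * / exp T))) at 2. apply Rmult_le_compat_l; [|lra].
        assert (0 < / exp T) by now apply Rinv_0_lt_compat. pose proof (pow_lt 2 (S M) ltac:(lra)) as H2M.
        assert (H2T : 0 <= T ^ S M * / exp T) by (apply Rmult_le_pos; lra). revert H2M H2T. generalize (2 ^ S M) (T ^ S M * / exp T).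
        intros q2 q3 H2M H2T. repeat apply Rmult_le_pos; lra.
      + replace (2 ^ S M * K * 2 * P / T) with (2 ^ S M * K * 2 * (P * / T)) by (field; lra). apply Rmult_le_compat_l.
        { pose proof (pow_lt 2 (S M) ltac:(lra)) as H2M. revert H2M HP. generalize (2 ^ S M) P. intros q2 q3 H2M HP. repeat apply Rmult_le_pos; lra. }
        apply Rmult_le_reg_r with (exp T * T); [apply Rmult_lt_0_compat; lra|].
        replace (T ^ S M * / exp T * (exp T * T)) with (T ^ S (S M)) by (simpl; field; lra).
        replace (P * / T * (exp T * T)) with (P * exp T) by (field; lra). exact PE. }
  assert (ER : Cmod (Seg Fw p (0%R, 0%R)) <= rho ^ S (S (S M)) / kap * (B2 + eps) / Cmod z).
  (* The powers of rho: N - 1 from |w| = rho s, one from the distance to z, and one more from the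
     arc length, through [Hp] below. *)
  { set (c := rho ^ S M * (rho / (kap * Cmod z))).
    assert (Hc : 0 < c).
    { unfold c. apply Rmult_lt_0_compat; [apply pow_lt; lra|]. apply Rdiv_lt_0_compat; [lra|]. apply Rmult_lt_0_compat; lra. }
    assert (Epos : forall t : R, (p + RtoC t * ((0%R, 0%R) - p))%C = ((- kap * (- T * t + T))%R, (- T * t + T)%R)).
    { intros t. unfold p. apply C_eq; unfold Re, Im, RtoC; simpl; ring. }
    assert (Es : forall t, 0 <= t <= 1 -> 0 <= - T * t + T) by (intros; nra).
    assert (cR : ccont (fun t => Fw (p + RtoC t * ((0%R, 0%R) - p))%C) 0 1).
    { intros t Ht. rewrite Rmin_left, Rmax_right in Ht by lra. specialize (Es t Ht).
      apply (continuous_comp (fun t : R => (p + RtoC t * ((0%R, 0%R) - p))%C) Fw); [apply cont_line|].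
      rewrite Epos. apply Fw_cont; unfold Re, Im; cbn [fst snd]; [nra|].
      destruct (Req_dec (- T * t + T) 0) as [E0|E0]; [right; rewrite E0; apply C_eq; unfold Re, Im, RtoC; simpl; ring|left; lra]. }
    assert (exg : forall u v, ex_RInt g u v) by (intros; apply (ex_RInt_continuous (V:=R_CompleteNormedModule)); intros; apply g_cont).
    assert (gcomp : forall t, continuous (fun t => g (- T * t + T)) t).
    { intros t. apply (continuous_comp (fun t => - T * t + T) g); [|apply g_cont].
      apply (ex_derive_continuous (fun t => - T * t + T)). auto_derive; trivial. }
    assert (exgc : ex_RInt (fun t => g (- T * t + T)) 0 1) by (apply (ex_RInt_continuous (V:=R_CompleteNormedModule)); intros; apply gcomp).
    assert (I : RInt (fun t => c * g (- T * t + T)) 0 1 * T <= c * (B2 + eps)).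
    { pose proof (RInt_comp_lin (V:=R_CompleteNormedModule) g (- T) T 0 1 (exg _ _)) as E.
      replace (- T * 0 + T) with T in E by ring. replace (- T * 1 + T) with 0 in E by ring.
      rewrite <- (opp_RInt_swap (V:=R_CompleteNormedModule) g 0 T) in E by apply exg.
      rewrite (RInt_scal (V:=R_CompleteNormedModule) (fun t => g (- T * t + T))) in E by exact exgc.
      change (- T * RInt (fun t => g (- T * t + T)) 0 1 = - RInt g 0 T) in E.
      rewrite (RInt_scal (V:=R_CompleteNormedModule) (fun t => g (- T * t + T))) by exact exgc.
      change (c * RInt (fun t => g (- T * t + T)) 0 1 * T <= c * (B2 + eps)).
      rewrite Rmult_assoc. apply Rmult_le_compat_l; [lra|]. pose proof (g_int T ltac:(lra)). lra. }
    unfold Seg. rewrite Cmod_mult.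
    assert (Hp : Cmod ((0%R, 0%R) - p) = rho * T).
    { unfold p. unfold Cmod; cbn [fst snd Cminus Cplus Copp]. unfold rho.
      transitivity (sqrt ((1 + kap ^ 2) * T ^ 2)); [f_equal; ring|].
      rewrite sqrt_mult_alt by nra. f_equal. rewrite <- Rsqr_pow2. apply sqrt_Rsqr; lra. }
    rewrite Hp.
    assert (J : Cmod (CInt (fun t => Fw (p + RtoC t * ((0%R, 0%R) - p))%C) 0 1) <= RInt (fun t => c * g (- T * t + T)) 0 1).
    { apply CInt_le; [lra|exact cR| |].
      - apply (ex_RInt_scal (V:=R_NormedModule)). exact exgc.
      - intros t Ht. rewrite Epos. specialize (Es t Ht). set (s := - T * t + T) in *.
        destruct Es as [Hs|Hs].
        + unfold Fw. rewrite !Cmod_mult, Cmod_inv, Cmod_pow by (apply left_ne; unfold Re; cbn [fst]; nra).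
          assert (Hm : Cmod ((- kap * s)%R, s) = rho * s).
          { unfold Cmod; cbn [fst snd]. unfold rho.
            transitivity (sqrt ((1 + kap ^ 2) * s ^ 2)); [f_equal; ring|].
            rewrite sqrt_mult_alt by nra. f_equal. rewrite <- Rsqr_pow2. apply sqrt_Rsqr; lra. }
          rewrite Hm, Rpow_mult_distr.
          pose proof (ray_dist s ltac:(lra)) as RD.
          assert (Hq : 0 < Cmod z * kap / rho) by (apply Rdiv_lt_0_compat; [apply Rmult_lt_0_compat|]; lra).
          apply Rle_trans with (rho ^ S M * g s * (rho / (kap * Cmod z))).
          * apply Rmult_le_compat.
            -- repeat apply Rmult_le_pos; try apply pow_le; try apply Cmod_ge_0; lra.
            -- left. apply Rinv_0_lt_compat. lra.
            -- rewrite Rmult_assoc. apply Rmult_le_compat_l; [apply pow_le; lra|]. now apply g_maj.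
            -- replace (rho / (kap * Cmod z)) with (/ (Cmod z * kap / rho)) by (field; lra). now apply Rinv_le_contravar.
          * right. unfold c. ring.
        + rewrite <- Hs. replace ((- kap * 0)%R, 0) with (RtoC 0) by (apply C_eq; unfold Re, Im, RtoC; simpl; ring).
          rewrite Fw_0, Cmod_0. apply Rmult_le_pos; [lra|apply g_pos; lra]. }
    apply Rle_trans with (rho * (RInt (fun t => c * g (- T * t + T)) 0 1 * T)).
    - replace (rho * (RInt (fun t => c * g (- T * t + T)) 0 1 * T)) with (RInt (fun t => c * g (- T * t + T)) 0 1 * (rho * T)) by ring.
      apply Rmult_le_compat_r; [apply Rmult_le_pos; lra|exact J].
    - apply Rle_trans with (rho * (c * (B2 + eps))); [apply Rmult_le_compat_l; lra|].
      right. unfold c. cbn [pow]. field. lra. }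
  assert (EC : Cmod (CInt (jump F1 F2 M z) 0 T) = Cmod (Seg Fw p (0%R, T) - Seg Fw p (0%R, 0%R))).
  { rewrite <- Tri, EL, Cmod_mult, Cmod_Ci. ring. }
  rewrite EC. eapply Rle_trans; [apply Cmod_triangle_sub|]. lra.
Qed.

Lemma lower_bound eps T : 0 < eps -> 0 < T ->
  Cmod (CInt (jump F1 F2 M z) (- T) 0) <= (B1 + eps) / Cmod z.
Proof.
  intros He HT. destruct (axis_major eps He) as (g & g_cont & g_pos & g_maj & g_int).
  assert (Hz0 : 0 < Cmod z) by (apply RHc_mod, RH_RHc, z_in).
  assert (jc : forall s, continuous (jump F1 F2 M z) s) by (intros; apply (jump_cont F1 F2 a); assumption).
  replace (CInt (jump F1 F2 M z) (- T) 0) with (CInt (fun s => jump F1 F2 M z (- s)) 0 T)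
    by (rewrite (CInt_neg (jump F1 F2 M z)) by exact jc; now rewrite Ropp_0).
  assert (jc2 : forall s, continuous (fun s => jump F1 F2 M z (- s)) s).
  { intros s. apply (continuous_comp (fun s : R => - s) (jump F1 F2 M z)); [|apply jc].
    apply (ex_derive_continuous (fun s : R => - s)). auto_derive; trivial. }
  assert (exg : ex_RInt g 0 T) by (apply (ex_RInt_continuous (V:=R_CompleteNormedModule)); intros; apply g_cont).
  eapply Rle_trans; [apply (CInt_le _ (fun s => / Cmod z * g s))|].
  - lra.
  - intros s _. apply jc2.
  - apply (ex_RInt_scal (V:=R_NormedModule)). exact exg.
  - intros s Hs. unfold jump. rewrite Ropp_involutive. destruct (Req_dec s 0) as [->|Hs0].
    + rewrite Ropp_0. change (0, 0) with (RtoC 0). replace (Cpow 0 (S M) * (F1 0 - F2 0) * / (0 - z))%C with (RtoC 0) by (simpl; ring).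
      rewrite Cmod_0. apply Rmult_le_pos; [left; now apply Rinv_0_lt_compat|apply g_pos; lra].
    + assert (Hne : ((0%R, (- s)%R) - z)%C <> RtoC 0) by (apply left_ne; unfold Re; cbn [fst]; lra).
      rewrite !Cmod_mult, Cmod_inv, Cmod_pow by assumption.
      rewrite Cmod_Im_axis, Rabs_Ropp, Rabs_right by lra. rewrite Rmult_comm. apply Rmult_le_compat.
      * left. apply Rinv_0_lt_compat. now apply Cmod_gt_0.
      * apply Rmult_le_pos; [apply pow_le; lra|apply Cmod_ge_0].
      * apply Rinv_le_contravar; [assumption|]. unfold Cmod. apply sqrt_le_1_alt. unfold RH, Re, Im in *; cbn [fst snd Cminus Cplus Copp]. nra.
      * apply g_maj. lra.
  - rewrite (RInt_scal (V:=R_CompleteNormedModule) g) by exact exg. change (/ Cmod z * RInt g 0 T <= (B1 + eps) / Cmod z).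
    unfold Rdiv. rewrite Rmult_comm. apply Rmult_le_compat_r; [left; now apply Rinv_0_lt_compat|]. now apply g_int.
Qed.

Lemma remainder_bound :
  Cmod (F1 z - ipoly a (S (S M)) z) <=
    (B1 + rho ^ S (S (S M)) / kap * B2) / (2 * PI * Cmod z ^ S (S M)).
Proof.
  pose proof PI_RGT_0 as Hpi. pose proof rho_ge1 as Hr1.
  assert (Hz0 : 0 < Cmod z) by (apply RHc_mod, RH_RHc, z_in).
  assert (Hzn : z <> RtoC 0) by (now apply Cmod_gt_0).
  destruct (axis_formula F1 F2 a M z F1_hol F2_hol F1_cont F2_cont F1_asy F2_asy F1_near0 F2_near0 z_in) as (K & Y0 & HK & HA).
  assert (E : Hrem F1 a M z = (Cpow z (S M) * (F1 z - ipoly a (S (S M)) z))%C).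
  { unfold Hrem. rewrite qpoly_ipoly by assumption. ring. }
  set (c := rho ^ S (S (S M)) / kap).
  assert (Hc : 0 < c) by (unfold c; apply Rdiv_lt_0_compat; [apply pow_lt|]; lra).
  assert (Main : 2 * PI * Cmod (Hrem F1 a M z) <= (B1 + c * B2) / Cmod z).
  { apply le_of_small. intros eps He.
    (* The error eps is shared among the two limits in Y and the two majorants, which carry the
       weights 1/|z| and c/|z|. *)
    set (e := eps / (2 + (1 + c) / Cmod z)).
    assert (Hq : 0 < (1 + c) / Cmod z) by (apply Rdiv_lt_0_compat; lra).
    assert (He' : 0 < e) by (apply Rdiv_lt_0_compat; lra).
    destruct (upper_bound e He') as [K3 [HK3 HU]].
    set (Y := 1 + Rabs Y0 + 2 * Im z + K / e + K3 / e).
    pose proof (Rabs_pos Y0). pose proof (Rle_abs Y0).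
    assert (Q1 : 0 <= K / e) by (apply Rmult_le_pos; [lra|left; now apply Rinv_0_lt_compat]).
    assert (Q2 : 0 <= K3 / e) by (apply Rmult_le_pos; [lra|left; now apply Rinv_0_lt_compat]).
    assert (HY : 1 <= Y) by (unfold Y; lra).
    specialize (HA Y ltac:(unfold Y; lra) HY). specialize (HU (Im z + Y) ltac:(lra) ltac:(unfold Y; lra)).
    pose proof (lower_bound e (Y - Im z) He' ltac:(unfold Y; lra)) as HL.
    replace (- (Y - Im z)) with (Im z - Y) in HL by ring.
    assert (jc : forall s, continuous (jump F1 F2 M z) s) by (intros; apply (jump_cont F1 F2 a); assumption).
    rewrite <- (CInt_Chasles (jump F1 F2 M z) (Im z - Y) 0 (Im z + Y)) in HA by (intros s _; apply jc).
    assert (S1 : K / Y <= e).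
    { apply Rmult_le_reg_r with Y; [lra|]. replace (K / Y * Y) with (e * (K / e)) by (field; lra).
      apply Rmult_le_compat_l; [lra|]. unfold Y; lra. }
    assert (S2 : K3 / (Im z + Y) <= e).
    { apply Rmult_le_reg_r with (Im z + Y); [lra|]. replace (K3 / (Im z + Y) * (Im z + Y)) with (e * (K3 / e)) by (field; lra).
      apply Rmult_le_compat_l; [lra|]. unfold Y; lra. }
    set (X := (CInt (jump F1 F2 M z) (Im z - Y) 0 + CInt (jump F1 F2 M z) 0 (Im z + Y))%C) in *.
    pose proof (Cmod_triangle_rev (RtoC (2 * PI) * Hrem F1 a M z) X) as T.
    rewrite Cmod_mult, Cmod_R, (Rabs_right (2 * PI)) in T by lra.
    assert (HX : Cmod X <= (B1 + e) / Cmod z + (K3 / (Im z + Y) + c * (B2 + e) / Cmod z)).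
    { eapply Rle_trans; [apply Cmod_triangle|]. apply Rplus_le_compat; assumption. }
    assert (Ee : eps = e * 2 + e / Cmod z + c * e / Cmod z) by (unfold e; field; split; [lra|]; apply Rgt_not_eq; nra).
    replace ((B1 + e) / Cmod z) with (B1 / Cmod z + e / Cmod z) in HX by (field; lra).
    replace (c * (B2 + e) / Cmod z) with (c * B2 / Cmod z + c * e / Cmod z) in HX by (field; lra).
    replace ((B1 + c * B2) / Cmod z) with (B1 / Cmod z + c * B2 / Cmod z) by (field; lra). lra. }
  rewrite E, Cmod_mult, Cmod_pow in Main.
  assert (Hp : 0 < Cmod z ^ S M) by now apply pow_lt.
  apply Rmult_le_reg_r with (2 * PI * Cmod z ^ S M); [apply Rmult_lt_0_compat; lra|].
  replace ((B1 + c * B2) / (2 * PI * Cmod z ^ S (S M)) * (2 * PI * Cmod z ^ S M)) with ((B1 + c * B2) / Cmod z).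
  2:{ change (Cmod z ^ S (S M)) with (Cmod z * Cmod z ^ S M). field. repeat split; lra. }
  lra.
Qed.
End Ray.

(** * The two remainders on the axis and in the half-plane *)

Lemma PI_bounds : 3.14 <= PI <= 3.15.
Proof.
  destruct (PI_2_3_7_ineq 1) as [A B].
  unfold tg_alt, PI_2_3_7_tg, Ratan_seq, sum_f_R0 in A, B. simpl in A, B. lra.
Qed.

Lemma Phi_hol : hol RH Phi.
Proof. apply hol_exp, mu_hol. Qed.
Lemma Psi_hol : hol RH Psi.
Proof. apply hol_exp, hol_opp, mu_hol. Qed.
Lemma Phi_cont w : w <> RtoC 0 -> continuous Phi w.
Proof. intros H. apply cont_Cexp, mu_cont, H. Qed.
Lemma Psi_cont w : w <> RtoC 0 -> continuous Psi w.
Proof. intros H. apply cont_Cexp, cont_Copp, mu_cont, H. Qed.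

Lemma mu_fold w : mu w = mu (fold_re w).
Proof. unfold mu at 2. rewrite (fold_re_id (fold_re w)) by apply fold_re_Re. reflexivity. Qed.

Lemma Cmod_Phi w : Cmod (Phi w) = exp (Re (mu w)).
Proof. apply Cmod_Cexp. Qed.
Lemma Cmod_Psi w : Cmod (Psi w) = exp (- Re (mu w)).
Proof. apply Cmod_Cexp. Qed.

Lemma Phi_near0 : exists K, 0 <= K /\ forall w, w <> RtoC 0 -> Cmod w <= 1 -> Cmod (Phi w) ^ 2 * Cmod w <= K.
Proof.
  destruct mu_near0 as (K & HK & H). exists K. split; [lra|]. intros w Hn H1.
  rewrite Cmod_Phi, mu_fold, <- (Cmod_fold_re w). apply H; [now apply fold_re_RHc|now rewrite Cmod_fold_re].
Qed.

Lemma Psi_near0_lin : exists K, 0 <= K /\ forall w, w <> RtoC 0 -> Cmod w <= 1 -> Cmod (Psi w) ^ 2 <= K * Cmod w.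
Proof.
  destruct mu_near0 as (K & HK & H). exists K. split; [lra|]. intros w Hn H1.
  rewrite Cmod_Psi, mu_fold, <- (Cmod_fold_re w). apply H; [now apply fold_re_RHc|now rewrite Cmod_fold_re].
Qed.

Lemma Psi_near0 : exists K, 0 <= K /\ forall w, w <> RtoC 0 -> Cmod w <= 1 -> Cmod (Psi w) ^ 2 * Cmod w <= K.
Proof.
  destruct Psi_near0_lin as (K & HK & H). exists K. split; [assumption|]. intros w Hn H1.
  specialize (H w Hn H1). pose proof (Cmod_ge_0 w). pose proof (pow2_ge_0 (Cmod (Psi w))). nra.
Qed.

Lemma mu_far w : 1 <= Cmod w -> Rabs (Re (mu w)) <= 2.
Proof.
  intros H1. eapply Rle_trans; [apply re_le_Cmod|]. unfold mu.
  assert (Hn : w <> RtoC 0) by (apply Cmod_pos_neq; lra).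
  eapply Rle_trans; [apply binet_bound, fold_re_RHc, Hn|]. rewrite Cmod_fold_re.
  apply Rmult_le_reg_r with (Cmod w); [lra|]. unfold Rdiv. rewrite Rmult_assoc, Rinv_l, Rmult_1_r by lra.
  assert (/ Cmod w <= 1) by (rewrite <- Rinv_1; apply Rinv_le_contravar; lra). lra.
Qed.

Lemma Phi_far w : 1 <= Cmod w -> Cmod (Phi w) <= exp 2.
Proof. intros H. rewrite Cmod_Phi. apply exp_mono. pose proof (mu_far w H) as B. apply Rabs_le_between in B. lra. Qed.
Lemma Psi_far w : 1 <= Cmod w -> Cmod (Psi w) <= exp 2.
Proof. intros H. rewrite Cmod_Psi. apply exp_mono. pose proof (mu_far w H) as B. apply Rabs_le_between in B. lra. Qed.

Lemma mu_neg_imag s : 0 < s -> mu (0, - s) = Cconj (mu (0, s)).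
Proof. intros H. rewrite <- mu_conj; [reflexivity|]. apply RHc_imag. lra. Qed.

Lemma q_imag_lt s : 0 < s -> 0 < exp (- (2 * PI * s)) < 1.
Proof.
  intros H. pose proof PI_RGT_0. split; [apply exp_pos|]. rewrite <- exp_0. apply exp_increasing.
  assert (0 < 2 * PI * s) by (apply Rmult_lt_0_compat; lra). lra.
Qed.

(** The reflection formula is known so far only in modulus, but mu(-is) is the conjugate of mu(is).
    Thus -mu(-is) and mu(is) differ by the real number 2 Re mu(is), and the modulus determines the
    whole factor. *)
Lemma Psi_neg_imag s : 0 < s -> Psi (0, - s) = (Phi (0, s) * RtoC (1 - exp (- (2 * PI * s))))%C.
Proof.
  intros H. unfold Psi, Phi. rewrite mu_neg_imag by assumption.
  replace (- Cconj (mu (0%R, s)))%C with (mu (0%R, s) + RtoC (- (2 * Re (mu (0%R, s)))))%C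
    by (apply C_eq; unfold Re, Im, RtoC, Cconj; simpl; ring).
  rewrite Cexp_plus, Cexp_RtoC. do 2 f_equal. rewrite (exp_Ropp (2 * Re _)), exp_mu_imag by assumption. apply Rinv_inv.
Qed.

Lemma Phi_neg_imag s : 0 < s -> Phi (0, - s) = (Psi (0, s) * RtoC (/ (1 - exp (- (2 * PI * s)))))%C.
Proof.
  intros H. unfold Psi, Phi. rewrite mu_neg_imag by assumption.
  replace (Cconj (mu (0%R, s)))%C with (- mu (0%R, s) + RtoC (2 * Re (mu (0%R, s))))%C
    by (apply C_eq; unfold Re, Im, RtoC, Cconj; simpl; ring).
  rewrite Cexp_plus, Cexp_RtoC. do 2 f_equal. now apply exp_mu_imag.
Qed.

Lemma Cmod_Phi_imag s : s <> 0 -> Cmod (Phi (0, s)) ^ 2 = / (1 - exp (- (2 * PI * Rabs s))).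
Proof.
  intros H. rewrite Cmod_Phi, exp_pow. change (INR 2) with 2. destruct (Rle_lt_dec 0 s).
  - rewrite Rabs_right by lra. apply exp_mu_imag. lra.
  - rewrite Rabs_left by assumption. rewrite <- exp_mu_imag by lra.
    replace (0, s) with (0, - - s) by (f_equal; ring). rewrite (mu_neg_imag (- s)) by lra. reflexivity.
Qed.

Lemma Cmod_Psi_Phi w : Cmod (Psi w) * Cmod (Phi w) = 1.
Proof. rewrite Cmod_Phi, Cmod_Psi, <- exp_plus. rewrite <- exp_0. f_equal. ring. Qed.

Lemma Cmod_Psi_imag s : s <> 0 -> Cmod (Psi (0, s)) ^ 2 = 1 - exp (- (2 * PI * Rabs s)).
Proof.
  intros H. pose proof (Cmod_Psi_Phi (0, s)) as E. pose proof (Cmod_Phi_imag s H) as F.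
  pose proof (q_imag_lt (Rabs s) (Rabs_pos_lt _ H)).
  apply Rmult_eq_reg_r with (Cmod (Phi (0, s)) ^ 2).
  - rewrite <- Rpow_mult_distr, E, F. field. lra.
  - rewrite F. apply Rinv_neq_0_compat. lra.
Qed.

(** With q = exp(-2 pi s) this is q/sqrt(1 - q), the common modulus of both jumps on the lower half
    of the axis, so one estimate serves both remainders there. *)
Definition axis_jump (s : R) : R := exp (- (2 * PI * s)) / sqrt (1 - exp (- (2 * PI * s))).

Lemma axis_jump_R s : 0 < s -> Cmod (Phi (0, - s) - Psi (0, s)) = axis_jump s.
Proof.
  intros H. pose proof (q_imag_lt s H) as Hq. rewrite Phi_neg_imag by assumption. unfold axis_jump.
  pose proof (Cmod_Psi_imag s ltac:(lra)) as E. rewrite Rabs_right in E by lra.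
  set (q := exp (- (2 * PI * s))) in *.
  assert (E2 : Cmod (Psi (0, s)) = sqrt (1 - q)) by (rewrite <- E, <- Rsqr_pow2, sqrt_Rsqr; [reflexivity|apply Cmod_ge_0]).
  replace (Psi (0%R, s) * RtoC (/ (1 - q)) - Psi (0%R, s))%C with (Psi (0%R, s) * RtoC (q / (1 - q)))%C.
  2:{ replace (q / (1 - q)) with (/ (1 - q) - 1) by (field; lra). rewrite RtoC_minus. ring. }
  assert (0 < q / (1 - q)) by (apply Rdiv_lt_0_compat; lra).
  rewrite Cmod_mult, Cmod_R, Rabs_right, E2 by lra.
  assert (Hs : 0 < sqrt (1 - q)) by (apply sqrt_lt_R0; lra).
  pose proof (sqrt_sqrt (1 - q) ltac:(lra)) as S. rewrite <- S at 2. field. lra.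
Qed.

Lemma axis_jump_Rinv s : 0 < s -> Cmod (Psi (0, - s) - Phi (0, s)) = axis_jump s.
Proof.
  intros H. pose proof (q_imag_lt s H) as Hq. rewrite Psi_neg_imag by assumption. unfold axis_jump.
  pose proof (Cmod_Phi_imag s ltac:(lra)) as E. rewrite Rabs_right in E by lra.
  set (q := exp (- (2 * PI * s))) in *.
  assert (E2 : Cmod (Phi (0, s)) = / sqrt (1 - q)).
  { rewrite <- sqrt_inv, <- E, <- Rsqr_pow2, sqrt_Rsqr; [reflexivity|apply Cmod_ge_0]. }
  replace (Phi (0%R, s) * RtoC (1 - q) - Phi (0%R, s))%C with (Phi (0%R, s) * RtoC (- q))%C.
  2:{ rewrite RtoC_opp, RtoC_minus. ring. }
  rewrite Cmod_mult, Cmod_R, Rabs_Ropp, Rabs_right, E2 by lra. unfold Rdiv. ring.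
Qed.

Definition qe (w : C) : C := Cexp ((0%R, (2 * PI)%R) * w).

Lemma Cmod_qe w : Cmod (qe w) = exp (- (2 * PI * Im w)).
Proof. unfold qe. rewrite Cmod_Cexp. f_equal. rewrite Re_Cmult. unfold Re, Im; cbn [fst snd]. ring. Qed.

Lemma qe_imag s : qe (0, s) = RtoC (exp (- (2 * PI * s))).
Proof.
  unfold qe. rewrite <- Cexp_RtoC. f_equal. apply C_eq; unfold Re, Im, RtoC; simpl; ring.
Qed.

Lemma qe_ne w : 0 < Im w -> (1 - qe w)%C <> RtoC 0.
Proof.
  intros H E. pose proof (q_imag_lt _ H) as [_ L]. rewrite <- Cmod_qe in L.
  replace (qe w) with (1 - (1 - qe w))%C in L by ring. rewrite E in L.
  replace (1 - RtoC 0)%C with (RtoC 1) in L by ring. rewrite Cmod_1 in L. lra.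
Qed.

Lemma qe_hol U : hol U qe.
Proof. apply hol_exp, hol_mult; [apply hol_const|apply hol_id]. Qed.
Lemma qe_cont w : continuous qe w.
Proof. apply cont_Cexp, cont_Cmult; [apply continuous_const|apply continuous_id]. Qed.

(** For |w| < 1/320 the exponent h = 2 pi i w has modulus at most 1/40. The error 20 |h|^2 of the
    exponential is then at most |h|/2, whence |1 - q| >= |h|/2 >= |w|. *)
Lemma qe_near0 w : w <> RtoC 0 -> Cmod w < / 320 -> Cmod (qe w) <= exp 1 /\ Cmod w * / Cmod (1 - qe w) <= 1.
Proof.
  intros Hn H. apply Cmod_gt_0 in Hn. pose proof PI_bounds. set (h := ((0%R, (2 * PI)%R) * w)%C).
  assert (Eh : Cmod h = 2 * PI * Cmod w) by (unfold h; rewrite Cmod_mult, Cmod_Im_axis, Rabs_right; lra).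
  assert (h1 : Cmod h <= / 40) by (rewrite Eh; nra).
  split.
  - rewrite Cmod_qe. apply exp_mono. pose proof (im_le_Cmod w) as I. apply Rabs_le_between in I. nra.
  - pose proof (Cexp_taylor1 h ltac:(lra)) as T. fold (qe w) in T. change (Cexp h) with (qe w) in T.
    pose proof (Cmod_triangle_rev h (qe w - 1 - h)) as T2.
    replace (h + (qe w - 1 - h))%C with (- (1 - qe w))%C in T2 by ring. rewrite Cmod_opp in T2.
    pose proof (Cmod_ge_0 h).
    assert (L : Cmod w <= Cmod (1 - qe w)) by nra.
    apply Rmult_le_reg_r with (Cmod (1 - qe w)); [lra|]. rewrite Rmult_assoc, Rinv_l by lra. lra.
Qed.

(* The jumps [Phi(w) - Psi(-w)] and [Psi(w) - Phi(-w)] on the positive imaginary axis, continued into the second quadrant by the reflection formula. *)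
Definition G_R (w : C) : C := (Psi (- w) * (qe w * / (1 - qe w)))%C.
Definition G_Rinv (w : C) : C := (- (Phi (- w) * qe w))%C.

Lemma opp_RH w : quad2 w -> RH (- w).
Proof. intros [H _]. unfold RH. change (Re (- w)%C) with (- Re w). lra. Qed.

Lemma opp_ne w : 0 < Im w -> (- w)%C <> RtoC 0.
Proof. intros H E. apply (f_equal Im) in E. unfold Im, RtoC in *; simpl in *. lra. Qed.

Lemma cont_opp_comp (f : C -> C) w : continuous f (- w)%C -> continuous (fun v : C => f (- v)%C) w.
Proof. intros H. apply (continuous_comp (fun v : C => (- v)%C) f); [apply cont_Copp, continuous_id|exact H]. Qed.

Lemma G_R_hol : hol quad2 G_R.
Proof.
  unfold G_R. apply hol_mult; [|apply hol_mult; [apply qe_hol|apply hol_inv]].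
  - apply (hol_comp quad2 RH Psi (fun w => (- w)%C)); [apply Psi_hol|apply hol_opp, hol_id|apply opp_RH].
  - apply hol_minus; [apply hol_const|apply qe_hol].
  - intros w [_ H]. now apply qe_ne.
Qed.

Lemma G_Rinv_hol : hol quad2 G_Rinv.
Proof.
  unfold G_Rinv. apply hol_opp, hol_mult; [|apply qe_hol].
  apply (hol_comp quad2 RH Phi (fun w => (- w)%C)); [apply Phi_hol|apply hol_opp, hol_id|apply opp_RH].
Qed.

Lemma G_R_cont w : 0 < Im w -> continuous G_R w.
Proof.
  intros H. unfold G_R. apply cont_Cmult; [now apply cont_opp_comp, Psi_cont, opp_ne|].
  apply cont_Cmult; [apply qe_cont|]. apply cont_Cinv; [|now apply qe_ne].
  apply cont_Cminus; [apply continuous_const|apply qe_cont].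
Qed.

Lemma G_Rinv_cont w : 0 < Im w -> continuous G_Rinv w.
Proof.
  intros H. unfold G_Rinv. apply cont_Copp, cont_Cmult; [now apply cont_opp_comp, Phi_cont, opp_ne|apply qe_cont].
Qed.

Lemma opp_ne' (w : C) : w <> RtoC 0 -> (- w)%C <> RtoC 0.
Proof. intros H E. apply H. replace w with (- - w)%C by ring. rewrite E. ring. Qed.

(** Psi vanishes like |w|^(1/2), and the simple zero of 1 - q is compensated by the factor w. *)
Lemma G_R_near0 : exists K d, 0 <= K /\ 0 < d <= 1 /\ forall w, w <> RtoC 0 -> Cmod w < d -> Cmod (w * G_R w) ^ 2 <= K * Cmod w.
Proof.
  destruct Psi_near0_lin as (K & HK & H). exists (K * exp 1 ^ 2), (/ 320).
  split; [apply Rmult_le_pos; [lra|apply pow2_ge_0]|]. split; [lra|]. intros w Hn Hd.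
  pose proof (H (- w)%C (opp_ne' _ Hn)) as P. rewrite Cmod_opp in P. specialize (P ltac:(lra)).
  unfold G_R. destruct (qe_near0 w Hn Hd) as [Q1 Q2]. pose proof (Cmod_ge_0 (qe w)). pose proof (Cmod_ge_0 w).
  assert (N : (1 - qe w)%C <> RtoC 0).
  { intros E. pose proof Hn as Hp. apply Cmod_gt_0 in Hp.
    pose proof PI_bounds. set (h := ((0%R, (2 * PI)%R) * w)%C).
    assert (Eh : Cmod h = 2 * PI * Cmod w) by (unfold h; rewrite Cmod_mult, Cmod_Im_axis, Rabs_right; lra).
    pose proof (Cexp_taylor1 h ltac:(nra)) as T. change (Cexp h) with (qe w) in T.
    replace (qe w - 1 - h)%C with (- (1 - qe w) - h)%C in T by ring. rewrite E in T.
    replace (- 0 - h)%C with (- h)%C in T by ring. rewrite Cmod_opp in T.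
    assert (0 < Cmod h <= / 40) by (rewrite Eh; nra). nra. }
  rewrite !Cmod_mult, Cmod_inv by assumption.
  replace (Cmod w * (Cmod (Psi (- w)) * (Cmod (qe w) * / Cmod (1 - qe w))))
    with (Cmod (Psi (- w)) * (Cmod (qe w) * (Cmod w * / Cmod (1 - qe w)))) by ring.
  assert (0 <= Cmod w * / Cmod (1 - qe w)) by (apply Rmult_le_pos; [lra|left; apply Rinv_0_lt_compat, Cmod_gt_0, N]).
  rewrite Rpow_mult_distr. replace (K * exp 1 ^ 2 * Cmod w) with (K * Cmod w * exp 1 ^ 2) by ring.
  apply Rmult_le_compat; [apply pow2_ge_0|apply pow2_ge_0|exact P|]. apply pow_incr. nra.
Qed.

Lemma G_Rinv_near0 : exists K d, 0 <= K /\ 0 < d <= 1 /\ forall w, w <> RtoC 0 -> Cmod w < d -> Cmod (w * G_Rinv w) ^ 2 <= K * Cmod w.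
Proof.
  destruct Phi_near0 as (K & HK & H). exists (K * exp 1 ^ 2), (/ 320).
  split; [apply Rmult_le_pos; [lra|apply pow2_ge_0]|]. split; [lra|]. intros w Hn Hd.
  pose proof (H (- w)%C (opp_ne' _ Hn)) as P. rewrite Cmod_opp in P. specialize (P ltac:(lra)).
  unfold G_Rinv. destruct (qe_near0 w Hn Hd) as [Q1 _]. pose proof (Cmod_ge_0 (qe w)). pose proof (Cmod_ge_0 w).
  rewrite Cmod_mult, Cmod_opp, Cmod_mult.
  replace ((Cmod w * (Cmod (Phi (- w)) * Cmod (qe w))) ^ 2) with (Cmod (Phi (- w)) ^ 2 * Cmod w * Cmod (qe w) ^ 2 * Cmod w) by ring.
  apply Rmult_le_compat_r; [assumption|]. apply Rmult_le_compat; [|apply pow2_ge_0|exact P|].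
  - apply Rmult_le_pos; [apply pow2_ge_0|assumption].
  - apply pow_incr. lra.
Qed.

Lemma exp_2PI y : 1 <= y -> exp (- (2 * PI * y)) <= / 2 /\ exp (- (2 * PI * y)) <= exp (- y).
Proof.
  intros H. pose proof PI_bounds. split; [|apply exp_mono; nra].
  rewrite exp_Ropp. apply Rinv_le_contravar; [lra|]. pose proof (exp_ineq1_le (2 * PI * y)). nra.
Qed.

Lemma G_R_decay : exists K, 0 <= K /\ forall w, Re w <= 0 -> 1 <= Im w -> Cmod (G_R w) <= K * exp (- Im w).
Proof.
  exists (exp 2 * 2). pose proof (exp_pos 2). split; [lra|]. intros w _ Hw. unfold G_R.
  destruct (exp_2PI _ Hw) as [E1 E2]. rewrite <- Cmod_qe in E1, E2.
  pose proof (Cmod_triangle_rev 1 (- qe w)) as T. rewrite Cmod_opp, Cmod_1 in T. change (1 + - qe w)%C with (1 - qe w)%C in T.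
  rewrite !Cmod_mult, Cmod_inv by (apply qe_ne; lra). rewrite Rmult_assoc.
  apply Rmult_le_compat; [apply Cmod_ge_0| | |].
  - apply Rmult_le_pos; [apply Cmod_ge_0|left; apply Rinv_0_lt_compat; lra].
  - apply Psi_far. rewrite Cmod_opp. eapply Rle_trans; [|apply im_le_Cmod]. rewrite Rabs_right; lra.
  - rewrite Rmult_comm. apply Rmult_le_compat; [left; apply Rinv_0_lt_compat; lra|apply Cmod_ge_0| |exact E2].
    rewrite <- (Rinv_inv 2). apply Rinv_le_contravar; lra.
Qed.

Lemma G_Rinv_decay : exists K, 0 <= K /\ forall w, Re w <= 0 -> 1 <= Im w -> Cmod (G_Rinv w) <= K * exp (- Im w).
Proof.
  exists (exp 2). pose proof (exp_pos 2). split; [lra|]. intros w _ Hw. unfold G_Rinv.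
  destruct (exp_2PI _ Hw) as [E1 E2]. rewrite <- Cmod_qe in E1, E2.
  rewrite Cmod_opp, Cmod_mult. apply Rmult_le_compat; try apply Cmod_ge_0; [|exact E2].
  apply Phi_far. rewrite Cmod_opp. eapply Rle_trans; [|apply im_le_Cmod]. rewrite Rabs_right; lra.
Qed.

Lemma G_R_axis s : 0 < s -> (Phi (0%R, s) - Psi (0%R, (- s)%R))%C = G_R (0%R, s).
Proof.
  intros H. unfold G_R. rewrite Cpair_opp, Psi_neg_imag, qe_imag by assumption.
  pose proof (q_imag_lt s H). set (q := exp (- (2 * PI * s))) in *. rewrite RtoC_minus.
  assert (N : (1 - RtoC q)%C <> RtoC 0) by (rewrite <- RtoC_minus; intros E; injection E; lra).
  field. exact N.
Qed.

Lemma G_Rinv_axis s : 0 < s -> (Psi (0%R, s) - Phi (0%R, (- s)%R))%C = G_Rinv (0%R, s).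
Proof.
  intros H. unfold G_Rinv. rewrite Cpair_opp, Phi_neg_imag, qe_imag by assumption.
  pose proof (q_imag_lt s H). set (q := exp (- (2 * PI * s))) in *.
  assert (N : RtoC (1 - q) <> RtoC 0) by (intros E; injection E; lra).
  rewrite RtoC_inv by lra. rewrite RtoC_minus in *. field. exact N.
Qed.

(** * Bounds for Psi and Phi from the maximum principle *)

Lemma Psi_le_1 w : RH w -> Cmod (Psi w) <= 1.
Proof.
  destruct Psi_near0_lin as (K & HK & H). pose proof (exp_pos 2) as He2. pose proof (Cmod_ge_0 (Psi 0)) as H0.
  (* A bound on the whole plane is asked for: K + 1 serves 0 < |v| < 1, exp 2 serves |v| >= 1, and
     the value at 0, a default without meaning, is added separately. *)
  apply (max_principle Psi (K + 1 + exp 2 + Cmod (Psi 0))).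
  - apply Psi_hol.
  - intros; now apply Psi_cont.
  - intros v. pose proof (Cmod_ge_0 (Psi v)). destruct (Rle_lt_dec 1 (Cmod v)) as [F1|F1].
    + pose proof (Psi_far v F1). lra.
    + destruct (Ceq_dec v (RtoC 0)) as [->|Hn]; [lra|]. specialize (H v Hn ltac:(lra)). pose proof (Cmod_ge_0 v). nra.
  - intros s Hs. pose proof (Cmod_Psi_imag s Hs) as E. pose proof (q_imag_lt _ (Rabs_pos_lt _ Hs)).
    pose proof (Cmod_ge_0 (Psi (0, s))). nra.
Qed.

Lemma exp_lower x : 0 <= x -> 1 + x * (1 + x / 2 + x ^ 2 / 6 + x ^ 3 / 24) <= exp x.
Proof.
  intros Hx. pose proof (exp_ge_taylor x 4 Hx) as T. simpl in T. simpl. lra.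
Qed.

(** [U] truncates (e^x - 1)/x from below, so 1 - e^(-x) >= xU/(1 + xU), and the claim becomes the
    polynomial inequality k U^2 >= 2xU + 1. The constant 1.577 is (2 pi)^2/25 rounded down, the
    value that the constant 5 of [Phi_sq_bound] calls for. *)
Lemma Phi_imag_num x k : 0 < x -> 1.577 <= k -> 1 <= (1 - exp (- x)) ^ 2 * (1 + k / x ^ 2).
Proof.
  intros Hx Hk. set (U := 1 + x / 2 + x ^ 2 / 6 + x ^ 3 / 24).
  pose proof (exp_lower x ltac:(lra)) as HL. fold U in HL.
  assert (HU : 0 < U) by (unfold U; pose proof (pow_lt x 2 Hx); pose proof (pow_lt x 3 Hx); lra).
  assert (HxU : 0 < x * U) by (now apply Rmult_lt_0_compat).
  assert (HP : 0 <= k * U ^ 2 - 2 * x * U - 1).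
  { apply Rle_trans with (1.577 * U ^ 2 - 2 * x * U - 1); [|pose proof (pow2_ge_0 U); nra].
    unfold U. pose proof (pow_lt x 2 Hx). pose proof (pow_lt x 5 Hx). pose proof (pow_lt x 6 Hx). pose proof (pow_lt x 4 Hx). pose proof (pow_lt x 3 Hx).
    (* The part of degree at most 4, with coefficients rounded down; the terms of degree 5 and 6 are
       positive. The quartic is smallest near x = 1.4, whence the two squares. *)
    assert (0 <= 0.577 - 0.423 * x - 0.081 * x ^ 2 + 0.0609 * x ^ 3 + 0.026 * x ^ 4).
    { pose proof (pow2_ge_0 (x - 1.4)). pose proof (pow2_ge_0 (x ^ 2 - 1.96)). nra. }
    lra. }
  assert (E1 : x * U / (1 + x * U) <= 1 - exp (- x)).
  { rewrite exp_Ropp. apply Rle_trans with (1 - / (1 + x * U)); [right; field; lra|].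
    assert (/ exp x <= / (1 + x * U)) by (apply Rinv_le_contravar; lra). lra. }
  assert (Hx2 : 0 < x ^ 2) by (now apply pow_lt).
  assert (0 <= x * U / (1 + x * U)) by (apply Rlt_le, Rdiv_lt_0_compat; lra).
  assert (0 < k / x ^ 2) by (apply Rdiv_lt_0_compat; lra).
  apply Rle_trans with ((x * U / (1 + x * U)) ^ 2 * (1 + k / x ^ 2)).
  - replace ((x * U / (1 + x * U)) ^ 2 * (1 + k / x ^ 2)) with (U ^ 2 * (x ^ 2 + k) / (1 + x * U) ^ 2) by (field; split; lra).
    apply Rmult_le_reg_r with ((1 + x * U) ^ 2); [apply pow_lt; lra|].
    replace (U ^ 2 * (x ^ 2 + k) / (1 + x * U) ^ 2 * (1 + x * U) ^ 2) with (U ^ 2 * (x ^ 2 + k)) by (field; lra). nra.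
  - apply Rmult_le_compat_r; [lra|]. apply pow_incr. lra.
Qed.

Lemma Cmod_5w1 v : 0 <= Re v -> 1 <= Cmod (RtoC 5 * v + 1) /\ 5 * Cmod v <= Cmod (RtoC 5 * v + 1).
Proof.
  intros H. split.
  - eapply Rle_trans; [|apply re_le_Cmod]. replace (Re (RtoC 5 * v + 1)%C) with (5 * Re v + 1) by (unfold Re, RtoC; simpl; ring).
    rewrite Rabs_right; lra.
  - replace (5 * Cmod v) with (Cmod (RtoC 5 * v)) by (rewrite Cmod_mult, Cmod_R, Rabs_right; lra).
    unfold Cmod. apply sqrt_le_1_alt. unfold Re, RtoC in *; simpl in *. nra.
Qed.

(* Maximum principle for [Phi(w)^2 5w/(5w+1)]; the constant 5 is what the boundary values [|Phi(is)|^2 = 1/(1 - exp(-2 pi s))] allow. *)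
Lemma Phi_sq_bound w : RH w -> Cmod (Phi w) ^ 2 <= Cmod (1 + / (RtoC 5 * w)).
Proof.
  intros Hw. destruct Phi_near0 as (K & HK & H). pose proof (exp_pos 2) as He2.
  (* [fold_re] keeps the denominator away from 0 on the left, where [max_principle] still asks for a
     bound. The numerator absorbs the growth |w|^(-1) of |Phi|^2 at the origin. *)
  set (r := fun v : C => (RtoC 5 * fold_re v * / (RtoC 5 * fold_re v + 1))%C).
  set (h := fun v : C => (Phi v * Phi v * r v)%C).
  assert (Hne : forall v, 0 <= Re v -> (RtoC 5 * v + 1)%C <> RtoC 0).
  { intros v Hv. apply Cmod_pos_neq. pose proof (Cmod_5w1 v Hv). lra. }
  assert (Hr : forall v, Cmod (r v) <= 1 /\ Cmod (r v) <= 5 * Cmod v).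
  { intros v. pose proof (Cmod_5w1 _ (fold_re_Re v)) as [L1 L2].
    unfold r. rewrite !Cmod_mult, Cmod_inv by (apply Hne, fold_re_Re). rewrite Cmod_R, (Rabs_right 5), <- (Cmod_fold_re v) by lra.
    set (D := Cmod (RtoC 5 * fold_re v + 1)) in *. pose proof (Cmod_ge_0 (fold_re v)). split.
    - apply Rmult_le_reg_r with D; [lra|]. rewrite Rmult_assoc, Rinv_l by lra. lra.
    - assert (/ D <= 1) by (rewrite <- Rinv_1; apply Rinv_le_contravar; lra). nra. }
  assert (Hmax : Cmod (h w) <= 1).
  { apply (max_principle h (5 * K + exp 2 ^ 2 + 0)); [| | | |exact Hw].
    - apply (hol_ext RH (fun v => Phi v * Phi v * (RtoC 5 * v * / (RtoC 5 * v + 1)))%C); [apply RH_open| |].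
      + intros v Hv. unfold h, r. rewrite fold_re_id by (unfold RH in Hv; lra). reflexivity.
      + apply hol_mult; [apply hol_mult; apply Phi_hol|]. apply hol_mult; [apply hol_mult; [apply hol_const|apply hol_id]|].
        apply hol_inv; [apply hol_plus; [apply hol_mult; [apply hol_const|apply hol_id]|apply hol_const]|].
        intros v Hv. apply Hne. unfold RH in Hv; lra.
    - intros v _ Hn. assert (cf : continuous fold_re v).
      { apply cont_eps. intros eps He. exists eps. split; [assumption|]. intros u Hu.
        eapply Rle_lt_trans; [apply fold_re_lip|exact Hu]. }
      assert (c5 : continuous (fun v => RtoC 5 * fold_re v)%C v) by (apply cont_Cmult; [apply continuous_const|exact cf]).
      unfold h. apply cont_Cmult; [apply cont_Cmult; now apply Phi_cont|].
      unfold r. apply cont_Cmult; [exact c5|]. apply cont_Cinv; [apply cont_Cplus; [exact c5|apply continuous_const]|].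
      apply Hne, fold_re_Re.
    - intros v. unfold h. rewrite !Cmod_mult. destruct (Hr v) as [R1 R2]. pose proof (Cmod_ge_0 (r v)).
      pose proof (Cmod_ge_0 (Phi v)). pose proof (Cmod_ge_0 v).
      assert (Hsq : Cmod (Phi v) * Cmod (Phi v) = Cmod (Phi v) ^ 2) by ring. rewrite Hsq.
      pose proof (pow2_ge_0 (Cmod (Phi v))). pose proof (pow2_ge_0 (exp 2)).
      destruct (Rle_lt_dec 1 (Cmod v)) as [F1|F1].
      + pose proof (pow_incr _ _ 2 (conj (Cmod_ge_0 (Phi v)) (Phi_far v F1))). nra.
      + destruct (Ceq_dec v (RtoC 0)) as [->|Hn].
        * rewrite Cmod_0 in R2. replace (Cmod (r 0)) with 0 by lra. lra.
        * specialize (H v Hn ltac:(lra)). nra.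
    - intros s Hs. unfold h, r. rewrite fold_re_id by (unfold Re; simpl; lra).
      rewrite !Cmod_mult, Cmod_inv by (apply Hne; unfold Re; simpl; lra).
      rewrite Cmod_R, (Rabs_right 5), Cmod_Im_axis by lra.
      pose proof (Cmod_Phi_imag s Hs) as E. pose proof (Rabs_pos_lt _ Hs) as Ha. pose proof (q_imag_lt _ Ha) as Hq.
      set (D := Cmod (RtoC 5 * (0%R, s) + 1)).
      assert (ED : D ^ 2 = 1 + 25 * Rabs s ^ 2).
      { unfold D. rewrite Cmod2_alt, pow2_abs. unfold Re, Im, RtoC; simpl. ring. }
      assert (D0 : 0 < D) by (apply Cmod_gt_0, Hne; unfold Re; simpl; lra).
      replace (Cmod (Phi (0, s)) * Cmod (Phi (0, s))) with (Cmod (Phi (0, s)) ^ 2) by ring. rewrite E.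
      pose proof PI_bounds as Hpi.
      (* At x = 2 pi |s| this k makes k/x^2 equal to 1/(25 s^2), which matches |5is + 1|^2 = 1 + 25
         s^2. *)
      pose proof (Phi_imag_num (2 * PI * Rabs s) ((2 * PI) ^ 2 / 25) ltac:(nra) ltac:(nra)) as N.
      set (q := exp (- (2 * PI * Rabs s))) in *. set (t := Rabs s) in *.
      replace ((2 * PI) ^ 2 / 25 / (2 * PI * t) ^ 2) with (/ (25 * t ^ 2)) in N by (field; split; lra).
      assert (N2 : (5 * t) ^ 2 <= ((1 - q) * D) ^ 2).
      { rewrite (Rpow_mult_distr (1 - q)), ED. apply Rle_trans with (25 * t ^ 2 * ((1 - q) ^ 2 * (1 + / (25 * t ^ 2)))).
        - pose proof (pow_lt t 2 Ha). nra.
        - right. field. lra. }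
      assert (N3 : 5 * t <= (1 - q) * D).
      { apply Rsqr_incr_0_var; [rewrite !Rsqr_pow2; exact N2|]. apply Rmult_le_pos; lra. }
      apply Rmult_le_reg_r with ((1 - q) * D); [apply Rmult_lt_0_compat; lra|].
      replace (/ (1 - q) * (5 * t * / D) * ((1 - q) * D)) with (5 * t) by (field; lra). lra. }
  assert (Hw0 : w <> RtoC 0) by (apply RH_RHc, Hw).
  assert (H5w : (RtoC 5 * w)%C <> RtoC 0).
  { apply Cmult_neq_0; [|assumption]. intros E; injection E; lra. }
  assert (Hw1 : 0 <= Re w) by (unfold RH in Hw; lra).
  unfold h, r in Hmax. rewrite fold_re_id in Hmax by assumption.
  rewrite Cmod_mult, (Cmod_mult (Phi w)), (Cmod_mult (RtoC 5 * w)), Cmod_inv in Hmax by now apply Hne.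
  replace (1 + / (RtoC 5 * w))%C with ((RtoC 5 * w + 1) * / (RtoC 5 * w))%C by (field; exact Hw0).
  rewrite Cmod_mult, Cmod_inv by assumption.
  assert (D1 : 0 < Cmod (RtoC 5 * w)) by now apply Cmod_gt_0.
  assert (D2 : 0 < Cmod (RtoC 5 * w + 1)) by now apply Cmod_gt_0, Hne.
  apply Rmult_le_reg_r with (Cmod (RtoC 5 * w) * / Cmod (RtoC 5 * w + 1)).
  - apply Rmult_lt_0_compat; [assumption|now apply Rinv_0_lt_compat].
  - replace (Cmod (RtoC 5 * w + 1) * / Cmod (RtoC 5 * w) * (Cmod (RtoC 5 * w) * / Cmod (RtoC 5 * w + 1))) with 1 by (field; lra).
    replace (Cmod (Phi w) ^ 2) with (Cmod (Phi w) * Cmod (Phi w)) by ring. exact Hmax.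
Qed.

(** * Upper integrals *)

(** Improper integrals are replaced by bounds on all initial integrals of a continuous nonnegative
    function; such functions serve as the majorants in [majorized]. *)
Definition intbd (g : R -> R) (B : R) :=
  (forall s, continuous g s) /\ (forall s, 0 <= s -> 0 <= g s) /\ (forall T, 0 < T -> RInt g 0 T <= B).

Lemma cont_ex_RInt (g : R -> R) a b : (forall s, continuous g s) -> ex_RInt g a b.
Proof. intros H. apply (ex_RInt_continuous (V:=R_CompleteNormedModule)). intros; apply H. Qed.

Lemma intbd_plus g h B B' : intbd g B -> intbd h B' -> intbd (fun s => g s + h s) (B + B').
Proof.
  intros (c1 & p1 & i1) (c2 & p2 & i2). repeat split.
  - intros s. now apply cont_Rplus.
  - intros s Hs. specialize (p1 s Hs). specialize (p2 s Hs). lra.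
  - intros T HT. rewrite (RInt_plus (V:=R_CompleteNormedModule)) by (now apply cont_ex_RInt).
    change (RInt g 0 T + RInt h 0 T <= B + B'). specialize (i1 T HT). specialize (i2 T HT). lra.
Qed.

Lemma intbd_scal c g B : 0 <= c -> intbd g B -> intbd (fun s => c * g s) (c * B).
Proof.
  intros Hc (c1 & p1 & i1). repeat split.
  - intros s. apply cont_Rmult; [apply continuous_const|apply c1].
  - intros s Hs. specialize (p1 s Hs). nra.
  - intros T HT. rewrite (RInt_scal (V:=R_CompleteNormedModule) g) by (now apply cont_ex_RInt).
    change (c * RInt g 0 T <= c * B). now apply Rmult_le_compat_l; [|apply i1].
Qed.

Lemma intbd_le g B B' : B <= B' -> intbd g B -> intbd g B'.
Proof. intros H (c & p & i). repeat split; try assumption. intros T HT. specialize (i T HT). lra. Qed.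

(** A primitive stands in for the improper Gamma integral: it is nonpositive for s >= 0, so every
    initial integral is at most minus its value at 0, which is m!/l^(m+1). *)
Lemma pow_exp_prim m l : 0 < l -> exists G : R -> R,
  (forall s, is_derive G s (s ^ m * exp (- (l * s)))) /\ G 0 = - (INR (fact m) / l ^ S m) /\ (forall s, 0 <= s -> G s <= 0).
Proof.
  intros Hl. induction m as [|m (G & D & G0 & Gn)].
  - exists (fun s => - / l * exp (- (l * s))). refine (conj _ (conj _ _)).
    + intros s. auto_derive; [trivial|]. simpl. field. lra.
    + rewrite Rmult_0_r, Ropp_0, exp_0. simpl. field. lra.
    + intros s _. pose proof (exp_pos (- (l * s))). pose proof (Rinv_0_lt_compat l Hl). nra.
  - exists (fun s => - / l * (s ^ S m * exp (- (l * s))) + INR (S m) / l * G s). refine (conj _ (conj _ _)).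
    + intros s. replace (s ^ S m * exp (- (l * s)))
        with ((- / l * (INR (S m) * s ^ m * exp (- (l * s)) + s ^ S m * (- l * exp (- (l * s))))) + INR (S m) / l * (s ^ m * exp (- (l * s))))
        by (field; lra).
      apply (is_derive_plus (V:=R_NormedModule) (fun s => - / l * (s ^ S m * exp (- (l * s)))) (fun s => INR (S m) / l * G s)).
      * apply (is_derive_scal (fun s => s ^ S m * exp (- (l * s)))).
        generalize (S m) (eq_refl : pred (S m) = m). intros n Hn. rewrite <- Hn.
        auto_derive; [trivial|]. ring.
      * apply (is_derive_scal G). apply D.
    + rewrite Rmult_0_r, Ropp_0, exp_0, G0. rewrite fact_simpl, mult_INR, pow_i by lia.
      cbn [pow]. field. split; [apply pow_nonzero|]; lra.
    + intros s Hs. specialize (Gn s Hs). pose proof (exp_pos (- (l * s))). pose proof (Rinv_0_lt_compat l Hl).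
      pose proof (pow_le s (S m) Hs). assert (0 <= s ^ S m * exp (- (l * s))) by (apply Rmult_le_pos; lra).
      assert (0 <= INR (S m) / l) by (apply Rmult_le_pos; [apply pos_INR|lra]). nra.
Qed.

Lemma RInt_prim (G g : R -> R) a b : (forall s, is_derive G s (g s)) -> (forall s, continuous g s) -> RInt g a b = G b - G a.
Proof.
  intros D c. apply is_RInt_unique. apply (is_RInt_derive (V:=R_CompleteNormedModule) G); intros; [apply D|apply c].
Qed.

Lemma cont_pow_exp m l s : continuous (fun s => s ^ m * exp (- (l * s))) s.
Proof. apply (ex_derive_continuous (fun s => s ^ m * exp (- (l * s)))). auto_derive. trivial. Qed.

Lemma intbd_pow_exp m l : 0 < l -> intbd (fun s => s ^ m * exp (- (l * s))) (INR (fact m) / l ^ S m).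
Proof.
  intros Hl. repeat split.
  - apply cont_pow_exp.
  - intros s Hs. apply Rmult_le_pos; [now apply pow_le|left; apply exp_pos].
  - intros T HT. destruct (pow_exp_prim m l Hl) as (G & D & G0 & Gn).
    rewrite (RInt_prim G (fun s : R => s ^ m * exp (- (l * s))) 0 T D) by apply cont_pow_exp. rewrite G0. specialize (Gn T ltac:(lra)). lra.
Qed.

Lemma majorized_intbd f g B : intbd g B -> (forall s, 0 < s -> f s <= g s) -> majorized f B.
Proof.
  intros (c & p & i) H eps He. exists g. repeat split; try assumption. intros T HT. specialize (i T HT). lra.
Qed.

Lemma majorized_approx f B : (forall eps, 0 < eps -> exists g, intbd g (B + eps) /\ forall s, 0 < s -> f s <= g s) -> majorized f B.
Proof.
  intros H eps He. destruct (H eps He) as (g & (c & p & i) & Hf). exists g. repeat split; assumption.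
Qed.

Lemma majorized_le f f' B : (forall s, 0 < s -> f s <= f' s) -> majorized f' B -> majorized f B.
Proof.
  intros H M eps He. destruct (M eps He) as (g & c & p & Hf & i). exists g. repeat split; try assumption.
  intros s Hs. specialize (H s Hs). specialize (Hf s Hs). lra.
Qed.

Lemma majorized_plus f f' B B' : majorized f B -> majorized f' B' -> majorized (fun s => f s + f' s) (B + B').
Proof.
  intros M M' eps He. destruct (M (eps / 2) ltac:(lra)) as (g & c & p & Hf & i).
  destruct (M' (eps / 2) ltac:(lra)) as (g' & c' & p' & Hf' & i'). exists (fun s => g s + g' s). repeat split.
  - intros s. now apply cont_Rplus.
  - intros s Hs. specialize (p s Hs). specialize (p' s Hs). lra.
  - intros s Hs. specialize (Hf s Hs). specialize (Hf' s Hs). lra.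
  - intros T HT. rewrite (RInt_plus (V:=R_CompleteNormedModule)) by (now apply cont_ex_RInt).
    change (RInt g 0 T + RInt g' 0 T <= B + B' + eps). specialize (i T HT). specialize (i' T HT). lra.
Qed.

Lemma majorized_scal f B k : 0 < k -> majorized f B -> majorized (fun s => k * f s) (k * B).
Proof.
  intros Hk M eps He. destruct (M (eps / k)) as (g & c & p & Hf & i); [now apply Rdiv_lt_0_compat|].
  exists (fun s => k * g s). repeat split.
  - intros s. apply cont_Rmult; [apply continuous_const|apply c].
  - intros s Hs. specialize (p s Hs). nra.
  - intros s Hs. specialize (Hf s Hs). nra.
  - intros T HT. rewrite (RInt_scal (V:=R_CompleteNormedModule) g) by (now apply cont_ex_RInt).
    change (k * RInt g 0 T <= k * B + eps). specialize (i T HT).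
    replace (k * B + eps) with (k * (B + eps / k)) by (field; lra). apply Rmult_le_compat_l; lra.
Qed.

Definition zetaN (N : nat) : R := Series (fun k => / INR (S k) ^ N).

Lemma ex_zetaN N : (2 <= N)%nat -> ex_series (fun k => / INR (S k) ^ N).
Proof.
  intros HN.
  assert (P : forall k, 0 < INR (S k)) by (intros; apply lt_0_INR; lia).
  apply (ex_series_le (K:=R_AbsRing) (V:=R_CompleteNormedModule) _ (fun k => 2 * tele 1 k)).
  - intros k. change (Rabs (/ INR (S k) ^ N) <= 2 * tele 1 k).
    assert (1 <= INR (S k)) by (rewrite <- INR_1; apply le_INR; lia).
    assert (HL : INR (S k) ^ 2 <= INR (S k) ^ N) by (apply Rle_pow; [assumption|lia]).
    assert (H2 : 0 < INR (S k) ^ 2) by (apply pow_lt, P).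
    rewrite Rabs_right by (left; apply Rinv_0_lt_compat; lra).
    apply Rle_trans with (/ INR (S k) ^ 2); [now apply Rinv_le_contravar|].
    unfold tele. rewrite (S_INR k). pose proof (pos_INR k).
    replace (2 * (/ (1 + INR k) - / (1 + (INR k + 1)))) with (/ ((INR k + 1) * (INR k + 2) / 2)) by (field; lra).
    apply Rinv_le_contravar; [|simpl]; nra.
  - apply ex_series_tele. lra.
Qed.

Lemma zetaN_partial N n : (2 <= N)%nat -> sum_f_R0 (fun k => / INR (S k) ^ N) n <= zetaN N.
Proof.
  intros HN. rewrite <- sum_n_Reals.
  pose proof (Series_correct _ (ex_zetaN N HN)) as H.
  apply (is_lim_seq_le_loc (fun _ => sum_n (fun k => / INR (S k) ^ N) n) (sum_n (fun k => / INR (S k) ^ N)) (sum_n (fun k => / INR (S k) ^ N) n) (zetaN N)).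
  - exists n. intros m Hm. induction Hm as [|m Hm IH]; [lra|]. rewrite sum_Sn. change plus with Rplus.
    assert (0 < / INR (S (S m)) ^ N) by (apply Rinv_0_lt_compat, pow_lt, lt_0_INR; lia). lra.
  - apply is_lim_seq_const.
  - exact H.
Qed.

Lemma geom_finite q n : 0 < q < 1 -> q / (1 - q) = sum_f_R0 (fun k => q ^ S k) n + q ^ S (S n) / (1 - q).
Proof.
  intros Hq. induction n as [|n IH]; [simpl; field; lra|]. rewrite IH. simpl. field. lra.
Qed.

Lemma div_one_sub_exp x : 0 < x -> x / (1 - exp (- x)) <= 1 + x.
Proof.
  intros Hx. pose proof (exp_ineq1_le x).
  assert (L : exp (- x) <= / (1 + x)) by (rewrite exp_Ropp; apply Rinv_le_contravar; lra).
  assert (L2 : / (1 + x) < 1) by (rewrite <- Rinv_1; apply Rinv_lt_contravar; lra).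
  apply Rmult_le_reg_r with (1 - exp (- x)); [lra|].
  unfold Rdiv. rewrite Rmult_assoc, Rinv_l, Rmult_1_r by lra.
  apply Rle_trans with ((1 + x) * (1 - / (1 + x))); [right; field; lra|]. apply Rmult_le_compat_l; lra.
Qed.

Lemma intbd_sum m n : intbd (fun s => sum_f_R0 (fun k => s ^ m * exp (- (2 * PI * INR (S k) * s))) n)
  (INR (fact m) / (2 * PI) ^ S m * sum_f_R0 (fun k => / INR (S k) ^ S m) n).
Proof.
  pose proof PI_RGT_0 as Hpi.
  assert (T : forall k, intbd (fun s => s ^ m * exp (- (2 * PI * INR (S k) * s))) (INR (fact m) / (2 * PI) ^ S m * / INR (S k) ^ S m)).
  { intros k. assert (0 < INR (S k)) by (apply lt_0_INR; lia).
    eapply intbd_le; [|apply intbd_pow_exp; apply Rmult_lt_0_compat; lra].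
    right. rewrite Rpow_mult_distr. field. split; apply pow_nonzero; lra. }
  induction n as [|n IH]; [apply (T 0%nat)|].
  eapply intbd_le; [|apply (intbd_plus _ _ _ _ IH (T (S n)))]. right. cbn [sum_f_R0]. ring.
Qed.

(* Summing the geometric series termwise; the tail [q^(n+2)/(1-q)] is absorbed by one power of [s], which keeps the majorant continuous at 0. *)
Lemma majorized_bose m : (1 <= m)%nat ->
  majorized (fun s => s ^ m * (exp (- (2 * PI * s)) / (1 - exp (- (2 * PI * s))))) (INR (fact m) / (2 * PI) ^ S m * zetaN (S m)).
Proof.
  intros Hm. pose proof PI_RGT_0 as Hpi. destruct m as [|m]; [lia|]. clear Hm.
  apply majorized_approx. intros eps He.
  set (A := INR (fact (S m)) / (2 * PI) ^ S (S m)).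
  set (B := / (2 * PI) * (INR (fact m) / (2 * PI) ^ S m)).
  assert (HA : 0 < A) by (apply Rdiv_lt_0_compat; [apply INR_fact_lt_0|apply pow_lt; lra]).
  assert (HB : 0 < B).
  { apply Rmult_lt_0_compat; [apply Rinv_0_lt_compat; lra|]. apply Rdiv_lt_0_compat; [apply INR_fact_lt_0|apply pow_lt; lra]. }
  (* With this n the integral of the tail, B/(n + 2)^(m + 1), is at most eps. *)
  destruct (nfloor_ex (B / eps)) as [n [_ Hn]]; [left; now apply Rdiv_lt_0_compat|].
  set (l := 2 * PI * INR (S (S n))).
  assert (Hn2 : 1 <= INR (S (S n)) /\ B / eps <= INR (S (S n))).
  { rewrite !S_INR. pose proof (pos_INR n). lra. }
  assert (Hl : 0 < l) by (unfold l; apply Rmult_lt_0_compat; lra).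
  exists (fun s => sum_f_R0 (fun k => s ^ S m * exp (- (2 * PI * INR (S k) * s))) (S n) + / (2 * PI) * (s ^ m * exp (- (l * s)))).
  split.
  - eapply intbd_le; [|apply intbd_plus; [apply intbd_sum|apply intbd_scal; [left; apply Rinv_0_lt_compat; lra|apply intbd_pow_exp, Hl]]].
    fold A. apply Rplus_le_compat.
    + apply Rmult_le_compat_l; [lra|]. apply zetaN_partial. lia.
    + replace (/ (2 * PI) * (INR (fact m) / l ^ S m)) with (B * / INR (S (S n)) ^ S m).
      2:{ unfold B, l. rewrite (Rpow_mult_distr (2 * PI)). field. repeat split; try apply pow_nonzero; lra. }
      apply Rle_trans with (B * / INR (S (S n))).
      * apply Rmult_le_compat_l; [lra|]. apply Rinv_le_contravar; [lra|].
        rewrite <- (pow_1 (INR (S (S n)))) at 1. apply Rle_pow; [lra|lia].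
      * apply Rmult_le_reg_r with (INR (S (S n))); [lra|]. rewrite Rmult_assoc, Rinv_l, Rmult_1_r by lra.
        apply Rmult_le_reg_r with (/ eps); [now apply Rinv_0_lt_compat|].
        replace (eps * INR (S (S n)) * / eps) with (INR (S (S n))) by (field; lra). lra.
  - intros s Hs. pose proof (q_imag_lt s Hs) as Hq. set (q := exp (- (2 * PI * s))) in *.
    assert (E : forall k, exp (- (2 * PI * INR k * s)) = q ^ k).
    { intros k. unfold q. rewrite exp_pow. f_equal. ring. }
    rewrite (geom_finite q n Hq), Rmult_plus_distr_l, scal_sum.
    cbn [sum_f_R0]. rewrite Rplus_assoc. apply Rplus_le_compat.
    + right. apply sum_eq. intros k _. rewrite E. ring.
    + unfold l. rewrite !E. pose proof (div_one_sub_exp (2 * PI * s) ltac:(apply Rmult_lt_0_compat; lra)) as D.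
      fold q in D. pose proof (pow_lt q (S (S n)) ltac:(lra)) as Hqn. pose proof (pow_lt s m Hs) as Hsm.
      replace (s ^ S m * (q ^ S (S n) / (1 - q))) with (/ (2 * PI) * (s ^ m * q ^ S (S n)) * (2 * PI * s / (1 - q)))
        by (cbn [pow]; field; lra).
      replace (s ^ S m * q ^ S (S n) + / (2 * PI) * (s ^ m * q ^ S (S n))) with (/ (2 * PI) * (s ^ m * q ^ S (S n)) * (1 + 2 * PI * s))
        by (cbn [pow]; field; lra).
      apply Rmult_le_compat_l; [|exact D]. apply Rmult_le_pos; [left; apply Rinv_0_lt_compat; lra|]. apply Rmult_le_pos; lra.
Qed.

(** The inequality 1/sqrt(1 - q) <= (1 + 1/(1 - q))/2 between geometric and arithmetic mean replaces
    the square root by two integrals with values proportional to 1 and to zeta(N). This is the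
    origin of the term (1 + zeta(N))/2. *)
Lemma majorized_axis m : (1 <= m)%nat ->
  majorized (fun s => s ^ m * axis_jump s) (INR (fact m) / (2 * PI) ^ S m * ((1 + zetaN (S m)) / 2)).
Proof.
  intros Hm. pose proof PI_RGT_0 as Hpi.
  pose proof (majorized_intbd _ _ _ (intbd_pow_exp m (2 * PI) ltac:(lra)) (fun s _ => Rle_refl _)) as M1.
  pose proof (majorized_scal _ _ (/ 2) ltac:(lra) (majorized_plus _ _ _ _ M1 (majorized_bose m Hm))) as M.
  replace (INR (fact m) / (2 * PI) ^ S m * ((1 + zetaN (S m)) / 2))
    with (/ 2 * (INR (fact m) / (2 * PI) ^ S m + INR (fact m) / (2 * PI) ^ S m * zetaN (S m))) by (unfold Rdiv; ring).
  revert M. apply majorized_le. intros s Hs. unfold axis_jump. pose proof (q_imag_lt s Hs) as Hq. set (q := exp (- (2 * PI * s))) in *.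
  pose proof (pow_lt s m Hs).
  replace (/ 2 * (s ^ m * q + s ^ m * (q / (1 - q)))) with (s ^ m * (q * ((1 + / (1 - q)) / 2))) by (field; lra).
  apply Rmult_le_compat_l; [lra|]. apply Rmult_le_compat_l; [lra|].
  rewrite <- sqrt_inv.
  assert (0 < / (1 - q)) by (apply Rinv_0_lt_compat; lra).
  pose proof (sqrt_sqrt (/ (1 - q)) ltac:(lra)). pose proof (pow2_ge_0 (sqrt (/ (1 - q)) - 1)). nra.
Qed.

(** * Integrals along the tilted ray *)

Lemma Cpair_opp2 (x y : R) : (- (x, y))%C = ((- x)%R, (- y)%R).
Proof. reflexivity. Qed.

Lemma ray_RH kap s : 0 < kap -> 0 < s -> RH (- (- kap * s, s)).
Proof. intros. unfold RH. change (0 < - (- kap * s)). nra. Qed.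

Lemma G_R_ray kap s : 0 < kap -> 0 < s ->
  Cmod (G_R (- kap * s, s)) <= exp (- (2 * PI * s)) * / Cmod (1 - qe (- kap * s, s)).
Proof.
  intros Hk Hs. unfold G_R.
  assert (Hn : (1 - qe ((- kap * s)%R, s))%C <> RtoC 0) by (apply qe_ne; exact Hs).
  rewrite !Cmod_mult, Cmod_inv, Cmod_qe by assumption. change (Im ((- kap * s)%R, s)) with s.
  rewrite <- (Rmult_1_l (exp (- (2 * PI * s)) * / _)) at 2. apply Rmult_le_compat_r.
  - apply Rmult_le_pos; [left; apply exp_pos|left; apply Rinv_0_lt_compat, Cmod_gt_0, Hn].
  - now apply Psi_le_1, ray_RH.
Qed.

Lemma one_sub_qe_ge w : 1 - exp (- (2 * PI * Im w)) <= Cmod (1 - qe w).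
Proof.
  pose proof (Cmod_triangle_rev 1 (- qe w)) as T. rewrite Cmod_opp, Cmod_1, Cmod_qe in T. exact T.
Qed.

(** Replacing |1 - q| by 1 - |q| ignores the rotation of q along the ray, so the bound is the same
    for every tilt. The loss is affordable from N = 3 on. *)
Lemma majorized_ray_R kap m : 0 < kap -> (1 <= m)%nat ->
  majorized (fun s => s ^ m * Cmod (G_R (- kap * s, s))) (INR (fact m) / (2 * PI) ^ S m * zetaN (S m)).
Proof.
  intros Hk Hm. generalize (majorized_bose m Hm). apply majorized_le. intros s Hs.
  apply Rmult_le_compat_l; [apply pow_le; lra|]. eapply Rle_trans; [now apply G_R_ray|].
  apply Rmult_le_compat_l; [left; apply exp_pos|]. pose proof (q_imag_lt s Hs).
  apply Rinv_le_contravar; [lra|]. apply (one_sub_qe_ge ((- kap * s)%R, s)).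
Qed.

Section RayInv.
Variable kap : R.
Hypothesis Hk : 0 < kap.
Let rho := sqrt (1 + kap ^ 2).

Lemma rho2 : rho ^ 2 = 1 + kap ^ 2.
Proof. unfold rho. rewrite <- (Rsqr_pow2 (sqrt _)). apply Rsqr_sqrt. nra. Qed.
Lemma rho_pos : 0 < rho.
Proof. apply sqrt_lt_R0. nra. Qed.

Lemma G_Rinv_ray s : Cmod (G_Rinv (- kap * s, s)) = Cmod (Phi (kap * s, - s)) * exp (- (2 * PI * s)).
Proof.
  unfold G_Rinv. rewrite Cmod_opp, Cmod_mult, Cmod_qe. rewrite Cpair_opp2. replace (- (- kap * s)) with (kap * s) by ring. reflexivity.
Qed.

Lemma Phi_ray s : 0 < s -> Cmod (Phi (kap * s, - s)) ^ 2 <= 1 + / (5 * rho * s).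
Proof.
  intros Hs. pose proof rho_pos as Hr. assert (HR : RH ((kap * s)%R, (- s)%R)) by (unfold RH; simpl; nra).
  eapply Rle_trans; [apply Phi_sq_bound, HR|]. eapply Rle_trans; [apply Cmod_triangle|]. rewrite Cmod_1.
  assert (E : Cmod ((kap * s)%R, (- s)%R) = rho * s).
  { unfold Cmod; cbn [fst snd]. unfold rho. transitivity (sqrt ((1 + kap ^ 2) * s ^ 2)); [f_equal; ring|].
    rewrite sqrt_mult_alt by nra. f_equal. rewrite <- Rsqr_pow2. apply sqrt_Rsqr; lra. }
  assert (N : (RtoC 5 * ((kap * s)%R, (- s)%R))%C <> RtoC 0).
  { apply Cmult_neq_0; [intros F; injection F; lra|]. apply Cmod_pos_neq. rewrite E. now apply Rmult_lt_0_compat. }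
  rewrite Cmod_inv, Cmod_mult, E, Cmod_R, Rabs_right by (assumption || lra). right. f_equal. f_equal. ring.
Qed.

(** The weighted inequality p <= (lam + p^2/lam)/2 passes from |Phi| to |Phi|^2, for which [Phi_ray]
    has elementary integrals. The weight is tuned to N in [Psi_err]. *)
Lemma majorized_ray_Rinv lam m : 0 < lam -> (1 <= m)%nat ->
  majorized (fun s => s ^ m * Cmod (G_Rinv (- kap * s, s)))
    (INR (fact m) / (2 * PI) ^ S m * ((lam + / lam) / 2 + 2 * PI / (10 * lam * rho * INR m))).
Proof.
  intros Hl Hm. pose proof PI_RGT_0 as Hpi. pose proof rho_pos as Hr. destruct m as [|m]; [lia|]. clear Hm.
  pose proof (Rinv_0_lt_compat lam Hl) as Hil.
  assert (Hc : 0 < / (10 * lam * rho)) by (apply Rinv_0_lt_compat; repeat apply Rmult_lt_0_compat; lra).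
  apply (majorized_intbd _ (fun s => (lam + / lam) / 2 * (s ^ S m * exp (- (2 * PI * s))) + / (10 * lam * rho) * (s ^ m * exp (- (2 * PI * s))))).
  - eapply intbd_le; [|apply intbd_plus; apply intbd_scal; [lra|apply intbd_pow_exp; lra|lra|apply intbd_pow_exp; lra]].
    right. rewrite fact_simpl, mult_INR. assert (0 < INR (S m)) by (apply lt_0_INR; lia).
    change ((2 * PI) ^ S (S m)) with (2 * PI * (2 * PI) ^ S m). field. repeat split; try lra. apply pow_nonzero; lra.
  - intros s Hs. rewrite G_Rinv_ray. pose proof (Phi_ray s Hs) as HP. set (p := Cmod (Phi (kap * s, - s))) in *.
    set (q := exp (- (2 * PI * s))). assert (Hq : 0 < q) by apply exp_pos.
    replace ((lam + / lam) / 2 * (s ^ S m * q) + / (10 * lam * rho) * (s ^ m * q))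
      with (s ^ S m * (((lam + / lam) / 2 + / (10 * lam * rho * s)) * q)) by (cbn [pow]; field; lra).
    apply Rmult_le_compat_l; [apply pow_le; lra|]. apply Rmult_le_compat_r; [lra|].
    apply Rle_trans with ((lam + p ^ 2 * / lam) / 2).
    + apply Rmult_le_reg_r with (2 * lam); [lra|].
      replace ((lam + p ^ 2 * / lam) / 2 * (2 * lam)) with (lam ^ 2 + p ^ 2) by (field; lra).
      pose proof (pow2_ge_0 (p - lam)). nra.
    + replace ((lam + / lam) / 2 + / (10 * lam * rho * s)) with ((lam + (1 + / (5 * rho * s)) * / lam) / 2) by (field; lra).
      assert (p ^ 2 * / lam <= (1 + / (5 * rho * s)) * / lam) by (apply Rmult_le_compat_r; lra). lra.
Qed.

(** The squared modulus of 1 + 1/(5w) is explicit on the ray, and smaller than what the triangle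
    inequality in [Phi_ray] gives. It is the fourth power of |Phi| that it controls. *)
Lemma Phi_ray4 s : 0 < s ->
  Cmod (Phi (kap * s, - s)) ^ 4 <= 1 + 2 * kap / (5 * rho ^ 2 * s) + / (25 * rho ^ 2 * s ^ 2).
Proof.
  intros Hs. assert (HR : RH ((kap * s)%R, (- s)%R)) by (unfold RH; simpl; nra).
  pose proof (Phi_sq_bound _ HR) as H.
  pose proof (pow_incr _ _ 2 (conj (pow2_ge_0 _) H)) as H2. rewrite <- pow_mult in H2. change (2 * 2)%nat with 4%nat in H2.
  eapply Rle_trans; [exact H2|]. right.
  assert (E : (/ (RtoC 5 * ((kap * s)%R, (- s)%R)))%C = ((kap / (5 * rho ^ 2 * s))%R, (/ (5 * rho ^ 2 * s))%R)).
  { rewrite rho2. unfold Cinv, Cmult, RtoC; cbn [fst snd]. apply C_eq; unfold Re, Im; cbn [fst snd]; field; repeat split; nra. }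
  rewrite E, Cmod2_alt. unfold Re, Im, RtoC, Cplus; cbn [fst snd]. pose proof rho2 as H3. pose proof rho_pos.
  apply Rmult_eq_reg_r with (25 * (rho ^ 2) ^ 2 * s ^ 2); [|apply Rgt_not_eq; repeat apply Rmult_lt_0_compat; try apply pow_lt; try apply pow_lt; lra].
  rewrite H3. field. split; nra.
Qed.

(** Meant for N = 3. The inequality p <= 3 lam/4 + p^4/(4 lam^3), an equality at p = lam, makes the
    sharper [Phi_ray4] applicable. *)
Lemma majorized_ray_Rinv2 lam : 0 < lam ->
  majorized (fun s => s ^ 2 * Cmod (G_Rinv (- kap * s, s)))
    (2 / (2 * PI) ^ 3 * (3 * lam / 4 + / (4 * lam ^ 3) * (1 + 2 * kap / (5 * rho ^ 2) * PI + 2 * PI ^ 2 / (25 * rho ^ 2)))).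
Proof.
  intros Hl. pose proof PI_RGT_0 as Hpi. pose proof rho_pos as Hr.
  assert (Hc : 0 < / (4 * lam ^ 3)) by (apply Rinv_0_lt_compat; pose proof (pow_lt lam 3 Hl); lra).
  assert (Hr2 : 0 < rho ^ 2) by now apply pow_lt.
  assert (Hc1 : 0 < 2 * kap / (5 * rho ^ 2)) by (apply Rdiv_lt_0_compat; lra).
  assert (Hc2 : 0 < / (25 * rho ^ 2)) by (apply Rinv_0_lt_compat; lra).
  apply (majorized_intbd _ (fun s => (3 * lam / 4 + / (4 * lam ^ 3)) * (s ^ 2 * exp (- (2 * PI * s))) + / (4 * lam ^ 3) *
     (2 * kap / (5 * rho ^ 2) * (s ^ 1 * exp (- (2 * PI * s))) + / (25 * rho ^ 2) * (s ^ 0 * exp (- (2 * PI * s)))))).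
  - eapply intbd_le; [|apply intbd_plus; apply intbd_scal; [lra|apply intbd_pow_exp; lra|lra|]].
    2:{ apply intbd_plus; apply intbd_scal; [lra|apply intbd_pow_exp; lra|lra|apply intbd_pow_exp; lra]. }
    right. simpl fact. change (INR 2) with 2. change (INR 1) with 1. simpl. field. repeat split; nra.
  - intros s Hs. rewrite G_Rinv_ray. pose proof (Phi_ray4 s Hs) as HP. set (p := Cmod (Phi (kap * s, - s))) in *.
    set (q := exp (- (2 * PI * s))). assert (Hq : 0 < q) by apply exp_pos.
    set (X := 1 + 2 * kap / (5 * rho ^ 2 * s) + / (25 * rho ^ 2 * s ^ 2)) in *.
    replace ((3 * lam / 4 + / (4 * lam ^ 3)) * (s ^ 2 * q) + / (4 * lam ^ 3) *
       (2 * kap / (5 * rho ^ 2) * (s ^ 1 * q) + / (25 * rho ^ 2) * (s ^ 0 * q)))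
      with (s ^ 2 * ((3 * lam / 4 + / (4 * lam ^ 3) * X) * q)) by (unfold X; field; repeat split; lra).
    apply Rmult_le_compat_l; [apply pow_le; lra|]. apply Rmult_le_compat_r; [lra|].
    assert (p ^ 4 * / (4 * lam ^ 3) <= X * / (4 * lam ^ 3)) by (apply Rmult_le_compat_r; lra).
    apply Rle_trans with (3 * lam / 4 + p ^ 4 * / (4 * lam ^ 3)); [|lra].
    apply Rmult_le_reg_r with (4 * lam ^ 3); [pose proof (pow_lt lam 3 Hl); lra|].
    replace ((3 * lam / 4 + p ^ 4 * / (4 * lam ^ 3)) * (4 * lam ^ 3)) with (3 * lam ^ 4 + p ^ 4) by (field; lra).
    assert (0 <= (p - lam) ^ 2 * (p ^ 2 + 2 * p * lam + 3 * lam ^ 2)).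
    { apply Rmult_le_pos; [apply pow2_ge_0|]. assert (0 <= p) by apply Cmod_ge_0. nra. }
    nra.
Qed.
End RayInv.

(** * The diagonal ray for R_2 *)

Lemma nonneg_of_derive (f f' : R -> R) : 0 <= f 0 -> (forall x, 0 <= x -> is_derive f x (f' x)) ->
  (forall x, 0 <= x -> 0 <= f' x) -> forall x, 0 <= x -> 0 <= f x.
Proof.
  intros H0 D P x Hx. destruct (MVT_gen f 0 x f') as [c [Hc E]].
  - intros y Hy. rewrite Rmin_left in Hy by lra. apply D; lra.
  - intros y Hy. rewrite Rmin_left in Hy by lra. apply continuity_pt_filterlim.
    apply (ex_derive_continuous f). exists (f' y). apply D; lra.
  - rewrite Rmin_left, Rmax_right in Hc by lra. specialize (P c ltac:(lra)). nra.
Qed.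

(** Four successive integrations from 0, starting with cosh x >= 1 >= cos x. For q = exp(-a - ia)
    the right side times exp(-a) is |1 - q|^2, so this bounds the jump on the diagonal. *)
Lemma cosh_cos a : 0 <= a -> 2 * a ^ 2 <= exp a + exp (- a) - 2 * cos a.
Proof.
  intros Ha.
  assert (S0 : forall x, 0 <= x -> 0 <= exp x + exp (- x) - 2 * cos x).
  { intros x _. pose proof (COS_bound x). rewrite exp_Ropp. pose proof (exp_pos x).
    assert (2 <= exp x + / exp x).
    { apply Rmult_le_reg_r with (exp x); [assumption|]. rewrite Rmult_plus_distr_r, Rinv_l by lra.
      pose proof (pow2_ge_0 (exp x - 1)). nra. }
    lra. }
  assert (S1 : forall x, 0 <= x -> 0 <= exp x - exp (- x) - 2 * sin x).
  { apply (nonneg_of_derive _ (fun x => exp x + exp (- x) - 2 * cos x)); [|intros x _; auto_derive; [trivial|ring]|exact S0].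
    rewrite Ropp_0, sin_0. lra. }
  assert (S2 : forall x, 0 <= x -> 0 <= exp x + exp (- x) + 2 * cos x - 4).
  { apply (nonneg_of_derive _ (fun x => exp x - exp (- x) - 2 * sin x)); [|intros x _; auto_derive; [trivial|ring]|exact S1].
    rewrite Ropp_0, cos_0, exp_0. lra. }
  assert (S3 : forall x, 0 <= x -> 0 <= exp x - exp (- x) + 2 * sin x - 4 * x).
  { apply (nonneg_of_derive _ (fun x => exp x + exp (- x) + 2 * cos x - 4)); [|intros x _; auto_derive; [trivial|ring]|exact S2].
    rewrite Ropp_0, sin_0. lra. }
  assert (S4 : forall x, 0 <= x -> 0 <= exp x + exp (- x) - 2 * cos x - 2 * x ^ 2).
  { apply (nonneg_of_derive _ (fun x => exp x - exp (- x) + 2 * sin x - 4 * x)); [|intros x _; auto_derive; [trivial|ring]|exact S3].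
    rewrite Ropp_0, cos_0, exp_0. lra. }
  specialize (S4 a Ha). lra.
Qed.

(* With [a = 2 pi s] and [q = exp(- a - i a)], two bounds for [a |q| / |1 - q|]: [diag_x] is sharp near 0, [diag_y] for large [a]. *)
Definition diag_x (a : R) : R := / sqrt 2 * exp (- (a / 2)).
Definition diag_y (a : R) : R := exp (- a) * (a + / (1 + a / 2 + a ^ 2 / 6)).
Definition diag_g (a : R) : R := Rmin (diag_x a) (diag_y a).

Lemma diag_den a : 0 < 1 + a / 2 + a ^ 2 / 6.
Proof. pose proof (pow2_ge_0 (a + 3 / 2)). lra. Qed.

Lemma diag_x_cont a : continuous diag_x a.
Proof. apply (ex_derive_continuous diag_x). unfold diag_x. auto_derive. trivial. Qed.
Lemma diag_y_cont a : continuous diag_y a.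
Proof. apply (ex_derive_continuous diag_y). unfold diag_y. auto_derive. pose proof (diag_den a). lra. Qed.

Lemma Rmin_abs x y : Rmin x y = / 2 * (x + y - Rabs (x - y)).
Proof. unfold Rmin. destruct (Rle_dec x y); [rewrite Rabs_left1 by lra|rewrite Rabs_right by lra]; lra. Qed.

Lemma diag_g_cont a : continuous diag_g a.
Proof.
  apply (continuous_ext (fun a => / 2 * (diag_x a + diag_y a - Rabs (diag_x a - diag_y a)))).
  - intros x. symmetry. apply Rmin_abs.
  - apply cont_Rmult; [apply continuous_const|]. apply cont_Rminus.
    + apply cont_Rplus; [apply diag_x_cont|apply diag_y_cont].
    + apply (continuous_comp (fun a => diag_x a - diag_y a) Rabs); [|apply continuous_Rabs].
      apply cont_Rminus; [apply diag_x_cont|apply diag_y_cont].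
Qed.

Lemma diag_g_pos a : 0 <= a -> 0 <= diag_g a.
Proof.
  intros Ha. unfold diag_g, diag_x, diag_y. apply Rmin_glb.
  - apply Rmult_le_pos; [left; apply Rinv_0_lt_compat, sqrt_lt_R0; lra|left; apply exp_pos].
  - pose proof (Rinv_0_lt_compat _ (diag_den a)). apply Rmult_le_pos; [left; apply exp_pos|lra].
Qed.

Lemma sqrt2_bounds : 1.4142 <= sqrt 2 <= 1.41422.
Proof.
  pose proof (sqrt_sqrt 2 ltac:(lra)). pose proof (sqrt_lt_R0 2 ltac:(lra)). split; nra.
Qed.

Lemma exp_m32_bounds : 0.19 <= exp (- (3 / 2)) <= 0.2236.
Proof.
  split.
  - rewrite exp_Ropp. apply Rle_trans with (/ 5.2); [lra|]. apply Rinv_le_contravar; [apply exp_pos|].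
    pose proof exp_le_3 as E. pose proof (exp_pos (3 / 2)).
    assert (exp (3 / 2) ^ 2 = exp 1 ^ 3) by (rewrite !exp_pow; f_equal; simpl; field).
    assert (exp 1 ^ 3 <= 3 ^ 3) by (apply pow_incr; split; [left; apply exp_pos|assumption]). nra.
  - rewrite exp_Ropp. apply Rle_trans with (/ 4.4725); [|lra]. apply Rinv_le_contravar; [lra|].
    pose proof (exp_ge_taylor (3 / 2) 7 ltac:(lra)) as T. simpl in T. lra.
Qed.

(** The two bounds are exchanged at a = 3. Up to there [diag_x] integrates to sqrt 2 (1 - e^(-3/2));
    beyond, 1 + a/2 + a^2/6 >= 4 and the tail is at most 4.25 e^(-3). The value 1.315 is half of 1 +
    1.63, all that N = 2 allows when zeta(2) >= 1.63 is used. *)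
Lemma intbd_diag : intbd diag_g 1.315.
Proof.
  split; [exact diag_g_cont|]. split; [exact diag_g_pos|].
  pose proof sqrt2_bounds as H2. pose proof exp_m32_bounds as HU.
  assert (H22 : sqrt 2 * sqrt 2 = 2) by (apply sqrt_sqrt; lra).
  assert (Hinv : / sqrt 2 = sqrt 2 / 2).
  { apply Rmult_eq_reg_r with (sqrt 2); [rewrite Rinv_l by lra; lra|lra]. }
  assert (Ex : forall T, 0 <= T -> RInt diag_g 0 T <= sqrt 2 * (1 - exp (- (T / 2)))).
  { intros T HT. apply Rle_trans with (RInt diag_x 0 T).
    - apply RInt_le; [assumption|apply cont_ex_RInt, diag_g_cont|apply cont_ex_RInt, diag_x_cont|].
      intros s _. apply Rmin_l.
    - right. rewrite (RInt_prim (fun a => - sqrt 2 * exp (- (a / 2))) diag_x).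
      + replace (- (0 / 2)) with 0 by field. rewrite exp_0. ring.
      + intros s. unfold diag_x. auto_derive; [trivial|]. rewrite Hinv. unfold Rdiv. field.
      + exact diag_x_cont. }
  assert (E3 : RInt diag_g 0 3 <= sqrt 2 * (1 - exp (- (3 / 2)))) by (apply Ex; lra).
  (* The left side is a convex function of exp(-3/2), which is why that number is enclosed from both
     sides. *)
  assert (Fin : sqrt 2 * (1 - exp (- (3 / 2))) + 4.25 * exp (- (3 / 2)) ^ 2 <= 1.315) by nra.
  intros T HT. destruct (Rle_lt_dec T 3) as [H3|H3].
  - specialize (Ex T ltac:(lra)). pose proof (exp_mono (- (3 / 2)) (- (T / 2)) ltac:(lra)).
    pose proof (pow2_ge_0 (exp (- (3 / 2)))). nra.
  - rewrite <- (RInt_Chasles diag_g 0 3 T) by (apply cont_ex_RInt, diag_g_cont).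
    change (RInt diag_g 0 3 + RInt diag_g 3 T <= 1.315).
    assert (RInt diag_g 3 T <= 4.25 * exp (- (3 / 2)) ^ 2); [|lra].
    apply Rle_trans with (RInt (fun a => exp (- a) * (a + / 4)) 3 T).
    + apply RInt_le; [lra|apply cont_ex_RInt, diag_g_cont| |].
      * apply cont_ex_RInt. intros s. apply (ex_derive_continuous (fun a => exp (- a) * (a + / 4))). auto_derive. trivial.
      * intros s Hs. apply Rle_trans with (diag_y s); [apply Rmin_r|]. unfold diag_y.
        apply Rmult_le_compat_l; [left; apply exp_pos|]. apply Rplus_le_compat_l, Rinv_le_contravar; nra.
    + rewrite (RInt_prim (fun a => - exp (- a) * (a + 5 / 4)) (fun a => exp (- a) * (a + / 4))).
      * rewrite exp_pow. change (INR 2) with 2. replace (2 * - (3 / 2)) with (- (3)) by field.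
        pose proof (exp_pos (- T)). assert (0 <= exp (- T) * (T + 5 / 4)) by (apply Rmult_le_pos; lra). lra.
      * intros s. auto_derive; [trivial|]. field.
      * intros s. apply (ex_derive_continuous (fun a => exp (- a) * (a + / 4))). auto_derive. trivial.
Qed.

Lemma intbd_rescale g B c : 0 < c -> intbd g B -> intbd (fun s => g (c * s)) (B / c).
Proof.
  intros Hc (cg & p & i). refine (conj _ (conj _ _)).
  - intros s. apply (continuous_comp (fun s => c * s) g); [|apply cg].
    apply (ex_derive_continuous (fun s : R => c * s)). auto_derive. trivial.
  - intros s Hs. apply p. apply Rmult_le_pos; lra.
  - intros T HT. pose proof (RInt_comp_lin (V:=R_CompleteNormedModule) g c 0 0 T (cont_ex_RInt _ _ _ cg)) as E.
    specialize (i (c * T) ltac:(now apply Rmult_lt_0_compat)).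
    assert (cc : forall s, continuous (fun s => g (c * s)) s).
    { intros s. apply (continuous_comp (fun s => c * s) g); [|apply cg].
      apply (ex_derive_continuous (fun s : R => c * s)). auto_derive. trivial. }
    rewrite (RInt_ext _ (fun y => scal c (g (c * y)))) in E by (intros; now rewrite Rplus_0_r).
    rewrite (RInt_scal (V:=R_CompleteNormedModule) (fun y => g (c * y))) in E by (now apply cont_ex_RInt).
    change (c * RInt (fun y => g (c * y)) 0 T = RInt g (c * 0 + 0) (c * T + 0)) in E.
    replace (c * 0 + 0) with 0 in E by ring. replace (c * T + 0) with (c * T) in E by ring.
    apply Rmult_le_reg_l with c; [assumption|]. replace (c * (B / c)) with B by (field; lra). lra.
Qed.

Lemma majorized_ray_R1 : majorized (fun s => s ^ 1 * Cmod (G_R (- (1) * s, s))) (/ (2 * PI) ^ 2 * 1.315).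
Proof.
  pose proof PI_RGT_0 as Hpi. assert (H2pi : 0 < 2 * PI) by lra. pose proof (Rinv_0_lt_compat _ H2pi) as Hi.
  apply (majorized_intbd _ (fun s => / (2 * PI) * diag_g (2 * PI * s))).
  - eapply intbd_le; [|apply intbd_scal; [lra|apply intbd_rescale; [exact H2pi|apply intbd_diag]]].
    right. field. lra.
  - intros s Hs. set (a := 2 * PI * s). assert (Ha : 0 < a) by (unfold a; now apply Rmult_lt_0_compat).
    replace (s ^ 1) with (/ (2 * PI) * a) by (unfold a; field; lra). rewrite Rmult_assoc. apply Rmult_le_compat_l; [lra|].
    pose proof (G_R_ray 1 s ltac:(lra) Hs) as HG. fold a in HG.
    set (D := Cmod (1 - qe (- (1) * s, s))) in *. pose proof (exp_pos (- a)) as He.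
    assert (D1 : 1 - exp (- a) <= D) by apply (one_sub_qe_ge ((- (1) * s)%R, s)).
    pose proof (q_imag_lt s Hs) as Hq. fold a in Hq.
    (* On the diagonal q = exp(-a - ia), and |1 - q|^2 = e^(-a) (e^a + e^(-a) - 2 cos a). *)
    assert (D2 : 2 * a ^ 2 * exp (- a) <= D ^ 2).
    { unfold D. rewrite Cmod2_alt. unfold qe.
      replace ((0%R, (2 * PI)%R) * ((- (1) * s)%R, s))%C with ((- a)%R, (- a)%R)
        by (apply C_eq; unfold a, Re, Im; simpl; ring).
      unfold Cexp. change (Re ((- a)%R, (- a)%R)) with (- a). change (Im ((- a)%R, (- a)%R)) with (- a).
      rewrite cos_neg, sin_neg. unfold Re, Im; simpl fst; simpl snd.
      pose proof (sin2_cos2 a) as SC. unfold Rsqr in SC. pose proof (cosh_cos a ltac:(lra)) as CC.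
      assert (Ee : exp a * exp (- a) = 1) by (rewrite <- exp_plus, <- exp_0; f_equal; ring).
      pose proof (Rmult_le_compat_r _ _ _ (Rlt_le _ _ He) CC) as CC2.
      replace ((exp a + exp (- a) - 2 * cos a) * exp (- a)) with (exp a * exp (- a) + exp (- a) * exp (- a) - 2 * exp (- a) * cos a) in CC2 by ring.
      rewrite Ee in CC2.
      replace (exp (- a) * exp (- a)) with (exp (- a) * exp (- a) * (sin a * sin a + cos a * cos a)) in CC2 by (rewrite SC; ring).
      lra. }
    apply Rle_trans with (a * (exp (- a) * / D)); [apply Rmult_le_compat_l; lra|].
    unfold diag_g. apply Rmin_glb.
    + unfold diag_x. pose proof sqrt2_bounds as H2. assert (H22 : sqrt 2 * sqrt 2 = 2) by (apply sqrt_sqrt; lra).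
      pose proof (exp_pos (- (a / 2))) as Hh. set (h := exp (- (a / 2))) in *.
      assert (Eh : exp (- a) = h * h) by (unfold h; rewrite <- exp_plus; f_equal; field).
      assert (D3 : sqrt 2 * a * h <= D).
      { apply Rsqr_incr_0_var; [|lra]. unfold Rsqr. rewrite Eh in D2.
        replace (sqrt 2 * a * h * (sqrt 2 * a * h)) with (2 * a ^ 2 * (h * h)) by (transitivity ((sqrt 2 * sqrt 2) * a ^ 2 * (h * h)); [rewrite H22|]; ring). lra. }
      rewrite Eh. apply Rmult_le_reg_r with (sqrt 2 * D); [apply Rmult_lt_0_compat; lra|].
      replace (a * (h * h * / D) * (sqrt 2 * D)) with (h * (sqrt 2 * a * h)) by (field; lra).
      replace (/ sqrt 2 * h * (sqrt 2 * D)) with (h * D) by (field; lra). apply Rmult_le_compat_l; lra.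
    + unfold diag_y. replace (a * (exp (- a) * / D)) with (exp (- a) * (a * / D)) by ring. apply Rmult_le_compat_l; [lra|].
      apply Rle_trans with (a * / (1 - exp (- a))); [apply Rmult_le_compat_l; [lra|]; apply Rinv_le_contravar; lra|].
      pose proof (exp_ge_taylor a 3 ltac:(lra)) as T. simpl in T.
      assert (T2 : a * (1 + a / 2 + a ^ 2 / 6) <= exp a - 1) by (simpl; lra).
      pose proof (diag_den a) as Hd. set (U := 1 + a / 2 + a ^ 2 / 6) in *.
      assert (0 < a * U) by now apply Rmult_lt_0_compat.
      rewrite exp_Ropp. replace (a * / (1 - / exp a)) with (a + a * / (exp a - 1)) by (field; lra).
      apply Rplus_le_compat_l. replace (/ U) with (a * / (a * U)) by (field; lra).
      apply Rmult_le_compat_l; [lra|]. apply Rinv_le_contravar; lra.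
Qed.

(** * Zeta values and constants *)

(** The bound of the theorem, with Gamma(N) as a factorial; it depends on z only through its modulus
    r, so conjugation and small displacements of z are easily tracked. *)
Definition err_bound (N : nat) (r : R) : R :=
  (1 + zetaN N) * INR (fact (N - 1)) / ((2 * PI) ^ (N + 1) * r ^ N) * ((2 * sqrt (INR N) + 1) / 2).

Lemma zetaN_upper N B : (2 <= N)%nat -> (forall n, sum_f_R0 (fun k => / INR (S k) ^ N) n <= B) -> zetaN N <= B.
Proof.
  intros HN H.
  apply (is_lim_seq_le (sum_n (fun k => / INR (S k) ^ N)) (fun _ => B) (zetaN N) B).
  - intros n. rewrite sum_n_Reals. apply H.
  - exact (Series_correct _ (ex_zetaN N HN)).
  - apply is_lim_seq_const.
Qed.

(** For k >= 2 the term 1/k^3 is below 1/((k - 1) k (k + 1)), and these telescope to 1/4. *)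
Lemma zetaN_le N : (3 <= N)%nat -> zetaN N <= 5 / 4.
Proof.
  intros HN. apply zetaN_upper; [lia|].
  assert (P : forall n, sum_f_R0 (fun k => / INR (S k) ^ N) n <= 5 / 4 - / 2 * / (INR (S n) * (INR n + 2))).
  { induction n as [|n IH].
    - simpl sum_f_R0. rewrite INR_1, pow1. simpl. lra.
    - cbn [sum_f_R0]. eapply Rle_trans; [apply Rplus_le_compat_r, IH|].
      rewrite !S_INR. pose proof (pos_INR n). set (x := INR n) in *.
      assert (E : / (x + 1 + 1) ^ N <= / (x + 1 + 1) ^ 3) by (apply Rinv_le_contravar; [apply pow_lt; lra|apply Rle_pow; [lra|lia]]).
      assert (F : / (x + 1 + 1) ^ 3 <= / ((x + 1) * (x + 2) * (x + 3))) by (apply Rinv_le_contravar; [repeat apply Rmult_lt_0_compat; lra|simpl; nra]).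
      assert (G : / ((x + 1) * (x + 2) * (x + 3)) = / 2 * / ((x + 1) * (x + 2)) - / 2 * / ((x + 1 + 1) * (x + 1 + 2))) by (field; lra).
      lra. }
  intros n. eapply Rle_trans; [apply P|]. pose proof (pos_INR n). rewrite S_INR.
  assert (0 < / ((INR n + 1) * (INR n + 2))) by (apply Rinv_0_lt_compat, Rmult_lt_0_compat; lra). lra.
Qed.

(* Partial sum plus the telescoping lower bound [1/(n+1)] for the tail. *)
Lemma zetaN_2 : 1.63 <= zetaN 2.
Proof.
  assert (P : forall n, 1.634 - / (INR n + 7) <= sum_f_R0 (fun k => / INR (S k) ^ 2) (5 + n)).
  { induction n as [|n IH].
    - simpl. lra.
    - replace (5 + S n)%nat with (S (5 + n)) by lia. cbn [sum_f_R0]. replace (INR (S (S (5 + n)))) with (INR n + 7).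
      2:{ rewrite !S_INR, plus_INR. simpl. ring. }
      rewrite S_INR. pose proof (pos_INR n). set (x := INR n) in *.
      assert (F : / ((x + 7) * (x + 8)) <= / (x + 7) ^ 2) by (apply Rinv_le_contravar; [apply pow_lt; lra|simpl; nra]).
      assert (E : / ((x + 7) * (x + 8)) = / (x + 7) - / (x + 1 + 7)) by (field; lra). lra. }
  pose proof (zetaN_partial 2 (5 + 300) ltac:(lia)) as Z. specialize (P 300%nat).
  replace (INR 300) with 300 in P by (rewrite INR_IZR_INZ; reflexivity). lra.
Qed.

Lemma zetaN_3 : 1.16 <= zetaN 3.
Proof. pose proof (zetaN_partial 3 2 ltac:(lia)) as Z. simpl in Z. lra. Qed.
Lemma zetaN_4 : 1.0625 <= zetaN 4.
Proof. pose proof (zetaN_partial 4 1 ltac:(lia)) as Z. simpl in Z. lra. Qed.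
Lemma zetaN_ge1 N : (2 <= N)%nat -> 1 <= zetaN N.
Proof. intros H. pose proof (zetaN_partial N 0 H) as Z. cbn in Z. rewrite pow1, Rinv_1 in Z. lra. Qed.

(** The quotient of the two bases is 1 + 1/(x(x + 2)), and Bernoulli's inequality with exponent x +
    2 returns exactly 1 + 1/x. Monotonicity lets one numerical check cover all larger N. *)
Lemma compound_decr n : (1 + / INR (S (S n))) ^ S (S (S n)) <= (1 + / INR (S n)) ^ S (S n).
Proof.
  rewrite (S_INR (S n)). assert (Hx : 1 <= INR (S n)) by (rewrite <- INR_1; apply le_INR; lia).
  pose proof (poly (S (S (S n))) (/ (INR (S n) * (INR (S n) + 2)))) as B.
  rewrite !(S_INR (S _)) in B. set (x := INR (S n)) in *.
  assert (Hp : 0 < / (x * (x + 2))) by (apply Rinv_0_lt_compat; nra). specialize (B Hp).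
  set (a := 1 + / (x + 1)) in *. set (b := 1 + / x).
  assert (Ha : 0 < a) by (unfold a; assert (0 < / (x + 1)) by (apply Rinv_0_lt_compat; lra); lra).
  assert (Hb : 0 < b) by (unfold b; assert (0 < / x) by (apply Rinv_0_lt_compat; lra); lra).
  replace (1 + (x + 1 + 1) * / (x * (x + 2))) with b in B by (unfold b; field; lra).
  replace (1 + / (x * (x + 2))) with (b / a) in B by (unfold a, b; field; split; lra).
  apply Rmult_le_reg_l with b; [assumption|]. change (b * b ^ S (S n)) with (b ^ S (S (S n))).
  replace (b ^ S (S (S n))) with ((b / a) ^ S (S (S n)) * a ^ S (S (S n))) by (rewrite <- Rpow_mult_distr; f_equal; field; lra).
  apply Rmult_le_compat_r; [apply pow_le; lra|exact B].
Qed.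

Lemma compound_le k n : (k <= n)%nat -> (1 + / INR (S n)) ^ S (S n) <= (1 + / INR (S k)) ^ S (S k).
Proof.
  induction 1 as [|n H IH]; [apply Rle_refl|]. eapply Rle_trans; [apply compound_decr|exact IH].
Qed.

(** * The tilt of the ray and the numerical inequalities *)

Lemma sqrt_pow_le x c n : 0 <= x -> 0 <= c -> x ^ n <= c ^ 2 -> sqrt x ^ n <= c.
Proof.
  intros Hx Hc H. apply Rsqr_incr_0_var; [|assumption]. rewrite !Rsqr_pow2, <- pow_mult, Nat.mul_comm, pow_mult.
  rewrite <- (Rsqr_pow2 (sqrt x)), Rsqr_sqrt by assumption. exact H.
Qed.

(** The minimizer of (1 + kap^2)^((N+1)/2)/kap, the factor that [remainder_bound] puts on the ray
    integral; the minimum is (1 + 1/N)^((N+1)/2) sqrt N. *)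
Definition kapN (N : nat) : R := / sqrt (INR N).

Lemma kapN_in N : (1 <= N)%nat -> 0 < kapN N <= 1.
Proof.
  intros H. assert (H1 : 1 <= INR N) by (rewrite <- INR_1; now apply le_INR).
  assert (1 <= sqrt (INR N)) by (rewrite <- sqrt_1; now apply sqrt_le_1_alt). unfold kapN. split; [apply Rinv_0_lt_compat; lra|].
  rewrite <- Rinv_1. apply Rinv_le_contravar; lra.
Qed.

Lemma kapN_sq N : (1 <= N)%nat -> 1 + kapN N ^ 2 = 1 + / INR N.
Proof.
  intros H. unfold kapN. assert (0 < INR N) by (apply lt_0_INR; lia). rewrite pow_inv, <- (Rsqr_pow2 (sqrt _)), Rsqr_sqrt by lra. reflexivity.
Qed.

(** The lower half axis accounts exactly for the summand 1 of 2 sqrt N + 1, so the ray has to fit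
    into 2 sqrt N. Here m = N - 1. *)
Lemma combine m r kap b : (1 <= m)%nat -> 0 < r -> 0 < kap ->
  sqrt (1 + kap ^ 2) ^ S (S m) / kap * b <= sqrt (INR (S m)) * (1 + zetaN (S m)) ->
  (INR (fact m) / (2 * PI) ^ S m * ((1 + zetaN (S m)) / 2) + sqrt (1 + kap ^ 2) ^ S (S m) / kap * (INR (fact m) / (2 * PI) ^ S m * b))
    / (2 * PI * r ^ S m) <= err_bound (S m) r.
Proof.
  intros Hm Hr Hk H. pose proof PI_RGT_0 as Hpi. set (A := INR (fact m) / (2 * PI) ^ S m).
  assert (H2 : 0 < (2 * PI) ^ S m) by (apply pow_lt; lra). assert (Hrp : 0 < r ^ S m) by now apply pow_lt.
  assert (HA : 0 < A) by (apply Rdiv_lt_0_compat; [apply INR_fact_lt_0|assumption]).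
  set (c := sqrt (1 + kap ^ 2) ^ S (S m) / kap) in *.
  assert (E : err_bound (S m) r = A * ((1 + zetaN (S m)) / 2 + sqrt (INR (S m)) * (1 + zetaN (S m))) / (2 * PI * r ^ S m)).
  { unfold err_bound, A. replace (S m - 1)%nat with m by lia. replace (S m + 1)%nat with (S (S m)) by lia.
    change ((2 * PI) ^ S (S m)) with (2 * PI * (2 * PI) ^ S m). field. repeat split; lra. }
  rewrite E. apply Rmult_le_compat_r; [left; apply Rinv_0_lt_compat, Rmult_lt_0_compat; lra|].
  replace (A * ((1 + zetaN (S m)) / 2) + c * (A * b)) with (A * ((1 + zetaN (S m)) / 2 + c * b)) by ring.
  apply Rmult_le_compat_l; lra.
Qed.

(** At the optimal tilt sqrt N cancels, leaving c b <= 1 + zeta(N), where c bounds (1 +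
    1/N)^((N+1)/2) from above. Squares are compared to stay with integer powers. *)
Lemma combine_kapN m r b c : (1 <= m)%nat -> 0 < r -> 0 <= c -> 0 <= b ->
  (1 + / INR (S m)) ^ S (S m) <= c ^ 2 -> c * b <= 1 + zetaN (S m) ->
  (INR (fact m) / (2 * PI) ^ S m * ((1 + zetaN (S m)) / 2)
    + sqrt (1 + kapN (S m) ^ 2) ^ S (S m) / kapN (S m) * (INR (fact m) / (2 * PI) ^ S m * b))
    / (2 * PI * r ^ S m) <= err_bound (S m) r.
Proof.
  intros Hm Hr Hc Hb H1 H2. pose proof (kapN_in (S m) ltac:(lia)) as Hk. apply combine; [assumption|assumption|lra|].
  rewrite kapN_sq by lia. assert (0 < INR (S m)) by (apply lt_0_INR; lia). pose proof (Rinv_0_lt_compat _ H).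
  unfold kapN, Rdiv. rewrite Rinv_inv.
  pose proof (sqrt_pow_le (1 + / INR (S m)) c _ ltac:(lra) Hc H1). pose proof (sqrt_pos (INR (S m))).
  replace (sqrt (1 + / INR (S m)) ^ S (S m) * sqrt (INR (S m)) * b) with (sqrt (INR (S m)) * (sqrt (1 + / INR (S m)) ^ S (S m) * b)) by ring.
  apply Rmult_le_compat_l; [assumption|]. eapply Rle_trans; [apply Rmult_le_compat_r; eassumption|exact H2].
Qed.

Lemma majorized_eq f f' B : (forall s, 0 < s -> f s = f' s) -> majorized f' B -> majorized f B.
Proof. intros H. apply majorized_le. intros s Hs. rewrite H by assumption. apply Rle_refl. Qed.

Lemma axis_major_R m : (1 <= m)%nat ->
  majorized (fun s => s ^ m * Cmod (Phi (0, - s) - Psi (0, s))) (INR (fact m) / (2 * PI) ^ S m * ((1 + zetaN (S m)) / 2)).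
Proof. intros Hm. generalize (majorized_axis m Hm). apply majorized_eq. intros s Hs. now rewrite axis_jump_R. Qed.

Lemma axis_major_Rinv m : (1 <= m)%nat ->
  majorized (fun s => s ^ m * Cmod (Psi (0, - s) - Phi (0, s))) (INR (fact m) / (2 * PI) ^ S m * ((1 + zetaN (S m)) / 2)).
Proof. intros Hm. generalize (majorized_axis m Hm). apply majorized_eq. intros s Hs. now rewrite axis_jump_Rinv. Qed.

Lemma Psi_asy' : asy Psi (fun n => (-1) ^ n * ((-1) ^ n * stirling_coef n)).
Proof. apply (asy_ext Psi Psi stirling_coef); [reflexivity|intros; now rewrite alt_alt|exact Psi_asy]. Qed.

Lemma R_via_ray M z kap B : RH z -> 0 <= Im z -> 0 < kap <= 1 ->
  majorized (fun s => s ^ S M * Cmod (G_R (- kap * s, s))) B ->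
  Cmod (Phi z - ipoly (fun n => (-1) ^ n * stirling_coef n)%R (S (S M)) z) <=
    (INR (fact (S M)) / (2 * PI) ^ S (S M) * ((1 + zetaN (S (S M))) / 2) + sqrt (1 + kap ^ 2) ^ S (S (S M)) / kap * B)
    / (2 * PI * Cmod z ^ S (S M)).
Proof.
  intros Hz Hi Hk HB.
  apply (remainder_bound Phi Psi G_R); try assumption.
  - apply Phi_hol.
  - apply Psi_hol.
  - apply Phi_cont.
  - apply Psi_cont.
  - apply Phi_asy.
  - apply Psi_asy'.
  - apply Phi_near0.
  - apply Psi_near0.
  - apply G_R_hol.
  - apply G_R_cont.
  - apply G_R_near0.
  - apply G_R_decay.
  - apply G_R_axis.
  - apply axis_major_R. lia.
Qed.

Lemma Rinv_via_ray M z kap B : RH z -> 0 <= Im z -> 0 < kap <= 1 ->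
  majorized (fun s => s ^ S M * Cmod (G_Rinv (- kap * s, s))) B ->
  Cmod (Psi z - ipoly stirling_coef (S (S M)) z) <=
    (INR (fact (S M)) / (2 * PI) ^ S (S M) * ((1 + zetaN (S (S M))) / 2) + sqrt (1 + kap ^ 2) ^ S (S (S M)) / kap * B)
    / (2 * PI * Cmod z ^ S (S M)).
Proof.
  intros Hz Hi Hk HB.
  apply (remainder_bound Psi Phi G_Rinv); try assumption.
  - apply Psi_hol.
  - apply Phi_hol.
  - apply Psi_cont.
  - apply Phi_cont.
  - apply Psi_asy.
  - apply Phi_asy.
  - apply Psi_near0.
  - apply Phi_near0.
  - apply G_Rinv_hol.
  - apply G_Rinv_cont.
  - apply G_Rinv_near0.
  - apply G_Rinv_decay.
  - apply G_Rinv_axis.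
  - apply axis_major_Rinv. lia.
Qed.

Lemma Phi_err N z : (2 <= N)%nat -> RH z -> 0 <= Im z ->
  Cmod (Phi z - ipoly (fun n => (-1) ^ n * stirling_coef n)%R N z) <= err_bound N (Cmod z).
Proof.
  intros HN Hz Hi. assert (Hz0 : 0 < Cmod z) by (apply RHc_mod, RH_RHc, Hz).
  destruct N as [|[|M]]; [lia|lia|]. destruct M as [|M].
  (* N = 2. The tilt 1/sqrt 2 combined with |1 - q| >= 1 - |q| would require (3/2)^(3/2) zeta(2),
     about 3.02, to stay below 1 + zeta(2), about 2.65. On the diagonal, with the phase of q taken
     into account, the requirement is 2.63 <= 1 + zeta(2). *)
  - eapply Rle_trans; [apply (R_via_ray 0 z 1 _ Hz Hi ltac:(lra) majorized_ray_R1)|].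
    replace (/ (2 * PI) ^ 2 * 1.315) with (INR (fact 1) / (2 * PI) ^ 2 * 1.315) by (simpl; unfold Rdiv; ring).
    apply combine; [lia|assumption|lra|]. pose proof zetaN_2 as Z. replace (1 + 1 ^ 2) with 2 by ring.
    change (INR 2) with 2. pose proof sqrt2_bounds as S2. assert (S22 : sqrt 2 * sqrt 2 = 2) by (apply sqrt_sqrt; lra).
    replace (sqrt 2 ^ 3 / 1 * 1.315) with (sqrt 2 * ((sqrt 2 * sqrt 2) * 1.315)) by (simpl; field). rewrite S22.
    apply Rmult_le_compat_l; lra.
  - pose proof (kapN_in (S (S (S M))) ltac:(lia)) as Hk.
    eapply Rle_trans; [eapply (R_via_ray (S M) z _ _ Hz Hi Hk); apply majorized_ray_R; [lra|lia]|].
    pose proof (zetaN_ge1 (S (S (S M))) ltac:(lia)). pose proof (zetaN_le (S (S (S M))) ltac:(lia)).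
    (* 16/9 is the square root of (4/3)^4, the value at N = 3 of a decreasing sequence. The
       inequality 16 b/9 <= 1 + b holds up to b = 9/7, hence for zeta(N) <= 5/4. *)
    apply combine_kapN with (16 / 9); [lia|assumption|lra|lra| |lra].
    eapply Rle_trans; [apply (compound_le 2 (S (S M))); lia|]. simpl. lra.
Qed.

Lemma Psi_err N z : (2 <= N)%nat -> RH z -> 0 <= Im z ->
  Cmod (Psi z - ipoly stirling_coef N z) <= err_bound N (Cmod z).
Proof.
  intros HN Hz Hi. assert (Hz0 : 0 < Cmod z) by (apply RHc_mod, RH_RHc, Hz). pose proof PI_bounds as Hpi.
  destruct N as [|[|M]]; [lia|lia|]. pose proof (kapN_in (S (S M)) ltac:(lia)) as Hk.
  pose proof (kapN_sq (S (S M)) ltac:(lia)) as Hk2.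
  assert (HN0 : 1 <= INR (S M)) by (rewrite <- INR_1; apply le_INR; lia).
  (* Here c bounds (1 + 1/N)^((N+1)/2) from above, d bounds rho = sqrt(1 + 1/N) from below, and 6.3
     replaces 2 pi. The best lam is sqrt(1 + 1.26/(d (N - 1))), which is rounded in each case. *)
  assert (Gen : forall lam c d, 0 < lam -> 0 <= c -> 0 < d -> d ^ 2 <= 1 + / INR (S (S M)) ->
     (1 + / INR (S (S M))) ^ S (S (S M)) <= c ^ 2 ->
     c * ((lam + / lam) / 2 + 6.3 / (10 * lam * d * INR (S M))) <= 1 + zetaN (S (S M)) ->
     Cmod (Psi z - ipoly stirling_coef (S (S M)) z) <= err_bound (S (S M)) (Cmod z)).
  { intros lam c d Hl Hc Hd Hd2 H1 H2.
    eapply Rle_trans; [eapply (Rinv_via_ray M z _ _ Hz Hi Hk); apply (majorized_ray_Rinv _ (proj1 Hk) lam); [assumption|lia]|].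
    set (rho := sqrt (1 + kapN (S (S M)) ^ 2)) in *.
    assert (Hr : d <= rho).
    { unfold rho. rewrite Hk2. rewrite <- (sqrt_Rsqr d) by lra. apply sqrt_le_1_alt. rewrite Rsqr_pow2. exact Hd2. }
    pose proof (Rinv_0_lt_compat lam Hl).
    assert (Hl10 : 0 < 10 * lam) by lra.
    assert (P1 : 0 < 10 * lam * d) by now apply Rmult_lt_0_compat.
    assert (P2 : 10 * lam * d <= 10 * lam * rho) by (apply Rmult_le_compat_l; lra).
    assert (P3 : 0 < 10 * lam * d * INR (S M)) by (apply Rmult_lt_0_compat; lra).
    assert (P4 : 10 * lam * d * INR (S M) <= 10 * lam * rho * INR (S M)) by (apply Rmult_le_compat_r; lra).
    assert (B0 : 0 < 2 * PI / (10 * lam * rho * INR (S M))) by (apply Rdiv_lt_0_compat; lra).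
    assert (B1 : 2 * PI / (10 * lam * rho * INR (S M)) <= 6.3 / (10 * lam * d * INR (S M))).
    { apply Rmult_le_compat; [lra|left; apply Rinv_0_lt_compat; lra|lra|apply Rinv_le_contravar; lra]. }
    apply combine_kapN with c; [lia|assumption|assumption|lra|exact H1|].
    eapply Rle_trans; [|exact H2]. apply Rmult_le_compat_l; lra. }
  destruct M as [|[|[|M]]].
  (* N = 2: c and d come from (3/2)^(3/2) and (3/2)^(1/2). *)
  - pose proof zetaN_2. apply (Gen 1.42 1.8372 1.2247); simpl; lra.
  (* N = 3: even with the best weight the general estimate needs about 2.21, more than 1 + zeta(3),
     about 2.202. The fourth-power bound with lam = 1.21 needs about 2.151, below 2.16. *)
  - clear Gen.
    eapply Rle_trans; [eapply (Rinv_via_ray 1 z _ _ Hz Hi Hk); apply (majorized_ray_Rinv2 _ (proj1 Hk) 1.21); lra|].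
    replace (2 / (2 * PI) ^ 3) with (INR (fact 2) / (2 * PI) ^ 3) by reflexivity.
    pose proof zetaN_3. set (kap := kapN 3) in *.
    assert (Hr2 : sqrt (1 + kap ^ 2) ^ 2 = 4 / 3).
    { rewrite <- (Rsqr_pow2 (sqrt _)), Rsqr_sqrt by nra. rewrite Hk2. simpl. field. }
    assert (Hk3 : kap <= 0.5774).
    { assert (kap ^ 2 = / 3) by (simpl in Hk2; simpl; lra). nra. }
    rewrite Hr2.
    assert (HX : 2 * kap / (5 * (4 / 3)) * PI + 2 * PI ^ 2 / (25 * (4 / 3)) <= 1.142) by nra.
    assert (HX0 : 0 <= 2 * kap / (5 * (4 / 3)) * PI + 2 * PI ^ 2 / (25 * (4 / 3))) by nra.
    apply combine_kapN with (16 / 9); [lia|assumption|lra| |simpl; lra|]; lra.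
  (* N = 4: c and d come from (5/4)^(5/2) and (5/4)^(1/2). *)
  - pose proof zetaN_4. apply (Gen 1.17 1.747 1.118); simpl; lra.
  (* All N >= 5 at once: 1.728 is (6/5)^3, the value at N = 5, and rho >= 1 and N - 1 >= 4 are the
     worst cases. *)
  - set (n := S (S (S (S (S M))))) in *.
    pose proof (zetaN_ge1 n ltac:(unfold n; lia)).
    assert (HI : 0 < / INR n) by (apply Rinv_0_lt_compat, lt_0_INR; unfold n; lia).
    apply (Gen 1.14 1.728 1); [lra|lra|lra|lra| |].
    + eapply Rle_trans; [apply (compound_le 4); lia|]. simpl. lra.
    + assert (H4 : 4 <= INR (S (S (S (S M))))).
      { replace 4 with (INR 4) by (simpl; ring). apply le_INR. lia. }
      assert (6.3 / (10 * 1.14 * 1 * INR (S (S (S (S M))))) <= 6.3 / (10 * 1.14 * 1 * 4)).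
      { apply Rmult_le_compat_l; [lra|]. apply Rinv_le_contravar; lra. }
      lra.
Qed.

(** * Zeta and Gamma at integers, and the passage to the closed half-plane *)

Lemma zeta_zetaN N : zeta (INR N) = zetaN N.
Proof.
  apply Series_ext. intros k. rewrite Rpower_pow; [reflexivity|]. apply lt_0_INR. lia.
Qed.

Lemma rising_nat N n : rising (RtoC (INR (S N))) n = RtoC (INR (fact (S N + n)) / INR (fact N)).
Proof.
  induction n as [|n IH]; cbn [rising].
  - rewrite Nat.add_0_r, fact_simpl, mult_INR. f_equal. field. apply INR_fact_neq_0.
  - rewrite IH, <- RtoC_plus, <- RtoC_mult, <- plus_INR. f_equal.
    replace (S N + S n)%nat with (S (S N + n)) by lia. rewrite (fact_simpl (S N + n)), mult_INR.
    replace (S (S N + n)) with (S N + S n)%nat by lia. field. apply INR_fact_neq_0.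
Qed.

(** Raising N by one multiplies the ratio by n/(n + N + 1), which tends to 1. *)
Lemma factorial_ratio_lim N :
  is_lim_seq (fun n => INR (fact n) * INR n ^ N / INR (fact (N + n))) 1.
Proof.
  induction N as [|N IH].
  - apply (is_lim_seq_ext (fun _ => 1)); [|apply is_lim_seq_const].
    intros n. simpl. field. apply INR_fact_neq_0.
  - apply (is_lim_seq_ext (fun n => INR (fact n) * INR n ^ N / INR (fact (N + n)) * (1 - INR (S N) * / INR (n + S N)))).
    + intros n. replace (S N + n)%nat with (S (N + n)) by lia. rewrite fact_simpl, mult_INR. replace (n + S N)%nat with (S (N + n)) by lia.
      assert (0 < INR (S (N + n))) by (apply lt_0_INR; lia).
      assert (E : INR n = INR (S (N + n)) - INR (S N)) by (rewrite !S_INR, plus_INR; ring).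
      replace (1 - INR (S N) * / INR (S (N + n))) with (INR n / INR (S (N + n))) by (rewrite E; field; lra).
      cbn [pow]. field. split; [apply INR_fact_neq_0|lra].
    + replace (Finite 1) with (Finite (1 * (1 - INR (S N) * 0))) by (f_equal; ring).
      apply is_lim_seq_mult'; [exact IH|]. rewrite Rmult_0_r. apply is_lim_seq_minus'; [apply is_lim_seq_const|].
      apply (is_lim_seq_incr_n (fun n => INR (S N) * / INR n)). apply is_lim_seq_invINR.
Qed.

(** Gamma is defined as a limit, so its value at an integer is read off from Gauss's quotient, which
    is a ratio of factorials there. *)
Lemma Gamma_nat N : Re (Gamma (RtoC (INR (S N)))) = INR (fact N).
Proof.
  unfold Gamma, Re; cbn [fst].
  rewrite (is_lim_seq_unique _ (INR (fact N))); [reflexivity|].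
  apply (is_lim_seq_ext_loc (fun n => INR (fact N) * (INR (fact n) * INR n ^ S N / INR (fact (S N + n))))).
  - exists 1%nat. intros n Hn. unfold Gamma_seq, Cpower. rewrite Clog_INR by lia. rewrite rising_nat, <- RtoC_mult, Cexp_RtoC.
    rewrite <- exp_pow, exp_ln by (apply lt_0_INR; lia).
    assert (INR (fact (S N + n)) / INR (fact N) <> 0).
    { apply Rmult_integral_contrapositive_currified; [apply INR_fact_neq_0|apply Rinv_neq_0_compat, INR_fact_neq_0]. }
    unfold Cdiv. rewrite <- RtoC_inv, <- !RtoC_mult by assumption. cbn [fst RtoC].
    field. split; apply INR_fact_neq_0.
  - replace (Finite (INR (fact N))) with (Finite (INR (fact N) * 1)) by (f_equal; ring).
    apply is_lim_seq_mult'; [apply is_lim_seq_const|apply factorial_ratio_lim].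
Qed.

Lemma Re_of_Carg z : z <> RtoC 0 -> Rabs (Carg z) <= PI / 2 -> 0 <= Re z.
Proof.
  intros Hz H. apply Rabs_le_between in H. pose proof (cos_ge_0 (Carg z) ltac:(lra) ltac:(lra)) as C.
  rewrite cos_Carg in C by assumption. apply Cmod_gt_0 in Hz.
  replace (Re z) with (Re z / Cmod z * Cmod z) by (field; lra). apply Rmult_le_pos; lra.
Qed.

Lemma sum_n_Csum (f : nat -> C) n : sum_n f n = Csum f (S n).
Proof.
  induction n as [|n IH].
  - rewrite sum_O. cbn [Csum]. now rewrite Cplus_0_l.
  - rewrite sum_Sn, IH. reflexivity.
Qed.

Lemma ipoly_cont a N w : w <> RtoC 0 -> continuous (ipoly a N) w.
Proof.
  intros Hw. unfold ipoly. induction N as [|N IH]; cbn [Csum]; [apply continuous_const|].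
  apply cont_Cplus; [exact IH|]. apply cont_Cmult; [apply continuous_const|].
  apply cont_Cinv; [apply cont_Cpow, continuous_id|now apply Cpow_nz].
Qed.

Lemma ipoly_conj a N w : w <> RtoC 0 -> ipoly a N (Cconj w) = Cconj (ipoly a N w).
Proof.
  intros Hw. unfold ipoly. induction N as [|N IH]; cbn [Csum]; [now rewrite Cconj_RtoC|].
  rewrite IH, Cconj_plus, Cconj_mult, Cconj_RtoC, Cconj_inv, Cconj_pow. reflexivity.
Qed.

Lemma err_bound_le N r r' : (2 <= N)%nat -> 0 < r -> r <= r' -> err_bound N r' <= err_bound N r.
Proof.
  intros HN Hr H. unfold err_bound. pose proof PI_RGT_0 as Hpi. pose proof (zetaN_ge1 N HN). pose proof (sqrt_pos (INR N)).
  pose proof (INR_fact_lt_0 (N - 1)). pose proof (pow_lt (2 * PI) (N + 1) ltac:(lra)). pose proof (pow_lt r N Hr).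
  pose proof (pow_incr r r' N ltac:(lra)).
  apply Rmult_le_compat_r; [lra|]. apply Rmult_le_compat_l; [apply Rmult_le_pos; lra|].
  apply Rinv_le_contravar; [now apply Rmult_lt_0_compat|]. apply Rmult_le_compat_l; lra.
Qed.

(* The estimate on the open quarter plane passes to the closed half plane by conjugation and continuity. *)
Lemma err_extend (F : C -> C) a N : (2 <= N)%nat ->
  (forall w, w <> RtoC 0 -> continuous F w) -> (forall w, RHc w -> F (Cconj w) = Cconj (F w)) ->
  (forall z, RH z -> 0 <= Im z -> Cmod (F z - ipoly a N z) <= err_bound N (Cmod z)) ->
  forall z, RHc z -> Cmod (F z - ipoly a N z) <= err_bound N (Cmod z).
Proof.
  intros HN cF conjF H.
  assert (H1 : forall z, RH z -> Cmod (F z - ipoly a N z) <= err_bound N (Cmod z)).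
  { intros z Hz. destruct (Rle_lt_dec 0 (Im z)) as [Hi|Hi]; [now apply H|].
    pose proof (H (Cconj z)) as HC. pose proof (RH_RHc z Hz) as Hc.
    rewrite conjF, ipoly_conj, <- Cconj_minus, !Cmod_conj in HC by (exact Hc || apply Hc).
    apply HC; [exact Hz|]. unfold Im, Cconj in *; cbn [snd]. lra. }
  intros z Hz. pose proof (RHc_mod z Hz) as Hp. destruct Hz as [Hz0 Hzn].
  apply le_of_small. intros eps He.
  assert (cH : continuous (fun w => F w - ipoly a N w)%C z) by (apply cont_Cminus; [now apply cF|now apply ipoly_cont]).
  destruct (proj1 (cont_eps _ _) cH eps He) as (d & Hd & Hv). set (v := (z + RtoC (d / 2))%C).
  assert (Hvz : Cmod (v - z) < d).
  { unfold v. replace (z + RtoC (d / 2) - z)%C with (RtoC (d / 2)) by ring. rewrite Cmod_R, Rabs_right; lra. }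
  specialize (Hv v Hvz). rewrite Cmod_sub_sym in Hv.
  assert (HvR : RH v) by (unfold RH, v; rewrite Re_shift; lra).
  specialize (H1 v HvR).
  assert (HM : Cmod z <= Cmod v).
  { apply (Cmod_shift z (d / 2)); lra. }
  pose proof (err_bound_le N _ _ HN Hp HM).
  pose proof (Cmod_triangle (F z - ipoly a N z - (F v - ipoly a N v)) (F v - ipoly a N v)) as T.
  replace (F z - ipoly a N z - (F v - ipoly a N v) + (F v - ipoly a N v))%C with (F z - ipoly a N z)%C in T by ring. lra.
Qed.

Theorem theorem1p3 (N : nat) (z : C) :
  (2 <= N)%nat ->
  z <> RtoC 0 ->
  Rabs (Carg z) <= PI / 2 ->
  Cmod (stirling_R N z)
    <= (1 + zeta (INR N)) * Re (Gamma (RtoC (INR N)))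
       / ((2 * PI) ^ (N + 1) * Cmod z ^ N)
       * ((2 * sqrt (INR N) + 1) / 2)
  /\
  Cmod (stirling_R_inv N z)
    <= (1 + zeta (INR N)) * Re (Gamma (RtoC (INR N)))
       / ((2 * PI) ^ (N + 1) * Cmod z ^ N)
       * ((2 * sqrt (INR N) + 1) / 2).
Proof.
  intros HN Hz Harg. assert (Hc : RHc z) by (split; [now apply Re_of_Carg|assumption]).
  assert (EB : (1 + zeta (INR N)) * Re (Gamma (RtoC (INR N))) / ((2 * PI) ^ (N + 1) * Cmod z ^ N) * ((2 * sqrt (INR N) + 1) / 2)
    = err_bound N (Cmod z)).
  { unfold err_bound. rewrite zeta_zetaN. destruct N as [|m]; [lia|]. rewrite Gamma_nat. now replace (S m - 1)%nat with m by lia. }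
  rewrite EB. unfold stirling_R, stirling_R_inv. rewrite scaled_Gamma_mu, <- Cexp_opp, !sum_n_Csum by assumption.
  (* [sum_n] includes its upper index N - 1, which makes the N terms counted by [ipoly]. *)
  replace (S (N - 1)) with N by lia. split.
  - apply (err_extend Phi (fun n => (-1) ^ n * stirling_coef n) N HN); [apply Phi_cont| | |exact Hc].
    + intros w Hw. unfold Phi. now rewrite mu_conj, Cexp_Cconj.
    + intros w Hw Hi. now apply Phi_err.
  - apply (err_extend Psi stirling_coef N HN); [apply Psi_cont| | |exact Hc].
    + intros w Hw. unfold Psi. rewrite mu_conj, <- Cexp_Cconj by assumption. reflexivity.
    + intros w Hw Hi. now apply Psi_err.
Qed.
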